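(* Let $\mathcal P$ be an exponentially clustering spin model on $\mathbb Z^d$ and suppose that $\mathcal P$ or $\mathcal P^c=\mathbb Z^d\setminus\mathcal P$ is a subcritical spin model. Let $k\in\{0,\dots,d-1\}$. If $\operatorname{Var}(\beta_k(C(\mathcal P_n)))=\Omega(w_n^\nu)$ for some $\nu>0$, then as $n\to\infty$, $$\operatorname{Var}(\beta_k(C(\mathcal P_n)))^{-1/2}\bigl(\beta_k(C(\mathcal P_n))-\mathbb E(\beta_k(C(\mathcal P_n)))\bigr)\stackrel{d}{\Rightarrow}N(0,1).$$ Further (without any variance assumption), $$w_n^{-1/2}\bigl(\beta_0(C(\mathcal P_n))-\mathbb E(\beta_0(C(\mathcal P_n))),\dots,\beta_{d-1}(C(\mathcal P_n))-\mathbb E(\beta_{d-1}(C(\mathcal P_n)))\bigr)\stackrel{d}{\Rightarrow}N(0,\Sigma),$$ where $\Sigma=(\Sigma(i,j))_{0\le i,j\le d-1}$ is the covariance matrix given by $$\Sigma(i,j)=\sum_{z\in\mathbb Z^d}\operatorname{Cov}\bigl(\xi_i(O,\mathcal P),\xi_j(z,\mathcal P)\bigr),\qquad \xi_k(x,\mu)=\frac{\beta_k(C(x,\mu))}{|C(x,\mu)|}.$$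
   Context: $\mathbb Z^d$ is the Cayley graph with edges between points at $\ell_1$-distance $1$; $|x|$ is the $\ell_1$-norm, $W_n=\{y\in\mathbb Z^d:|y|\le n\}$, $w_n=|W_n|$ is its cardinality, $O$ is the origin. $a_n=\Omega(b_n)$ means there is $c>0$ with $a_n\ge c\,b_n$ for all large $n$. The Gaussian limit may be degenerate. For $\mu\subset\mathbb Z^d$, $C(\mu)=\bigcup_{x\in\mu}(x+[-\tfrac12,\tfrac12]^d)\subset\mathbb R^d$. For $x\in\mu$, $C(x,\mu)$ is the connected component of $C(\mu)$ containing $x$, regarded both as a union of unit cubes and as the set of lattice points in it; $|C(x,\mu)|$ is its number of lattice points. Scores $\xi_k(x,\mu)$ are set to $0$ when $x\notin\mu$. $\beta_k$ is the $k$th Betti number (rank of the $k$th homology group with coefficients in a fixed field). A spin model $\mathcal P$ is subcritical if there are constants $C^*,c^*>0$ with $\mathbb P(y\in C(x,\mathcal P))\le C^*e^{-c^*|x-y|}$ for all $x,y\in\mathbb Z^d$. A spin model is a random element $\mathcal P$ of $\{0,1\}^{\mathbb Z^d}$, identified with a random subset of $\mathbb Z^d$; $\mathcal P_n=\mathcal P\cap W_n$. It is stationary if $\mathcal P+y\stackrel d=\mathcal P$ for all $y\in\mathbb Z^d$, non-degenerate if $\mathbb P(O\in\mathcal P)\in(0,1)$. A function $\phi:[0,\infty)\to[0,\infty)$ is fast decreasing if $\phi\le1$, $\phi$ is decreasing and $\lim_{s\to\infty}s^m\phi(s)=0$ for all $m\ge1$. A stationary non-degenerate $\mathcal P$ is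 an exponentially clustering spin model if there are constants $C_k,c_k\in(0,\infty)$ ($C_k$ non-decreasing, $c_k$ non-increasing in $k$) and a fast decreasing $\phi$ such that for all $p,q\ge1$ and distinct $x_1,\dots,x_{p+q}\in\mathbb Z^d$, $$|\mathbb P(\{x_1,\dots,x_{p+q}\}\subset\mathcal P)-\mathbb P(\{x_1,\dots,x_p\}\subset\mathcal P)\mathbb P(\{x_{p+1},\dots,x_{p+q}\}\subset\mathcal P)|\le C_{p+q}\phi(c_{p+q}s),$$ where $s=\min_{1\le i\le p,\,1\le j\le q}|x_i-x_{p+j}|$, and moreover $c_k\ge c>0$ for all $k$, $C_k=O(k^{ak})$ for some $a\in[0,1)$, and $\limsup_{t\to\infty}\log\phi(t)/t^b<0$ for some $b\in(0,\infty)$.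
   Formalization: The formula for Σ(i,j) is asserted only when each index is 0 or C(O,P) is a.s. finite (as when P is subcritical); if only P^c is subcritical, ξ_k for k≥1 can be ∞/∞ (e.g. i.i.d. sites of density near 1, d=2), and there only existence of Σ and the limit law is claimed. *)

(* Defs.v *)
From HB Require Import structures.
From mathcomp Require Import all_boot all_order all_algebra.
From mathcomp Require Import finmap.
From mathcomp Require Import all_classical all_reals all_analysis.
From mathcomp.analysis.showcase Require summability.

Set Implicit Arguments.
Unset Strict Implicit.
Unset Printing Implicit Defensive.

Import Order.TTheory GRing.Theory Num.Theory.
Import numFieldNormedType.Exports.

Local Open Scope classical_set_scope.
Local Open Scope ring_scope.

Notation lattice d := 'rV[int]_d.

Definition l1norm d (x : lattice d) : nat := (\sum_(i < d) `|x 0%R i|)%N.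

Definition window d (n : nat) : set (lattice d) := [set y | (l1norm y <= n)%N].
Arguments window : clear implicits.

Definition window_card d (n : nat) : nat := #|` fset_set (window d n)|%fset.

(* min_(a in x, b in y) |a - b|; only meaningful for nonempty x and y *)
Definition seq_dist d (x y : seq (lattice d)) : nat :=
  let D := [seq l1norm (a - b) | a <- x, b <- y] in
  \big[minn/head 0%N D]_(s <- D) s.

(* {0,1}^(Z^d) as the type of subsets of Z^d, with its product sigma-algebra *)
Definition coordinate_events d : set (set (set (lattice d))) :=
  [set [set mu | mu x] | x in [set: lattice d]].

Definition config d := g_sigma_algebraType (@coordinate_events d).

Definition translate d (mu : set (lattice d)) (y : lattice d) :
  set (lattice d) := [set x + y | x in mu].

Section Cubical.
Variables (R : realType) (d : nat).

Definition embed (x : lattice d) : 'rV[R]_d := map_mx intr x.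

Definition cubes (mu : set (lattice d)) : set 'rV[R]_d :=
  [set p | exists2 x, mu x & forall i, `|p 0 i - (x 0 i)%:~R| <= 2^-1].

(* Empty when x is not in mu *)
Definition component (x : lattice d) (mu : set (lattice d)) : set 'rV[R]_d :=
  connected_component (cubes mu) (embed x).

Definition component_points (x : lattice d) (mu : set (lattice d)) : set (lattice d) :=
  embed @^-1` component x mu.

(* Elementary cubes of the cubical grid with vertex set (Z + 1/2)^d. A cube is
   encoded by twice its centre c: the i-th factor is the interval
   [c_i/2 - 1/2, c_i/2 + 1/2] if c_i is even, and the point {c_i/2} if c_i is
   odd. *)
Definition elementary_cube (c : lattice d) : set 'rV[R]_d :=
  [set p | forall i, if (2 %| c ord0 i)%Z
                     then (`|2 * p 0 i - (c 0 i)%:~R| <= 1 : Prop)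
                     else 2 * p 0 i = (c 0 i)%:~R].

Definition cube_dim (c : lattice d) : nat := #|[pred i | (2 %| c ord0 i)%Z]|.

(* The elementary k-cubes contained in A. As fset_set sends infinite sets to
   fset0, this is only meaningful for A containing finitely many of them (e.g.
   A bounded). *)
Definition elementary_cubes (k : nat) (A : set 'rV[R]_d) : seq (lattice d) :=
  fset_set [set c | cube_dim c = k /\ elementary_cube c `<=` A].

(* Coefficient of b in the cubical boundary of c: the two faces of c in each
   nondegenerate direction i have opposite signs, twisted by the parity of the
   number of nondegenerate directions before i. *)
Definition incidence (F : fieldType) (c b : lattice d) : F :=
  \sum_(i < d | (2 %| c ord0 i)%Z)
    (-1) ^+ #|[pred j : 'I_d | (j < i)%N && (2 %| c ord0 j)%Z]| *
    ((b == c + delta_mx 0 i)%:R - (b == c - delta_mx 0 i)%:R).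

(* Matrix, acting on row vectors, of the boundary map from k-chains to
   (k-1)-chains of the cubical set A with coefficients in F. It is 0 for k = 0,
   because a 0-cube has no nondegenerate direction. *)
Definition boundary_mx (F : fieldType) (k : nat) (A : set 'rV[R]_d) :
    'M[F]_(size (elementary_cubes k A), size (elementary_cubes k.-1 A)) :=
  \matrix_(i, j) incidence F (nth 0 (elementary_cubes k A) i)
                             (nth 0 (elementary_cubes k.-1 A) j).

(* dim (Z_k / B_k) of the cubical chain complex of A over F, for a set A that is
   a finite union of elementary cubes *)
Definition betti (F : fieldType) (k : nat) (A : set 'rV[R]_d) : nat :=
  (\rank (kermx (boundary_mx F k A)) - \rank (boundary_mx F k.+1 A))%N.

(* For an infinite component the cardinal below is 0, so that the score is 0; this
   agrees with 1 / oo = 0 for k = 0 but is a junk value for k > 0. *)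
Definition score (F : fieldType) (k : nat) (x : lattice d)
    (mu : set (lattice d)) : R :=
  if `[< mu x >] then
    (betti F k (component x mu))%:R / #|` fset_set (component_points x mu)|%fset%:R
  else 0.

End Cubical.

Arguments cubes R {d} mu.
Arguments component_points R {d} x mu.
Arguments score {R d} F k x mu.

Section SpinModels.
Context (R : realType) (dT : measure_display) (T : measurableType dT).
Context (P : probability T R) (d : nat).
Implicit Types X : T -> config d.

Definition stationary X := forall (y : lattice d) (B : set (config d)),
  measurable B -> P [set w | B (translate (X w) y)] = P [set w | B (X w)].

Definition nondegenerate_spin X := (0 < P [set w | X w 0%R] < 1)%E.

Definition fast_decreasing (phi : R -> R) : Prop :=
  [/\ forall s, 0 <= s -> 0 <= phi s <= 1,
      forall s t, 0 <= s -> s <= t -> phi t <= phi s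
    & forall m : nat, (1 <= m)%N -> s ^+ m * phi s @[s --> +oo] --> 0].

Definition prob_contains X (s : seq (lattice d)) : R :=
  fine (P [set w | forall x, x \in s -> X w x]).

Definition clustering X (C c : nat -> R) (phi : R -> R) :=
  forall x y : seq (lattice d), x != [::] -> y != [::] -> uniq (x ++ y) ->
  let k := (size x + size y)%N in
  `|prob_contains X (x ++ y) - prob_contains X x * prob_contains X y|
    <= C k * phi (c k * (seq_dist x y)%:R).

Definition exponentially_clustering X : Prop :=
  [/\ stationary X, nondegenerate_spin X &
  exists (C c : nat -> R) (phi : R -> R),
  [/\ [/\ forall k, 0 < C k /\ 0 < c k,
          {homo C : k l / (k <= l)%N >-> k <= l}
        & {homo c : k l / (k <= l)%N >-> l <= k}],
      fast_decreasing phi /\ clustering X C c phi,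
      exists2 c0, 0 < c0 & forall k, c0 <= c k,
      exists2 a : R, 0 <= a < 1 & C =O_\oo (fun k => k%:R `^ (a * k%:R))
    & (* lne 0 = -oo, whereas ln 0 = 0 *)
      exists2 b : R, 0 < b &
        (limf_esup (fun t => lne (phi t)%:E * ((t `^ b)^-1)%:E)
                   (pinfty_nbhs R) < 0)%E]].

(* Stated for any random set, since it is also applied to complements *)
Definition subcritical (Y : T -> set (lattice d)) : Prop :=
  exists C c : R, [/\ 0 < C, 0 < c & forall x y : lattice d,
    (P [set w | component_points R x (Y w) y]
       <= (C * expR (- (c * (l1norm (x - y))%:R)))%:E)%E].

(* The quotient beta_k / |.| is almost surely not of the form oo / oo at the
   origin; for k = 0 its numerator is 1. This holds for every k when X is
   subcritical, but for d > 1 it can fail when only the complement is. *)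
Definition score_meaningful (k : nat) X : Prop :=
  k = 0%N \/ {ae P, forall w, finite_set (component_points R 0 (X w))}.

End SpinModels.

Section Limits.
Context (R : realType) (dT : measure_display) (T : measurableType dT).
Context (P : probability T R).

(* Weak convergence of the laws of the Y n to a probability law, the latter
   being given by its expectation functional L *)
Definition cvg_in_law (S : topologicalType) (Y : nat -> T -> S)
    (L : (S -> R) -> \bar R) : Prop :=
  forall f : S -> R, continuous f -> (exists M, forall x, `|f x| <= M) ->
  'E_P[fun w => f (Y n w)]%E @[n --> \oo] --> L f.

End Limits.

Definition borel (S : ptopologicalType) := g_sigma_algebraType (@open S).

(* N(0, v) for v >= 0; normal_prob is not a Dirac mass for a zero variance *)
Definition centered_normal (R : realType) (v : R) (B : set R) : \bar R :=
  if v == 0 then \d_(0 : R) B else normal_prob 0 (Num.sqrt v) B.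

(* gamma = N(0, Sigma), possibly degenerate: every linear functional t has law
   N(0, t Sigma t^T) *)
Definition is_gaussian (R : realType) (d : nat)
    (gamma : probability (borel 'rV[R]_d) R) (Sigma : 'M[R]_d) : Prop :=
  Sigma^T = Sigma /\
  forall t : 'rV[R]_d, let v := (t *m Sigma *m t^T) 0 0 in
  0 <= v /\
  forall B : set R, measurable B ->
    gamma [set x : 'rV[R]_d | B ((x *m t^T) 0 0)] = centered_normal v B.

Definition has_sum (R : realType) d (f : lattice d -> R) (s : R) : Prop :=
  summability.partial_sum f A @[A --> summability.totally] --> s.

Section BettiNumbers.
Context (F : fieldType) (R : realType).
Context (dT : measure_display) (T : measurableType dT) (P : probability T R).
Context (d : nat) (X : T -> config d).

Definition betti_window (k n : nat) (w : T) : R :=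
  (betti F k (cubes R (X w `&` window d n)))%:R.

Definition betti_mean k n : R := fine ('E_P[betti_window k n])%E.

Definition betti_var k n : R := fine (variance P (betti_window k n)).

Definition betti_normalized k n (w : T) : R :=
  betti_var k n `^ (- 2^-1) * (betti_window k n w - betti_mean k n).

Definition betti_vector n (w : T) : 'rV[R]_d :=
  \row_(k < d) ((window_card d n)%:R `^ (- 2^-1) *
                (betti_window k n w - betti_mean k n)).

Definition score_cov (i j : nat) (z : lattice d) : R :=
  fine (covariance P (fun w => score F i 0 (X w))
                     (fun w => score F j z (X w))).

End BettiNumbers.

(* Main.v *)
Require Import Defs.
From HB Require Import structures.
From mathcomp Require Import all_boot all_order all_algebra.
From mathcomp Require Import finmap.
From mathcomp Require Import all_classical all_reals all_analysis.
From mathcomp Require Import measurable_realfun.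
From mathcomp Require Import ring lra zify.

Set Implicit Arguments.
Unset Strict Implicit.
Unset Printing Implicit Defensive.

Import Order.TTheory GRing.Theory Num.Theory.
Import numFieldNormedType.Exports.

Local Open Scope classical_set_scope.
Local Open Scope ring_scope.

(** The Betti number of a finite union of unit cubes is additive over groups of cubes that do not
    touch. Hence it is a sum over lattice sites of a score computed from the cluster of the site
    ([cluster_sum]). If [X] is subcritical, clusters have exponential tails. Keeping only the scores
    of clusters inside a box of radius [m] then costs less than any power of [m], and the truncated
    scores depend on finitely many sites. If the complement is subcritical, the same is done with
    the complement: the window is an acyclic cubical complex ([acyclic_window]), so by an
    Alexander-type duality ([primal_dual]) the Betti number is a constant plus a relative homology
    count that is additive over the clusters of removed points.

    The central limit theorem for such local fields is proved by cumulants. The clustering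
    hypothesis gives superpolynomial decorrelation between local functionals at polynomial distance
    ([exponential_mixing]). A cumulant of a sum is a sum of joint cumulants over tuples of sites. A
    tuple that falls into two distant groups contributes almost nothing ([jcum_split]), and the
    number of other tuples is the volume times a power of [m] ([cum_bound]). With [m] a small power
    of the window radius, normalized cumulants of large order vanish. A variance of order [w_n^nu]
    with small [nu] controls only large orders; the remaining orders from three on follow from
    [janson], which rests on [marcinkiewicz]: a positive moment sequence with finitely many nonzero
    cumulants is Gaussian. Cumulants give moments, moments give characteristic functions by Taylor
    expansion, and these give weak convergence through trigonometric polynomials ([cvg_in_law_chf]).

    For the vector, covariances divided by the volume converge to the summed covariances of the
    stationary scores ([cov_sum_cvg]). Linear combinations are treated with [nu] equal to 1, where
    all cumulants of order at least three are controlled directly and the limit may be degenerate.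

    When only the complement is subcritical, this produces the series of the dual scores. It is
    matched with the series of the original scores by computing the same covariance limit a second
    way ([score_cov_dual]). In dimension one the clusters of [X] also have fast tails. In higher
    dimension, a large finite cluster has a large complementary cluster along its outer boundary
    ([finite_cluster_boundary], by way of [janiszewski]), so almost surely finite clusters have fast
    tails. For the number of components, the window has at most one large cluster outside a rare
    event, and this changes the count by at most one ([zero_cov]). *)

(** * Expectation and covariance of bounded random variables *)

Section BoundedExpectation.
Context (R : realType) (dT : measure_display) (T : measurableType dT).
Context (P : probability T R).
Implicit Types f g : T -> R.

(** Every observable of a finite window is bounded. Restricting to bounded measurable functions
    makes [Ex] and [cv] real valued and linear with no integrability conditions to carry. *)
Definition bmf f := measurable_fun setT f /\ exists M, forall w, `|f w| <= M.

Definition Ex f : R := \int[P]_w f w.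

Lemma bmf_integrable f : bmf f -> P.-integrable setT (EFin \o f).
Proof.
move=> [mf [M fM]]; apply: measurable_bounded_integrable => //.
  by rewrite [X in (X < _)%E](@probability_setT _ _ _ P) ltry.
exists M; split; first exact: num_real.
by move=> x Mx w _; apply: le_trans (fM w) (ltW Mx).
Qed.

Lemma bmf_cst c : bmf (fun=> c).
Proof. by split; [exact: measurable_cst|exists `|c|]. Qed.

Lemma bmfD f g : bmf f -> bmf g -> bmf (fun w => f w + g w).
Proof.
move=> [mf [M fM]] [mg [N gN]]; split; first exact: measurable_funD.
by exists (M + N) => w; apply: le_trans (ler_normD _ _) (lerD _ _).
Qed.

Lemma bmfM f g : bmf f -> bmf g -> bmf (fun w => f w * g w).
Proof.
move=> [mf [M fM]] [mg [N gN]]; split; first exact: measurable_funM.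
by exists (M * N) => w; rewrite normrM ler_pM.
Qed.

Lemma bmfZ c f : bmf f -> bmf (fun w => c * f w).
Proof. exact/bmfM/bmf_cst. Qed.

Lemma bmfN f : bmf f -> bmf (fun w => - f w).
Proof.
by move=> bf; rewrite (_ : (fun _ => _) = (fun w => -1 * f w)); [exact: bmfZ|apply/funext => w; rewrite mulN1r].
Qed.

Lemma bmfB f g : bmf f -> bmf g -> bmf (fun w => f w - g w).
Proof. by move=> bf /bmfN; exact: bmfD. Qed.

Lemma bmf_sum (I : Type) (r : seq I) (p : pred I) (F : I -> T -> R) :
  (forall i, p i -> bmf (F i)) -> bmf (fun w => \sum_(i <- r | p i) F i w).
Proof.
move=> bF; elim: r => [|i r IH].
  by rewrite (_ : (fun _ => _) = (fun=> 0)); [exact: bmf_cst|apply/funext => w; rewrite big_nil].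
have [pi|pi] := boolP (p i).
  rewrite (_ : (fun _ => _) = (fun w => F i w + \sum_(j <- r | p j) F j w)).
    exact: (bmfD (bF i pi)).
  by apply/funext => w; rewrite big_cons pi.
by rewrite (_ : (fun _ => _) = (fun w => \sum_(j <- r | p j) F j w))//;
  apply/funext => w; rewrite big_cons (negbTE pi).
Qed.

Lemma bmf_prod (I : Type) (r : seq I) (p : pred I) (F : I -> T -> R) :
  (forall i, p i -> bmf (F i)) -> bmf (fun w => \prod_(i <- r | p i) F i w).
Proof.
move=> bF; elim: r => [|i r IH].
  by rewrite (_ : (fun _ => _) = (fun=> 1)); [exact: bmf_cst|apply/funext => w; rewrite big_nil].
have [pi|pi] := boolP (p i).
  rewrite (_ : (fun _ => _) = (fun w => F i w * \prod_(j <- r | p j) F j w)).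
    exact: (bmfM (bF i pi)).
  by apply/funext => w; rewrite big_cons pi.
by rewrite (_ : (fun _ => _) = (fun w => \prod_(j <- r | p j) F j w))//;
  apply/funext => w; rewrite big_cons (negbTE pi).
Qed.

Lemma bmfX f n : bmf f -> bmf (fun w => f w ^+ n).
Proof.
move=> bf; elim: n => [|n IH]; first exact: bmf_cst.
by rewrite (_ : (fun _ => _) = (fun w => f w * f w ^+ n)); [exact: bmfM|apply/funext => w; rewrite exprS].
Qed.

Lemma bmf_norm f : bmf f -> bmf (fun w => `|f w|).
Proof.
move=> [mf [M fM]]; split; last by exists M => w; rewrite normr_id.
exact: (measurableT_comp _ mf).
Qed.

Lemma bmf_comp f (h : R -> R) : bmf f -> continuous h ->
  (exists M, forall x, `|h x| <= M) -> bmf (h \o f).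
Proof.
move=> [mf _] ch [M hM]; split; last by exists M => w /=.
by apply: measurableT_comp mf; exact: continuous_measurable_fun.
Qed.

Lemma bmf_indic (A : set T) : measurable A -> bmf (fun w => (\1_A w : R)).
Proof.
move=> mA; split; first exact: measurable_indic.
by exists 1 => w; rewrite indicE; case: (w \in A); rewrite ?normr1 ?normr0.
Qed.

Lemma ExD f g : bmf f -> bmf g -> Ex (fun w => f w + g w) = Ex f + Ex g.
Proof. by move=> bf bg; rewrite /Ex RintegralD//; exact: bmf_integrable. Qed.

Lemma ExZ c f : bmf f -> Ex (fun w => c * f w) = c * Ex f.
Proof. by move=> bf; rewrite /Ex RintegralZl//; exact: bmf_integrable. Qed.

Lemma ExN f : bmf f -> Ex (fun w => - f w) = - Ex f.
Proof.
move=> bf; rewrite (_ : (fun _ => _) = (fun w => -1 * f w)) ?ExZ ?mulN1r//.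
by apply/funext => w; rewrite mulN1r.
Qed.

Lemma ExB f g : bmf f -> bmf g -> Ex (fun w => f w - g w) = Ex f - Ex g.
Proof. by move=> bf bg; rewrite ExD ?ExN//; exact: bmfN. Qed.

Lemma Ex_cst c : Ex (fun=> c) = c.
Proof.
by rewrite /Ex Rintegral_cst// [X in fine X](@probability_setT _ _ _ P) mulr1.
Qed.

Lemma Ex_ge0 f : (forall w, 0 <= f w) -> 0 <= Ex f.
Proof. by move=> f0; exact: Rintegral_ge0. Qed.

Lemma Ex_le f g : bmf f -> bmf g -> (forall w, f w <= g w) -> Ex f <= Ex g.
Proof.
by move=> bf bg fg; apply: le_Rintegral => //; exact: bmf_integrable.
Qed.

Lemma Ex_abs f : bmf f -> `|Ex f| <= Ex (fun w => `|f w|).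
Proof. by move=> bf; apply: le_normr_Rintegral => //; exact: bmf_integrable. Qed.

Lemma Ex_bound f M : bmf f -> (forall w, `|f w| <= M) -> `|Ex f| <= M.
Proof.
move=> bf fM; apply: le_trans (Ex_abs bf) _; rewrite -[leRHS]Ex_cst.
by apply: Ex_le => //; [exact: bmf_norm|exact: bmf_cst].
Qed.

(** Intended for an error [e] on a good event and [K] on a bad event whose indicator is dominated by
    [b]. *)
Lemma Ex_diff_le f g b e K : bmf f -> bmf g -> bmf b ->
  (forall w, `|f w - g w| <= e + K * b w) -> `|Ex f - Ex g| <= e + K * Ex b.
Proof.
move=> bf bg bb h; have be := bmfD (bmf_cst e) (bmfZ K bb).
rewrite -ExB//; apply: le_trans (Ex_abs (bmfB bf bg)) _.
apply: le_trans (Ex_le (bmf_norm (bmfB bf bg)) be h) _.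
by rewrite (ExD (bmf_cst e) (bmfZ K bb)) Ex_cst ExZ.
Qed.

Lemma Ex_sum (I : Type) (r : seq I) (p : pred I) (F : I -> T -> R) :
  (forall i, p i -> bmf (F i)) ->
  Ex (fun w => \sum_(i <- r | p i) F i w) = \sum_(i <- r | p i) Ex (F i).
Proof.
move=> bF; elim: r => [|i r IH].
  rewrite big_nil (_ : (fun _ => _) = (fun=> 0)) ?Ex_cst//.
  by apply/funext => w; rewrite big_nil.
rewrite big_cons -IH; case: ifP => pi.
  rewrite -ExD//; [|exact: bF|exact: bmf_sum].
  by congr Ex; apply/funext => w; rewrite big_cons pi.
by congr Ex; apply/funext => w; rewrite big_cons pi.
Qed.

Lemma Ex_indic (A : set T) : measurable A -> Ex (fun w => \1_A w) = fine (P A).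
Proof.
by move=> mA; rewrite /Ex /Rintegral integral_indic// setIT.
Qed.

Definition cv f g : R := Ex (fun w => f w * g w) - Ex f * Ex g.

Lemma cvDl f g h : bmf f -> bmf g -> bmf h ->
  cv (fun w => f w + g w) h = cv f h + cv g h.
Proof.
move=> bf bg bh; rewrite /cv ExD//.
rewrite (_ : (fun _ => _) = (fun w => f w * h w + g w * h w)); last first.
  by apply/funext => w; rewrite mulrDl.
by rewrite ExD; [ring|exact: bmfM..].
Qed.

Lemma cvZl c f h : bmf f -> bmf h -> cv (fun w => c * f w) h = c * cv f h.
Proof.
move=> bf bh; rewrite /cv ExZ//.
rewrite (_ : (fun _ => _) = (fun w => c * (f w * h w))); last first.
  by apply/funext => w; rewrite mulrA.
by rewrite ExZ; [ring|exact: bmfM].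
Qed.

Lemma cvC f g : cv f g = cv g f.
Proof. by rewrite /cv mulrC; congr (Ex _ - _); apply/funext => w; rewrite mulrC. Qed.

Lemma cv_cst c f : bmf f -> cv (fun=> c) f = 0.
Proof. by move=> bf; rewrite /cv ExZ// Ex_cst subrr. Qed.

Lemma cv_suml (I : Type) (r : seq I) (p : pred I) (F : I -> T -> R) h :
  (forall i, p i -> bmf (F i)) -> bmf h ->
  cv (fun w => \sum_(i <- r | p i) F i w) h = \sum_(i <- r | p i) cv (F i) h.
Proof.
move=> bF bh; rewrite /cv Ex_sum// mulr_suml.
rewrite (_ : (fun _ => _) = (fun w => \sum_(i <- r | p i) F i w * h w)); last first.
  by apply/funext => w; rewrite mulr_suml.
rewrite Ex_sum => [|i pi]; last by apply: bmfM => //; exact: bF.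
by rewrite -sumrB.
Qed.

Lemma cv_bound f g M N : bmf f -> bmf g ->
  (forall w, `|f w| <= M) -> (forall w, `|g w| <= N) -> `|cv f g| <= 2 * M * N.
Proof.
move=> bf bg fM gN; rewrite /cv (le_trans (ler_normB _ _))//.
have M0 : 0 <= M by apply: le_trans (fM point).
have N0 : 0 <= N by apply: le_trans (gN point).
have h1 : `|Ex (fun w => f w * g w)| <= M * N by apply: Ex_bound => [|w]; [exact: bmfM|rewrite normrM ler_pM].
have h2 : `|Ex f * Ex g| <= M * N by rewrite normrM ler_pM//; exact: Ex_bound.
by have := lerD h1 h2; lra.
Qed.

Lemma cvDr f g h : bmf f -> bmf g -> bmf h ->
  cv h (fun w => f w + g w) = cv h f + cv h g.
Proof. by move=> *; rewrite ![cv h _]cvC cvDl. Qed.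

Lemma cvZr c f h : bmf f -> bmf h -> cv h (fun w => c * f w) = c * cv h f.
Proof. by move=> *; rewrite ![cv h _]cvC cvZl. Qed.

Lemma cv_sumr (I : Type) (r : seq I) (p : pred I) (F : I -> T -> R) h :
  (forall i, p i -> bmf (F i)) -> bmf h ->
  cv h (fun w => \sum_(i <- r | p i) F i w) = \sum_(i <- r | p i) cv h (F i).
Proof.
by move=> *; rewrite cvC cv_suml//; apply: eq_bigr => i _; exact: cvC.
Qed.

Lemma expectation_Ex f : bmf f -> 'E_P[f]%E = (Ex f)%:E.
Proof.
move=> /bmf_integrable bf.
by rewrite unlock /Ex /Rintegral fineK//; exact: integrable_fin_num.
Qed.

Lemma covariance_cv f g : bmf f -> bmf g -> covariance P f g = (cv f g)%:E.
Proof.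
move=> bf bg; rewrite unlock.
set h := (X in expectation P X).
have -> : h = (fun w => (f w - Ex f) * (g w - Ex g)) by apply/funext => w; rewrite /h /= !expectation_Ex.
rewrite expectation_Ex; last by apply: bmfM; apply: bmfB => //; exact: bmf_cst.
  congr EFin; rewrite /cv.
rewrite (_ : (fun _ => _) = (fun w => f w * g w - (Ex g * f w + (Ex f * g w - Ex f * Ex g)))).
  have bc := bmf_cst (Ex f * Ex g).
  have b2 := bmfB (bmfZ (Ex f) bg) bc.
  rewrite (ExB (bmfM bf bg) (bmfD (bmfZ (Ex g) bf) b2)) (ExD (bmfZ (Ex g) bf) b2).
  by rewrite (ExB (bmfZ (Ex f) bg) bc) (ExZ _ bf) (ExZ _ bg) Ex_cst; ring.
by apply/funext => w; ring.
Qed.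

Lemma variance_cv f : bmf f -> variance P f = (cv f f)%:E.
Proof. by move=> bf; rewrite /variance covariance_cv. Qed.

Lemma cv_ge0 f : bmf f -> 0 <= cv f f.
Proof. by move=> bf; rewrite -lee_fin -variance_cv// variance_ge0. Qed.

End BoundedExpectation.


(** * Cumulants of a moment sequence *)

Section MomentCumulants.
Variable R : comNzRingType.
Implicit Types m : nat -> R.

(* [cum m n] is the cumulant of order [n + 1] of the moment sequence [m]. *)
Fixpoint cumf (N : nat) m (n : nat) : R :=
  if N is N'.+1 then
    m n.+1 - \sum_(j < n) 'C(n, j)%:R * cumf N' m j * m (n - j)%N
  else 0.
Definition cum m n := cumf n.+1 m n.

Lemma cumfE N m n : (n < N)%N -> cumf N m n = cum m n.
Proof.
rewrite /cum; elim: N {-2}N (leqnn N) n => [|K IH] N NK n nN.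
  by move: NK nN; rewrite leqn0 => /eqP->.
case: N NK nN => // N NK nN /=; congr (_ - _); apply: eq_bigr => j _.
by rewrite (IH N) ?(IH n) //; have := ltn_ord j; lia.
Qed.

Lemma cum_rec m n : cum m n = m n.+1 - \sum_(j < n) 'C(n, j)%:R * cum m j * m (n - j)%N.
Proof. by rewrite {1}/cum /=; congr (_ - _); apply: eq_bigr => j _; rewrite cumfE. Qed.

Lemma moment_cum m n : m 0%N = 1 ->
  m n.+1 = \sum_(j < n.+1) 'C(n, j)%:R * cum m j * m (n - j)%N.
Proof.
move=> m0; by rewrite big_ord_recr /= subnn m0 mulr1 binn mul1r [in X in _ + X]cum_rec subrKC.
Qed.

Lemma cum_scale m c n : cum (fun k => c ^+ k * m k) n = c ^+ n.+1 * cum m n.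
Proof.
elim/ltn_ind: n => n IH; rewrite !cum_rec mulrBr; congr (_ - _).
rewrite mulr_sumr; apply: eq_bigr => j _; rewrite IH //.
have -> : c ^+ n.+1 = c ^+ j.+1 * c ^+ (n - j) by rewrite -exprD; congr (_ ^+ _); have := ltn_ord j; lia.
ring.
Qed.

Lemma eq_cum m m' n : (forall k, (k <= n.+1)%N -> m k = m' k) -> cum m n = cum m' n.
Proof.
elim/ltn_ind: n => n IH mm'; rewrite !cum_rec mm'//; congr (_ - _).
apply: eq_bigr => j _; rewrite IH// ?mm'//; first by lia.
by move=> k kj; apply: mm'; have := ltn_ord j; lia.
Qed.

End MomentCumulants.

(** * Joint cumulants of a set function *)

Section JointCumulants.
Import mathcomp.boot.fintype mathcomp.boot.finset.


Variables (R : realFieldType) (I : finType).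
Implicit Types (M : {set I} -> R) (A B U : {set I}).

(** Joint cumulants through the recursion over the block containing one distinguished element, here
    the one given by [pick]. This avoids sums over set partitions and mirrors the one-variable
    recursion of [cumf]. [N] is fuel. *)
Fixpoint jcumf (N : nat) M A : R :=
  if N is N'.+1 then
    if [pick i in A] is Some a then
      M A - \sum_(B : {set I} | (a \in B) && (B \proper A)) jcumf N' M B * M (A :\: B)
    else 0
  else 0.
Definition jcum M A := jcumf #|A| M A.

Lemma jcumfE N M A : (#|A| <= N)%N -> jcumf N M A = jcum M A.
Proof.
rewrite /jcum; elim: N {-2}N (leqnn N) A => [|K IH] N NK A AN.
  have -> : #|A| = N by apply/eqP; rewrite eqn_leq AN (leq_trans NK).
  by [].
case: N NK AN => [|N] NK AN; first by move: AN; rewrite leqn0 => /eqP->.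
case E : #|A| => [|n] /=; case: pickP => [a aA|//].
- by move/eqP: E; rewrite cards_eq0 => /eqP A0; rewrite A0 inE in aA.
- congr (_ - _); apply: eq_bigr => B /andP[_ /proper_card BA]; congr (_ * _).
  by rewrite (IH N)// ?(IH n)//; lia.
Qed.

Lemma jcum0 M : jcum M set0 = 0.
Proof. by rewrite /jcum cards0. Qed.

Lemma jcum_rec M A a : [pick i in A] = Some a ->
  jcum M A = M A - \sum_(B : {set I} | (a \in B) && (B \proper A)) jcum M B * M (A :\: B).
Proof.
move=> pa; rewrite {1}/jcum; have aA : a \in A by case: pickP pa => // x xA [<-].
have : (0 < #|A|)%N by apply/card_gt0P; exists a.
case E : #|A| => [//|n] _ /=; rewrite pa; congr (_ - _); apply: eq_bigr => B.
by case/andP=> _ /proper_card BA; rewrite jcumfE//; lia.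
Qed.

Lemma moment_jcum M A a : M set0 = 1 -> [pick i in A] = Some a ->
  M A = \sum_(B : {set I} | (a \in B) && (B \subset A)) jcum M B * M (A :\: B).
Proof.
move=> M0 pa; have aA : a \in A by case: pickP pa => // x xA [<-].
rewrite (bigD1 A) /=; last by rewrite aA subxx.
rewrite setDv M0 mulr1 (jcum_rec M pa).
set S := (X in _ - X); set S' := (X in _ + X).
suff -> : S = S' by rewrite subrK.
apply: eq_bigl => B; rewrite -andbA; congr (_ && _).
by rewrite properEneq andbC.
Qed.

Lemma pick_some (A : {set I}) : A != set0 -> exists2 a, [pick i in A] = Some a & a \in A.
Proof.
case/set0Pn => x xA; case: pickP => [a aA|/(_ x)]; first by exists a.
by rewrite xA.
Qed.

(** [pick] returns the first element in a fixed enumeration, so it survives in any subset that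
    contains it. The recursions for [A] and for a subset of [A] can thus be run through the same
    element. *)
Lemma pick_sub A B a : [pick i in A] = Some a -> a \in B -> B \subset A ->
  [pick i in B] = Some a.
Proof.
move=> + aB /subsetP BA.
have ohead_filter (p q : pred I) (s : seq I) : ohead [seq x <- s | p x] = Some a -> q a ->
    (forall x, q x -> p x) -> ohead [seq x <- s | q x] = Some a.
  move=> + qa qp; elim: s => //= x s IH; case qx : (q x); first by rewrite qp.
  by case: ifP => //= _ [xa]; rewrite -xa qx in qa.
move=> pa; apply: (ohead_filter (fun x => x \in A)) => //=.
Qed.

Lemma eq_jcum M M' A : (forall B, B \subset A -> M B = M' B) -> jcum M A = jcum M' A.
Proof.
elim: {A}#|A| {-2}A (leqnn #|A|) => [|n IH] A An MM'.
  by move: An; rewrite leqn0 cards_eq0 => /eqP->; rewrite !jcum0.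
have [->|/pick_some[a pa _]] := eqVneq A set0; first by rewrite !jcum0.
rewrite !(jcum_rec _ pa) MM' ?subxx//; congr (_ - _).
apply: eq_bigr => B /andP[_ BA]; have /andP[sBA _] := BA.
rewrite MM' ?subsetDl// IH//; first by have := proper_card BA; lia.
by move=> C CB; apply: MM'; exact: subset_trans sBA.
Qed.

Lemma jcum_bound (Bd : R) : 1 <= Bd -> forall n, exists c : R, 0 <= c /\
  forall M, (forall A, `|M A| <= Bd) -> forall A, (#|A| <= n)%N -> `|jcum M A| <= c.
Proof.
move=> B1; elim=> [|n [c [c0 IH]]].
  exists 0; split=> // M _ A; rewrite leqn0 cards_eq0 => /eqP->.
  by rewrite jcum0 normr0.
have B0 : 0 <= Bd by apply: le_trans B1.
exists (Bd + #|{set I}|%:R * (c * Bd)); split.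
  by rewrite addr_ge0// mulr_ge0 ?mulr_ge0.
move=> M MB A An; have [->|/pick_some[a pa _]] := eqVneq A set0.
  by rewrite jcum0 normr0 addr_ge0// mulr_ge0 ?mulr_ge0.
rewrite (jcum_rec _ pa) (le_trans (ler_normB _ _))// lerD//.
apply: le_trans (ler_norm_sum _ _ _) _.
apply: (@le_trans _ _ (\sum_(B : {set I}) c * Bd)); last by rewrite sumr_const mulr_natl.
rewrite big_mkcond /=; apply: ler_sum => B _; case: ifP => [/andP[_ BA]|_].
  rewrite normrM ler_pM// IH//; by have := proper_card BA; lia.
by rewrite mulr_ge0.
Qed.

(* The product of two independent groups has no mixed cumulants: in the
   recursion for a set meeting both groups, the sets on the side of the
   distinguished element reassemble the factorized moment. *)
Lemma jcum_split (Bd : R) : 1 <= Bd -> forall n, exists c : R, 0 <= c /\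
  forall M (U : {set I}) (eps : R), M set0 = 1 -> (forall A, `|M A| <= Bd) ->
  (forall A, `|M A - M (A :&: U) * M (A :\: U)| <= eps) ->
  forall A, (#|A| <= n)%N -> A :&: U != set0 -> A :\: U != set0 ->
  `|jcum M A| <= c * eps.
Proof.
move=> B1; elim=> [|n [c [c0 IH]]].
  exists 0; split=> // M U e _ _ _ A; rewrite leqn0 cards_eq0 => /eqP->.
  by rewrite set0I eqxx.
have [b [b0 jb]] := jcum_bound B1 n.
have B0 : 0 <= Bd by apply: le_trans B1.
set N : R := #|{set I}|%:R.
have N0 : 0 <= N by [].
exists (1 + N * (c * Bd) + N * b); split.
  by rewrite !addr_ge0// !mulr_ge0.
have key M U (e : R) : M set0 = 1 -> (forall A, `|M A| <= Bd) ->
    (forall A, `|M A - M (A :&: U) * M (A :\: U)| <= e) ->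
    (forall A, (#|A| <= n)%N -> A :&: U != set0 -> A :\: U != set0 ->
      `|jcum M A| <= c * e) ->
    forall A a, (#|A| <= n.+1)%N -> A :\: U != set0 ->
      [pick i in A] = Some a -> a \in U ->
    `|jcum M A| <= (1 + N * (c * Bd) + N * b) * e.
  move=> M0 MB Me IHM A a An AU pa aU.
  have e0 : 0 <= e by apply: le_trans (Me set0).
  have aA : a \in A by case: pickP pa => // x xA [<-].
  pose Q := [pred B : {set I} | (a \in B) && (B \proper A)].
  have AUp : A :&: U \proper A.
    rewrite properEneq subsetIl andbT; apply: contra AU => /eqP {1}<-.
    by rewrite setDIl setDv setI0.
  (* The expansion of [M (A :&: U)] through [a] runs over the blocks inside [U]. Subtracting it
     leaves three errors: the factorization error of [A]; the blocks not inside [U], which contain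
     [a] and so meet both sides, where induction applies; and, for blocks inside [U], only the
     factorization error of [A :\: B]. *)
  have eA : jcum M A = (M A - M (A :&: U) * M (A :\: U))
      - \sum_(B | Q B && ~~ (B \subset U)) jcum M B * M (A :\: B)
      - \sum_(B | Q B && (B \subset U)) jcum M B *
           (M (A :\: B) - M ((A :\: B) :&: U) * M ((A :\: B) :\: U)).
    rewrite (jcum_rec _ pa) (bigID (fun B : {set I} => B \subset U)) /=.
    under [X in _ = _ - X]eq_bigr do rewrite mulrBr.
    rewrite sumrB.
    suff -> : M (A :&: U) * M (A :\: U) =
      \sum_(B : {set I} | (a \in B) && (B \proper A) && (B \subset U))
         jcum M B * (M ((A :\: B) :&: U) * M ((A :\: B) :\: U)) by ring.
    have aAU : a \in A :&: U by rewrite inE aA.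
    rewrite {1}(@moment_jcum M (A :&: U) a)//; last first.
      by apply: pick_sub pa aAU _; exact: subsetIl.
    rewrite mulr_suml; apply: eq_big => B.
      rewrite -andbA subsetI; case: (a \in B) => //=.
      case BU : (B \subset U); rewrite ?andbF// !andbT.
      apply/idP/idP => [BA|/proper_sub//]; rewrite properEneq BA andbT.
      by apply: contra AU => /eqP <-; rewrite setD_eq0.
    case/andP=> aB /subsetIP[BA BU]; rewrite -mulrA; congr (_ * (M _ * M _)).
      by apply/setP => x; rewrite !inE; case: (x \in B); case: (x \in U); rewrite ?andbF.
    apply/setP => x; rewrite !inE; case xB : (x \in B) => //=.
    by rewrite (subsetP BU x xB).
  rewrite eA; apply: le_trans (ler_normB _ _) _; rewrite !mulrDl mul1r.
  apply: lerD; last first.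
    apply: le_trans (ler_norm_sum _ _ _) _.
    apply: (@le_trans _ _ (\sum_(B : {set I}) b * e)); last by rewrite sumr_const -mulrA /N mulr_natl.
    rewrite big_mkcond /=; apply: ler_sum => B _; case: ifP => [/andP[/andP[_ BA] _]|_].
      rewrite normrM ler_pM// jb//; by have := proper_card BA; lia.
    by rewrite mulr_ge0.
  apply: le_trans (ler_normB _ _) _; apply: lerD; first exact: Me.
  apply: le_trans (ler_norm_sum _ _ _) _.
  apply: (@le_trans _ _ (\sum_(B : {set I}) c * e * Bd)); last by rewrite sumr_const -[leRHS]mulrA /N mulr_natl mulrAC.
  rewrite big_mkcond /=; apply: ler_sum => B _.
  case: ifP => [/andP[/andP[aB BA] BU]|_]; last by rewrite !mulr_ge0.
  rewrite normrM ler_pM// IHM//.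
  - by have := proper_card BA; lia.
  - by apply/set0Pn; exists a; rewrite inE aB.
  - by rewrite setD_eq0.
move=> M U e M0 MB Me A An AU AD.
have [a pa aA] : exists2 a, [pick i in A] = Some a & a \in A by apply: pick_some; apply: contraNneq AU => ->; rewrite set0I.
have [aU|aU] := boolP (a \in U).
  by apply: (key M U e M0 MB Me _ A a) => // B; exact: (IH M U e).
(* When the distinguished element is outside [U], the two groups exchange roles. *)
have DC B : B :\: ~: U = B :&: U by rewrite setDE setCK.
apply: (key M (~: U) e M0 MB _ _ A a) => //.
- by move=> B; rewrite -setDE DC mulrC.
- by move=> B Bn; rewrite -setDE DC => BD BI; exact: (IH M U e).
- by rewrite DC.
- by rewrite inE.
Qed.

End JointCumulants.


(** * Averaging joint cumulants over index maps *)

Section AveragedCumulants.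
Import mathcomp.boot.fintype mathcomp.boot.finset.
Variables (R : realFieldType) (I W : finType).
Implicit Types (A B : {set I}) (f g : {ffun I -> W}).

Local Notation N := (#|{ffun I -> W}|%:R : R).

(* Swapping the coordinates outside [B] between two independent indices is an
   involution of the pairs of indices. *)
Lemma sum_ffun_resample B (g h : {ffun I -> W} -> R) :
  (forall f f', {in B, f =1 f'} -> g f = g f') ->
  (forall f f', {in ~: B, f =1 f'} -> h f = h f') ->
  N * (\sum_f g f * h f) = (\sum_f g f) * (\sum_f h f).
Proof.
move=> gB hB.
pose mix f f' : {ffun I -> W} := [ffun i => if i \in B then f i else f' i].
have mixK f f' : mix (mix f f') (mix f' f) = f by apply/ffunP => i; rewrite !ffunE; case: (i \in B).
rewrite big_distrlr /= pair_big /=.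
rewrite (reindex (fun p => (mix p.1 p.2, mix p.2 p.1))) /=; last first.
  by exists (fun p => (mix p.1 p.2, mix p.2 p.1)) => -[f f'] _ /=; rewrite !mixK.
transitivity (\sum_(p : {ffun I -> W} * {ffun I -> W}) g p.1 * h p.1).
  rewrite -(pair_big predT predT (fun f _ => g f * h f)) /=.
  by rewrite mulr_natl -sumrMnl; apply: eq_bigr => f _; rewrite sumr_const.
apply: eq_bigr => -[f f'] _ /=; congr (_ * _).
  by apply: gB => i iB; rewrite ffunE iB.
by apply: hB => i; rewrite inE ffunE => /negbTE ->.
Qed.

(** Under the uniform law on index maps the coordinates are independent, and the two factors of each
    product in the recursion depend on disjoint sets of coordinates. Averaging therefore passes
    through every product. *)
Lemma jcum_average (M : {ffun I -> W} -> {set I} -> R) : (0 < #|W|)%N ->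
  (forall f f' A, {in A, f =1 f'} -> M f A = M f' A) ->
  forall A, \sum_f jcum (M f) A = N * jcum (fun B => (\sum_f M f B) / N) A.
Proof.
move=> W0 Mloc.
have N0 : N != 0 by rewrite pnatr_eq0 card_ffun -lt0n expn_gt0 W0.
have jloc f f' A : {in A, f =1 f'} -> jcum (M f) A = jcum (M f') A.
  move=> ff; apply: eq_jcum => B /subsetP BA; apply: Mloc => i iB; exact/ff/BA.
move=> A; elim: {A}#|A| {-2}A (leqnn #|A|) => [|n IH] A An.
  move: An; rewrite leqn0 cards_eq0 => /eqP->; rewrite jcum0 mulr0.
  by rewrite big1// => f _; rewrite jcum0.
have [->|/pick_some[a pa _]] := eqVneq A set0.
  by rewrite jcum0 mulr0 big1// => f _; rewrite jcum0.
under eq_bigr do rewrite (jcum_rec _ pa).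
rewrite (jcum_rec _ pa) sumrB mulrBr mulrC divfK//; congr (_ - _).
rewrite exchange_big /= mulr_sumr; apply: eq_bigr => B /andP[_ BA].
have Bn : (#|B| <= n)%N by have := proper_card BA; lia.
apply: (mulfI N0); rewrite (@sum_ffun_resample B).
- by rewrite IH//; field.
- by move=> f f'; exact: jloc.
- move=> f f' ff; apply: Mloc => i; rewrite inE => /andP[iB _].
  by apply: ff; rewrite inE.
Qed.

(** When the moment of a set depends only on its size, the blocks through [a] can be grouped by
    size, and their number is the binomial coefficient of the one-variable recursion. *)
Lemma jcum_card (m : nat -> R) A : m 0%N = 1 -> A != set0 ->
  jcum (fun B => m #|B|) A = cum m #|A|.-1.
Proof.
move=> m0; elim: {A}#|A| {-2}A (leqnn #|A|) => [|n IH] A An.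
  by move: An; rewrite leqn0 cards_eq0 => ->.
move=> /pick_some[a pa aA].
rewrite (jcum_rec _ pa) cum_rec; have A1 : (0 < #|A|)%N by apply/card_gt0P; exists a.
rewrite prednK//; congr (_ - _).
rewrite (reindex_onto (fun C => a |: C) (fun B => B :\ a)) /=; last first.
  by move=> B /andP[aB _]; rewrite setD1K.
have cA : #|A :\ a| = #|A|.-1 by rewrite [in RHS](cardsD1 a A) aA.
rewrite (eq_bigl (fun C : {set I} => (C \subset A :\ a) && (#|C| < #|A|.-1)%N)); last first.
  move=> C; rewrite setU11 /= -cA.
  have -> : ((a |: C) :\ a == C) = (a \notin C).
    apply/eqP/idP => [<-|aC]; first by rewrite !inE eqxx.
    by apply/setP => x; rewrite !inE; case: eqVneq => // ->; rewrite (negbTE aC).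
  rewrite properEcard subsetD1 subUset sub1set aA /=.
  case aC : (a \in C); rewrite ?andbF ?andbT //=; congr (_ && _).
  by rewrite cardsU1 aC cA /=; lia.
rewrite (partition_big (fun C : {set I} => (inord #|C| : 'I_(#|A|.-1).+1)) predT) //=.
rewrite big_ord_recr /= [X in _ + X]big1 ?addr0; last first.
  move=> C /andP[/andP[_ Clt] /eqP e]; have := congr1 val e.
  by rewrite /= inordK; lia.
apply: eq_bigr => j _.
rewrite (eq_bigr (fun=> cum m j * m (#|A|.-1 - j)%N)).
  rewrite sumr_const mulr_natl -mulrnAl; congr (_ *+ _ * _).
  rewrite -[X in 'C(X, _)]cA -cards_draws; apply: eq_card => C; rewrite [LHS]unfold_in inE.
  rewrite -andbA; congr (_ && _); apply/andP/eqP => [[Clt /eqP e]|->].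
    by have := congr1 val e; rewrite /= inordK; lia.
  split; first by [].
  by apply/eqP/val_inj; rewrite /= inordK//; have := ltn_ord j; lia.
move=> C /andP[/andP[CA Clt] /eqP e].
have Cj : #|C| = j by have := congr1 val e; rewrite /= inordK; lia.
have aC : a \notin C by move: CA; rewrite subsetD1 => /andP[].
have c1 : #|a |: C| = j.+1 by rewrite cardsU1 aC Cj.
rewrite IH /= ?c1//; last 2 first.
- by have := ltn_ord j; lia.
- by rewrite -cards_eq0 c1.
have -> : A :\: (a |: C) = (A :\ a) :\: C by rewrite setDDl.
by rewrite cardsDS// cA Cj.
Qed.

End AveragedCumulants.

(** * Cumulants of sums of weakly dependent variables *)

Section CumulantBound.
Import mathcomp.boot.fintype mathcomp.boot.finset.
Context (R : realType) (dT : measure_display) (T : measurableType dT).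
Context (P : probability T R).

Definition moment (S : T -> R) (j : nat) : R := Ex P (fun w => S w ^+ j).

Lemma moment0 S : moment S 0 = 1.
Proof. by rewrite /moment -[RHS](Ex_cst P 1). Qed.

Definition mixed_moment (I W : finType) (Z : W -> T -> R) (f : {ffun I -> W})
  (A : {set I}) : R := Ex P (fun w => \prod_(i in A) Z (f i) w).

(** Multilinearity of cumulants without partitions. The average over index maps of the mixed moments
    is the moment sequence of the sum divided by the number of indices, so [jcum_average] and
    [jcum_card] turn the average of joint cumulants into an ordinary cumulant. *)
Lemma cum_sum (k : nat) (W : finType) (Z : W -> T -> R) : (0 < #|W|)%N ->
  (forall x, bmf (Z x)) ->
  cum (moment (fun w => \sum_x Z x w)) k =
  \sum_(f : {ffun 'I_k.+1 -> W}) jcum (mixed_moment Z f) setT.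
Proof.
move=> W0 bZ; set S := fun w => _.
have W0' : (#|W|%:R : R) != 0 by rewrite pnatr_eq0 -lt0n.
rewrite jcum_average//; last first.
  move=> f f' A ff; congr Ex; apply/funext => w; apply: eq_bigr => i iA.
  by rewrite ff.
(* Coordinates outside [B] are free: each contributes a factor equal to the number of indices, and
   this cancels against the normalization. *)
rewrite (@eq_jcum _ _ _ (fun B => (fun j => #|W|%:R^-1 ^+ j * moment S j) #|B|)).
  rewrite (@jcum_card _ _ (fun j => (#|W|%:R ^-1) ^+ j * moment S j)) //; last 2 first.
  - by rewrite expr0 mul1r moment0.
  - by rewrite -card_gt0 cardsT card_ord.
  rewrite cardsT card_ord /= cum_scale card_ffun card_ord natrX mulrA.
  by rewrite -exprMn divff// expr1n mul1r.
move=> B _; rewrite /mixed_moment -Ex_sum; last by move=> f _; apply: bmf_prod.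
apply: (canLR (mulfK _)).
  by rewrite pnatr_eq0 card_ffun -lt0n expn_gt0 W0.
rewrite mulrAC -ExZ; last by apply/bmfX/bmf_sum => x _.
congr Ex; apply/funext => w.
transitivity (\sum_(f : {ffun 'I_k.+1 -> W})
    \prod_i (if i \in B then Z (f i) w else 1)).
  by apply: eq_bigr => f _; rewrite big_mkcond.
rewrite -(bigA_distr_bigA (fun i x => if i \in B then Z x w else 1)) /=.
rewrite (bigID (mem B)) /=.
rewrite (eq_bigr (fun=> S w)) => [|i iB]; last by rewrite iB.
rewrite [X in _ * X](eq_bigr (fun=> #|W|%:R)) => [|i iB]; last by rewrite (negbTE iB) sumr_const.
rewrite !prodr_const mulrC; congr (_ * _).
rewrite card_ffun card_ord natrX.
rewrite [X in _ * (_ ^+ X)](_ : _ = (#|[predC B]| + #|B|)%N); last by rewrite addnC cardC card_ord.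
by rewrite exprD mulrCA -exprMn mulVf// expr1n mulr1.
Qed.

(** Index tuples are of two kinds. If every index lies in the ball of the first, there are few such
    tuples and each joint cumulant is bounded. Otherwise the positions linked to the first one by a
    chain of [near] pairs form a proper group that is far from the rest, and [jcum_split] makes the
    joint cumulant small. *)
Theorem cum_bound (k : nat) (Bd : R) : 1 <= Bd -> exists2 c : R, 0 <= c &
  forall (W : finType) (Z : W -> T -> R) (near : rel W) (ball : W -> {set W})
    (D : nat) (eps : R),
  (0 < #|W|)%N -> symmetric near ->
  (forall x, bmf (Z x)) -> (forall x w, `|Z x w| <= Bd) ->
  (forall x p, path near x p -> (size p <= k)%N -> last x p \in ball x) ->
  (forall x, #|ball x| <= D)%N ->
  (forall (f : {ffun 'I_k.+1 -> W}) (U : {set 'I_k.+1}),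
     (forall i j, i \in U -> j \notin U -> ~~ near (f i) (f j)) ->
     forall A, `|mixed_moment Z f A - mixed_moment Z f (A :&: U) * mixed_moment Z f (A :\: U)|
                 <= eps) ->
  `|cum (moment (fun w => \sum_x Z x w)) k| <=
     c * (#|W|%:R * D%:R ^+ k.+1 + #|W|%:R ^+ k.+1 * eps).
Proof.
move=> B1; have B0 : 0 <= Bd by apply: le_trans B1.
have Bk1 : 1 <= Bd ^+ k.+1 by exact: exprn_ege1.
have [c1 [c10 jb]] := jcum_bound 'I_k.+1 Bk1 k.+1.
have [c2 [c20 js]] := jcum_split 'I_k.+1 Bk1 k.+1.
exists (c1 + c2); first exact: addr_ge0.
move=> W Z near ball D e W0 ns bZ ZB hball hD hmix.
have Mb f A : `|mixed_moment (I:='I_k.+1) Z f A| <= Bd ^+ k.+1.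
  apply: Ex_bound; first exact: bmf_prod.
  move=> w; rewrite normr_prod.
  apply: (@le_trans _ _ (\prod_(i in A) Bd)).
    by apply: ler_prod => i _; rewrite normr_ge0 ZB.
  rewrite prodr_const; apply: ler_weXn2l => //.
  by rewrite -[leqRHS]card_ord max_card.
have M0 f : mixed_moment (I:='I_k.+1) Z f set0 = 1.
  rewrite /mixed_moment -[RHS](Ex_cst P 1); congr Ex; apply/funext => w.
  by rewrite big_set0.
have e0 : 0 <= e.
  have /card_gt0P[x _] := W0.
  apply: le_trans (hmix [ffun=> x] set0 _ set0); first exact: normr_ge0.
  by move=> i j; rewrite inE.
rewrite cum_sum//; apply: le_trans (ler_norm_sum _ _ _) _.
pose conn (f : {ffun 'I_k.+1 -> W}) := [forall i, f i \in ball (f ord0)].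
rewrite (bigID conn) /= mulrDl !mulrDr; apply: (@le_trans _ _
  (c1 * (#|W|%:R * D%:R ^+ k.+1) + c2 * (#|W|%:R ^+ k.+1 * e))); last first.
  rewrite lerD ?lerDl ?lerDr// !mulr_ge0 ?exprn_ge0//.
apply: lerD.
  apply: (@le_trans _ _ (\sum_(f | conn f) c1)).
    by apply: ler_sum => f _; apply: jb; [exact: Mb|rewrite cardsT card_ord].
  rewrite sumr_const -[leLHS]mulr_natr -natrX -natrM ler_wpM2l// ler_nat.
  apply: (@leq_trans (\sum_(x : W) #|family (fun _ : 'I_k.+1 => ball x)|)); last first.
    rewrite -sum_nat_const; apply: leq_sum => x _.
    by rewrite card_ffun_on card_ord leq_exp2r.
  rewrite -sum1_card (partition_big (fun f : {ffun 'I_k.+1 -> W} => f ord0) predT)//=.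
  apply: leq_sum => x _; rewrite sum1_card; apply: subset_leq_card.
  apply/subsetP => f; rewrite unfold_in => /andP[/forallP fb /eqP <-].
  by apply/familyP => i; exact: fb.
apply: (@le_trans _ _ (\sum_(f | ~~ conn f) (c2 * e))); last first.
  rewrite sumr_const -[leLHS]mulr_natl mulrCA ler_wpM2l// ler_wpM2r//.
  by rewrite -natrX -[in leRHS](card_ord k.+1) -card_ffun ler_nat max_card.
apply: ler_sum => f /forallPn[i0 fi0].
pose e' := [rel i j : 'I_k.+1 | near (f i) (f j)].
(* A shortest chain among [k.+1] positions has at most [k] steps, so it cannot leave the ball of the
   first index. The index outside the ball is therefore outside [U]. *)
pose U := [set i | connect e' ord0 i].
have i0U : i0 \notin U.
  rewrite inE; apply: contra fi0 => /connectP[p ep ->].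
  have [p' ep' up' _ ] := shortenP ep.
  rewrite -last_map; apply: hball; first by rewrite path_map.
  rewrite size_map; have := card_uniqP up'; have := max_card (mem (ord0 :: p')).
  by rewrite card_ord /= => + e1; rewrite e1.
apply: (js _ U) => //.
- move=> A; apply: hmix => i j; rewrite !inE => ci cj.
  by apply: contra cj => nij; apply: connect_trans ci (connect1 _).
- by rewrite cardsT card_ord.
- by apply/set0Pn; exists ord0; rewrite !inE connect0.
- by apply/set0Pn; exists i0; rewrite inE i0U inE.
Qed.

End CumulantBound.


(** * Power series of infinite radius *)

Section EntireSequences.
Variable R : realType.

Lemma cvg_ord_sum (T : Type) (F : set_system T) (FF : Filter F) n
    (f : 'I_n -> T -> R) (l : 'I_n -> R) :
  (forall j, f j @ F --> l j) -> (fun t => \sum_(j < n) f j t) @ F --> \sum_(j < n) l j.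
Proof.
elim: n f l => [|n IH] f l fl.
  rewrite big_ord0 (_ : (fun _ => _) = fun=> 0); first exact: cvg_cst.
  by apply/funext => t; rewrite big_ord0.
rewrite big_ord_recl (_ : (fun _ => _) = fun t => f ord0 t + \sum_(j < n) f (lift ord0 j) t).
  by apply: cvgD => //; apply: IH.
by apply/funext => t; rewrite big_ord_recl.
Qed.

Let b0 n k : 'C(n, @ord0 k)%:R = 1 :> R.
Proof. by rewrite /= bin0. Qed.

Lemma sum_binomial_pascal l (G : nat -> R) :
  \sum_(i < l.+2) 'C(l.+1, i)%:R * G i = \sum_(i < l.+1) 'C(l, i)%:R * (G i + G i.+1).
Proof.
rewrite big_ord_recl b0 mul1r.
rewrite (eq_bigr (fun i : 'I_l.+1 => 'C(l, i.+1)%:R * G i.+1 + 'C(l, i)%:R * G i.+1)); last first.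
  by move=> i _; rewrite -mulrDl -natrD -binS.
rewrite big_split /= addrA.
have -> : G 0%N + \sum_(i < l.+1) 'C(l, i.+1)%:R * G i.+1 = \sum_(i < l.+2) 'C(l, i)%:R * G i by rewrite [RHS]big_ord_recl b0 mul1r.
rewrite big_ord_recr /= bin_small// mul0r addr0 -big_split /=.
by apply: eq_bigr => i _; rewrite mulrDr.
Qed.

Lemma sum_binomial l : \sum_(i < l.+1) 'C(l, i)%:R = 2 ^+ l :> R.
Proof.
rewrite -natrX -(addn1 1) expnDn natr_sum; apply: eq_bigr => i _.
by rewrite !exp1n !muln1.
Qed.

(** The real part of [exp(i ph) (exp(i th) + exp(- i th))^l]. The phase [ph] is what lets the
    induction on [l] close. *)
Lemma sum_binomial_cos l th ph : \sum_(i < l.+1) 'C(l, i)%:R * cos ((i%:R *+ 2 - l%:R) * th + ph)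
   = 2 ^+ l * cos th ^+ l * cos ph :> R.
Proof.
elim: l ph => [|l IH] ph.
  by rewrite big_ord_recl big_ord0 b0 mul0rn subrr mul0r add0r addr0 expr0 !mul1r.
rewrite (sum_binomial_pascal l (fun i => cos ((i%:R *+ 2 - l.+1%:R) * th + ph))).
rewrite (eq_bigr (fun i : 'I_l.+1 => 'C(l, i)%:R * cos ((i%:R *+ 2 - l%:R) * th + (ph - th))
  + 'C(l, i)%:R * cos ((i%:R *+ 2 - l%:R) * th + (ph + th)))); last first.
  move=> i _; rewrite -mulrDr; congr (_ * (cos _ + cos _)).
    by rewrite -natr1; ring.
  by rewrite -!natr1; ring.
by rewrite big_split /= !IH cosB cosD !exprS; ring.
Qed.
Implicit Types (c g : nat -> R).

Definition entire c := forall r : R, 0 <= r -> exists B, forall n, `|c n| * r ^+ n <= B.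

Lemma entire_cvg c x : entire c -> cvgn (pseries c x).
Proof.
move=> /(_ (2 * `|x|)) []; first by rewrite mulr_ge0.
move=> B hB; apply: normed_cvg.
apply: (@series_le_cvg _ _ (geometric B 2^-1)).
- by move=> n /=; exact: normr_ge0.
- move=> n /=; rewrite mulr_ge0 ?exprn_ge0// ?invr_ge0//.
  by apply: le_trans (hB 0%N); rewrite expr0 mulr1.
- move=> n /=; rewrite normrM normrX exprVn ler_pdivlMr ?exprn_gt0//.
  by apply: le_trans (hB n); rewrite exprMn mulrAC -mulrA.
- apply: is_cvg_geometric_series; rewrite ger0_norm ?invr_ge0//.
  by rewrite invf_lt1// ltr1n.
Qed.

Lemma entire_mul c g : entire c -> (forall n, `|g n| <= 1) ->
  entire (fun n => c n * g n).
Proof.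
move=> ec g1 r r0; have [B hB] := ec r r0; exists B => n.
apply: le_trans (hB n); rewrite ler_wpM2r ?exprn_ge0// normrM.
by rewrite ler_piMr.
Qed.

Lemma entire_diffs c : entire c -> entire (pseries_diffs c).
Proof.
move=> ec r r0; have h : 0 <= 2 * (r + 1) by rewrite mulr_ge0 ?addr_ge0.
have [B hB] := ec _ h.
exists B => n; apply: le_trans (hB n.+1).
rewrite /pseries_diffs normrM ger0_norm// mulrC mulrA mulrC ler_wpM2l// exprMn mulrC.
have r1 : r ^+ n <= (r + 1) ^+ n.+1.
  apply: (@le_trans _ _ ((r + 1) ^+ n)).
    by rewrite lerXn2r// ?nnegrE ?addr_ge0// lerDl.
  by rewrite exprS ler_peMl ?exprn_ge0 ?addr_ge0// lerDr.
apply: ler_pM => //; rewrite ?exprn_ge0//.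
by rewrite -natrX ler_nat; apply: ltnW; exact: ltn_expl.
Qed.

Lemma is_derive_entire c (x : R) : entire c ->
  is_derive x (1 : R) (fun x => limn (pseries c x)) (limn (pseries (pseries_diffs c) x)).
Proof.
move=> ec; apply: (@pseries_snd_diffs _ _ (`|x| + 1)).
- exact: entire_cvg.
- exact/entire_cvg/entire_diffs.
- exact/entire_cvg/entire_diffs/entire_diffs.
- by rewrite [ltRHS]ger0_norm ?addr_ge0// ltrDl.
Qed.

End EntireSequences.

Lemma is_derive_monom (R : realType) (c : R) n (x : R) :
  is_derive x (1 : R) (fun y => c * y ^+ n.+1) (c * n.+1%:R * x ^+ n).
Proof.
have h := is_deriveZ c (@is_deriveX _ _ id n.+1 x 1 1 (is_derive_id x 1)).
rewrite (_ : (fun y => _) = c \*: (@id R ^+ n.+1)); last first.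
  by apply/funext => y; rewrite /= exprfctE.
by apply: is_derive_eq h _; rewrite /GRing.scale /= mulr1 mulrA.
Qed.

(** * Marcinkiewicz's theorem *)

Section Marcinkiewicz.
Variable R : realType.
Variables (m : nat -> R) (D : nat).
Hypothesis m0 : m 0%N = 1.
Hypothesis cumD : forall j, (D <= j)%N -> cum m j = 0.
Hypothesis mpos : forall (J : nat) (t : nat -> R),
  0 <= \sum_(i < J) \sum_(j < J) t i * t j * m (i + j)%N.

(** [a] lists the Taylor coefficients of the formal moment generating function [Phi], and [p] those
    of the derivative of its logarithm. The recursion between moments and cumulants is the
    differential equation [Phi' = p Phi], where [p] is a polynomial by [cumD]. *)
Let a n := m n / n`!%:R.
Let p j := cum m j / j`!%:R.

Let fact_neq0 n : n`!%:R != 0 :> R.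
Proof. by rewrite pnatr_eq0 -lt0n fact_gt0. Qed.

Let a_rec n : pseries_diffs a n = \sum_(j < n.+1) p j * a (n - j)%N.
Proof.
rewrite /pseries_diffs /a factS natrM moment_cum// invfM.
rewrite mulrCA mulVKf ?pnatr_eq0// mulr_suml; apply: eq_bigr => j _.
have jn : (j <= n)%N by rewrite -ltnS.
have h := bin_fact jn; rewrite /p /a.
have -> : n`!%:R = 'C(n, j)%:R * (j`!%:R * (n - j)`!%:R) :> R by rewrite -!natrM h.
have C0 : 'C(n, j)%:R != 0 :> R by rewrite pnatr_eq0 -lt0n bin_gt0.
by field; rewrite C0 !fact_neq0.
Qed.

(** As [p] is a polynomial, [n+1] times the next weighted coefficient is at most a fixed [K] times
    the largest earlier one. Past index [K] the weighted coefficients can no longer grow. *)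
Let ent_a : entire a.
Proof.
move=> r r0; pose K := \sum_(j < D) `|p j| * r ^+ j.+1.
have K0 : 0 <= K by apply: sumr_ge0 => j _; rewrite mulr_ge0 ?exprn_ge0.
pose N := Num.bound K.
have KN : K <= N%:R by apply/ltW/archi_boundP.
exists (\sum_(i < N.+1) `|a i| * r ^+ i); elim/ltn_ind => n IH.
have [nN|Nn] := ltnP n N.+1.
  rewrite (bigD1 (Ordinal nN)) //= lerDl sumr_ge0// => j _.
  by rewrite mulr_ge0 ?exprn_ge0.
case: n Nn IH => // n Nn IH; set B := \sum_(i < N.+1) _ in IH *.
have B0 : 0 <= B by apply: sumr_ge0 => j _; rewrite mulr_ge0 ?exprn_ge0.
have n1 : 0 < n.+1%:R :> R by rewrite ltr0n.
rewrite -(ler_pM2l n1); apply: (@le_trans _ _ (K * B)); last first.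
  by rewrite ler_wpM2r// (le_trans KN)// ler_nat; lia.
have -> : n.+1%:R * (`|a n.+1| * r ^+ n.+1) = `|pseries_diffs a n| * r ^+ n.+1 by rewrite /pseries_diffs [in RHS](normrM n.+1%:R) normr_nat mulrA.
rewrite a_rec (big_ord_widen_cond (maxn n.+1 D) predT (fun j => p j * a (n - j)%N)) ?leq_maxl//.
apply: (@le_trans _ _ (\sum_(i < maxn n.+1 D | (i < D)%N) `|p i| * r ^+ i.+1 * B)); last first.
  by rewrite /K mulr_suml (big_ord_widen_cond (maxn n.+1 D) predT
     (fun i => `|p i| * r ^+ i.+1 * B)) ?leq_maxr.
apply: (@le_trans _ _ (\sum_(i < maxn n.+1 D | (i < n.+1)%N) `|p i * a (n - i)%N| * r ^+ n.+1)).
  by rewrite -mulr_suml ler_wpM2r ?exprn_ge0// ler_norm_sum.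
rewrite [leLHS]big_mkcond [leRHS]big_mkcond; apply: ler_sum => i _ /=.
have [iD|Di] := ltnP i D; last first.
  by case: ifP => // _; rewrite /p cumD// mul0r mul0r normr0 mul0r.
case: ifP => [i_n|_]; last by rewrite !mulr_ge0 ?exprn_ge0.
rewrite normrM -!mulrA ler_wpM2l//.
have -> : r ^+ n.+1 = r ^+ (n - i) * r ^+ i.+1 by rewrite -exprD; congr (_ ^+ _); lia.
by rewrite mulrA [leRHS]mulrC ler_wpM2r ?exprn_ge0// IH//; lia.
Qed.

(** With [g] equal to [cosn th] or [sinn th], these are the real and imaginary parts of [Phi] at the
    complex point [x exp(i th)]. No complex analysis is used. *)
Let U (g : nat -> R) (x : R) : R := limn (pseries (fun n => a n * g n) x).

Let cosn (th : R) (n : nat) : R := cos (n%:R * th).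
Let sinn (th : R) (n : nat) : R := sin (n%:R * th).

Let cosn1 th n : `|cosn th n| <= 1. Proof. exact: cos_max. Qed.
Let sinn1 th n : `|sinn th n| <= 1. Proof. exact: sin_max. Qed.

Let Ucvg (g : nat -> R) (x : R) : (forall n, `|g n| <= 1) -> pseries (fun n => a n * g n) x @ \oo --> U g x.
Proof. by move=> g1; apply: entire_cvg; exact: entire_mul. Qed.

Let sum_shift (j n : nat) (G : nat -> R) :
  \sum_(0 <= l < n) (if (j <= l)%N then G (l - j)%N else 0) = \sum_(0 <= i < n - j) G i.
Proof.
elim: n => [|n IH]; first by rewrite !big_geq.
rewrite big_nat_recr//= IH; case: leqP => jn.
  by rewrite subSn// big_nat_recr.
by rewrite addr0 (_ : n.+1 - j = n - j)%N//; lia.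
Qed.

(* If [g (j + 1 + i)] decomposes by an addition formula, the recurrence of the
   coefficients turns into a linear differential system. *)
Let U_deriv (g g1 g2 al be : nat -> R) (x : R) : (forall n, `|g n| <= 1) ->
  (forall n, `|g1 n| <= 1) -> (forall n, `|g2 n| <= 1) ->
  (forall i j, g (j + i).+1 = al j * g1 i + be j * g2 i) ->
  is_derive x (1 : R) (U g) (\sum_(j < D) p j * x ^+ j * (al j * U g1 x + be j * U g2 x)).
Proof.
move=> gb g1b g2b gadd.
suff -> : \sum_(j < D) p j * x ^+ j * (al j * U g1 x + be j * U g2 x) =
    limn (pseries (pseries_diffs (fun n => a n * g n)) x).
  by apply: is_derive_entire; exact: entire_mul.
apply/esym/cvg_lim => //.
have -> : pseries (pseries_diffs (fun n => a n * g n)) x = fun n =>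
    \sum_(j < D) p j * x ^+ j * (al j * pseries (fun n => a n * g1 n) x (n - j)%N
        + be j * pseries (fun n => a n * g2 n) x (n - j)%N).
  apply/funext => n; rewrite /pseries /series /=.
  under [RHS]eq_bigr => j _ do rewrite !mulr_sumr -big_split /= mulr_sumr
    -(sum_shift j n (fun i => p j * x ^+ j * (al j * (a i * g1 i * x ^+ i) + be j * (a i * g2 i * x ^+ i)))).
  rewrite exchange_big /=; apply: eq_bigr => l _.
  have -> : pseries_diffs (fun n => a n * g n) l = pseries_diffs a l * g l.+1 by rewrite /pseries_diffs mulrA.
  rewrite a_rec mulr_suml mulr_suml.
  rewrite (big_ord_widen_cond (maxn l.+1 D) predT (fun j => p j * a (l - j)%N * g l.+1 * x ^+ l)) ?leq_maxl//.
  rewrite (big_ord_widen_cond (maxn l.+1 D) predT (fun j => if (j <= l)%N then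
     p j * x ^+ j * (al j * (a (l - j)%N * g1 (l - j)%N * x ^+ (l - j)) + be j * (a (l - j)%N * g2 (l - j)%N * x ^+ (l - j))) else 0)) ?leq_maxr//.
  rewrite [LHS]big_mkcond [RHS]big_mkcond; apply: eq_bigr => j _ /=; rewrite ltnS.
  have [jl|jl] := leqP j l; last by case: (j < D)%N.
  case: ltnP => jD; last by rewrite /p cumD// !mul0r.
  have -> : g l.+1 = al j * g1 (l - j)%N + be j * g2 (l - j)%N by rewrite -gadd subnKC.
  have -> : x ^+ l = x ^+ j * x ^+ (l - j) by rewrite -exprD subnKC.
  by ring.
have sub_oo j : (fun n => (n - j)%N) @ \oo --> \oo.
  exact: cvg_subnr.
apply: cvg_ord_sum => j.
apply: cvgMl_tmp; apply: cvgD; apply: cvgMl_tmp.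
  exact: (cvg_comp _ _ (sub_oo j) (@Ucvg g1 x g1b)).
exact: (cvg_comp _ _ (sub_oo j) (@Ucvg g2 x g2b)).
Qed.

(** The real part, at [x exp(i th)], of the primitive of [p] that vanishes at 0. *)
Let q th (x : R) := \sum_(j < D) p j / j.+1%:R * cosn th j.+1 * x ^+ j.+1.

Let q_deriv th (x : R) : is_derive x (1 : R) (q th) (\sum_(j < D) p j * cosn th j.+1 * x ^+ j).
Proof.
rewrite /q.
have -> : (fun x0 => \sum_(j < D) p j / j.+1%:R * cosn th j.+1 * x0 ^+ j.+1) =
   \sum_(j < D) (fun x0 => p j / j.+1%:R * cosn th j.+1 * x0 ^+ j.+1).
  by apply/funext => y; rewrite fct_sumE.
apply: is_derive_sum => j; apply: is_derive_eq (is_derive_monom _ _ _) _.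
by rewrite -!mulrA [cosn _ _ * (_ * _)]mulrCA mulKf ?pnatr_eq0.
Qed.

(** Since [Phi' = p Phi], the squared modulus of [Phi] times [exp(-2 q)] has zero derivative along
    the ray, and it equals 1 at the origin. *)
Let modulus th x :
  U (cosn th) x ^+ 2 + U (sinn th) x ^+ 2 = expR (2 * q th x).
Proof.
pose h x := (U (cosn th) x ^+ 2 + U (sinn th) x ^+ 2) * expR (- 2 * q th x).
have dU y : is_derive y (1 : R) (U (cosn th))
    (\sum_(j < D) p j * y ^+ j * (cosn th j.+1 * U (cosn th) y + (- sinn th j.+1) * U (sinn th) y)).
  apply: (@U_deriv _ _ _ (fun j => cosn th j.+1) (fun j => - sinn th j.+1)) => // i j.
  by rewrite /cosn /sinn -addSn natrD mulrDl cosD mulNr.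
have dV y : is_derive y (1 : R) (U (sinn th))
    (\sum_(j < D) p j * y ^+ j * (sinn th j.+1 * U (cosn th) y + cosn th j.+1 * U (sinn th) y)).
  apply: (@U_deriv _ _ _ (fun j => sinn th j.+1) (fun j => cosn th j.+1)) => // i j.
  by rewrite /cosn /sinn -addSn natrD mulrDl sinD.
have dh y : is_derive y (1 : R) h 0.
  have dq := q_deriv th y; have du := dU y; have dv := dV y.
  have de : is_derive y (1 : R) (expR \o (-2 \*: q th)) _ :=
    is_derive1_comp (is_derive_expR _) (is_deriveZ (-2) dq).
  have duv : is_derive y (1 : R) (U (cosn th) * U (cosn th) + U (sinn th) * U (sinn th)) _ :=
    is_deriveD (is_deriveM du du) (is_deriveM dv dv).
  rewrite (_ : h = (U (cosn th) * U (cosn th) + U (sinn th) * U (sinn th)) * (expR \o (-2 \*: q th))).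
    apply: is_derive_eq (is_deriveM duv de) _.
    rewrite /GRing.scale /= !fctE.
    set u := U _ y; set v := U (sinn th) y; set e := expR _.
    set S1 := \sum_(j < D) p j * cosn th j.+1 * y ^+ j.
    set S2 := \sum_(j < D) p j * y ^+ j * (cosn th j.+1 * u + _).
    set S3 := \sum_(j < D) p j * y ^+ j * (sinn th j.+1 * u + _).
    suff E : u * S2 + v * S3 = (u ^+ 2 + v ^+ 2) * S1.
      rewrite (_ : _ + _ = 2 * e * ((u * S2 + v * S3) - (u ^+ 2 + v ^+ 2) * S1)); first by rewrite E subrr mulr0.
      by ring.
    rewrite !mulr_sumr -big_split /=; apply: eq_bigr => j _; ring.
  by apply/funext => z; rewrite /h /= !fctE -!expr2.
have h1 : h x = h 0 by apply: is_derive_0_is_cst.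
have U0 (g : nat -> R) : U g 0 = g 0%N.
  apply: cvg_lim => //; rewrite -cvg_shiftS /=.
  suff -> : (fun n => pseries (fun n => a n * g n) 0 n.+1) = fun=> g 0%N by exact: cvg_cst.
  apply/funext => n; rewrite /pseries /series /= big_nat_recl//= big1 => [|i _].
    by rewrite /a m0 fact0 divr1 mul1r expr0 mulr1 addr0.
  by rewrite expr0n mulr0.
have q0 : q th 0 = 0 by apply: big1 => j _; rewrite expr0n mulr0.
move: h1; rewrite /h !U0 q0 mulr0 expR0 mulr1 /cosn /sinn mul0r cos0 sin0.
rewrite expr1n expr0n addr0 mulNr expRN => /(canRL (mulfVK _)) ->.
  by rewrite mul1r.
by rewrite gt_eqF// expR_gt0.
Qed.

(* Comparison of the square partial sums of the double series with the
   triangular ones, which are the partial sums of a power series. *)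
Let square_cvg (g : nat -> nat -> R) (w : nat -> R) x :
  (forall i j, `|g i j| <= 1) ->
  (forall l, w l = 2 ^- l * \sum_(i < l.+1) 'C(l, i)%:R * g i (l - i)%N) ->
  (fun J => \sum_(i < J) \sum_(j < J) (x / 2) ^+ i / i`!%:R * ((x / 2) ^+ j / j`!%:R)
      * m (i + j)%N * g i j) @ \oo --> U w x.
Proof.
move=> gb wE.
pose F i j := (x / 2) ^+ i / i`!%:R * ((x / 2) ^+ j / j`!%:R) * m (i + j)%N * g i j.
have FE i j : F i j = 'C(i + j, i)%:R * a (i + j)%N * (x / 2) ^+ (i + j) * g i j.
  rewrite /F /a -(@bin_fact (i + j) i) ?leq_addr// !natrM addKn exprD.
  have C0 : 'C(i + j, i)%:R != 0 :> R by rewrite pnatr_eq0 -lt0n bin_gt0 leq_addr.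
  by field; rewrite C0 !fact_neq0.
(* The factor 8 absorbs the terms outside the triangle: there are at most [J^2] of them, each at
   most [B / 8^J], and [J^2] is at most [4^J]. *)
have x8 : 0 <= 8 * `|x| by rewrite mulr_ge0.
have [B hB] := ent_a x8.
have FB i j J : (J <= i + j)%N -> `|F i j| <= B / 8 ^+ J.
  move=> Jij; rewrite FE; move: (hB (i + j)%N); move: (a (i + j)%N) => A hA.
  rewrite !normrM normrX.
  have B0 : 0 <= B by apply: le_trans (hB 0%N); rewrite expr0 mulr1.
  apply: (@le_trans _ _ (B / 8 ^+ (i + j))); last by rewrite ler_wpM2l// lef_pV2 ?posrE ?exprn_gt0// ler_weXn2l// ler1n.
  rewrite ler_pdivlMr ?exprn_gt0//; apply: le_trans hA.
  rewrite normr_nat [Num.norm (x / 2)]normrM [Num.norm 2^-1]ger0_norm ?invr_ge0//.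
  rewrite !exprMn exprVn; set c := 'C(_, _)%:R; set t := 2 ^+ _; set e := 8 ^+ _.
  have ct : c / t <= 1.
    rewrite ler_pdivrMr ?exprn_gt0// mul1r /c /t -sum_binomial.
    have l : (i < (i + j).+1)%N by rewrite ltnS leq_addr.
    by rewrite (bigD1 (Ordinal l)) //= lerDl sumr_ge0.
  have -> : c * `|A| * (`|x| ^+ (i + j) / t) * `|g i j| * e =
     `|A| * (e * `|x| ^+ (i + j)) * (c / t * `|g i j|) by ring.
  rewrite ler_piMr//; first by rewrite !mulr_ge0 ?exprn_ge0.
  by rewrite mulr_ile1// divr_ge0// exprn_ge0.
have wb l : `|w l| <= 1.
  rewrite wE normrM ger0_norm ?invr_ge0 ?exprn_ge0// mulrC ler_pdivrMr ?exprn_gt0// mul1r.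
  rewrite -sum_binomial; apply: le_trans (ler_norm_sum _ _ _) _.
  by apply: ler_sum => i _; rewrite normrM ger0_norm// ler_piMr.
have TE J : pseries (fun n => a n * w n) x J = \sum_(i < J) \sum_(0 <= j < J - i) F i j.
  rewrite /pseries /series /=.
  under [RHS]eq_bigr do rewrite -sum_shift.
  rewrite exchange_big /=; apply: eq_big_nat => l /andP[_ lJ].
  rewrite wE -big_mkcond /= [RHS](_ : _ = \sum_(i < J | (i < l.+1)%N) F i (l - i)%N)//.
  rewrite -(big_ord_widen J (fun i => F i (l - i)%N))//.
  rewrite mulr_sumr mulr_sumr mulr_suml; apply: eq_bigr => i _.
  have il : (i <= l)%N by rewrite -ltnS.
  rewrite FE subnKC// exprMn exprVn; set t := 2 ^+ l.
  by ring.
have SE J : \sum_(i < J) \sum_(j < J) F i j = pseries (fun n => a n * w n) x J +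
    \sum_(i < J) \sum_(J - i <= j < J) F i j.
  rewrite TE -big_split /=; apply: eq_bigr => i _.
  by rewrite -(big_mkord predT (fun j => F i j)) (@big_cat_nat _ _ _ (J - i)%N)//= leq_subr.
rewrite (_ : (fun J => _) = fun J => pseries (fun n => a n * w n) x J +
    \sum_(i < J) \sum_(J - i <= j < J) F i j); last by apply/funext => J; exact: SE.
rewrite -[U w x]addr0; apply: cvgD; first exact: Ucvg.
have /cvgr0Pnorm_le lim0 : (fun J => B * 2^-1 ^+ J) @ \oo --> 0 by rewrite -(mulr0 B); apply: cvgMl_tmp; apply: cvg_expr; rewrite ger0_norm// invf_lt1// ltr1n.
apply/cvgr0Pnorm_le => e e0; have := lim0 e e0; apply: filterS => J hJ.
apply: (@le_trans _ _ (B * 2^-1 ^+ J)).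
  apply: le_trans (ler_norm_sum _ _ _) _.
  apply: (@le_trans _ _ (\sum_(i < J) \sum_(j < J) B / 8 ^+ J)).
    apply: ler_sum => i _; rewrite -(big_mkord predT (fun j => B / 8 ^+ J)).
    rewrite [leRHS](@big_cat_nat _ _ _ (J - i)%N)//= ?leq_subr//.
    have B0 : 0 <= B by apply: le_trans (hB 0%N); rewrite expr0 mulr1.
    apply: ler_wpDl.
      by apply: sumr_ge0 => *; rewrite divr_ge0// exprn_ge0.
    apply: le_trans (ler_norm_sum _ _ _) _.
    by apply: ler_sum_nat => j /andP[ij _]; apply: FB; lia.
  rewrite !sumr_const !card_ord -mulrnA -[leLHS]mulr_natr -[leLHS]mulrA ler_wpM2l//.
    by apply: le_trans (hB 0%N); rewrite expr0 mulr1.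
  rewrite exprVn ler_pdivrMl ?exprn_gt0// ler_pdivlMr ?exprn_gt0//.
  rewrite -!natrX -natrM ler_nat.
  rewrite (_ : 8 = (2 * (2 * 2)))%N// !expnMn mulnC leq_mul2l; apply/orP; right.
  by apply: leq_mul; apply: ltnW; exact: ltn_expl.
by apply: le_trans (ler_norm _) hJ.
Qed.

(** The inequality [|E exp(zY)| <= E exp(Re(z) Y)], deduced from positivity of the moment form
    alone. Write [exp(zY)] as the square of [exp(zY/2)], truncate the latter, and apply
    Cauchy-Schwarz to its real and imaginary parts. The square truncations converge by
    [square_cvg]. *)
Let modulus_le th x :
  U (cosn th) x ^+ 2 + U (sinn th) x ^+ 2 <= U (fun=> 1) (x * cos th) ^+ 2.
Proof.
pose al i := (x / 2) ^+ i / i`!%:R.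
pose Sq (g : nat -> nat -> R) J :=
  \sum_(i < J) \sum_(j < J) al i * al j * m (i + j)%N * g i j.
have SqD g h J : Sq g J + Sq h J = Sq (fun i j => g i j + h i j) J.
  rewrite /Sq -big_split; apply: eq_bigr => i _; rewrite -big_split.
  by apply: eq_bigr => j _; rewrite mulrDr.
have SqZ c g J : c * Sq g J = Sq (fun i j => c * g i j) J.
  rewrite /Sq mulr_sumr; apply: eq_bigr => i _; rewrite mulr_sumr.
  by apply: eq_bigr => j _; rewrite mulrCA.
pose c := cosn th; pose s := sinn th.
have ineq J : Sq (fun i j => cosn th (i + j)%N) J ^+ 2 + Sq (fun i j => sinn th (i + j)%N) J ^+ 2
    <= Sq (fun i j => cos ((i%:R - j%:R) * th)) J ^+ 2.
  pose A := Sq (fun i j => c i * c j) J; pose C := Sq (fun i j => s i * s j) J.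
  pose B := Sq (fun i j => c i * s j + s i * c j) J.
  have -> : Sq (fun i j => cosn th (i + j)%N) J = A + (- 1) * C.
    rewrite SqZ SqD; congr (Sq _ J); apply/funext => i; apply/funext => j.
    by rewrite /cosn natrD mulrDl cosD mulN1r.
  have -> : Sq (fun i j => sinn th (i + j)%N) J = B.
    congr (Sq _ J); apply/funext => i; apply/funext => j.
    by rewrite /sinn natrD mulrDl sinD addrC.
  have -> : Sq (fun i j => cos ((i%:R - j%:R) * th)) J = A + C.
    rewrite SqD; congr (Sq _ J); apply/funext => i; apply/funext => j.
    by rewrite mulrBl cosB.
  have pos la mu : 0 <= la ^+ 2 * A + la * mu * B + mu ^+ 2 * C.
    rewrite !SqZ !SqD.
    have := mpos J (fun i => al i * (la * c i + mu * s i)).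
    congr (_ <= _); apply: eq_bigr => i _; apply: eq_bigr => j _; ring.
  have A0 : 0 <= A by have := pos 1 0; lra.
  have C0 : 0 <= C by have := pos 0 1; lra.
  (* The goal [(A - C)^2 + B^2 <= (A + C)^2] is the discriminant condition of the nonnegative
     quadratic form [pos]. The case [A = 0] is treated apart. *)
  suff : B ^+ 2 <= 4 * A * C by nra.
  have [A00|/eqP An0] := eqVneq A 0.
    have := pos (- (C + 1)) B; have := pos (C + 1) (-B); rewrite A00; nra.
  have Ap : 0 < A by rewrite lt_neqAle eq_sym; apply/andP; split => //; exact/eqP.
  have := pos (- B) (2 * A).
  have -> : (- B) ^+ 2 * A + - B * (2 * A) * B + (2 * A) ^+ 2 * C = A * (4 * A * C - B ^+ 2) by ring.
  by rewrite pmulr_rge0// subr_ge0.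
have -> : U (fun=> 1) (x * cos th) = U (fun l => cos th ^+ l) x.
  rewrite /U; congr (limn _); apply/funext => n; rewrite /pseries /series /=.
  by apply: eq_bigr => l _; rewrite exprMn; ring.
have two0 l : 2 ^+ l != 0 :> R by rewrite expf_eq0 pnatr_eq0 andbF.
have lim1 : (Sq (fun i j => cosn th (i + j)%N)) @ \oo --> U (cosn th) x.
  apply: square_cvg => [i j|l]; first exact: cosn1.
  rewrite (eq_bigr (fun i : 'I_l.+1 => 'C(l, i)%:R * cosn th l)).
    by rewrite -mulr_suml sum_binomial mulrA mulVf// mul1r.
  by move=> i _; rewrite subnKC// -ltnS.
have lim2 : (Sq (fun i j => sinn th (i + j)%N)) @ \oo --> U (sinn th) x.
  apply: square_cvg => [i j|l]; first exact: sinn1.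
  rewrite (eq_bigr (fun i : 'I_l.+1 => 'C(l, i)%:R * sinn th l)).
    by rewrite -mulr_suml sum_binomial mulrA mulVf// mul1r.
  by move=> i _; rewrite subnKC// -ltnS.
have lim3 : (Sq (fun i j => cos ((i%:R - j%:R) * th))) @ \oo --> U (fun l => cos th ^+ l) x.
  apply: square_cvg => [i j|l]; first exact: cos_max.
  have := sum_binomial_cos l th 0; rewrite cos0 mulr1 => h.
  rewrite (eq_bigr (fun i : 'I_l.+1 => 'C(l, i)%:R * cos ((i%:R *+ 2 - l%:R) * th + 0))).
    by rewrite h mulrA mulVf// mul1r.
  move=> i _; rewrite addr0 natrB ?opprB ?addrA ?mulr2n// -ltnS.
  exact: ltn_ord.
have sq (f : nat -> R) (l : R) : f @ \oo --> l -> (fun J => f J ^+ 2) @ \oo --> l ^+ 2 by move=> fl; rewrite expr2; under eq_fun do rewrite expr2; exact: cvgM.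
apply: (ler_cvg_to (cvgD (sq _ _ lim1) (sq _ _ lim2)) (sq _ _ lim3)).
by apply: nearW => J; exact: ineq.
Qed.

Let q_le th x : q th x <= q 0 (x * cos th).
Proof.
have := modulus_le th x; rewrite modulus.
have c1 : cosn 0 = fun=> 1 by apply/funext => n; rewrite /cosn mulr0 cos0.
have s1 y : U (sinn 0) y = 0.
  apply: cvg_lim => //; rewrite (_ : pseries _ _ = fun=> 0); first exact: cvg_cst.
  by apply/funext => n; rewrite /pseries /series /= big1// => i _; rewrite /sinn mulr0 sin0 mulr0 mul0r.
have := modulus 0 (x * cos th); rewrite c1 s1 expr0n addr0 => ->.
by rewrite ler_expR ler_pM2l.
Qed.

Let lead_ge0 (e : nat -> R) n :
  (forall x, 0 < x -> 0 <= \sum_(j < n.+1) e j * x ^+ j.+1) -> 0 <= e n.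
Proof.
move=> h; rewrite leNgt; apply/negP => en.
pose S := \sum_(j < n) `|e j|; have S0 : 0 <= S by exact: sumr_ge0.
pose x := 1 + S / `|e n|.
have en0 : 0 < `|e n| by rewrite normr_gt0 lt_eqF.
have x1 : 1 <= x by rewrite lerDl divr_ge0.
have x0 : 0 < x by apply: lt_le_trans x1.
have := h x x0; apply/negP; rewrite -ltNge big_ord_recr /=.
apply: (@le_lt_trans _ _ (S * x ^+ n + e n * x ^+ n.+1)).
  rewrite lerD2r mulr_suml; apply: ler_sum => j _.
  apply: (@le_trans _ _ (`|e j| * x ^+ j.+1)).
    by rewrite ler_wpM2r ?exprn_ge0 ?ler_norm// ltW.
  by rewrite ler_wpM2l// ler_weXn2l.
rewrite exprS mulrA -mulrDl pmulr_llt0 ?exprn_gt0// /x mulrDr mulr1.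
rewrite ltr0_norm// invrN mulrN mulrN mulrC divfK ?lt_eqF//.
by lra.
Qed.

(** As [x] grows, [q_le] compares leading coefficients: the top cumulant times
    [cos(th)^D - cos(D th)] is nonnegative for every angle. At [th = 2 pi / D] the second factor is
    negative and at [th = pi / D] it is positive, so the cumulant vanishes. The condition on [D]
    keeps the cosine strictly between -1 and 1 at the first angle and positive at the second. *)
Lemma top_cumulant_eq0 : (3 <= D)%N -> cum m D.-1 = 0.
Proof.
move=> D3; have [n Dn] : exists n, D = n.+3 by exists (D - 3)%N; lia.
have key th : 0 <= cum m n.+2 * (cos th ^+ n.+3 - cos (n.+3%:R * th)).
  suff : 0 <= p n.+2 / n.+3%:R * (cos th ^+ n.+3 - cosn th n.+3).
    set X := cos th ^+ _ - _.
    have -> : p n.+2 / n.+3%:R * X = ((n.+2)`!%:R^-1 * n.+3%:R^-1) * (cum m n.+2 * X) by rewrite /p; ring.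
    by rewrite pmulr_rge0// mulr_gt0 ?invr_gt0 ?ltr0n ?fact_gt0.
  apply: (@lead_ge0 (fun j => p j / j.+1%:R * (cos th ^+ j.+1 - cosn th j.+1))) => x x0.
  rewrite -Dn; have := q_le th x; rewrite -subr_ge0 /q -sumrB.
  congr (_ <= _); apply: eq_bigr => j _.
  by rewrite /cosn mulr0 cos0 mulr1 exprMn; ring.
have pi0 := pi_gt0 R.
have n3 : 0 < n.+3%:R :> R by rewrite ltr0n.
have n31 : n.+3%:R^-1 <= 3^-1 :> R by rewrite lef_pV2 ?posrE// ler_nat.
have k1 := key (2 * pi / n.+3%:R).
have k2 := key (pi / n.+3%:R).
move: k1 k2; rewrite [_ * (2 * _ / _)]mulrC divfK ?gt_eqF// [_ * (pi / _)]mulrC divfK ?gt_eqF//.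
rewrite mulr_natl cos2pi cospi Dn /= -[pi *+ 2]mulr_natl => k1 k2.
have q1 : pi / n.+3%:R <= pi / 3 :> R by rewrite ler_pM2l.
have q2 : 0 < pi / n.+3%:R :> R by rewrite divr_gt0.
have c2 : 0 < cos (pi / n.+3%:R : R) by apply: (@cos_gt0_pihalf R (pi / n.+3%:R)); move: q1 q2; move: (pi / _) => t *; apply/andP; split; lra.
have {}k2 : 0 <= cum m n.+2 by move: k2; rewrite pmulr_lge0// opprK addr_gt0// exprn_gt0.
have c1 : `|cos (2 * pi / n.+3%:R : R)| < 1.
  have := cos_max (2 * pi / n.+3%:R : R); rewrite le_eqVlt => /predU1P[e|//].
  exfalso.
  have s0 : sin (2 * pi / n.+3%:R : R) = 0.
    have := cos2Dsin2 (2 * pi / n.+3%:R : R).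
    rewrite -(real_normK (num_real (cos (2 * pi / n.+3%:R)))) e expr1n => h.
    by apply/eqP; rewrite -sqrf_eq0; apply/eqP; move: h; lra.
  have := @sin_gt0_pi R (2 * pi / n.+3%:R); rewrite s0 ltxx => H.
  suff : false by []. 
  apply: H; rewrite -mulrA; move: q1 q2; move: (pi / _) => t *; apply/andP; split; lra.
have {}k1 : cum m n.+2 <= 0.
  move: k1; rewrite nmulr_lge0// subr_lt0.
  apply: le_lt_trans (ler_norm _) _; rewrite normrX.
  by rewrite exprn_ilt1 ?normr_ge0 ?c1.
by apply/eqP; rewrite eq_le k1 k2.
Qed.

End Marcinkiewicz.

(** Descending induction removes the top cumulant as long as its order is at least three. Index [j]
    stands for order [j+1]. *)
Theorem marcinkiewicz (R : realType) (m : nat -> R) (D : nat) : m 0%N = 1 ->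
  (forall j, (D <= j)%N -> cum m j = 0) ->
  (forall (J : nat) (t : nat -> R),
     0 <= \sum_(i < J) \sum_(j < J) t i * t j * m (i + j)%N) ->
  forall j, (2 <= j)%N -> cum m j = 0.
Proof.
move=> m0 cD mp; elim: D cD => [|D IH] cD; first by move=> j _; exact: cD.
have [D2|D2] := leqP 2 D; last by move=> j j2; apply: cD; lia.
apply: IH => j; rewrite leq_eqVlt => /predU1P[<-|]; last exact: cD.
exact: (@top_cumulant_eq0 _ _ D.+1).
Qed.


(** * Limits along ultrafilters *)

Section UltraLimits.
Variables (R : realType).

Lemma ultra_bounded_cvg (I : Type) (G : set_system I) (f : I -> R) (M : R) :
  UltraFilter G -> G [set t | `|f t| <= M] -> exists l : R, f @ G --> l.
Proof.
move=> UG GM; have PG : ProperFilter G by exact: ultra_proper.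
have [|l [_ cl]] := @segment_compact R (- M) M (f @ G) _.
  have : G (f @^-1` `[- M, M]); last by [].
  by apply: filterS GM => t /= h; rewrite in_itv /= -ler_norml.
exists l => V nV.
have [//|GV] := in_ultra_setVsetC (f @^-1` V) UG.
have [y [/= yV nyV]] := cl (~` V) V GV nV.
by [].
Qed.

(** Replaces the extraction of subsequences: along an ultrafilter every bounded sequence converges,
    so no diagonal argument is needed. *)
Lemma not_cvg0_ultra (u : nat -> R) : ~ (u @ \oo --> 0) -> exists2 e : R, 0 < e &
  exists G : set_system nat, [/\ UltraFilter G, \oo `<=` G & G [set n | e < `|u n|]].
Proof.
move=> /cvgr0Pnorm_le/existsNP[e /not_implyP[e0 ne]]; exists e => //.
pose A := [set n | e < `|u n|].
have PW : ProperFilter (within A \oo).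
  split; last exact: within_filter.
  move=> w0; apply: ne.
  have w1 : \oo (fun n => A n -> set0 n) by exact: w0.
  apply: filterS w1 => n nA; rewrite leNgt; apply/negP => An.
  exact: nA An.
have [G [UG WG]] := ultraFilterLemma PW.
exists G; split=> //.
  by move=> B ooB; apply: WG; apply: filterS ooB.
by apply: WG; rewrite /within /=; apply: nearW.
Qed.

End UltraLimits.

Section CumulantLimits.
Variables (R : realType) (I : Type) (G : set_system I).
Context {PG : ProperFilter G}.
Implicit Types (m : I -> nat -> R).

(** Moments are polynomials in the cumulants, so they converge together and the limits satisfy the
    same recursion. *)
Lemma cvg_moment m (k : nat -> R) : (forall t, m t 0%N = 1) ->
  (forall j, (fun t => cum (m t) j) @ G --> k j) ->
  exists2 l : nat -> R, (forall j, (fun t => m t j) @ G --> l j) &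
     l 0%N = 1 /\ forall j, cum l j = k j.
Proof.
move=> m0 ck.
have ex j : exists x : R, (fun t => m t j) @ G --> x.
  elim/ltn_ind: j => -[_|j IH]; first by exists 1; rewrite (_ : (fun t => _) = fun=> 1); [exact: cvg_cst|apply/funext => t; rewrite m0].
  (* The limits already obtained by induction. The value 0 for larger [i] is a default that the sum
     below never reads. *)
  pose L i := if (i < j.+1)%N =P true is ReflectT h then sval (cid (IH i h)) else 0.
  have LP i : (i < j.+1)%N -> (fun t => m t i) @ G --> L i by rewrite /L => ij; case: eqP => // h; exact: (svalP (cid (IH i h))).
  exists (\sum_(i < j.+1) 'C(j, i)%:R * k i * L (j - i)%N).
  rewrite (_ : (fun t => _) = fun t => \sum_(i < j.+1) 'C(j, i)%:R * cum (m t) i * m t (j - i)%N).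
    apply: cvg_ord_sum => i; apply: cvgM; last by apply: LP; lia.
    by apply: cvgMl_tmp; exact: ck.
  by apply/funext => t; rewrite moment_cum.
pose l j := sval (cid (ex j)).
have lP j : (fun t => m t j) @ G --> l j by exact: (svalP (cid (ex j))).
exists l => //; split.
  have c1 : (fun t => m t 0%N) @ G --> (1 : R) by rewrite (_ : (fun t => _) = fun=> 1); [exact: cvg_cst|apply/funext => t; rewrite m0].
  by apply: cvg_unique (lP 0%N) c1.
elim/ltn_ind => j IH.
apply: (cvg_unique _ _ (ck j)) => //.
rewrite cum_rec (_ : (fun t => _) = fun t => m t j.+1 - \sum_(i < j) 'C(j, i)%:R * cum (m t) i * m t (j - i)%N).
  apply: cvgB => //; apply: cvg_ord_sum => i; apply: cvgM => //.
  by apply: cvgMl_tmp; rewrite IH//; exact: ck.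
by apply/funext => t; rewrite cum_rec.
Qed.

End CumulantLimits.

(** * From vanishing high cumulants to vanishing cumulants *)

Section Janson.
Context (R : realType) (dT : measure_display) (T : measurableType dT).
Context (P : probability T R).

Lemma moment_pos (Y : T -> R) : bmf Y -> forall (J : nat) (t : nat -> R),
  0 <= \sum_(i < J) \sum_(j < J) t i * t j * moment P Y (i + j)%N.
Proof.
move=> bY J t.
have bt i : bmf (fun w => t i * Y w ^+ i) by apply/bmfZ/bmfX.
have -> : \sum_(i < J) \sum_(j < J) t i * t j * moment P Y (i + j)%N =
    Ex P (fun w => (\sum_(i < J) t i * Y w ^+ i) * (\sum_(i < J) t i * Y w ^+ i)).
  transitivity (Ex P (fun w => \sum_(i < J) \sum_(j < J) t i * t j * Y w ^+ (i + j))).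
    rewrite Ex_sum => [|i _]; last by apply: bmf_sum => j _; apply/bmfZ/bmfX.
    apply: eq_bigr => i _; rewrite Ex_sum => [|j _]; last by apply/bmfZ/bmfX.
    by apply: eq_bigr => j _; rewrite ExZ//; exact: bmfX.
  congr Ex; apply/funext => w; rewrite big_distrlr /=; apply: eq_bigr => i _.
  by apply: eq_bigr => j _; rewrite exprD; ring.
by apply: Ex_ge0 => w; rewrite -expr2 sqr_ge0.
Qed.

Let rt (j : nat) (x : R) := `|x| `^ (j.+1%:R^-1).

Let rtX j x : rt j x ^+ j.+1 = `|x|.
Proof. by rewrite /rt -powR_mulrn ?powR_ge0// -powRrM mulVf ?pnatr_eq0// powRr1. Qed.

Let rt_ge0 j x : 0 <= rt j x. Proof. exact: powR_ge0. Qed.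

Let rt_le j x d : 0 <= d -> `|x| <= d ^+ j.+1 -> rt j x <= d.
Proof.
by move=> d0 h; rewrite -(@ler_pXn2r _ j.+1) ?nnegrE// rtX.
Qed.

Let rtM j x c : 0 < c -> rt j (c ^+ j.+1 * x) = c * rt j x.
Proof.
move=> c0; apply/eqP; rewrite -(@eqrXn2 _ j.+1)// ?rt_ge0 ?mulr_ge0 ?rt_ge0 ?(ltW c0)//.
by rewrite exprMn !rtX normrM ger0_norm ?exprn_ge0 ?ltW.
Qed.

Variable (Y : nat -> T -> R) (K : nat).
Hypothesis bY : forall n, bmf (Y n).
Hypothesis Y1 : forall n, Ex P (Y n) = 0.
Hypothesis Y2 : moment P (Y n) 2 @[n --> \oo] --> (1 : R).
Hypothesis cK : forall j, (K <= j)%N -> cum (moment P (Y n)) j @[n --> \oo] --> (0 : R).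

Let c n j := cum (moment P (Y n)) j.
(** Dividing by [lam] brings each cumulant of index between 2 and [K] below 1 in absolute value,
    because index [j] scales with the power [j+1]. The summand 1 keeps the scale from
    degenerating. *)
Let lam n := 1 + \sum_(j < K) (if (2 <= j)%N then rt j (c n j) else 0).

Let lam1 n : 1 <= lam n.
Proof. by rewrite lerDl sumr_ge0// => j _; case: ifP. Qed.

Let lam0 n : 0 < lam n. Proof. exact: lt_le_trans (lam1 n). Qed.

Let c' n j := (lam n)^-1 ^+ j.+1 * c n j.

Let c'_le n j : (2 <= j < K)%N -> `|c' n j| <= 1.
Proof.
case/andP=> j2 jK; rewrite normrM normrX ger0_norm ?invr_ge0 ?(ltW (lam0 n))// exprVn.
rewrite ler_pdivrMl ?exprn_gt0// mulr1 -(rtX j (c n j)) lerXn2r ?nnegrE ?rt_ge0 ?(ltW (lam0 n))//.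
rewrite /lam (bigD1 (Ordinal jK)) //= j2 addrCA lerDl addr_ge0// sumr_ge0// => i _.
by case: ifP.
Qed.

Let c'_le_c n j : `|c' n j| <= `|c n j|.
Proof.
rewrite normrM ler_piMl// normrX exprn_ile1// ger0_norm ?invr_ge0 ?(ltW (lam0 n))//.
by rewrite invf_le1.
Qed.

Let c0 n : c n 0%N = 0.
Proof.
rewrite /c cum_rec big_ord0 subr0 /moment -[RHS](Y1 n).
by congr Ex; apply/funext => w; rewrite expr1.
Qed.

Let c1 n : c n 1%N = moment P (Y n) 2.
Proof.
by rewrite /c cum_rec big_ord_recl big_ord0 -/(c n 0%N) c0 mulr0 mul0r addr0 subr0.
Qed.

(** After rescaling by [lam] all cumulants are bounded, so an ultrafilter limit of the moment
    sequences exists. It is positive and has finitely many nonzero cumulants, hence by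
    [marcinkiewicz] none of order at least three. Feeding this back bounds [lam], so the cumulants
    before rescaling tend to 0 along the ultrafilter, against its choice. *)
Theorem janson j : (2 <= j)%N -> cum (moment P (Y n)) j @[n --> \oo] --> (0 : R).
Proof.
move=> j2; apply: contrapT => /not_cvg0_ultra[e e0 [G [UG ooG Ge]]].
have PG : ProperFilter G by exact: ultra_proper.
have toG (u : nat -> R) (l : R) : u @ \oo --> l -> u @ G --> l by move=> ul A /ul; exact: ooG.
pose m' n l := (lam n)^-1 ^+ l * moment P (Y n) l.
have cm' n i : cum (m' n) i = c' n i by rewrite /m' cum_scale.
have ex i : exists l : R, (fun n => cum (m' n) i) @ G --> l.
  have [Ki|iK] := leqP K i.
    exists 0; apply: toG; apply/cvgr0Pnorm_le => d d0.
    have /cvgr0Pnorm_le/(_ d d0) := cK Ki; apply: filterS => n.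
    by rewrite cm'; apply: le_trans; exact: c'_le_c.
  apply: (@ultra_bounded_cvg _ _ _ _ 2) => //; apply: ooG.
  have /cvgrPdist_le/(_ 1 ltr01) := Y2; apply: filterS => n h; rewrite /= cm'.
  have [i2|i2] := leqP 2 i.
    by apply: le_trans (c'_le _ _) _; rewrite ?i2// ler1n.
  apply: le_trans (c'_le_c _ _) _; case: i i2 {iK} => [|[|//]] _.
    by rewrite c0 normr0.
  by rewrite c1; move: h; rewrite !ler_norml; lra.
pose k i := sval (cid (ex i)).
have kP i : (fun n => cum (m' n) i) @ G --> k i by exact: (svalP (cid (ex i))).
have [|l ml [l0 lk]] := cvg_moment (m := m') _ kP.
  by move=> n; rewrite /m' expr0 mul1r moment0.
have kK i : (K <= i)%N -> cum l i = 0.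
  move=> Ki; rewrite lk; apply: (cvg_unique _ (kP i)) => //; apply: toG.
  apply/cvgr0Pnorm_le => d d0.
  have /cvgr0Pnorm_le/(_ d d0) := cK Ki; apply: filterS => n.
  by rewrite cm'; apply: le_trans; exact: c'_le_c.
have lpos (J : nat) (t : nat -> R) : 0 <= \sum_(i < J) \sum_(j < J) t i * t j * l (i + j)%N.
  have cl : (fun n => \sum_(i < J) \sum_(j < J) t i * t j * m' n (i + j)%N) @ G -->
      \sum_(i < J) \sum_(j < J) t i * t j * l (i + j)%N.
    by apply: cvg_ord_sum => i; apply: cvg_ord_sum => i'; apply: cvgMl_tmp; exact: ml.
  apply: (ler_cvg_to (cvg_cst (0 : R)) cl); apply: nearW => n.
  have -> : \sum_(i < J) \sum_(j < J) t i * t j * m' n (i + j)%N =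
     \sum_(i < J) \sum_(j < J) (t i * (lam n)^-1 ^+ i) * (t j * (lam n)^-1 ^+ j) * moment P (Y n) (i + j)%N.
    by apply: eq_bigr => i _; apply: eq_bigr => i' _; rewrite /m' exprD; ring.
  exact: (moment_pos (bY n) J (fun i => t i * (lam n)^-1 ^+ i)).
have k0 i : (2 <= i)%N -> (fun n => c' n i) @ G --> 0.
  move=> i2; have := kP i; rewrite -lk (marcinkiewicz l0 kK lpos i2).
  by under eq_fun do rewrite cm'.
have rt0 : (fun n => \sum_(i < K) (if (2 <= i)%N then rt i (c' n i) else 0)) @ G --> \sum_(i < K) 0.
  have := @cvg_ord_sum R nat G _ K (fun i n => if (2 <= i)%N then rt i (c' n i) else 0) (fun=> 0).
  apply => i.
  apply/cvgr0Pnorm_le => d d0.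
  case i2 : (2 <= i)%N; last by apply: nearW => n /=; rewrite normr0 ltW.
  have d'0 : 0 < d ^+ i.+1 by rewrite exprn_gt0.
  have /cvgr0Pnorm_le/(_ _ d'0) := k0 i i2; apply: filterS => n h.
  by rewrite ger0_norm ?rt_ge0// rt_le// ltW.
have lam2 : G [set n | lam n <= 2].
  have h0 : 0 < 2^-1 :> R by rewrite invr_gt0.
  rewrite big1_eq in rt0.
  have /cvgr0Pnorm_le/(_ _ h0) := rt0; apply: filterS => n /= h.
  (* By homogeneity of the roots, [lam] solves [lam = 1 + lam * s] where [s] is built from the
     rescaled cumulants. Once [s] is at most 1/2, [lam] is at most 2. *)
  have E : lam n = 1 + lam n * \sum_(i < K) (if (2 <= i)%N then rt i (c' n i) else 0).
    rewrite {1}/lam mulr_sumr; congr (_ + _); apply: eq_bigr => i _.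
    case: ifP => // _; last by rewrite mulr0.
    by rewrite -rtM// /c' mulrA -exprMn divff ?gt_eqF// expr1n mul1r.
  have := lam0 n; have := le_trans (ler_norm _) h; move: (\sum_(i < K) _) E => s E.
  by nra.
have d0 : 0 < e / 2 ^+ j.+1 by rewrite divr_gt0// exprn_gt0.
have /cvgr0Pnorm_lt/(_ _ d0) Gj := k0 j j2.
have [n [[Hl Hj] He]] := filter_ex (filterI (filterI lam2 Gj) Ge).
move: He => /=; rewrite ltNge => /negP; apply.
have -> : cum (moment P (Y n)) j = lam n ^+ j.+1 * c' n j by rewrite /c' mulrA -exprMn divff ?gt_eqF// expr1n mul1r.
rewrite normrM normrX (ger0_norm (ltW (lam0 n))).
apply: (@le_trans _ _ (2 ^+ j.+1 * (e / 2 ^+ j.+1))).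
  apply: ler_pM => //; first by rewrite exprn_ge0// ltW.
    by rewrite lerXn2r ?nnegrE// ltW.
  exact: ltW.
by rewrite mulrC divfK// expf_eq0 pnatr_eq0 andbF.
Qed.

End Janson.


(** * Taylor bounds for cosine and sine *)

Section TaylorTrig.
Variable R : realType.

Lemma inv_factS k : (k.+1)`!%:R^-1 * k.+1%:R = (k`!%:R)^-1 :> R.
Proof. by rewrite factS natrM invfM mulrAC mulVf ?mul1r ?pnatr_eq0. Qed.

Lemma primitive_bound (f g : R -> R) n :
  (forall x : R, is_derive x (1 : R) f (g x)) -> f 0 = 0 ->
  (forall x, `|g x| <= `|x| ^+ n / n`!%:R) ->
  forall x, `|f x| <= `|x| ^+ n.+1 / n.+1`!%:R.
Proof.
have nonneg (f' g' : R -> R) : (forall x : R, is_derive x (1 : R) f' (g' x)) -> f' 0 = 0 ->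
  (forall x, `|g' x| <= `|x| ^+ n / n`!%:R) ->
  forall x, 0 <= x -> f' x <= x ^+ n.+1 / n.+1`!%:R.
  move=> df f0 gb x x0.
  pose h (y : R) := n.+1`!%:R^-1 * y ^+ n.+1 - f' y.
  pose dh (y : R) := n.+1`!%:R^-1 * n.+1%:R * y ^+ n - g' y.
  have hd (y : R) : is_derive y (1 : R) h (dh y).
    exact: is_deriveB (is_derive_monom _ _ _) (df y).
  have [c cI E] : exists2 c, c \in `[0, x] & h x - h 0 = dh c * (x - 0).
    apply: MVT_segment => //; apply/continuous_subspaceT => y.
    apply/differentiable_continuous/derivable1_diffP.
    exact: (@ex_derive _ _ _ _ _ _ _ (hd y)).
  move: cI; rewrite in_itv /= => /andP[c0 _].
  have dc : 0 <= dh c.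
    rewrite /dh inv_factS mulrC.
    have := gb c; rewrite (ger0_norm c0) => /(le_trans (ler_norm _)).
    by rewrite subr_ge0.
  have : 0 <= h x - h 0 by rewrite E subr0 mulr_ge0.
  by rewrite /h f0 expr0n mulr0 !subr0 subr_ge0 mulrC.
move=> df f0 gb x.
wlog x0 : f g df f0 gb x / 0 <= x.
  move=> W; have [x0|x0] := leP 0 x; first exact: (W f g).
  have := W (fun y => f (- y)) (fun y => - g (- y)) _ _ _ (- x).
  rewrite opprK normrN; apply; rewrite ?oppr0 ?oppr_ge0 ?ltW//.
    move=> y; have := is_derive1_comp (df (- y)) (is_deriveN (is_derive_id y (1 : R))).
    by rewrite mulrN1.
  by move=> y; rewrite normrN -[in leRHS]normrN.
rewrite ler_norml (ger0_norm x0) (nonneg f g)// andbT lerNl.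
apply: (nonneg (fun y => - f y) (fun y => - g y)) => //.
- by rewrite f0 oppr0.
- by move=> y; rewrite normrN.
Qed.

Definition cos_taylor J (x : R) := \sum_(i < J) (-1) ^+ i / (2 * i)`!%:R * x ^+ (2 * i).
Definition sin_taylor J (x : R) := \sum_(i < J) (-1) ^+ i / (2 * i).+1`!%:R * x ^+ (2 * i).+1.

Let dsin J (x : R) : is_derive x (1 : R) (fun y => sin y - sin_taylor J y) (cos x - cos_taylor J x).
Proof.
apply: is_deriveB; rewrite (_ : sin_taylor J = \sum_(i < J) (fun y => (-1) ^+ i / (2 * i).+1`!%:R * y ^+ (2 * i).+1)); last first.
  by apply/funext => y; rewrite fct_sumE.
apply: is_derive_sum => i; apply: is_derive_eq (is_derive_monom _ _ _) _.
by rewrite -(inv_factS (2 * i)) !mulrA.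
Qed.

Let dcos J (x : R) : is_derive x (1 : R) (fun y => cos y - cos_taylor J.+1 y) (- (sin x - sin_taylor J x)).
Proof.
rewrite opprB addrC -[X in _ + X]opprK; apply: is_deriveB.
pose S := \sum_(i < J) (fun y : R => (-1) ^+ i.+1 / (2 * i).+2`!%:R * y ^+ (2 * i).+2 : R).
have -> : cos_taylor J.+1 = (cst 1 : R -> R) + S.
  apply/funext => y; rewrite /cos_taylor big_ord_recl !expr0 divr1 mulr1 fctE /S fct_sumE.
  by congr (_ + _); apply: eq_bigr => i _; rewrite lift0 mulnS.
have hS : is_derive x (1 : R) S (- sin_taylor J x).
  rewrite /sin_taylor -sumrN; apply: is_derive_sum => i; apply: is_derive_eq (is_derive_monom _ _ _) _.
  by rewrite -(inv_factS (2 * i).+1) exprS mulN1r !mulNr !mulrA.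
exact: is_derive_eq (is_deriveD (is_derive_cst (1 : R) x (1 : R)) hS) (add0r _).
Qed.

Let c0 J : cos 0 - cos_taylor J.+1 0 = 0 :> R.
Proof.
rewrite cos0 /cos_taylor big_ord_recl !expr0 divr1 mulr1 big1 ?addr0 ?subrr//.
by move=> i _; rewrite lift0 mulnS expr0n mulr0.
Qed.

Let s0 J : sin 0 - sin_taylor J 0 = 0 :> R.
Proof.
by rewrite sin0 /sin_taylor big1 ?subrr// => i _; rewrite expr0n mulr0.
Qed.

(** The bound 1 on the cosine is integrated from 0 repeatedly, alternating between sine and cosine;
    each integration gains one power. *)
Lemma cos_taylor_bound J x : `|cos x - cos_taylor J x| <= `|x| ^+ (2 * J) / (2 * J)`!%:R.
Proof.
elim: J x => [|J IH] x.
  by rewrite /cos_taylor big_ord0 subr0 expr0 divr1 cos_max.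
have IHs := primitive_bound (dsin J) (s0 J) IH.
have := primitive_bound (dcos J) (c0 J) _ x.
rewrite mulnS; apply => y; rewrite normrN; exact: IHs.
Qed.

(** The exponent stops at the even number [2 * J], so that the expected error is an even moment with
    no absolute value. *)
Lemma sin_taylor_bound J x : `|sin x - sin_taylor J x| <= `|x| ^+ (2 * J) / (2 * J)`!%:R.
Proof.
elim: J x => [|J IH] x.
  by rewrite /sin_taylor big_ord0 subr0 expr0 divr1 sin_max.
have IHc : forall x, `|cos x - cos_taylor J.+1 x| <= `|x| ^+ (2 * J).+1 / (2 * J).+1`!%:R by apply: primitive_bound (dcos J) (c0 J) _ => y; rewrite normrN; exact: IH.
by rewrite mulnS; exact: primitive_bound (dsin J.+1) (s0 J.+1) IHc x.
Qed.

End TaylorTrig.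

(** * Moments of the centered normal law *)

Section GaussianMoments.
Variables (R : realType) (v : R).

Definition gauss_moment (l : nat) : R :=
  if odd l then 0 else (v / 2) ^+ l./2 * l`!%:R / (l./2)`!%:R.

(** With the variance as the only nonzero cumulant, the recursion collapses to
    [m (l+2) = (l+1) v m l]. *)
Lemma gauss_moment_rec (m c : nat -> R) : m 0%N = 1 -> (forall j, cum m j = c j) ->
  c 1%N = v -> (forall j, j != 1%N -> c j = 0) -> forall l, m l = gauss_moment l.
Proof.
move=> m0 mc c1 c0; elim/ltn_ind => -[_|[_|l IH]].
- by rewrite m0 /gauss_moment /= expr0 fact0 divr1 mulr1.
- by rewrite moment_cum// big_ord_recl big_ord0 mc c0// mulr0 mul0r addr0.
rewrite moment_cum// big_ord_recl mc c0// mulr0 mul0r add0r big_ord_recl mc /= c1.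
rewrite big1 ?addr0; last by move=> i _; rewrite mc c0// mulr0 mul0r.
rewrite /bump /= subSS subn0 IH; last by lia.
rewrite bin1 /gauss_moment /= negbK; case: ifP => ol; first by rewrite mulr0.
rewrite !factS !natrM exprS invfM.
have -> : l.+2%:R = 2 * (l./2.+1)%:R :> R by rewrite -natrM; congr (_%:R); have := odd_double_half l; rewrite ol; lia.
have h1 : (l./2)`!%:R != 0 :> R by rewrite pnatr_eq0 -lt0n fact_gt0.
have h2 : (l./2.+1)%:R != 0 :> R by rewrite pnatr_eq0.
move: h2; move: (_.+1%:R : R) => a h2; move: h2; move: (l./2.+1%:R : R) => b h2.
by field; rewrite h1 h2.
Qed.

End GaussianMoments.

(** * From cumulants to characteristic functions *)

Section CharacteristicFunctions.
Context (R : realType) (dT : measure_display) (T : measurableType dT).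
Context (P : probability T R).

Lemma continuous_scaled_cos (t : R) : continuous (fun x : R => cos (t * x)).
Proof.
move=> x; apply: (@continuous_comp _ _ _ (fun x => t * x) cos); last exact: continuous_cos.
exact: mulrl_continuous.
Qed.

Lemma continuous_scaled_sin (t : R) : continuous (fun x : R => sin (t * x)).
Proof.
move=> x; apply: (@continuous_comp _ _ _ (fun x => t * x) sin); last exact: continuous_sin.
exact: mulrl_continuous.
Qed.

Lemma bmf_cos (Y : T -> R) t : bmf Y -> bmf (fun w => cos (t * Y w)).
Proof.
move=> bY; apply: (@bmf_comp _ _ _ Y (fun x => cos (t * x)) bY (@continuous_scaled_cos t)).
by exists 1 => x; exact: cos_max.
Qed.

Lemma bmf_sin (Y : T -> R) t : bmf Y -> bmf (fun w => sin (t * Y w)).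
Proof.
move=> bY; apply: (@bmf_comp _ _ _ Y (fun x => sin (t * x)) bY (@continuous_scaled_sin t)).
by exists 1 => x; exact: sin_max.
Qed.

Variables (Y : nat -> T -> R) (v : R).
Hypothesis bY : forall n, bmf (Y n).
Hypothesis c1 : cum (moment P (Y n)) 1 @[n --> \oo] --> v.
Hypothesis c0 : forall j, j != 1%N -> cum (moment P (Y n)) j @[n --> \oo] --> (0 : R).

Lemma cvg_gauss_moment l : moment P (Y n) l @[n --> \oo] --> gauss_moment v l.
Proof.
have ck j : cum (moment P (Y n)) j @[n --> \oo] --> (if j == 1%N then v else 0) by case: eqVneq => [->//|]; exact: c0.
have [|m ml [m0 mc]] := cvg_moment (m := fun n => moment P (Y n)) _ ck.
  by move=> n; exact: moment0.
have <- : m l = gauss_moment v l by apply: (gauss_moment_rec m0 mc) => // j /negbTE ->.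
exact: ml.
Qed.

(* [E h(t Y)] is compared with a Taylor polynomial whose remainder is controlled
   by an even moment. *)
Let taylor_cvg (h : R -> R) (tp : nat -> R -> R) (e : nat -> nat) (s : nat -> R) (t L : R) :
  (forall n, bmf (fun w => h (t * Y n w))) ->
  (forall J x, tp J x = \sum_(i < J) s i * x ^+ e i) ->
  (forall J x, `|h x - tp J x| <= `|x| ^+ (2 * J) / (2 * J)`!%:R) ->
  (fun J => \sum_(i < J) s i * t ^+ e i * gauss_moment v (e i)) @ \oo --> L ->
  Ex P (fun w => h (t * Y n w)) @[n --> \oo] --> L.
Proof.
move=> bh tpE rem cL.
(* The Gaussian value of the remainder is the general term of an exponential series. A single [J]
   therefore makes it small, and the limit in [n] is taken at that [J]. *)
have rem0 : (fun J => t ^+ (2 * J) / (2 * J)`!%:R * gauss_moment v (2 * J)) @ \oo --> 0.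
  have hx := cvg_exp_coeff (t ^+ 2 * (v / 2)).
  rewrite (_ : (fun J => _) = exp_coeff (t ^+ 2 * (v / 2))) //; apply/funext => J.
  rewrite /exp_coeff /gauss_moment mul2n odd_double doubleK -mul2n exprM /= [in RHS]exprMn.
  move: ((t ^+ 2) ^+ J) ((v / 2) ^+ J) => a b.
  by field; rewrite !pnatr_eq0 -!lt0n !fact_gt0.
have bp n J : bmf (fun w => tp J (t * Y n w)).
  rewrite (_ : (fun w => _) = fun w => \sum_(i < J) (s i * t ^+ e i) * Y n w ^+ e i).
    by apply: bmf_sum => i _; apply/bmfZ/bmfX.
  by apply/funext => w; rewrite tpE; apply: eq_bigr => i _; rewrite exprMn mulrA.
have Etp n J : Ex P (fun w => tp J (t * Y n w)) = \sum_(i < J) s i * t ^+ e i * moment P (Y n) (e i).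
  rewrite (_ : (fun w => _) = fun w => \sum_(i < J) (s i * t ^+ e i) * Y n w ^+ e i).
    rewrite Ex_sum => [|i _]; last by apply/bmfZ/bmfX.
    by apply: eq_bigr => i _; rewrite ExZ//; exact: bmfX.
  by apply/funext => w; rewrite tpE; apply: eq_bigr => i _; rewrite exprMn mulrA.
have bound n J : `|Ex P (fun w => h (t * Y n w)) - \sum_(i < J) s i * t ^+ e i * moment P (Y n) (e i)|
    <= t ^+ (2 * J) / (2 * J)`!%:R * moment P (Y n) (2 * J).
  rewrite -Etp -ExB//; apply: le_trans (Ex_abs _ (bmfB (bh n) (bp n J))) _.
  rewrite /moment -ExZ; last exact: bmfX.
  apply: Ex_le => [||w]; [exact/bmf_norm/bmfB|exact/bmfZ/bmfX|].
  apply: le_trans (rem J _) _.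
  by rewrite -normrX exprMn ger0_norm; [rewrite mulrAC|rewrite !exprM mulr_ge0// exprn_ge0// sqr_ge0].
apply/cvgrPdist_le => d d0; have d4 : 0 < d / 4 by rewrite divr_gt0.
have /cvgrPdist_le/(_ _ d4) c1' := cL.
have /cvgr0Pnorm_le/(_ _ d4) c2' := rem0.
have [J [HJ1 HJ2]] := filter_ex (filterI c1' c2').
have l1 : (fun n => \sum_(i < J) s i * t ^+ e i * moment P (Y n) (e i)) @ \oo -->
    \sum_(i < J) s i * t ^+ e i * gauss_moment v (e i).
  by apply: cvg_ord_sum => i; apply: cvgMl_tmp; exact: cvg_gauss_moment.
have l2 : (fun n => t ^+ (2 * J) / (2 * J)`!%:R * moment P (Y n) (2 * J)) @ \oo -->
    t ^+ (2 * J) / (2 * J)`!%:R * gauss_moment v (2 * J).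
  by apply: cvgMl_tmp; exact: cvg_gauss_moment.
have /cvgrPdist_le/(_ _ d4) h1 := l1; have /cvgrPdist_le/(_ _ d4) h2 := l2.
apply: filterS (filterI h1 h2) => n [/= H1 H2].
move: HJ1 HJ2 H1 H2 (bound n J) => /=; rewrite !ler_norml; lra.
Qed.

Lemma cvg_Ex_cos t : Ex P (fun w => cos (t * Y n w)) @[n --> \oo] --> expR (- (t ^+ 2 * v / 2)).
Proof.
apply: (@taylor_cvg cos (@cos_taylor R) (fun i => 2 * i)%N (fun i => (-1) ^+ i / (2 * i)`!%:R)) => //.
- by move=> n; exact: bmf_cos.
- by move=> J x; exact: cos_taylor_bound.
have := is_cvg_series_exp_coeff (- (t ^+ 2 * v / 2)); rewrite -/(expR _).
have -> : series (exp_coeff (- (t ^+ 2 * v / 2))) =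
  (fun J => \sum_(i < J) (-1) ^+ i / (2 * i)`!%:R * t ^+ (2 * i) * gauss_moment v (2 * i)).
  apply/funext => J; rewrite /series /= big_mkord; apply: eq_bigr => i _.
  rewrite /exp_coeff /gauss_moment /= mul2n odd_double doubleK -mul2n.
  have h1 : (2 * i)`!%:R != 0 :> R by rewrite pnatr_eq0 -lt0n fact_gt0.
  have -> : - (t ^+ 2 * v / 2) = -1 * (t ^+ 2 * (v / 2)) by rewrite mulrA mulN1r.
  rewrite exprM exprMn [X in _ * X / _]exprMn.
  move: ((t ^+ 2) ^+ i) ((v / 2) ^+ i) ((-1) ^+ i) => a b c.
  by field; rewrite h1 pnatr_eq0 -lt0n fact_gt0.
exact.
Qed.

Lemma cvg_Ex_sin t : Ex P (fun w => sin (t * Y n w)) @[n --> \oo] --> (0 : R).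
Proof.
apply: (@taylor_cvg sin (@sin_taylor R) (fun i => (2 * i).+1)%N (fun i => (-1) ^+ i / (2 * i).+1`!%:R)) => //.
- by move=> n; exact: bmf_sin.
- by move=> J x; exact: sin_taylor_bound.
rewrite (_ : (fun J => _) = fun=> 0); first exact: cvg_cst.
by apply/funext => J; apply: big1 => i _; rewrite /gauss_moment /= mul2n odd_double mulr0.
Qed.

End CharacteristicFunctions.


(** * Trigonometric polynomials in several variables *)

Section RowVectorTopology.
Variables (R : realType) (d : nat).
Implicit Types (x y : 'rV[R]_d).

Lemma nbhs_rVP x (V : set 'rV[R]_d) :
  nbhs x V <-> exists2 r : R, 0 < r & forall y, (forall i, `|x 0 i - y 0 i| < r) -> V y.
Proof.
split=> [/nbhs_ballP[r r0 rV]|[r r0 rV]].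
  exists r => // y xy; apply: rV; split => // i j.
  by rewrite (ord1 i); exact: xy.
by apply/nbhs_ballP; exists r => // y [_ xy]; apply: rV => i; exact: (xy 0 i).
Qed.

Definition dot x y : R := \sum_(i < d) x 0 i * y 0 i.

Lemma continuous_coord (i : 'I_d) : continuous (fun x : 'rV[R]_d => x 0 i).
Proof. exact: coord_continuous. Qed.

Lemma continuous_dot x : continuous (dot x).
Proof.
move=> y; apply: (@cvg_ord_sum R _ (nbhs y) _ d (fun i z => x 0 i * z 0 i)) => i.
by apply: cvgMl_tmp; exact: continuous_coord.
Qed.

Lemma uniform_continuity_on_box (f : 'rV[R]_d -> R) (A e : R) : continuous f -> 0 < e ->
  exists2 r : R, 0 < r & forall x y, (forall i, `|x 0 i| <= A) ->
    (forall i, `|x 0 i - y 0 i| <= r) -> `|f x - f y| <= e.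
Proof.
move=> cf e0.
have cK := @rV_compact R d (fun=> `[- A, A]%classic) (fun=> segment_compact (a := - A) (b := A)).
have /compact_near_coveringP cov := cK.
suff [r [r0 rP]] : exists r : R, 0 < r /\ forall x, (forall i, x 0 i \in `[- A, A]) ->
    forall y, (forall i, `|x 0 i - y 0 i| <= r) -> `|f x - f y| <= e.
  exists r => // x y xA; apply: rP => i; rewrite in_itv /= -ler_norml; exact: xA.
have := cov R (0^'+) (fun r x => forall y, (forall i, `|x 0 i - y 0 i| <= r) -> `|f x - f y| <= e) _.
move=> /(_ _)[].
- move=> x _; have e2 : 0 < e / 2 by rewrite divr_gt0.
  have /cvgrPdist_le/(_ _ e2)/nbhs_rVP[r r0 rP] := cf x.
  exists ([set x' : 'rV[R]_d | forall i, `|x 0 i - x' 0 i| < r / 2], [set t : R | t < r / 2]) => /=.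
    split; first by apply/nbhs_rVP; exists (r / 2); rewrite ?divr_gt0.
    by apply: nbhs_right_lt; rewrite divr_gt0.
  move=> [x' t] /= [xx' tr] y x'y.
  have h1 : `|f x - f x'| <= e / 2 by apply: rP => i; apply: lt_le_trans (xx' i) _; move: r0; lra.
  have h2 : `|f x - f y| <= e / 2.
    apply: rP => i; rewrite (le_lt_trans (ler_distD (x' 0 i) _ _))//.
    rewrite [ltRHS]splitr ltrD//; apply: le_lt_trans (x'y i) tr.
  by move: h1 h2; rewrite !ler_norml; lra.
- move=> s s0 H; exists (s / 2); split; first by rewrite divr_gt0.
  move=> x xA; apply: (H (s / 2)) => //=.
  + by rewrite sub0r normrN ger0_norm ?divr_ge0 ?ltW// ltr_pdivrMr// ltr_pMr// ltr1n.
  + by rewrite divr_gt0.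
Qed.

(** A list of terms: statements linear in the polynomial, such as convergence of expectations,
    follow by induction from one cosine and one sine. *)
Inductive trigpoly : ('rV[R]_d -> R) -> Prop :=
| trigpoly0 : trigpoly (fun=> 0)
| trigpolyS (a b : R) (t : 'rV[R]_d) (g : 'rV[R]_d -> R) : trigpoly g ->
    trigpoly (fun x => a * cos (dot t x) + b * sin (dot t x) + g x).

Lemma trigpolyD g h : trigpoly g -> trigpoly h -> trigpoly (fun x => g x + h x).
Proof.
move=> tg th; elim: tg => [|a b t g' _ IH].
  by under eq_fun do rewrite add0r.
rewrite (_ : (fun x => _) = (fun x => a * cos (dot t x) + b * sin (dot t x) + (g' x + h x))).
  exact: trigpolyS.
by apply/funext => x; rewrite addrA.
Qed.

Lemma trigpoly_term a b t : trigpoly (fun x => a * cos (dot t x) + b * sin (dot t x)).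
Proof.
have := trigpolyS a b t trigpoly0; congr trigpoly; apply/funext => x.
by rewrite addr0.
Qed.

Lemma trigpoly_cst c : trigpoly (fun=> c).
Proof.
have := trigpoly_term c 0 0; congr trigpoly; apply/funext => x.
by rewrite /dot big1 ?cos0 ?mulr1 ?mul0r ?addr0// => i _; rewrite mxE mul0r.
Qed.

Lemma dotDl s t x : dot (s + t) x = dot s x + dot t x.
Proof. by rewrite /dot -big_split; apply: eq_bigr => i _; rewrite mxE mulrDl. Qed.

Lemma dotBl s t x : dot (s - t) x = dot s x - dot t x.
Proof. by rewrite /dot -sumrB; apply: eq_bigr => i _; rewrite !mxE mulrBl. Qed.

Lemma trigpolyM g h : trigpoly g -> trigpoly h -> trigpoly (fun x => g x * h x).
Proof.
move=> tg th; elim: tg => [|a b t g' _ IH].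
  rewrite (_ : (fun x => _) = fun=> 0); first exact: trigpoly0.
  by apply/funext => x; rewrite mul0r.
rewrite (_ : (fun x => _) = (fun x => (a * cos (dot t x) + b * sin (dot t x)) * h x + g' x * h x)); last first.
  by apply/funext => x; rewrite mulrDl.
apply: trigpolyD => // {IH}; elim: th => [|a' b' t' h' _ IH].
  rewrite (_ : (fun x => _) = fun=> 0); first exact: trigpoly0.
  by apply/funext => x; rewrite mulr0.
have h1 := trigpoly_term ((a * a' - b * b') / 2) ((a * b' + b * a') / 2) (t + t').
have h2 := trigpoly_term ((a * a' + b * b') / 2) ((b * a' - a * b') / 2) (t - t').
have := trigpolyD (trigpolyD h1 h2) IH; congr trigpoly; apply/funext => x.
by rewrite dotDl dotBl cosD cosB sinD sinB; field.
Qed.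

Lemma trigpolyX g n : trigpoly g -> trigpoly (fun x => g x ^+ n).
Proof.
move=> tg; elim: n => [|n IH]; first by under eq_fun do rewrite expr0; exact: trigpoly_cst.
by rewrite (_ : (fun x => _) = (fun x => g x * g x ^+ n)); [exact: trigpolyM|apply/funext => x; rewrite exprS].
Qed.

Lemma trigpoly_sum (I : Type) (r : seq I) (F : I -> 'rV[R]_d -> R) :
  (forall i, trigpoly (F i)) -> trigpoly (fun x => \sum_(i <- r) F i x).
Proof.
move=> tF; elim: r => [|i r IH].
  by rewrite (_ : (fun x => _) = fun=> 0); [exact: trigpoly0|apply/funext => x; rewrite big_nil].
rewrite (_ : (fun x => _) = fun x => F i x + \sum_(j <- r) F j x); first exact: trigpolyD.
by apply/funext => x; rewrite big_cons.
Qed.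

Lemma trigpoly_prod (I : Type) (r : seq I) (F : I -> 'rV[R]_d -> R) :
  (forall i, trigpoly (F i)) -> trigpoly (fun x => \prod_(i <- r) F i x).
Proof.
move=> tF; elim: r => [|i r IH].
  by rewrite (_ : (fun x => _) = fun=> 1); [exact: trigpoly_cst|apply/funext => x; rewrite big_nil].
rewrite (_ : (fun x => _) = fun x => F i x * \prod_(j <- r) F j x); first exact: trigpolyM.
by apply/funext => x; rewrite big_cons.
Qed.

End RowVectorTopology.

(** * Bernstein weights *)

Section Bernstein.
Variable R : realType.

Definition bern (N : nat) (s : R) (j : nat) : R := 'C(N, j)%:R * s ^+ j * (1 - s) ^+ (N - j).

Lemma bern_ge0 N s j : 0 <= s <= 1 -> 0 <= bern N s j.
Proof. by case/andP=> s0 s1; rewrite /bern !mulr_ge0 ?exprn_ge0// subr_ge0. Qed.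

Lemma bern_rec N s (G : nat -> R) :
  \sum_(j < N.+2) bern N.+1 s j * G j =
  (1 - s) * (\sum_(j < N.+1) bern N s j * G j) + s * (\sum_(j < N.+1) bern N s j * G j.+1).
Proof.
under eq_bigr do rewrite /bern -!mulrA.
rewrite (sum_binomial_pascal N (fun j => s ^+ j * ((1 - s) ^+ (N.+1 - j) * G j))).
rewrite !mulr_sumr -big_split /=; apply: eq_bigr => j _; rewrite /bern subSS.
have jN : (j <= N)%N by rewrite -ltnS.
by rewrite subSn// !exprS; ring.
Qed.

Lemma bern_sum1 N s : \sum_(j < N.+1) bern N s j = 1.
Proof.
transitivity (\sum_(j < N.+1) bern N s j * 1); first by apply: eq_bigr => j _; rewrite mulr1.
elim: N => [|N IH]; first by rewrite big_ord_recl big_ord0 /bern bin0 !expr0 !mulr1 addr0.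
by rewrite (bern_rec N s (fun=> 1)) IH; ring.
Qed.

(** The second moment of a binomial variable about a shifted centre. The free shift [a] carries the
    induction, since adding one trial moves the centre by [-s] or [1 - s]. *)
Lemma bern_var_gen N s a :
  \sum_(j < N.+1) bern N s j * (j%:R - N%:R * s + a) ^+ 2 = N%:R * s * (1 - s) + a ^+ 2.
Proof.
elim: N a => [|N IH] a.
  by rewrite big_ord_recl big_ord0 /bern bin0 !expr0 /=; ring.
rewrite (bern_rec N s (fun j => (j%:R - N.+1%:R * s + a) ^+ 2)).
transitivity ((1 - s) * (N%:R * s * (1 - s) + (a - s) ^+ 2) + s * (N%:R * s * (1 - s) + (a + 1 - s) ^+ 2)).
  rewrite -!IH; congr (_ * _ + _ * _); apply: eq_bigr => j _; rewrite -!natr1; congr (_ * _); ring.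
by rewrite -natr1; ring.
Qed.

Lemma bern_var N s : 0 <= s <= 1 ->
  \sum_(j < N.+2) bern N.+1 s j * (j%:R / N.+1%:R - s) ^+ 2 <= N.+1%:R^-1.
Proof.
move=> /andP[s0 s1]; have N0 : N.+1%:R != 0 :> R by rewrite pnatr_eq0.
have -> : \sum_(j < N.+2) bern N.+1 s j * (j%:R / N.+1%:R - s) ^+ 2 =
    N.+1%:R^-1 ^+ 2 * \sum_(j < N.+2) bern N.+1 s j * (j%:R - N.+1%:R * s + 0) ^+ 2.
  rewrite mulr_sumr; apply: eq_bigr => j _.
  have -> : j%:R / N.+1%:R - s = N.+1%:R^-1 * (j%:R - N.+1%:R * s + 0) by rewrite addr0 mulrBr mulrA mulVf// mul1r mulrC.
  by ring.
rewrite bern_var_gen expr0n addr0 expr2 -mulrA ler_piMr ?invr_ge0//.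
rewrite -!mulrA mulKf//; have : 0 <= (s - 2^-1) ^+ 2 by exact: sqr_ge0.
nra.
Qed.

End Bernstein.

(** * Uniform approximation on boxes *)

Section AsinModulus.
Variable R : realType.

Lemma sin_lower (x : R) : 0 <= x -> x <= pi / 2 -> x * cos x <= sin x.
Proof.
move=> x0 xpi.
have [|c cI E] := @MVT_segment R sin cos 0 x x0 (fun y _ => is_derive_sin y).
  by apply/continuous_subspaceT => y; exact: continuous_sin.
move: cI E; rewrite in_itv /= sin0 !subr0 => /andP[c0 cx] ->.
rewrite mulrC ler_wpM2r//.
have hpi : pi / 2 <= pi :> R by have := pi_gt0 R; lra.
rewrite leNgt; apply/negP => cc.
have [|c' c'I E'] := @MVT_segment R cos (fun y => - sin y) c x cx (fun y _ => is_derive_cos y).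
  by apply/continuous_subspaceT => y; exact: continuous_cos.
move: c'I; rewrite in_itv /= => /andP[cc' c'x].
have s0 : 0 <= sin c'.
  apply: sin_ge0_pi; apply/andP; split; [exact: le_trans cc'|].
  by apply: le_trans c'x _; exact: le_trans hpi.
have : cos x - cos c <= 0 by rewrite E' mulNr oppr_le0 mulr_ge0// subr_ge0.
lra.
Qed.

(** The difference of sines is twice the cosine of the half sum times the sine of the half
    difference. As one angle stays within 1/2, both half angles stay away from [pi / 2], so both
    factors are controlled from below. *)
Lemma sin_modulus : exists2 K : R, 0 < K &
  forall u v : R, `|u| <= 2^-1 -> `|v| <= pi / 2 -> `|u - v| <= K * `|sin u - sin v|.
Proof.
have p2 := @pi_ge2 R.
pose mm : R := (2^-1 + pi / 2) / 2.
have m0 : 0 < mm by rewrite /mm; lra.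
have mp : mm < pi / 2 by rewrite /mm; lra.
have c0 : 0 < cos mm by apply: cos_gt0_pihalf; apply/andP; split; lra.
exists (cos mm ^+ 2)^-1 => [|u v]; first by rewrite invr_gt0 exprn_gt0.
rewrite ler_pdivlMl ?exprn_gt0// => u1 v1.
have cosge x : `|x| <= mm -> cos mm <= cos x.
  wlog x0 : x / 0 <= x => [W|].
    have [x0|x0] := leP 0 x; first exact: W.
    by rewrite -normrN -(cosN x); apply: W; rewrite oppr_ge0 ltW.
  rewrite ger0_norm// => xm.
  have [|c cI E] := @MVT_segment R cos (fun y => - sin y) x mm xm (fun y _ => is_derive_cos y).
    by apply/continuous_subspaceT => y; exact: continuous_cos.
  move: cI; rewrite in_itv /= => /andP[xc cm].
  have s0 : 0 <= sin c by apply: sin_ge0_pi; apply/andP; split; lra.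
  by rewrite -subr_le0 E mulNr oppr_le0 mulr_ge0// subr_ge0.
have ineq a : `|a| <= mm -> cos mm * `|a| <= `|sin a|.
  wlog a0 : a / 0 <= a => [W|].
    have [a0|a0] := leP 0 a; first exact: W.
    by rewrite -normrN -(normrN (sin a)) -sinN; apply: W; rewrite oppr_ge0 ltW.
  move=> am; have := am; rewrite ger0_norm// => am'.
  rewrite [leRHS]ger0_norm; last by apply: sin_ge0_pi; apply/andP; split; lra.
  apply: (@le_trans _ _ (a * cos a)).
    by rewrite mulrC ler_wpM2l// cosge.
  by apply: sin_lower => //; lra.
pose a := (u - v) / 2; pose b := (u + v) / 2.
have -> : u = b + a by rewrite /a /b; field.
have -> : v = b - a by rewrite /a /b; field.
have am : `|a| <= mm by move: u1 v1; rewrite /a /mm !ler_norml; lra.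
have bm : `|b| <= mm by move: u1 v1; rewrite /b /mm !ler_norml; lra.
clearbody a b; have -> : b + a - (b - a) = 2 * a by ring.
have -> : sin (b + a) - sin (b - a) = 2 * (cos b * sin a) by rewrite sinD sinB; ring.
rewrite !normrM normr_nat expr2 mulrCA ler_pM2l// -mulrA.
apply: ler_pM => //; first exact: ltW.
- by rewrite mulr_ge0// ltW.
- by apply: le_trans (ler_norm _); exact: cosge.
- exact: ineq.
Qed.

End AsinModulus.

Section TrigApproximation.
Variables (R : realType) (d : nat).
Implicit Types (x y : 'rV[R]_d).

(* Bernstein polynomials in the variables (1 + sin (x_i / 2A)) / 2. *)
Lemma trigpoly_approx (f : 'rV[R]_d -> R) (M A e : R) : continuous f ->
  (forall x, `|f x| <= M) -> 0 < A -> 0 < e ->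
  exists q : 'rV[R]_d -> R, [/\ trigpoly q, forall x, `|q x| <= M &
    forall x, (forall i, `|x 0 i| <= A) -> `|q x - f x| <= e].
Proof.
move=> cf fM A0 e0.
have M0 : 0 <= M by apply: le_trans (fM 0).
have [K K0 KP] := sin_modulus R.
have e2 : 0 < e / 2 by rewrite divr_gt0.
have [r r0 rP] := uniform_continuity_on_box A cf e2.
pose la : R := (2 * A)^-1; have la0 : 0 < la by rewrite invr_gt0 mulr_gt0.
pose s (i : 'I_d) x : R := (1 + sin (la * x 0 i)) / 2.
have s01 i x : 0 <= s i x <= 1.
  have := sin_max (la * x 0 i); rewrite /s ler_norml => /andP[h1 h2].
  by apply/andP; split; lra.
pose kap : R := 2 * M * (2 * K / la / r) ^+ 2.
have kap0 : 0 <= kap by apply: mulr_ge0; [exact: mulr_ge0|exact: sqr_ge0].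
pose N := Num.bound (2 * (kap * d%:R) / e).
have NP : kap * d%:R / N.+1%:R <= e / 2.
  have h0 : 0 <= 2 * (kap * d%:R) / e by apply: divr_ge0; [apply: mulr_ge0 => //; exact: mulr_ge0|exact: ltW].
  have := archi_boundP h0; rewrite -/N => hN.
  have N0 : 0 < N.+1%:R :> R by rewrite ltr0n.
  rewrite ler_pdivrMr// -ler_pdivrMl// invf_div; apply: ltW.
  have : N%:R < N.+1%:R :> R by rewrite ltr_nat.
  move: hN; rewrite mulrAC; move: (N%:R : R) (N.+1%:R : R) => a b; lra.
(* The coordinate at which the variable [s] takes the value [j / N.+1], so that [f] is sampled where
   the Bernstein weights concentrate. *)
pose node (j : 'I_N.+2) : R := asin (2 * (j%:R / N.+1%:R) - 1) / la.
pose pt (j : {ffun 'I_d -> 'I_N.+2}) : 'rV[R]_d := \row_i node (j i).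
pose wt (j : {ffun 'I_d -> 'I_N.+2}) x : R := \prod_i bern N.+1 (s i x) (j i).
pose q x := \sum_j f (pt j) * wt j x.
have wt0 j x : 0 <= wt j x by apply: prodr_ge0 => i _; exact: bern_ge0.
have wt1 x : \sum_j wt j x = 1.
  rewrite /wt -(bigA_distr_bigA (fun i (j : 'I_N.+2) => bern N.+1 (s i x) j)) /=.
  by rewrite big1// => i _; exact: bern_sum1.
have ts i : trigpoly (s i).
  have := trigpolyD (trigpoly_cst d 2^-1) (trigpoly_term 0 2^-1 (la *: delta_mx 0 i)).
  congr trigpoly; apply/funext => x; rewrite /s mul0r add0r.
  suff -> : dot (la *: delta_mx 0 i) x = la * x 0 i by rewrite mulrDl mul1r mulrC.
  rewrite /dot (bigD1 i) //= big1 ?addr0 => [|k ki]; first by rewrite !mxE !eqxx mulr1.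
  by rewrite !mxE (negbTE ki) andbF mulr0 mul0r.
have t1s i : trigpoly (fun x => 1 - s i x).
  have := trigpolyD (trigpoly_cst d 1) (trigpolyM (trigpoly_cst d (-1)) (ts i)).
  by congr trigpoly; apply/funext => x; rewrite mulN1r.
have tq : trigpoly q.
  apply: trigpoly_sum => j; apply: trigpolyM; first exact: trigpoly_cst.
  apply: trigpoly_prod => i; apply: trigpolyM; last exact: trigpolyX.
  by apply: trigpolyM; [exact: trigpoly_cst|exact: trigpolyX].
exists q; split=> // x.
  apply: le_trans (ler_norm_sum _ _ _) _; rewrite -[leRHS]mulr1 -(wt1 x) mulr_sumr.
  by apply: ler_sum => j _; rewrite normrM (ger0_norm (wt0 _ _)) ler_wpM2r.
move=> xA.
have -> : q x - f x = \sum_j (f (pt j) - f x) * wt j x.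
  rewrite -[f x in LHS]mulr1 -(wt1 x) mulr_sumr -sumrB.
  by apply: eq_bigr => j _; rewrite mulrBl.
have nodeP (j : 'I_N.+2) i : `|node j - x 0 i| <= 2 * K / la * `|j%:R / N.+1%:R - s i x|.
  have jN : 0 <= (j%:R / N.+1%:R : R) <= 1 by rewrite divr_ge0//= ler_pdivrMr ?ltr0n// mul1r ler_nat -ltnS.
  have u1 : `|la * x 0 i| <= 2^-1.
    rewrite normrM (ger0_norm (ltW la0)) /la invfM -mulrA ler_piMr ?invr_ge0//.
    by rewrite ler_pdivrMl// mulr1 xA.
  pose z : R := 2 * (j%:R / N.+1%:R) - 1.
  have z1 : -1 <= z <= 1 by rewrite /z; move: jN; move: (_ / _) => y /andP[y0 y1]; apply/andP; split; lra.
  have v1 : `|asin z| <= pi / 2 by rewrite ler_norml asin_geNpi2 ?asin_lepi2.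
  have := KP _ _ u1 v1; rewrite asinK ?in_itv//= => h.
  rewrite /node -/z -[x 0 i](mulKf (lt0r_neq0 la0)) [la^-1 * _]mulrC -mulrBl normrM.
  have li0 : 0 <= la^-1 by rewrite invr_ge0 (ltW la0).
  rewrite distrC (ger0_norm li0).
  rewrite [2 * K]mulrC -!mulrA mulrC mulrCA [leRHS]mulrC -!mulrA.
  rewrite [leRHS](_ : _ = la^-1 * (K * (2 * `|j%:R / N.+1%:R - s i x|))); last by ring.
  apply: ler_wpM2l; first by rewrite invr_ge0 (ltW la0).
  apply: le_trans h _; apply: ler_wpM2l; first exact: ltW.
  rewrite -[X in X * `|_|](normr_nat R 2) -normrM distrC le_eqVlt; apply/orP; left; apply/eqP.
  by congr `|_|; rewrite /s /z; field.
(* Chebyshev's argument. Either the node is within [r] of [x] in every coordinate and uniform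
   continuity applies, or some coordinate is off by more than [r]; then [nodeP] and the choice of
   [kap] make the quadratic term exceed [2 * M]. *)
have key j : `|f (pt j) - f x| <= e / 2 + \sum_i kap * ((j i)%:R / N.+1%:R - s i x) ^+ 2.
  have [cl|] := pselect (forall i, `|x 0 i - pt j 0 i| <= r).
    rewrite distrC; apply: le_trans (rP x (pt j) xA cl) _; rewrite lerDl sumr_ge0// => i _.
    by rewrite mulr_ge0// sqr_ge0.
  move/existsNP => [i /negP]; rewrite -ltNge mxE distrC => ri.
  apply: (@le_trans _ _ (2 * M)).
    by have := fM (pt j); have := fM x; rewrite !ler_norml; lra.
  apply: ler_wpDl; first exact: ltW.
  rewrite (bigD1 i) //=; apply: ler_wpDr.
    by apply: sumr_ge0 => k _; rewrite mulr_ge0// sqr_ge0.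
  rewrite /kap -[leRHS]mulrA ler_peMr ?mulr_ge0// -exprMn.
  rewrite -[leRHS]real_normK ?num_real// exprn_ege1// normrM.
  have := lt_le_trans ri (nodeP (j i) i).
  rewrite (ger0_norm (_ : 0 <= 2 * K / la / r)); last by rewrite !divr_ge0 ?mulr_ge0 ?ltW.
  by move/ltW; rewrite [2 * K / la / r * _]mulrAC ler_pdivlMr// mul1r.
apply: le_trans (ler_norm_sum _ _ _) _.
apply: (@le_trans _ _ (\sum_j (e / 2 * wt j x + \sum_i kap * (((j i)%:R / N.+1%:R - s i x) ^+ 2 * wt j x)))).
  apply: ler_sum => j _; rewrite normrM (ger0_norm (wt0 _ _)).
  apply: (@le_trans _ _ ((e / 2 + \sum_i kap * ((j i)%:R / N.+1%:R - s i x) ^+ 2) * wt j x)).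
    by rewrite ler_wpM2r.
  by rewrite mulrDl mulr_suml; under eq_bigr do rewrite -mulrA.
rewrite big_split /= -mulr_sumr wt1 mulr1 [leRHS]splitr lerD2l exchange_big /=.
apply: (@le_trans _ _ (\sum_(i < d) kap * N.+1%:R^-1)); last by rewrite sumr_const card_ord -[leLHS]mulr_natr mulrAC.
apply: ler_sum => i _; rewrite -mulr_sumr ler_wpM2l//.
apply: le_trans (bern_var N (s01 i x)).
rewrite (eq_bigr (fun j : {ffun 'I_d -> 'I_N.+2} =>
  \prod_k (bern N.+1 (s k x) (j k) * (if k == i then ((j k)%:R / N.+1%:R - s k x) ^+ 2 else 1)))); last first.
  move=> j _; rewrite big_split /= mulrC; congr (_ * _).
  by rewrite (bigD1 i) //= eqxx big1 ?mulr1// => k /negbTE ->.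
rewrite -(bigA_distr_bigA (fun k (j : 'I_N.+2) => bern N.+1 (s k x) j * (if k == i then (j%:R / N.+1%:R - s k x) ^+ 2 else 1))) /=.
rewrite (bigD1 i) //= eqxx [X in _ * X]big1 ?mulr1// => k /negbTE ki.
by rewrite ki; under eq_bigr do rewrite mulr1; exact: bern_sum1.
Qed.

End TrigApproximation.

(** * Weak convergence from characteristic functions *)

Section WeakConvergence.
Context (R : realType) (dT : measure_display) (T : measurableType dT).
Context (P : probability T R) (d : nat).

Lemma borel_measurable_continuous (f : borel 'rV[R]_d -> R) :
  continuous (f : 'rV[R]_d -> R) -> measurable_fun setT f.
Proof.
move=> /continuousP cf; apply: (measurability _ (RGenOpens.measurableE R)) => _ [_ [a [b ->]] <-].
rewrite setTI; apply: sub_sigma_algebra; apply: cf; exact: interval_open.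
Qed.

Lemma borel_bmf (f : 'rV[R]_d -> R) : continuous f -> (exists M, forall x, `|f x| <= M) ->
  bmf (f : borel 'rV[R]_d -> R).
Proof. by move=> cf bf; split => //; exact: borel_measurable_continuous. Qed.

Lemma continuous_dot_cos (t : 'rV[R]_d) : continuous (fun x => cos (dot t x)).
Proof.
by move=> x; apply: (@continuous_comp _ _ _ (dot t) cos);
  [exact: continuous_dot|exact: continuous_cos].
Qed.

Lemma continuous_dot_sin (t : 'rV[R]_d) : continuous (fun x => sin (dot t x)).
Proof.
by move=> x; apply: (@continuous_comp _ _ _ (dot t) sin);
  [exact: continuous_dot|exact: continuous_sin].
Qed.

Lemma dot_cos_max (t : 'rV[R]_d) : exists M, forall x, `|cos (dot t x)| <= M.
Proof. by exists 1 => x; exact: cos_max. Qed.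

Lemma dot_sin_max (t : 'rV[R]_d) : exists M, forall x, `|sin (dot t x)| <= M.
Proof. by exists 1 => x; exact: sin_max. Qed.

Lemma bmf_dot_cos t : bmf (fun x : borel 'rV[R]_d => cos (dot t x)).
Proof. exact: borel_bmf (@continuous_dot_cos t) (dot_cos_max t). Qed.

Lemma bmf_dot_sin t : bmf (fun x : borel 'rV[R]_d => sin (dot t x)).
Proof. exact: borel_bmf (@continuous_dot_sin t) (dot_sin_max t). Qed.

Lemma tight_borel (gamma : probability (borel 'rV[R]_d) R) (e : R) : 0 < e ->
  exists2 A : R, 0 < A & exists2 B : set (borel 'rV[R]_d), measurable B &
    (forall x : 'rV[R]_d, ~ B x -> forall i, `|x 0 i| <= A) /\ fine (gamma B) <= e.
Proof.
move=> e0.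
pose F (n : nat) : set (borel 'rV[R]_d) := [set x : 'rV[R]_d | exists i, n%:R < `|x 0 i|].
have mF n : measurable (F n).
  apply: sub_sigma_algebra.
  rewrite (_ : F n = \bigcup_(i in [set: 'I_d]) [set x : 'rV[R]_d | n%:R < `|x 0 i|]); last first.
    by rewrite eqEsubset; split => x /= [i]; exists i.
  apply: bigcup_open => i _.
  apply: (@open_comp _ _ (fun x : 'rV[R]_d => `|x 0 i|) [set t | n%:R < t]); last exact: open_gt.
  move=> x _; apply: (@continuous_comp _ _ _ (fun x : 'rV[R]_d => x 0 i)); first exact: continuous_coord.
  exact: norm_continuous.
have F0 : \bigcap_n F n = set0.
  rewrite -subset0 => x /= Fx.
  pose S := \sum_i `|(x : 'rV[R]_d) 0 i|.
  have S0 : 0 <= S by exact: sumr_ge0.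
  have [i] := Fx (Num.bound S) I; rewrite ltNge => /negP; apply.
  apply: le_trans (ltW (archi_boundP S0)); rewrite /S (bigD1 i) //= lerDl.
  exact: sumr_ge0.
have : gamma (F n) @[n --> \oo] --> gamma (\bigcap_n F n).
  apply: nonincreasing_cvg_mu => //.
  - by rewrite (le_lt_trans (probability_le1 _ _))// ltry.
  - by rewrite F0; exact: measurable0.
  - apply/nonincreasing_seqP => n; apply/subsetPset => x /= [i h]; exists i.
    by apply: le_lt_trans h; rewrite ler_nat.
rewrite F0 measure0.
move=> /fine_cvgP[_ /cvgr0Pnorm_le/(_ _ e0)[n _ nP]].
exists n.+1%:R; first by rewrite ltr0n.
exists (F n.+1); first exact: mF.
split; last by have /= := nP n.+1 (leqnSn n); apply: le_trans; exact: ler_norm.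
by move=> x nF i; rewrite leNgt; apply/negP => h; apply: nF; exists i.
Qed.

Variables (Y : nat -> T -> 'rV[R]_d) (gamma : probability (borel 'rV[R]_d) R).
Hypothesis cY : forall n (f : 'rV[R]_d -> R), continuous f ->
  (exists M, forall x, `|f x| <= M) -> bmf (f \o Y n).
Hypothesis tY : forall e : R, 0 < e -> exists2 A : R, 0 < A &
  \forall n \near \oo, exists b : T -> R, [/\ bmf b, forall w, 0 <= b w,
    forall w, ~ (forall i, `|Y n w 0 i| <= A) -> 1 <= b w & Ex P b <= e].
Hypothesis cosY : forall t, Ex P (fun w => cos (dot t (Y n w))) @[n --> \oo] -->
  Ex gamma (fun x => cos (dot t x)).
Hypothesis sinY : forall t, Ex P (fun w => sin (dot t (Y n w))) @[n --> \oo] -->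
  Ex gamma (fun x => sin (dot t x)).

Lemma trigpoly_bmf q : trigpoly q -> (forall n, bmf (q \o Y n)) /\ bmf (q : borel 'rV[R]_d -> R).
Proof.
elim=> [|a b t g _ [IH1 IH2]]; first by split=> [n|]; exact: bmf_cst.
split=> [n|].
  exact: (bmfD (bmfD (bmfZ a (cY n (@continuous_dot_cos t) (dot_cos_max t))) (bmfZ b (cY n (@continuous_dot_sin t) (dot_sin_max t)))) (IH1 n)).
exact: (bmfD (bmfD (bmfZ a (bmf_dot_cos t)) (bmfZ b (bmf_dot_sin t))) IH2).
Qed.

Lemma trigpoly_cvg q : trigpoly q -> Ex P (q \o Y n) @[n --> \oo] --> Ex gamma q.
Proof.
elim=> [|a b t g tg IH].
  have -> : Ex gamma (fun=> 0) = 0 by exact: Ex_cst.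
  rewrite (_ : (fun n => _) = fun=> (0 : R)); first exact: cvg_cst.
  by apply/funext => n; exact: Ex_cst.
have [b1 b2] := trigpoly_bmf tg.
have gc := bmf_dot_cos t; have gs := bmf_dot_sin t.
rewrite (ExD gamma (bmfD (bmfZ a gc) (bmfZ b gs)) b2) (ExD gamma (bmfZ a gc) (bmfZ b gs)).
rewrite (ExZ gamma a gc) (ExZ gamma b gs).
rewrite (_ : (fun n => _) = fun n => a * Ex P (fun w => cos (dot t (Y n w)))
    + b * Ex P (fun w => sin (dot t (Y n w))) + Ex P (g \o Y n)).
  by apply: cvgD => //; apply: cvgD; apply: cvgMl_tmp.
apply/funext => n.
have bc := cY n (@continuous_dot_cos t) (dot_cos_max t).
have bs := cY n (@continuous_dot_sin t) (dot_sin_max t).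
rewrite -(ExZ P a bc) -(ExZ P b bs) -(ExD P (bmfZ a bc) (bmfZ b bs)).
by rewrite -(ExD P (bmfD (bmfZ a bc) (bmfZ b bs)) (b1 n)).
Qed.

(** On a large box [f] is replaced by a trigonometric polynomial with the same uniform bound, whose
    expectations converge by hypothesis. Outside the box both are at most [M] and tightness bounds
    the cost. The common bound is essential because the polynomial is not close to [f] there. *)
Lemma cvg_Ex_chf (f : 'rV[R]_d -> R) : continuous f -> (exists M, forall x, `|f x| <= M) ->
  Ex P (f \o Y n) @[n --> \oo] --> Ex gamma f.
Proof.
move=> cf [M fM].
have M0 : 0 <= M by apply: le_trans (fM 0).
have bfY n : bmf (f \o Y n) by apply: cY => //; exists M.
have bf : bmf (f : borel 'rV[R]_d -> R) by apply: borel_bmf => //; exists M.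
apply/cvgrPdist_le => e e0 /=.
pose e1 := e / 10; have e10 : 0 < e1 by rewrite divr_gt0.
have e1M : 0 < e1 / (2 * M + 1) by rewrite divr_gt0// ltr_wpDl// mulr_ge0.
have [A1 A10 [Bs mBs [BsP gBs]]] := tight_borel gamma e1M.
have [A2 A20 tB] := tY e1M.
pose A := A1 + A2.
have A0 : 0 < A by rewrite /A; lra.
have A1A : A1 <= A by rewrite /A; lra.
have A2A : A2 <= A by rewrite /A; lra.
have M1 : 2 * M * (e1 / (2 * M + 1)) <= e1 by rewrite mulrA ler_pdivrMr ?ltr_wpDl ?mulr_ge0//; nra.
have [q [tq qM qf]] := trigpoly_approx cf fM A0 e10.
have [bqY bq] := trigpoly_bmf tq.
have h1 : `|Ex gamma f - Ex gamma q| <= 2 * e1.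
  have bi := bmf_indic R mBs.
  apply: (@le_trans _ _ (e1 + 2 * M * Ex gamma (fun x => \1_Bs x))).
    apply: Ex_diff_le => // x; rewrite indicE; case: (boolP (x \in Bs)) => [xB|xB] /=.
      by rewrite mulr1; have := fM x; have := qM x; rewrite !ler_norml; lra.
    rewrite mulr0 addr0 distrC; apply: qf => i; apply: le_trans A1A.
    by apply: BsP; move: xB; rewrite notin_setE.
  rewrite Ex_indic//.
  have : 2 * M * fine (gamma Bs) <= 2 * M * (e1 / (2 * M + 1)) by rewrite ler_wpM2l// mulr_ge0.
  lra.
have /cvgrPdist_le/(_ _ e10) tc := trigpoly_cvg tq.
apply: filterS (filterI tB tc) => n [[b [bb b0 b1 bE]] hc].
have h2 : `|Ex P (f \o Y n) - Ex P (q \o Y n)| <= 2 * e1.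
  apply: (@le_trans _ _ (e1 + 2 * M * Ex P b)).
    apply: Ex_diff_le => // w; have [inA|outA] := pselect (forall i, `|Y n w 0 i| <= A2).
      rewrite distrC; apply: le_trans (qf _ _) _ => [i|]; first exact: le_trans (inA i) A2A.
      by rewrite lerDl mulr_ge0// mulr_ge0.
    have : 2 * M * 1 <= 2 * M * b w by rewrite ler_wpM2l ?mulr_ge0//; exact: b1.
    by rewrite /=; have := fM (Y n w); have := qM (Y n w); rewrite !ler_norml; lra.
  have : 2 * M * Ex P b <= 2 * M * (e1 / (2 * M + 1)) by rewrite ler_wpM2l// mulr_ge0.
  lra.
by move: h1 h2 hc; rewrite /= !ler_norml /e1; lra.
Qed.

Theorem cvg_in_law_chf : cvg_in_law P Y (fun f => \int[gamma]_x (f x)%:E)%E.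
Proof.
move=> f cf bf.
have bg : bmf (f : borel 'rV[R]_d -> R) by exact: borel_bmf.
have -> : (\int[gamma]_x (f x)%:E = (Ex gamma f)%:E)%E by rewrite /Ex /Rintegral fineK//; apply: integrable_fin_num => //; exact: bmf_integrable.
rewrite (_ : (fun n => _) = fun n => (Ex P (f \o Y n))%:E); last first.
  by apply/funext => n; rewrite expectation_Ex//; exact: cY.
by apply: cvg_EFin; [exact: nearW|exact: cvg_Ex_chf].
Qed.

End WeakConvergence.

(** * Uniqueness of power series coefficients *)

Section PowerSeriesUniqueness.
Variable R : realType.
Implicit Type c : nat -> R.

Lemma entire_eq0 c : entire c -> (forall x : R, limn (pseries c x) = 0) -> forall n, c n = 0.
Proof.
move=> ec hc n; elim: n c ec hc => [|n IH] c ec hc.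
  rewrite -(hc 0); apply/esym/cvg_lim => //.
  rewrite -(cvg_shiftS (pseries c 0)).
  rewrite (_ : (fun n => _) = fun=> c 0%N); first exact: cvg_cst.
  apply/funext => n; rewrite /pseries/= seriesEord/= big_ord_recl expr0 mulr1 big1 ?addr0// => i _.
  by rewrite /= exprS mul0r mulr0.
have : pseries_diffs c n = 0.
  apply: IH => [|x]; first exact: entire_diffs.
  have h := is_derive_entire x ec.
  rewrite -(@derive_val _ _ _ _ _ _ _ h) (_ : (fun _ => _) = cst 0); last exact/funext.
  exact: derive_cst.
by move/eqP; rewrite mulf_eq0 pnatr_eq0 /= => /eqP.
Qed.

Lemma exp_coeff_le_expR (x : R) n : 0 <= x -> x ^+ n / n`!%:R <= expR x.
Proof.
move=> x0; have := nondecreasing_cvgn_le (nondecreasing_series (P := predT) (fun k _ _ => exp_coeff_ge0 k x0)) (is_cvg_series_exp_coeff _) n.+1.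
apply: le_trans; rewrite /= big_nat_recr//= lerDr sumr_ge0// => k _.
exact: exp_coeff_ge0.
Qed.

Lemma entireB c c' : entire c -> entire c' -> entire (fun n => c n - c' n).
Proof.
move=> ec ec' r r0; have [B hB] := ec r r0; have [B' hB'] := ec' r r0.
exists (B + B') => n; apply: le_trans (lerD (hB n) (hB' n)).
by rewrite -mulrDl ler_wpM2r ?exprn_ge0// ler_normB.
Qed.

Lemma entire_gauss_moment (v : R) : 0 <= v -> entire (fun n => gauss_moment v n / n`!%:R).
Proof.
move=> v0 r r0; exists (expR (v / 2 * r ^+ 2)) => n; rewrite /gauss_moment.
case: ifP => n1; first by rewrite mul0r normr0 mul0r expR_ge0.
have f1 : n`!%:R != 0 :> R by rewrite pnatr_eq0 -lt0n fact_gt0.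
have h : 0 <= v / 2 by rewrite divr_ge0.
rewrite mulrAC mulfK// ger0_norm; last by rewrite divr_ge0// exprn_ge0.
have e : r ^+ n = (r ^+ 2) ^+ n./2 by rewrite -exprM mul2n -[in LHS](odd_double_half n) n1.
rewrite e mulrAC -exprMn.
by apply: exp_coeff_le_expR; rewrite mulr_ge0// exprn_ge0.
Qed.

End PowerSeriesUniqueness.

(** * Transforms and moments of the normal law *)

Section NormalTransforms.
Variables (R : realType) (s : R).
Hypothesis s0 : 0 < s.
Notation mu := (@lebesgue_measure R).
Let sn0 : s != 0. Proof. exact: lt0r_neq0. Qed.

Lemma integral_normal_prob (m : R) (f : R -> \bar R) : (forall x, 0 <= f x)%E ->
  measurable_fun setT f ->
  (\int[normal_prob m s]_x f x = \int[mu]_x (f x * (normal_pdf m s x)%:E))%E.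
Proof.
move=> f0 mf.
have dom := normal_prob_dominates m s.
rewrite -(Radon_Nikodym_SigmaFinite.change_of_variables dom f0 measurableT mf).
apply: ae_eq_integral => //.
- apply: emeasurable_funM => //; apply: (measurable_int mu).
  exact: Radon_Nikodym_SigmaFinite.f_integrable.
- by apply: emeasurable_funM => //; apply/measurableT_comp => //; exact: measurable_normal_pdf.
apply: ae_eqe_mul2l => /=.
apply: integral_ae_eq => //=.
- exact: Radon_Nikodym_SigmaFinite.f_integrable.
- by apply/measurableT_comp => //; exact: measurable_normal_pdf.
by move=> E _ mE; rewrite -Radon_Nikodym_SigmaFinite.f_integral.
Qed.

Notation N := (normal_prob 0 s).

(** Completing the square turns the exponential tilt of the density into the density shifted by
    [t * s ^+ 2]. *)
Lemma normal_mgf (t : R) : (\int[N]_x (expR (t * x))%:E = (expR (t ^+ 2 * s ^+ 2 / 2))%:E)%E.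
Proof.
rewrite integral_normal_prob; first last.
- by apply/measurable_EFinP; apply: measurableT_comp => //; exact: mulrl_measurable.
- by move=> x; rewrite lee_fin expR_ge0.
transitivity (\int[mu]_x ((expR (t ^+ 2 * s ^+ 2 / 2))%:E * (normal_pdf (t * s ^+ 2) s x)%:E))%E.
  apply: eq_integral => x _; rewrite -!EFinM !normal_pdfE// /normal_fun.
  congr EFin; rewrite mulrCA [RHS]mulrCA; congr (_ * _).
  rewrite -!expRD; congr expR; rewrite -[X in X^-1]mulr_natr.
  by field.
rewrite ge0_integralZl//.
- by rewrite integral_normal_pdf mule1.
- by apply/measurable_EFinP; exact: measurable_normal_pdf.
- by move=> x _; rewrite lee_fin normal_pdf_ge0.
Qed.

Lemma expR_norm_le (y : R) : expR `|y| <= expR y + expR (- y).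
Proof.
have [y0|y0] := leP 0 y; first by rewrite ger0_norm// lerDl expR_ge0.
by rewrite ltr0_norm// lerDr expR_ge0.
Qed.

Lemma exp_poly_bound (a : nat -> R) (x : R) n : (forall k, `|a k| <= 1) ->
  `|\sum_(k < n) a k * x ^+ k / k`!%:R| <= expR `|x|.
Proof.
move=> a1; apply: le_trans (ler_norm_sum _ _ _) _.
have := nondecreasing_cvgn_le (nondecreasing_series (P := predT) (fun k _ _ => exp_coeff_ge0 k (normr_ge0 x))) (is_cvg_series_exp_coeff _) n.
move=> h; apply: le_trans h; rewrite big_mkord; apply: ler_sum => k _.
rewrite /exp_coeff/= normrM normrM normrX normfV normr_nat.
by rewrite ler_wpM2r ?invr_ge0// ler_piMl ?exprn_ge0.
Qed.

Let mexp (t : R) : measurable_fun [set: R] (fun x => (expR (t * x))%:E).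
Proof. by apply/measurable_EFinP; apply: measurableT_comp => //; exact: mulrl_measurable. Qed.

Lemma integrable_normal_exp (t : R) :
  integrable N setT (EFin \o (fun x => expR (t * x) + expR (- (t * x)))).
Proof.
have h u : integrable N setT (EFin \o (fun x => expR (u * x))).
  apply/integrableP; split; first exact: mexp.
  under eq_integral do rewrite /= ger0_norm ?expR_ge0//.
  by rewrite normal_mgf ltry.
have := integrableD measurableT (h t) (h (- t)).
by apply: eq_integrable => // x _; rewrite /= mulNr.
Qed.

Lemma integrable_normal_le (f : R -> R) (C t : R) : measurable_fun setT f ->
  (forall x, `|f x| <= C * expR `|t * x|) -> integrable N setT (EFin \o f).
Proof.
move=> mf fC.
apply: (le_integrable measurableT) (integrableZl measurableT `|C| (integrable_normal_exp t)).
  exact/measurable_EFinP.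
move=> x _ /=; rewrite lee_fin; apply: le_trans (fC x) _.
rewrite [leRHS]normrM normr_id; apply: (@le_trans _ _ (`|C| * expR `|t * x|)).
  by rewrite ler_wpM2r ?expR_ge0 ?ler_norm.
by rewrite ler_wpM2l// [leRHS]ger0_norm ?addr_ge0 ?expR_ge0 ?expR_norm_le.
Qed.

Definition normal_moment k : R := \int[N]_x (x ^+ k).

Lemma integrable_normal_monom k (c : R) : integrable N setT (EFin \o (fun x => c * x ^+ k)).
Proof.
apply: (@integrable_normal_le _ (`|c| * k`!%:R) 1).
  by apply: measurable_funM => //; exact: exprn_measurable.
move=> x; rewrite mul1r normrM -mulrA ler_wpM2l// normrX.
have k0 : 0 < k`!%:R :> R by rewrite ltr0n fact_gt0.
rewrite -ler_pdivrMl// mulrC.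
have := @exp_poly_bound (fun j => (j == k)%:R) `|x| k.+1.
rewrite normr_id big_ord_recr/= big1 => [|i _]; last by rewrite (ltn_eqF (ltn_ord i)) !mul0r.
rewrite add0r eqxx mul1r normrM normrX normr_id normfV normr_nat; apply.
by move=> j; case: eqP => _; rewrite ?normr1 ?normr0.
Qed.

(** Dominated convergence: with coefficients at most 1, all partial sums are below
    [exp(t x) + exp(- t x)], which is integrable by [normal_mgf]. The exponential, cosine and sine
    are all of this form. *)
Lemma normal_series (a : nat -> R) (f : R -> R) (t : R) : (forall k, `|a k| <= 1) ->
  (forall x, \sum_(k < n) a k * x ^+ k / k`!%:R @[n --> \oo] --> f x) ->
  \sum_(k < n) a k * t ^+ k * normal_moment k / k`!%:R @[n --> \oo] -->
    \int[N]_x (f (t * x)).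
Proof.
move=> a1 cf.
pose fn n (x : R) := \sum_(k < n) a k * (t * x) ^+ k / k`!%:R.
have mfn n : measurable_fun setT (fn n).
  apply: measurable_sum => k; apply: measurable_funM => //; apply: measurable_funM => //.
  by apply: measurable_funX; exact: mulrl_measurable.
have fnE n : \int[N]_x (fn n x) = \sum_(k < n) a k * t ^+ k * normal_moment k / k`!%:R.
  rewrite /fn /Rintegral.
  under eq_integral do rewrite -sumEFin.
  rewrite (@integral_sum _ _ _ N _ measurableT 'I_n (fun k x => (a k * (t * x) ^+ k / k`!%:R)%:E)); last first.
    move=> k; apply: eq_integrable (integrable_normal_monom k (a k * t ^+ k / k`!%:R)) => // x _.
    by rewrite /= exprMn; congr EFin; ring.
  rewrite -sum_fine => [|k _]; last first.
    apply: integrable_fin_num => //.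
    apply: eq_integrable (integrable_normal_monom k (a k * t ^+ k / k`!%:R)) => // x _.
    by rewrite /= exprMn; congr EFin; ring.
  apply: eq_bigr => k _.
  rewrite (_ : a k * _ * _ / _ = a k * t ^+ k / k`!%:R * normal_moment k); last by ring.
  rewrite -RintegralZl//; last first.
    apply: eq_integrable (integrable_normal_monom k 1) => // x _.
    by rewrite /= mul1r.
  by congr fine; apply: eq_integral => x _; congr EFin; rewrite exprMn; ring.
under eq_fun do rewrite -fnE.
have mf : measurable_fun setT (EFin \o (fun x => f (t * x))).
  apply/measurable_EFinP; apply: (measurable_fun_cvg mfn) => x _; exact: cf.
have h1 n : measurable_fun setT (EFin \o fn n) by apply/measurable_EFinP; exact: mfn.
have h2 : {ae N, forall x, setT x -> (EFin \o fn n) x @[n --> \oo] --> (EFin \o (fun x => f (t * x))) x} by apply/aeW => x _; apply: cvg_EFin; [near=> n|exact: cf].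
have [|intf _ lim_f] := @dominated_convergence _ _ _ N setT measurableT _ _ _ h1 mf h2 (integrable_normal_exp t).
  apply/aeW => x n _; rewrite /= lee_fin; apply: le_trans (exp_poly_bound _ _ a1) _.
  exact: expR_norm_le.
have ff : (\int[N]_x (f (t * x))%:E)%E \is a fin_num by apply: integrable_fin_num intf.
have /fine_cvgP[_] : (\int[N]_x (fn n x)%:E)%E @[n --> \oo] --> (\int[N]_x (f (t * x)))%:E by rewrite /Rintegral fineK.
exact.
Unshelve. all: by end_near. Qed.

Lemma even_sum (u : nat -> R) n : (forall i, u (2 * i).+1 = 0) ->
  \sum_(k < 2 * n) u k = \sum_(i < n) u (2 * i)%N.
Proof.
move=> u1; elim: n => [|n IH]; first by rewrite !big_ord0.
rewrite mulnS addnC addn2 !big_ord_recr /= IH u1 addr0.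
by [].
Qed.

Lemma even_gauss_series (c t v : R) (a : nat -> R) : (forall i, a (2 * i)%N = c ^+ i) ->
  \sum_(k < 2 * n) a k * t ^+ k * gauss_moment v k / k`!%:R @[n --> \oo] --> expR (c * (t ^+ 2 * v / 2)).
Proof.
move=> aE; rewrite (_ : (fun n => _) = series (exp_coeff (c * (t ^+ 2 * v / 2)))).
  exact: is_cvg_series_exp_coeff.
apply/funext => n; rewrite (even_sum (u := fun k => a k * t ^+ k * gauss_moment v k / k`!%:R)).
  rewrite seriesEord; apply: eq_bigr => i _; rewrite aE /gauss_moment /exp_coeff /= mul2n odd_double doubleK.
  rewrite -mul2n exprM.
  have f1 : (2 * i)`!%:R != 0 :> R by rewrite pnatr_eq0 -lt0n fact_gt0.
  have f2 : i`!%:R != 0 :> R by rewrite pnatr_eq0 -lt0n fact_gt0.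
  have -> : (c * (t ^+ 2 * v / 2)) ^+ i = c ^+ i * (t ^+ 2) ^+ i * (v / 2) ^+ i by rewrite -!exprMn; congr (_ ^+ _); ring.
  move: (c ^+ i) (_ ^+ i) (_ ^+ i) (i`!%:R : R) ((2 * i)`!%:R : R) f1 f2 => x y z p q f1 f2.
  by field; rewrite f1 f2.
by move=> i; rewrite /gauss_moment /= mul2n odd_double /= mulr0 mul0r.
Qed.

Lemma cvgn_double (u : nat -> R) (l : R) : u n @[n --> \oo] --> l -> u (2 * n)%N @[n --> \oo] --> l.
Proof.
apply: cvg_comp => A [n0 _ hA]; exists n0 => // n /= n0n; apply: hA => /=.
by rewrite mul2n -addnn (leq_trans n0n)// leq_addl.
Qed.

Lemma normal_exp_series (t : R) :
  \sum_(k < n) 1 * t ^+ k * normal_moment k / k`!%:R @[n --> \oo] --> \int[N]_x (expR (t * x)).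
Proof.
apply: (@normal_series (fun=> 1)) => [j|x]; first by rewrite normr1.
have : series (exp_coeff x) @ \oo --> expR x by exact: is_cvg_series_exp_coeff.
rewrite seriesEord.
rewrite (_ : (fun n => \sum_(k < n) exp_coeff x k) = (fun n => \sum_(k < n) 1 * x ^+ k / k`!%:R))//.
by apply/funext => n; apply: eq_bigr => j _; rewrite mul1r.
Qed.

Lemma entire_normal_moment : entire (fun n => normal_moment n / n`!%:R).
Proof.
move=> r r0.
have /cvgP/cvg_series_cvg_0/cvgP/cvg_seq_bounded[B [_ hB]] :
    series (fun k => 1 * r ^+ k * normal_moment k / k`!%:R) @ \oo --> \int[N]_x (expR (r * x)).
  by rewrite seriesEord; exact: normal_exp_series.
exists (B + 1) => n; have := hB (B + 1); rewrite ltrDl => /(_ ltr01 n I).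
by rewrite /= mul1r -mulrA normrM (ger0_norm (exprn_ge0 n r0)) mulrC.
Qed.

(** Both sequences have the entire generating function [exp(t^2 s^2 / 2)], so their coefficients
    agree by [entire_eq0]. *)
Lemma normal_momentE k : normal_moment k = gauss_moment (s ^+ 2) k.
Proof.
have k0 : (k`!%:R)^-1 != 0 :> R by rewrite invr_eq0 pnatr_eq0 -lt0n fact_gt0.
apply/eqP; rewrite -subr_eq0 -(mulIr_eq0 _ (mulIf k0)) mulrBl; apply/eqP.
have ec := entireB entire_normal_moment (entire_gauss_moment (sqr_ge0 s)).
apply: (entire_eq0 ec) => {k k0} t.
have h : pseries (fun n => normal_moment n / n`!%:R - gauss_moment (s ^+ 2) n / n`!%:R) t (2 * n)%N
    @[n --> \oo] --> expR (t ^+ 2 * s ^+ 2 / 2) - expR (1 * (t ^+ 2 * s ^+ 2 / 2)).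
  under eq_fun do rewrite /pseries seriesEord.
  rewrite (_ : (fun n => _) = (fun n => \sum_(k < 2 * n) 1 * t ^+ k * normal_moment k / k`!%:R -
     \sum_(k < 2 * n) 1 * t ^+ k * gauss_moment (s ^+ 2) k / k`!%:R)); last first.
    by apply/funext => n; rewrite -sumrB; apply: eq_bigr => k _ /=; ring.
  apply: cvgB; last by apply: (@even_gauss_series 1 t (s ^+ 2) (fun=> 1)) => i; rewrite expr1n.
  have := cvgn_double (@normal_exp_series t).
  by rewrite /Rintegral normal_mgf.
rewrite mul1r subrr in h; apply/cvg_lim => //.
have h2 := cvgn_double (entire_cvg (x := t) ec).
by rewrite -(cvg_lim (@Rhausdorff R) h) (cvg_lim (@Rhausdorff R) h2); exact: entire_cvg.
Qed.

Lemma normal_cos (t : R) : \int[N]_x cos (t * x) = expR (- (t ^+ 2 * s ^+ 2 / 2)).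
Proof.
pose a k : R := (~~ odd k)%:R * (-1) ^+ k./2.
have cosE (x : R) : \sum_(k < n) a k * x ^+ k / k`!%:R @[n --> \oo] --> cos x.
  have : series (cos_coeff x) @ \oo --> cos x by rewrite cos.unlock; exact: is_cvg_series_cos_coeff.
  by rewrite seriesEord.
have a1 k : `|a k| <= 1 by rewrite /a normrM normrX normrN1 expr1n mulr1 normr_nat; case: odd.
rewrite -(cvg_lim (@Rhausdorff R) (cvgn_double (@normal_series _ _ t a1 cosE))); apply/cvg_lim => //.
rewrite (_ : (fun n => _) = fun n => \sum_(k < 2 * n) a k * t ^+ k * gauss_moment (s ^+ 2) k / k`!%:R).
  rewrite -mulN1r; apply: even_gauss_series => i.
  by rewrite /a mul2n odd_double doubleK mul1r.
by apply/funext => n; apply: eq_bigr => k _; rewrite normal_momentE.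
Qed.

Lemma normal_sin (t : R) : \int[N]_x sin (t * x) = 0.
Proof.
pose a k : R := (odd k)%:R * (-1) ^+ k.-1./2.
have sinE (x : R) : \sum_(k < n) a k * x ^+ k / k`!%:R @[n --> \oo] --> sin x.
  have : series (sin_coeff x) @ \oo --> sin x by rewrite sin.unlock; exact: is_cvg_series_sin_coeff.
  by rewrite seriesEord.
have a1 k : `|a k| <= 1 by rewrite /a normrM normrX normrN1 expr1n mulr1 normr_nat; case: odd.
rewrite -(cvg_lim (@Rhausdorff R) (@normal_series _ _ t a1 sinE)); apply/cvg_lim => //.
rewrite (_ : (fun n => _) = fun=> 0); first exact: cvg_cst.
apply/funext => n; apply: big1 => k _; rewrite normal_momentE /gauss_moment /a.
by case: odd; rewrite ?mulr0 !mul0r.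
Qed.

End NormalTransforms.

(** * Image measures and measurability of vectors *)

Section Pushforward.
Context (R : realType).

Lemma pushforward_probability d1 d2 (T : measurableType d1) (S : measurableType d2)
    (P : probability T R) (f : T -> S) : measurable_fun setT f ->
  exists Q : probability S R, (forall B, measurable B -> Q B = P (f @^-1` B)) /\
    forall g : S -> R, bmf g -> bmf (g \o f) /\ Ex Q g = Ex P (g \o f).
Proof.
move=> mf.
pose X : {mfun T >-> S} := mfun_Sub (mem_set mf).
have XE : (X : T -> S) = f by [].
exists (distribution P X); split=> [B mB|g bg]; first by [].
have bgf : bmf (g \o f).
  case: bg => mg [M hM]; split; first exact: measurableT_comp mg mf.
  by exists M => w; exact: hM.
split=> //; rewrite /Ex /Rintegral; congr fine.
rewrite /distribution (@integral_pushforward _ _ _ _ _ X)//.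
- by case: bg => mg _; apply/measurable_EFinP.
- by rewrite preimage_setT; exact: bmf_integrable bgf.
Qed.

(** Every open set is a countable union of rational boxes, and the preimage of a box is a finite
    intersection of coordinate events. *)
Lemma measurable_rV d1 (T : measurableType d1) n (f : T -> borel 'rV[R]_n) :
  (forall i, measurable_fun setT (fun w => f w 0 i)) -> measurable_fun setT f.
Proof.
move=> mf.
apply: (@measurability _ _ T (borel 'rV[R]_n) setT f (@open 'rV[R]_n) erefl) => _ [U oU <-]; rewrite setTI.
pose box (q : 'rV[rat]_n) (r : nat) := [set x : 'rV[R]_n | forall i, `|ratr (q 0 i) - x 0 i| < r.+1%:R^-1].
pose I := ('rV[rat]_n * nat)%type.
rewrite (_ : f @^-1` U = \bigcup_(qr : I) [set w | box qr.1 qr.2 `<=` U /\ box qr.1 qr.2 (f w)]); last first.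
  apply/seteqP; split=> [w Uw|w [qr _ [sub /sub]]]//.
  have /nbhs_rVP[r r0 rU] : nbhs (f w : 'rV[R]_n) U by exact: open_nbhs_nbhs.
  have [N hN] : exists N : nat, N.+1%:R^-1 < r / 2.
    have r2 : 0 < r / 2 by rewrite divr_gt0.
    by have [N _ /(_ N (leqnn N))] := near_infty_natSinv_lt (PosNum r2); exists N.
  have N0 : 0 < N.+1%:R^-1 :> R by rewrite invr_gt0.
  have hq i : exists q : rat, `|ratr q - f w 0 i| < N.+1%:R^-1.
    have [q] : exists q : rat, ratr q \in `](f w 0 i - N.+1%:R^-1), (f w 0 i + N.+1%:R^-1)[ by apply: rat_in_itvoo; rewrite ltrBlDr -addrA ltrDl addr_gt0.
    by rewrite in_itv/= => q_in; exists q; rewrite ltr_distl.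
  pose q := \row_i projT1 (cid (hq i)).
  have qw : box q N (f w) by move=> i; rewrite mxE; exact: (projT2 (cid (hq i))).
  exists (q, N) => //; split=> // x qx; apply: rU => i.
  have := qx i; have := qw i => /= h1 h2.
  rewrite -(subrK (ratr (q 0 i)) (f w 0 i)) -addrA; apply: le_lt_trans (ler_normD _ _) _.
  by rewrite distrC [ltRHS]splitr; apply: ltrD; [exact: lt_trans h1 hN|exact: lt_trans h2 hN].
apply: countable_bigcupT_measurable => [|[q r]]; first exact: countableP.
have [sub|nsub] := pselect (box q r `<=` U); last first.
  by rewrite (_ : [set w | _] = set0)//; apply/seteqP; split=> w // [].
rewrite (_ : [set w | _] = \big[setI/setT]_i [set w | `|ratr (q 0 i) - f w 0 i| < r.+1%:R^-1]); last first.
  apply/seteqP; split=> [w [_ h]|w h]; first by rewrite -bigcap_seq => i _; exact: h.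
  by split=> // i; move: h; rewrite -bigcap_seq => /(_ i); apply; rewrite /= mem_index_enum.
apply: bigsetI_measurable => i _.
have -> : [set w | `|ratr (q 0 i) - f w 0 i| < r.+1%:R^-1] = (fun w => f w 0 i) @^-1` (ball (ratr (q 0 i) : R) r.+1%:R^-1) by [].
rewrite -[X in measurable X]setTI; apply: mf => //; exact: measurable_ball.
Qed.

End Pushforward.

(** * Uniqueness of laws from characteristic functions *)

Section ChfUniqueness.
Context (R : realType).

Lemma Ex_cvg_bounded d1 (T : measurableType d1) (P : probability T R) (g : nat -> T -> R) (f : T -> R) (M : R) :
  (forall n, bmf (g n)) -> (forall n w, `|g n w| <= M) ->
  (forall w, g n w @[n --> \oo] --> f w) -> Ex P (g n) @[n --> \oo] --> Ex P f.
Proof.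
move=> bg gM cg.
have h1 n : measurable_fun setT (EFin \o g n) by apply/measurable_EFinP; case: (bg n).
have mf : measurable_fun setT (EFin \o f) by apply/measurable_EFinP; apply: (measurable_fun_cvg (fun n => (bg n).1)) => x _; exact: cg.
have h2 : {ae P, forall x, setT x -> (EFin \o g n) x @[n --> \oo] --> (EFin \o f) x} by apply/aeW => x _; apply: cvg_EFin; [near=> n|exact: cg].
have iM : P.-integrable setT (EFin \o (fun _ : T => M)) by apply: bmf_integrable; exact: bmf_cst.
have [|intf _ lim_f] := @dominated_convergence _ _ _ P setT measurableT _ _ _ h1 mf h2 iM.
  by apply/aeW => x n _; rewrite /= lee_fin.
have ff : (\int[P]_x (f x)%:E)%E \is a fin_num by apply: integrable_fin_num intf.
have /fine_cvgP[_] : (\int[P]_x (g n x)%:E)%E @[n --> \oo] --> (\int[P]_x (f x))%:E by rewrite /Rintegral fineK.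
exact.
Unshelve. all: by end_near. Qed.

(** The weak convergence result applied to a constant sequence of variables is a uniqueness
    statement. *)
Lemma chf_eq_Ex d (g1 g2 : probability (borel 'rV[R]_d) R) :
  (forall t, Ex g1 (fun x => cos (dot t x)) = Ex g2 (fun x => cos (dot t x))) ->
  (forall t, Ex g1 (fun x => sin (dot t x)) = Ex g2 (fun x => sin (dot t x))) ->
  forall f : 'rV[R]_d -> R, continuous f -> (exists M, forall x, `|f x| <= M) -> Ex g1 f = Ex g2 f.
Proof.
move=> hc hs f cf bf.
have : Ex g1 (f \o id) @[n --> \oo] --> Ex g2 f.
  apply: (@cvg_Ex_chf R _ _ g1 d (fun _ => id) g2) => //.
  - by move=> n h ch bh; exact: borel_bmf.
  - move=> e e0; have [A A0 [B mB [hB gB]]] := tight_borel g1 e0.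
    exists A => //; near=> n; exists (fun w => \1_B w : R); split.
    + exact: bmf_indic.
    + by move=> w; rewrite indicE.
    + by move=> w /= nA; rewrite indicE mem_set//; apply: contrapT => /hB /nA.
    + by rewrite Ex_indic.
  - by move=> t; rewrite hc; exact: cvg_cst.
  - by move=> t; rewrite hs; exact: cvg_cst.
by move=> /(cvg_lim (@Rhausdorff R)) <-; rewrite lim_cst.
Unshelve. all: by end_near. Qed.

(** Open lower half-lines are stable under intersection and generate the Borel sets, and their
    indicators are bounded limits of the continuous ramps [g n]. *)
Lemma continuous_test_eq (mu1 mu2 : probability (measurableTypeR R) R) :
  (forall f : R -> R, continuous f -> (exists M, forall x, `|f x| <= M) -> Ex mu1 f = Ex mu2 f) ->
  forall B, measurable B -> mu1 B = mu2 B.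
Proof.
move=> h; apply: (@measure_unique _ R (measurableTypeR R) (@RGenInftyO.G R)
  (fun n : nat => `]-oo, (n%:R : R)[%classic) _ _ _ _ mu1 mu2).
- exact: RGenInftyO.measurableE.
- move=> _ _ [x ->] [y ->]; exists (Num.min x y); apply/seteqP; split=> z /=; rewrite !in_itv/= lt_min.
    by case=> -> ->.
  by move/andP.
- by move=> n; exists n%:R.
- apply/seteqP; split=> // x _; exists (Num.truncn `|x|).+1 => //=.
  by rewrite in_itv/=; apply: le_lt_trans (ler_norm x) _; exact: truncnS_gt.
- move=> _ [a ->].
  pose g n x : R := Num.min 1 (Num.max 0 (n%:R * (a - x))).
  have cg n : continuous (g n).
    move=> x; apply: (@continuous_min _ _ (fun=> 1) (fun x => Num.max 0 (n%:R * (a - x)))); first exact: cst_continuous.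
    apply: (@continuous_max _ _ (fun=> 0) (fun x => (n%:R * (a - x)))); first exact: cst_continuous.
    by apply: cvgMl_tmp; apply: cvgB; [exact: cvg_cst|exact: cvg_id].
  have g1 n x : `|g n x| <= 1 by rewrite ger0_norm /g ?ge_min ?lexx// le_min ler01 le_max lexx.
  have gl x : g n x @[n --> \oo] --> (\1_(`]-oo, a[) x : R).
    rewrite indicE; have [xa|xa] := ltP x a.
      rewrite mem_set ?in_itv//=; apply: cvg_near_cst.
      have [N _ hN] := nbhs_infty_ger ((a - x)^-1).
      exists N => // n /= Nn; apply/min_idPl; rewrite le_max; apply/orP; right.
      by rewrite -ler_pdivrMr ?subr_gt0// div1r; exact: hN.
    rewrite memNset; last by rewrite /= in_itv/= ltNge xa.
    rewrite (_ : (fun n => _) = fun=> 0); first exact: cvg_cst.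
    apply/funext => n; rewrite /g max_l ?min_r ?ler01//.
    by rewrite mulr_ge0_le0// subr_le0.
  have E (mu : probability (measurableTypeR R) R) : Ex mu (g n) @[n --> \oo] --> fine (mu `]-oo, a[%classic).
    rewrite -Ex_indic//; apply: (Ex_cvg_bounded (M := 1)) => // n.
    by split; [exact: continuous_measurable_fun|exists 1; exact: g1].
  have fin (mu : probability (measurableTypeR R) R) : mu `]-oo, a[%classic \is a fin_num by apply: fin_num_measure.
  suff e : fine (mu1 `]-oo, a[%classic) = fine (mu2 `]-oo, a[%classic).
    by move: (congr1 EFin e); rewrite (fineK (fin mu1)) (fineK (fin mu2)).
  rewrite -(cvg_lim (@Rhausdorff R) (E mu1)) -(cvg_lim (@Rhausdorff R) (E mu2)).
  have hn n : Ex mu1 (g n) = Ex mu2 (g n) by apply: h; [exact: cg|exists 1; exact: g1].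
  by under eq_fun do rewrite hn.
- by move=> n; rewrite ltey_eq fin_num_measure.
Qed.

Lemma chf_unique1 (mu1 mu2 : probability (measurableTypeR R) R) :
  (forall t : R, Ex mu1 (fun x => cos (t * x)) = Ex mu2 (fun x => cos (t * x))) ->
  (forall t : R, Ex mu1 (fun x => sin (t * x)) = Ex mu2 (fun x => sin (t * x))) ->
  forall B, measurable B -> mu1 B = mu2 B.
Proof.
move=> hc hs; apply: continuous_test_eq => f cf [M fM].
pose row (y : measurableTypeR R) : borel 'rV[R]_1 := \row_(_ < 1) (y : R).
have mrow : measurable_fun setT row.
  apply: measurable_rV => i; rewrite (_ : (fun w => _) = id); first exact: measurable_id.
  by apply/funext => w; rewrite mxE.
have [g1 [_ h1]] := pushforward_probability mu1 mrow.
have [g2 [_ h2]] := pushforward_probability mu2 mrow.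
have dotE (t : 'rV[R]_1) y : dot t (row y) = t 0 0 * y by rewrite /dot big_ord1 mxE.
have cf1 : continuous (fun x : 'rV[R]_1 => f (x 0 0)) by move=> x; apply: continuous_comp; [exact: continuous_coord|exact: cf].
have bf1 : exists M, forall x : 'rV[R]_1, `|f (x 0 0)| <= M by exists M => x; exact: fM.
have := @chf_eq_Ex 1 g1 g2 _ _ (fun x => f (x 0 0)) cf1 bf1.
rewrite (h1 _ (borel_bmf cf1 bf1)).2 (h2 _ (borel_bmf cf1 bf1)).2.
have fE : (fun x : 'rV[R]_1 => f (x 0 0)) \o row = f by apply/funext => y; rewrite /= mxE.
rewrite fE; apply=> t.
  rewrite (h1 _ (bmf_dot_cos t)).2 (h2 _ (bmf_dot_cos t)).2 (_ : _ \o row = (fun y => cos (t 0 0 * y))); first exact: hc.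
  by apply/funext => y; rewrite /= dotE.
rewrite (h1 _ (bmf_dot_sin t)).2 (h2 _ (bmf_dot_sin t)).2 (_ : _ \o row = (fun y => sin (t 0 0 * y))); first exact: hs.
by apply/funext => y; rewrite /= dotE.
Qed.

Lemma bmf_scaled_cos (t : R) : bmf (fun y : measurableTypeR R => cos (t * y)).
Proof.
split; last by exists 1 => x; exact: cos_max.
by apply: continuous_measurable_fun; exact: continuous_scaled_cos.
Qed.

Lemma bmf_scaled_sin (t : R) : bmf (fun y : measurableTypeR R => sin (t * y)).
Proof.
split; last by exists 1 => x; exact: sin_max.
by apply: continuous_measurable_fun; exact: continuous_scaled_sin.
Qed.

Lemma centered_normal_law (v : R) : 0 <= v ->
  exists Q : probability (measurableTypeR R) R, [/\ forall B, Q B = centered_normal v B,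
    forall t : R, Ex Q (fun x => cos (t * x)) = expR (- (t ^+ 2 * v / 2)) &
    forall t : R, Ex Q (fun x => sin (t * x)) = 0].
Proof.
move=> v0; have [->|vn0] := eqVneq v 0.
  exists (dirac (0 : measurableTypeR R)); split=> [B|t|t].
  - by rewrite /centered_normal eqxx.
  - rewrite /Ex /Rintegral integral_dirac//; last first.
      by apply/measurable_EFinP; have [] := bmf_scaled_cos t.
    by rewrite diracT mul1e /= !mulr0 mul0r oppr0 expR0 cos0.
  - rewrite /Ex /Rintegral integral_dirac//; last first.
      by apply/measurable_EFinP; have [] := bmf_scaled_sin t.
    by rewrite diracT mul1e /= !mulr0 sin0.
have s0 : 0 < Num.sqrt v by rewrite sqrtr_gt0 lt0r vn0.
exists (normal_prob 0 (Num.sqrt v)); split=> [B|t|t].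
- by rewrite /centered_normal (negbTE vn0).
- by rewrite [LHS]normal_cos// sqr_sqrtr.
- exact: normal_sin.
Qed.

End ChfUniqueness.

(** * Construction of possibly degenerate Gaussian vectors *)

Section GaussianVectors.
Context (R : realType) (d : nat).
Implicit Types (t v x : 'rV[R]_d).

Lemma Ex_prod_meas d1 d2 (T1 : measurableType d1) (T2 : measurableType d2)
    (P1 : probability T1 R) (P2 : probability T2 R) (f : T1 -> R) (g : T2 -> R) :
  bmf f -> bmf g ->
  bmf (fun z : T1 * T2 => f z.1 * g z.2) /\
  Ex (P1 \x P2)%E (fun z => f z.1 * g z.2) = Ex P1 f * Ex P2 g.
Proof.
move=> bf bg.
have b : bmf (fun z : T1 * T2 => f z.1 * g z.2).
  case: bf bg => mf [M fM] [mg [N gN]]; split.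
    apply: measurable_funM; first exact: (measurableT_comp mf measurable_fst).
    exact: (measurableT_comp mg measurable_snd).
  by exists (M * N) => z; rewrite normrM ler_pM.
split=> //; rewrite /Ex /Rintegral -integral12_prod_meas1; last exact: bmf_integrable b.
rewrite /fubini_F /=.
have ig := bmf_integrable P2 bg; have if_ := bmf_integrable P1 bf.
have fg := integrable_fin_num measurableT ig.
have ff := integrable_fin_num measurableT if_.
under eq_integral => x _.
  under eq_integral do rewrite EFinM.
  rewrite integralZl// -(fineK fg) -EFinM.
  over.
under eq_integral do rewrite EFinM.
by rewrite integralZr//= -{1}(fineK ff) -EFinM.
Qed.

(** The law of a combination of the vectors with independent standard normal coefficients, built by
    adding one factor of a product measure at a time. *)
Lemma gaussian_of_vectors (vs : seq 'rV[R]_d) :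
  exists gamma : probability (borel 'rV[R]_d) R, forall t,
    Ex gamma (fun x => cos (dot t x)) = expR (- (\sum_(v <- vs) dot t v ^+ 2 / 2)) /\
    Ex gamma (fun x => sin (dot t x)) = 0.
Proof.
elim: vs => [|v vs [g IH]].
  exists (dirac (0 : borel 'rV[R]_d)) => t.
  have d0 : dot t 0 = 0 by rewrite /dot big1// => i _; rewrite mxE mulr0.
  split; rewrite /Ex /Rintegral integral_dirac ?diracT ?mul1e//= ?d0 ?cos0 ?sin0 ?big_nil ?oppr0 ?expR0//.
    by apply/measurable_EFinP; case: (bmf_dot_cos t).
  by apply/measurable_EFinP; case: (bmf_dot_sin t).
pose Np : probability (measurableTypeR R) R := normal_prob 0 1.
pose f (z : borel 'rV[R]_d * measurableTypeR R) : borel 'rV[R]_d := (z.1 : 'rV[R]_d) + (z.2 : R) *: v.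
have mf : measurable_fun setT f.
  apply: measurable_rV => i.
  rewrite (_ : (fun w => _) = (fun w => (w.1 : 'rV[R]_d) 0 i + (w.2 : R) * v 0 i)); last first.
    by apply/funext => w; rewrite !mxE.
  apply: measurable_funD.
    apply: (measurableT_comp (f := fun x : borel 'rV[R]_d => (x : 'rV[R]_d) 0 i)); last exact: measurable_fst.
    by apply: borel_measurable_continuous; exact: continuous_coord.
  by apply: measurable_funM => //; exact: measurable_snd.
have [g' [_ hg]] := pushforward_probability (g \x Np)%E mf.
exists g' => t.
have [_ c1] := hg _ (bmf_dot_cos t); have [_ s1] := hg _ (bmf_dot_sin t).
have dotE z : dot t (f z) = dot t z.1 + dot t v * z.2 by rewrite /dot /f mulr_suml -big_split /=; apply: eq_bigr => i _; rewrite !mxE; ring.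
have mN := bmf_scaled_cos (dot t v); have mN' := bmf_scaled_sin (dot t v).
have [b1 e1] := Ex_prod_meas g Np (bmf_dot_cos t) mN.
have [b2 e2] := Ex_prod_meas g Np (bmf_dot_sin t) mN'.
have [b3 e3] := Ex_prod_meas g Np (bmf_dot_sin t) mN.
have [b4 e4] := Ex_prod_meas g Np (bmf_dot_cos t) mN'.
have Nc : Ex Np (fun y => cos (dot t v * y)) = expR (- (dot t v ^+ 2 / 2)) by rewrite [LHS]normal_cos// expr1n mulr1.
have Ns : Ex Np (fun y => sin (dot t v * y)) = 0 by exact: normal_sin.
split.
  rewrite c1 (_ : _ \o f = (fun z => cos (dot t z.1) * cos (dot t v * z.2) - sin (dot t z.1) * sin (dot t v * z.2))); last first.
    by apply/funext => z; rewrite /= dotE cosD.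
  rewrite ExB// e1 e2 Nc Ns mulr0 subr0 (IH t).1 big_cons opprD expRD mulrC.
  by [].
rewrite s1 (_ : _ \o f = (fun z => sin (dot t z.1) * cos (dot t v * z.2) + cos (dot t z.1) * sin (dot t v * z.2))); last first.
  by apply/funext => z; rewrite /= dotE sinD.
by rewrite ExD// e3 e4 Ns mulr0 addr0 (IH t).2 mul0r.
Qed.

Definition qform (S : 'M[R]_d) t := (t *m S *m t^T) 0 0.

(** Completing squares. A nonzero diagonal entry [S i i] allows the rank-one form of [v] to be
    subtracted; the result is still nonnegative, its entry at [i] is zero, and diagonal zeros
    persist. When the diagonal is zero, nonnegativity forces the matrix to be zero. *)
Lemma psd_sum_squares (S : 'M[R]_d) : S^T = S -> (forall t, 0 <= qform S t) ->
  exists vs : seq 'rV[R]_d, forall t, qform S t = \sum_(v <- vs) dot t v ^+ 2.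
Proof.
pose B (S : 'M[R]_d) (x y : 'rV[R]_d) := (x *m S *m y^T) 0 0.
have BC S0 x y : S0^T = S0 -> B S0 x y = B S0 y x.
  move=> sS; rewrite /B -[in LHS]sS; have -> : (x *m S0^T *m y^T) = (y *m S0 *m x^T)^T.
    by rewrite !trmx_mul trmxK mulmxA.
  by rewrite mxE.
have qD S0 x y c : S0^T = S0 -> qform S0 (x + c *: y) = qform S0 x + 2 * c * B S0 x y + c ^+ 2 * qform S0 y.
  move=> sS; rewrite /qform linearD linearZ /= !mulmxDl !mulmxDr -!scalemxAl -!scalemxAr.
  have mD (A C : 'M[R]_1) : (A + C) 0 0 = A 0 0 + C 0 0 by rewrite mxE.
  have mZ a (A : 'M[R]_1) : (a *: A) 0 0 = a * A 0 0 by rewrite mxE.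
  rewrite !(mD, mZ).
  have := BC S0 x y sS; rewrite /B => h; rewrite -[(y *m S0 *m x^T) 0 0]h; ring.
have Bd S0 t j : B S0 t (delta_mx 0 j) = (t *m S0) 0 j by rewrite /B trmx_delta -colE mxE.
have qd S0 j : qform S0 (delta_mx 0 j) = S0 j j by rewrite -[LHS]/(B S0 _ _) Bd -rowE mxE.
have Bdd S0 i j : B S0 (delta_mx 0 i) (delta_mx 0 j) = S0 i j by rewrite Bd -rowE mxE.
have [n] := ubnP #|[pred i | S i i != 0]|; elim: n S => // n IH S + sS pS.
have [i Si|no] := pickP [pred i | S i i != 0]; last first.
  move=> _; exists [::] => t; rewrite big_nil.
  have S0 j : S j j = 0 by apply/eqP; have := no j; rewrite /= => /negbFE.
  suff -> : S = 0 by rewrite /qform mulmx0 mul0mx mxE.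
  apply/matrixP => j k; rewrite mxE.
  have h c : 0 <= 2 * c * S j k.
    have := pS (delta_mx 0 j + c *: delta_mx 0 k).
    by rewrite qD// !qd !S0 Bdd mulr0 addr0 add0r.
  by have := h 1; have := h (-1); lra.
have Si' : i \in [pred j | S j j != 0] by [].
rewrite (cardD1 i) Si' add1n ltnS => nS; rewrite /= in Si.
have Sp : 0 < S i i by rewrite lt0r Si -qd pS.
pose v := (Num.sqrt (S i i))^-1 *: row i S.
have s0 : Num.sqrt (S i i) != 0 by rewrite sqrtr_eq0 -ltNge.
have dv t : dot t v = (t *m S) 0 i / Num.sqrt (S i i).
  rewrite /dot mxE mulr_suml; apply: eq_bigr => k _.
  have sk : S i k = S k i by rewrite -[in LHS]sS mxE.
  by rewrite !mxE sk mulrA mulrAC.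
have dv2 t : dot t v ^+ 2 = ((t *m S) 0 i) ^+ 2 / S i i by rewrite dv expr_div_n sqr_sqrtr// ltW.
pose S' := S - v^T *m v.
have q' t : qform S' t = qform S t - dot t v ^+ 2.
  rewrite /qform mulmxBr mulmxBl mxE [in X in _ + X]mxE; congr (_ - _).
  have -> : t *m (v^T *m v) *m t^T = (t *m v^T) *m (t *m v^T)^T by rewrite trmx_mul trmxK !mulmxA.
  rewrite !mxE big_ord1 !mxE; have -> : \sum_j t 0 j * v^T j 0 = dot t v.
    by apply: eq_bigr => k _; rewrite mxE.
  by rewrite expr2.
have [|||vs hvs] := IH S'.
- apply: leq_ltn_trans nS; apply: subset_leq_card; apply/fintype.subsetP => j.
  rewrite !inE => Sj; apply/andP; split.
    apply: contraNneq Sj => ->; rewrite -qd q' dv2 -rowE qd mxE.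
    by rewrite expr2 mulrK ?subrr// unitfE.
  apply: contraNneq Sj => Sjj; rewrite -qd q' dv2 -rowE qd Sjj mxE.
  suff -> : S j i = 0 by rewrite expr0n mul0r subrr.
  have h c : 0 <= 2 * c * S j i + c ^+ 2 * S i i.
    have := pS (delta_mx 0 j + c *: delta_mx 0 i).
    by rewrite qD// !qd Sjj Bdd add0r.
  have := h (- (S j i / S i i)).
  rewrite (_ : _ + _ = - (S j i ^+ 2 / S i i)); last by field.
  rewrite oppr_ge0 pmulr_lle0 ?invr_gt0// => h1; apply/eqP; rewrite -sqrf_eq0 eq_le h1 sqr_ge0.
  by [].
- by rewrite /S' linearB /= trmx_mul trmxK sS.
- move=> t; rewrite q' dv2.
  have := pS (t + (- ((t *m S) 0 i / S i i)) *: delta_mx 0 i).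
  rewrite qD// qd Bd; rewrite (_ : _ + _ = qform S t - ((t *m S) 0 i) ^+ 2 / S i i)//.
  by field.
exists (v :: vs) => t; rewrite big_cons -hvs q'; ring.
Qed.

(** The law of each linear form is recognized by its characteristic function, with the Dirac mass
    covering forms of zero variance. *)
Lemma gaussian_exists (S : 'M[R]_d) : S^T = S -> (forall t, 0 <= qform S t) ->
  exists gamma : probability (borel 'rV[R]_d) R, is_gaussian gamma S /\ forall t,
    Ex gamma (fun x => cos (dot t x)) = expR (- (qform S t / 2)) /\
    Ex gamma (fun x => sin (dot t x)) = 0.
Proof.
move=> sS pS; have [vs hvs] := psd_sum_squares sS pS.
have [g hg] := gaussian_of_vectors vs.
have hg' t : Ex g (fun x => cos (dot t x)) = expR (- (qform S t / 2)) /\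
    Ex g (fun x => sin (dot t x)) = 0.
  by rewrite hvs mulr_suml.
exists g; split=> //; split=> // t /=; rewrite -/(qform S t); split=> // B mB.
have dotE (x : 'rV[R]_d) : (x *m t^T) 0 0 = dot t x by rewrite mxE; apply: eq_bigr => i _; rewrite mxE mulrC.
have mt : measurable_fun setT (fun x : borel 'rV[R]_d => (dot t x : measurableTypeR R)) by apply: borel_measurable_continuous; exact: continuous_dot.
have [Q [QB QE]] := pushforward_probability g mt.
have [N [NB Nc Ns]] := centered_normal_law (pS t).
have dotZ u x : dot (u *: t) x = u * dot t x by rewrite /dot mulr_sumr; apply: eq_bigr => i _; rewrite mxE mulrA.
have qZ u : qform S (u *: t) = u ^+ 2 * qform S t by rewrite /qform linearZ /= -!scalemxAl -scalemxAr !mxE; ring.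
transitivity (Q B); first by rewrite QB//; congr (g _); apply/funext => x /=; rewrite dotE.
rewrite -NB; apply: chf_unique1 => // u.
  rewrite (QE _ (bmf_scaled_cos u)).2 Nc -qZ -(hg' _).1; congr (Ex g _).
  by apply/funext => x /=; rewrite dotZ.
rewrite (QE _ (bmf_scaled_sin u)).2 Ns -(hg' (u *: t)).2; congr (Ex g _).
by apply/funext => x /=; rewrite dotZ.
Qed.

End GaussianVectors.

(** * Sequences decaying faster than any power *)

Section FastDecay.
Variable R : realType.
Implicit Types (e : nat -> R) (j m : nat).

Definition fastdec e := forall j, exists C : R, forall m, `|e m| * m.+1%:R ^+ j <= C.

Lemma fastdec_near e : (forall j, exists C : R, exists m0 : nat,
  forall m, (m0 <= m)%N -> `|e m| * m.+1%:R ^+ j <= C) -> fastdec e.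
Proof.
move=> h j; have [C [m0 hC]] := h j.
exists (`|C| + \sum_(m < m0) `|e m| * m.+1%:R ^+ j) => m.
have [m0m|mm0] := leqP m0 m.
  apply: le_trans (hC m m0m) _; apply: le_trans (ler_norm _) _.
  by rewrite lerDl; apply: sumr_ge0 => i _; rewrite mulr_ge0// exprn_ge0.
rewrite (bigD1 (Ordinal mm0)) //= addrCA lerDl addr_ge0//; apply: sumr_ge0 => i _.
by rewrite mulr_ge0// exprn_ge0.
Qed.

Lemma fastdec_tail e e' (m0 : nat) : fastdec e' ->
  (forall m, (m0 <= m)%N -> `|e m| <= `|e' m|) -> fastdec e.
Proof.
move=> h hle; apply: fastdec_near => j; have [C hC] := h j; exists C, m0 => m m0m.
by apply: le_trans (hC m); rewrite ler_wpM2r ?exprn_ge0// hle.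
Qed.

Lemma fastdecZ e (c : R) : fastdec e -> fastdec (fun m => c * e m).
Proof.
move=> h j; have [C hC] := h j; exists (`|c| * C) => m.
by rewrite normrM -mulrA ler_wpM2l.
Qed.

Lemma fastdecD e e' : fastdec e -> fastdec e' -> fastdec (fun m => e m + e' m).
Proof.
move=> h h' j; have [C hC] := h j; have [C' hC'] := h' j.
exists (C + C') => m; apply: le_trans (lerD (hC m) (hC' m)).
by rewrite -mulrDl ler_wpM2r ?exprn_ge0// ler_normD.
Qed.

Lemma fastdec_poly e (c : R) i : fastdec e -> fastdec (fun m => c * m.+1%:R ^+ i * e m).
Proof.
move=> h j; have [C hC] := h (i + j)%N; exists (`|c| * C) => m.
rewrite !normrM -!mulrA ler_wpM2l//; apply: le_trans (hC m).
by rewrite exprD normrX normr_nat mulrA [_ * `|e m|]mulrC -mulrA.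
Qed.

Lemma fastdec_bound e : fastdec e -> exists C : R, forall m, `|e m| <= C.
Proof. by move=> /(_ 0%N)[C hC]; exists C => m; have := hC m; rewrite expr0 mulr1. Qed.

Lemma fastdec_cvg0 e : fastdec e -> e m @[m --> \oo] --> 0.
Proof.
move=> /(_ 1%N)[C hC]; apply/cvgr0Pnorm_le => eps e0; near=> m.
have h := hC m; rewrite expr1 in h.
have m0 : 0 < m.+1%:R :> R by rewrite ltr0n.
rewrite -(ler_pM2r m0); apply: le_trans h _; rewrite -ler_pdivrMl//.
apply: le_trans (_ : m%:R <= _); last by rewrite ler_nat.
near: m; exact: nbhs_infty_ger.
Unshelve. all: by end_near. Qed.

Lemma fastdec_expR (K c : R) : 0 < c -> fastdec (fun m => K * expR (- (c * m%:R))).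
Proof.
move=> c0 j; exists (`|K| * (expR c * (j`!%:R / c ^+ j))) => m.
rewrite normrM -mulrA ler_wpM2l// ger0_norm ?expR_ge0//.
have f0 : 0 < j`!%:R :> R by rewrite ltr0n fact_gt0.
have h : (c * m.+1%:R) ^+ j / j`!%:R <= expR (c * m.+1%:R) by apply: exp_coeff_le_expR; rewrite mulr_ge0// ltW.
rewrite exprMn ler_pdivrMr// in h.
have -> : m.+1%:R ^+ j = (c ^+ j * m.+1%:R ^+ j) / c ^+ j :> R by rewrite mulrC mulKf// expf_neq0// lt0r_neq0.
rewrite mulrA [leRHS]mulrA ler_wpM2r ?invr_ge0 ?exprn_ge0 ?(ltW c0)//.
apply: le_trans (ler_wpM2l (expR_ge0 _) h) _.
by rewrite mulrA -expRD -natr1; rewrite [X in expR X](_ : _ = c)//; ring.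
Qed.

End FastDecay.

(** * Functionals of finitely many sites *)

Section LocalFunctionals.
Context (R : realType) (d : nat).
Implicit Types (f g : set (lattice d) -> R) (A B S : seq (lattice d)) (x : lattice d).

Definition local f A := forall mu nu : set (lattice d),
  (forall x, x \in A -> mu x <-> nu x) -> f mu = f nu.

Definition contains A (mu : set (lattice d)) : R := (`[< forall x, x \in A -> mu x >])%:R.

Lemma contains_eq A B : A =i B -> contains A = contains B.
Proof.
move=> AB; apply/funext => mu; congr (nat_of_bool _)%:R.
by apply: asbool_equiv_eq; split=> h x xA; apply: h; rewrite ?AB// -AB.
Qed.

Lemma contains_cons x A mu : contains (x :: A) mu = contains [:: x] mu * contains A mu.
Proof.
rewrite /contains -natrM mulnb; congr (nat_of_bool _)%:R.
apply/asboolP/andP => [h|[/asboolP h1 /asboolP h2] y].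
  split; apply/asboolP => y yA; apply: h; last by rewrite inE yA orbT.
  by move: yA; rewrite !inE => ->.
by rewrite inE => /orP[/eqP->|/h2//]; apply: h1; rewrite inE.
Qed.

Lemma contains_nil mu : contains [::] mu = 1.
Proof. by rewrite /contains asboolT. Qed.

Lemma contains_norm A mu : `|contains A mu| <= 1.
Proof. by rewrite /contains; case: asbool; rewrite ?normr1 ?normr0. Qed.

Lemma local_sub f A B : {subset A <= B} -> local f A -> local f B.
Proof. by move=> AB lf mu nu h; apply: lf => x /AB /h. Qed.

(** One step of the expansion of a local functional as a polynomial in occupation indicators. The
    clustering hypothesis speaks only of such indicators. *)
Lemma local_split f x mu :
  f mu = f (mu `\ x) + contains [:: x] mu * (f (x |` mu) - f (mu `\ x)).
Proof.
have [mx|mx] := pselect (mu x).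
  have -> : contains [:: x] mu = 1 by rewrite /contains asboolT// => y; rewrite inE => /eqP->.
  have -> : x |` mu = mu by apply/seteqP; split=> [y [->|]|y my]//; right.
  by rewrite mul1r addrCA subrr addr0.
have -> : contains [:: x] mu = 0 by rewrite /contains asboolF// => /(_ x); rewrite inE eqxx => /(_ isT).
rewrite mul0r addr0; congr f; apply/seteqP; split=> [y my|y []]//.
by split=> // yx; apply: mx; rewrite -yx.
Qed.

Lemma local_remove f x A : local f (x :: A) -> local (fun mu => f (mu `\ x)) A.
Proof.
move=> lf mu nu h; apply: lf => y; rewrite inE => /orP[/eqP->|/h hy].
  by split=> -[_ []].
by split=> -[/hy].
Qed.

Lemma local_add f x A : local f (x :: A) -> local (fun mu => f (x |` mu)) A.
Proof.
move=> lf mu nu h; apply: lf => y; rewrite inE => /orP[/eqP->|/h hy].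
  by split=> _; left.
by split=> -[->|/hy]; by [left|right].
Qed.

Lemma localM f g A B : local f A -> local g B -> local (fun mu => f mu * g mu) (A ++ B).
Proof.
move=> lf lg mu nu h; rewrite (lf mu nu) ?(lg mu nu)// => x xA; apply: h;
  by rewrite mem_cat xA ?orbT.
Qed.

Lemma localD f g A B : local f A -> local g B -> local (fun mu => f mu + g mu) (A ++ B).
Proof.
move=> lf lg mu nu h; rewrite (lf mu nu) ?(lg mu nu)// => x xA; apply: h;
  by rewrite mem_cat xA ?orbT.
Qed.

Lemma local_prod (I : finType) (D : {pred I}) (F : I -> set (lattice d) -> R) (B : I -> seq (lattice d)) :
  (forall i, local (F i) (B i)) ->
  local (fun mu => \prod_(i in D) F i mu) (flatten [seq B i | i in D]).
Proof.
move=> lF mu nu h; apply: eq_bigr => i iD; apply: lF => x xB; apply: h.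
by apply/flattenP; exists (B i) => //; apply: map_f; rewrite mem_enum.
Qed.

End LocalFunctionals.
Arguments contains {R d} A mu.

(** * Decorrelation of local functionals *)

Section Mixing.
Context (R : realType) (dT : measure_display) (T : measurableType dT).
Context (P : probability T R) (d : nat) (X : {RV P >-> config d}).
Implicit Types (f g : set (lattice d) -> R) (A B S : seq (lattice d)) (x : lattice d).

Lemma measurable_site x : measurable [set w | X w x].
Proof.
have : measurable (X @^-1` [set mu : config d | mu x]).
  rewrite -[X in measurable X]setTI; apply: measurable_funP => //.
  by apply: sub_sigma_algebra; exists x.
by [].
Qed.

Lemma bmf_contains A : bmf (fun w => contains A (X w) : R).
Proof.
elim: A => [|x A IH].
  rewrite (_ : (fun _ => _) = cst 1); first exact: bmf_cst.
  by apply/funext => w; rewrite contains_nil.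
rewrite (_ : (fun _ => _) = (fun w => \1_[set w | X w x] w * contains A (X w))).
  by apply: bmfM IH; apply: bmf_indic; exact: measurable_site.
apply/funext => w; rewrite contains_cons; congr (_ * _); rewrite indicE /contains.
congr (nat_of_bool _)%:R; apply/asboolP/idP => [h|/set_mem h y].
  by rewrite inE; apply: h; rewrite inE.
by rewrite inE => /eqP->.
Qed.

Lemma local_bmf f A : local f A -> bmf (fun w => f (X w)).
Proof.
elim: A f => [|x A IH] f lf.
  rewrite (_ : (fun _ => _) = cst (f set0)); first exact: bmf_cst.
  by apply/funext => w; apply: lf.
rewrite (_ : (fun _ => _) = (fun w => f (X w `\ x) + contains [:: x] (X w) * (f (x |` X w) - f (X w `\ x)))); last first.
  by apply/funext => w; rewrite -local_split.
have b0 := IH _ (local_remove lf); have b1 := IH _ (local_add lf).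
exact: (bmfD b0 (bmfM (bmf_contains _) (bmfB b1 b0))).
Qed.

Lemma Ex_contains A : Ex P (fun w => contains A (X w)) = prob_contains P X A.
Proof.
rewrite /prob_contains -Ex_indic; last first.
  rewrite (_ : [set w | _] = \big[setI/setT]_(x <- A) [set w | X w x]).
    by apply: bigsetI_measurable => x _; exact: measurable_site.
  by rewrite -bigcap_seq; apply/seteqP; split=> w h x /h.
by congr (Ex P _); apply/funext => w; rewrite indicE; congr (nat_of_bool _)%:R.
Qed.

(** Removing a site splits the functional into one bounded by [M] and one bounded by [2 * M]
    multiplied by an indicator. The bounds add up to three times [M], whence the power of 3. [B]
    collects the sites already turned into indicators. *)
Lemma cv_local_bound A f B (M E : R) (h : T -> R) : bmf h -> 0 <= M -> 0 <= E ->
  local f A -> (forall mu, `|f mu| <= M) ->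
  (forall S, {subset S <= A} -> `|cv P (fun w => contains (S ++ B) (X w)) h| <= E) ->
  `|cv P (fun w => f (X w) * contains B (X w)) h| <= 3 ^+ size A * M * E.
Proof.
move=> bh M0 E0; elim: A f B M M0 => [|x A IH] f B M M0 lf fM hS.
  rewrite (_ : (fun w => _) = (fun w => f set0 * contains B (X w))); last first.
    by apply/funext => w; rewrite (lf _ set0).
  rewrite cvZl//; last exact: bmf_contains.
  rewrite expr0 mul1r normrM; apply: ler_pM => //.
  exact: (hS [::]).
have lr := local_remove lf; have la := local_add lf.
have b0 := local_bmf lr; have b1 := local_bmf la.
have h1 : `|cv P (fun w => f (X w `\ x) * contains B (X w)) h| <= 3 ^+ size A * M * E.
  apply: (IH (fun mu => f (mu `\ x))) => // S SA; apply: hS => y yS; by rewrite inE SA ?orbT.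
have h2 : `|cv P (fun w => (f (x |` X w) - f (X w `\ x)) * contains (x :: B) (X w)) h| <= 3 ^+ size A * (M + M) * E.
  apply: (IH (fun mu => f (x |` mu) - f (mu `\ x))); first by rewrite addr_ge0.
  - have := localD la (localM (A := [::]) (f := fun=> -1) _ lr); rewrite /= => hl.
    have {}hl := hl (fun _ _ _ => erefl) => mu nu hm.
    have := hl mu nu; rewrite !mulN1r; apply=> y; rewrite mem_cat => /orP[]; exact: hm.
  - by move=> mu; apply: le_trans (ler_normB _ _) _; apply: lerD; exact: fM.
  - move=> S SA; rewrite (@contains_eq R d _ ((x :: S) ++ B)).
      by apply: hS => y; rewrite !inE => /orP[->//|/SA ->]; rewrite orbT.
    by move=> y; rewrite !(mem_cat, inE) orbCA orbA.
rewrite (_ : (fun w => _) = (fun w => f (X w `\ x) * contains B (X w) +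
    (f (x |` X w) - f (X w `\ x)) * contains (x :: B) (X w))); last first.
  by apply/funext => w; rewrite (local_split f x (X w)) [contains (x :: B) _]contains_cons; ring.
rewrite cvDl//; first last.
- exact: (bmfM (bmfB b1 b0) (bmf_contains _)).
- exact: (bmfM b0 (bmf_contains _)).
apply: le_trans (ler_normD _ _) _; apply: le_trans (lerD h1 h2) _.
by rewrite exprS le_eqVlt; apply/orP; left; apply/eqP; ring.
Qed.

Section Rate.
Variables (C c : nat -> R) (phi : R -> R) (c0 : R).
Hypotheses (C0 : forall k, 0 < C k) (C_mono : {homo C : k l / (k <= l)%N >-> k <= l}).
Hypotheses (phi0 : forall s, 0 <= s -> 0 <= phi s <= 1)
  (phi_mono : forall s t, 0 <= s -> s <= t -> phi t <= phi s).
Hypotheses (clus : clustering P X C c phi) (c0_gt0 : 0 < c0) (c0c : forall k, c0 <= c k).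

Let phi_ge0 s : 0 <= phi (c0 * s%:R).
Proof. by have /andP[] := phi0 (mulr_ge0 (ltW c0_gt0) (ler0n R s)). Qed.

Lemma seq_dist_ge A B s : A != [::] -> B != [::] ->
  (forall a b, a \in A -> b \in B -> (s <= l1norm (a - b))%N) -> (s <= seq_dist A B)%N.
Proof.
move=> A0 B0 h; rewrite /seq_dist; set D := [seq l1norm (a - b) | a <- A, b <- B].
have hD : forall t, t \in D -> (s <= t)%N by move=> t /allpairsP[[a b] [/= aA bB ->]]; exact: h.
have : head 0%N D \in D.
  rewrite /D; case: A A0 {h hD D} => // a A _; case: B B0 => // b B _.
  by rewrite /= inE eqxx.
move: (head _ _) => t0 /hD h0; rewrite big_seq.
by elim/big_ind: _ => //; first by move=> x y sx sy; rewrite leq_min sx.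
Qed.

(** Clustering is stated for nonempty lists of distinct points. Repetitions are removed, positive
    distance makes the lists disjoint, and an empty list has a constant indicator and so zero
    covariance. *)
Lemma contains_mixing A B N s : (0 < s)%N -> (size A + size B <= N)%N ->
  (forall a b, a \in A -> b \in B -> (s <= l1norm (a - b))%N) ->
  `|cv P (fun w => contains A (X w)) (fun w => contains B (X w))| <= C N * phi (c0 * s%:R).
Proof.
move=> s0 AN h.
have rhs0 : 0 <= C N * phi (c0 * s%:R) by apply: mulr_ge0 => //; exact: ltW.
rewrite (@contains_eq R d A (undup A)); last by move=> x; rewrite mem_undup.
rewrite (@contains_eq R d B (undup B)); last by move=> x; rewrite mem_undup.
have [A0|A0] := eqVneq (undup A) [::].
  rewrite A0 (_ : (fun w => contains [::] _) = cst 1); last by apply/funext => w; rewrite contains_nil.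
  by rewrite cv_cst ?normr0//; exact: bmf_contains.
have [B0|B0] := eqVneq (undup B) [::].
  rewrite B0 (_ : (fun w => contains [::] _) = cst 1); last by apply/funext => w; rewrite contains_nil.
  by rewrite cvC cv_cst ?normr0//; exact: bmf_contains.
have uAB : uniq (undup A ++ undup B).
  rewrite cat_uniq !undup_uniq andbT /=; apply/hasPn => x; rewrite /= !mem_undup => xB.
  apply/negP => xA; have := h x x xA xB; rewrite subrr.
  by rewrite /l1norm big1 ?leqn0 ?(gtn_eqF s0)// => i _; rewrite mxE absz0.
have := clus A0 B0 uAB; rewrite /= -!Ex_contains => hc.
have -> : cv P (fun w => contains (undup A) (X w)) (fun w => contains (undup B) (X w)) =
    Ex P (fun w => contains (undup A ++ undup B) (X w)) -
    Ex P (fun w => contains (undup A) (X w)) * Ex P (fun w => contains (undup B) (X w)).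
  congr (_ - _); congr (Ex P _); apply/funext => w.
  elim: (undup A) => [|x S IH]; first by rewrite contains_nil mul1r.
  by rewrite /= contains_cons -mulrA IH -contains_cons.
apply: le_trans hc _; set k := (_ + _)%N.
have kN : (k <= N)%N by apply: leq_trans AN; rewrite leq_add ?size_undup.
have p0 : 0 <= phi (c k * (seq_dist (undup A) (undup B))%:R).
  have ck := lt_le_trans c0_gt0 (c0c k).
  by have /andP[] := phi0 (mulr_ge0 (ltW ck) (ler0n R (seq_dist (undup A) (undup B)))).
apply: ler_pM => //; [exact: ltW|exact: C_mono|].
apply: phi_mono; first by rewrite mulr_ge0// ltW.
apply: ler_pM => //; first exact: ltW.
rewrite ler_nat; apply: seq_dist_ge => // a b; rewrite !mem_undup; exact: h.
Qed.

Lemma local_mixing A B f g (M1 M2 : R) N s : (0 < s)%N -> (size A + size B <= N)%N ->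
  (forall a b, a \in A -> b \in B -> (s <= l1norm (a - b))%N) ->
  local f A -> local g B -> (forall mu, `|f mu| <= M1) -> (forall mu, `|g mu| <= M2) ->
  `|cv P (fun w => f (X w)) (fun w => g (X w))| <= 3 ^+ N * M1 * M2 * (C (N + N)%N * phi (c0 * s%:R)).
Proof.
move=> s0 ABN h lf lg fM gM.
have M1_0 : 0 <= M1 by apply: le_trans (fM set0).
have M2_0 : 0 <= M2 by apply: le_trans (gM set0).
set E := C (N + N)%N * _.
have E0 : 0 <= E by apply: mulr_ge0 => //; exact: ltW.
have bf := local_bmf lf; have bg := local_bmf lg.
have cB0 (k : T -> R) : (fun w => k w * contains [::] (X w)) = k by apply/funext => w; rewrite contains_nil mulr1.
have step S : {subset S <= A} ->
    `|cv P (fun w => contains S (X w)) (fun w => g (X w))| <= 3 ^+ size B * M2 * E.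
  move=> SA; rewrite cvC -(cB0 (fun w => g (X w))).
  apply: cv_local_bound => //; first exact: bmf_contains.
  move=> S' S'B; rewrite cats0 cvC.
  rewrite (@contains_eq R d S (undup S)); last by move=> x; rewrite mem_undup.
  rewrite (@contains_eq R d S' (undup S')); last by move=> x; rewrite mem_undup.
  have SA' : {subset undup S <= A} by move=> x; rewrite mem_undup => /SA.
  have SB' : {subset undup S' <= B} by move=> x; rewrite mem_undup => /S'B.
  apply: contains_mixing => //.
    have s1 := uniq_leq_size (undup_uniq S) SA'; have s2 := uniq_leq_size (undup_uniq S') SB'.
    by apply: leq_trans (leq_add s1 s2) _; rewrite (leq_trans ABN)// leq_addr.
  by move=> a b aS bS; apply: h; [exact: SA'|exact: SB'].
rewrite -(cB0 (fun w => f (X w))).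
have G0 : 0 <= 3 ^+ size B * M2 * E by apply: mulr_ge0 => //; apply: mulr_ge0 => //; exact: exprn_ge0.
apply: le_trans (cv_local_bound bg M1_0 G0 lf fM _) _.
  by move=> S SA; rewrite cats0; exact: step.
clear step G0; move: E E0 => E E0.
have e1 : 3 ^+ size A * M1 * (3 ^+ size B * M2 * E) = 3 ^+ (size A + size B) * (M1 * M2 * E) by rewrite exprD; ring.
have e2 : 3 ^+ N * M1 * M2 * E = 3 ^+ N * (M1 * M2 * E) by ring.
rewrite e1 e2; apply: ler_wpM2r; last by rewrite ler_weXn2l// ler1n.
by apply: mulr_ge0 => //; exact: mulr_ge0.
Qed.

End Rate.

(** A negative upper limit means that some neighbourhood of infinity has a negative supremum [r];
    its opposite is the rate. Where [phi] vanishes, [lne] is minus infinity and the bound is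
    trivial. *)
Lemma stretched_exponential_bound (phi : R -> R) (b : R) :
  (limf_esup (fun t => lne (phi t)%:E * ((t `^ b)^-1)%:E) (pinfty_nbhs R) < 0)%E ->
  exists2 delta : R, 0 < delta & exists t0 : R, forall t, t0 <= t ->
    phi t <= expR (- (delta * t `^ b)).
Proof.
move=> /ereal_inf_lt[_ [V VF <-]] supV.
have [r [r0 hr]] : exists r : R, r < 0 /\ (ereal_sup ((fun t => lne (phi t)%:E * ((t `^ b)^-1)%:E) @` V) <= r%:E)%E.
  move: supV; case: (ereal_sup _) => [r| |]//; first by rewrite lte_fin => r0; exists r.
  by move=> _; exists (-1); split; rewrite ?ltrN10// leNye.
exists (- r); first by rewrite oppr_gt0.
have [M [_ hM]] := VF; exists (Num.max M 0 + 1) => t tM.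
have Mt : M < t by apply: lt_le_trans tM; apply: (@le_lt_trans _ _ (Num.max M 0)); rewrite ?le_max ?lexx ?ltrDl.
have t0 : 0 < t by apply: lt_le_trans tM; rewrite ltr_wpDl// le_max lexx orbT.
have pt := powR_gt0 b t0.
rewrite mulNr opprK.
have := ereal_sup_ubound (ex_intro2 _ _ t (hM t Mt) erefl) : (_ <= ereal_sup ((fun t => lne (phi t)%:E * ((t `^ b)^-1)%:E) @` V))%E.
move=> /le_trans/(_ hr); rewrite /lne; case: ifP => [p0 _|/negbT].
  by apply: le_trans p0 _; exact: expR_ge0.
rewrite -ltNge => p0; rewrite -EFinM lee_fin ler_pdivrMr// => h.
by rewrite -[phi t]lnK ?posrE// ler_expR.
Qed.

(* Boxes of radius m are to be separated by a polynomial distance m ^ q. *)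
Definition mixing q := forall k : nat, exists e : nat -> R,
  [/\ fastdec e, forall m, 0 <= e m &
   forall m A B f g (M1 M2 : R), (0 < m)%N -> (size A + size B <= k * (2 * m).+1 ^ d)%N ->
    (forall a b, a \in A -> b \in B -> (m ^ q <= l1norm (a - b))%N) ->
    local f A -> local g B -> (forall mu, `|f mu| <= M1) -> (forall mu, `|g mu| <= M2) ->
    `|cv P (fun w => f (X w)) (fun w => g (X w))| <= M1 * M2 * e m].

(** A box of radius [m] has about [m^d] sites, so the expansion and the constants [C] cost at most
    an exponential of order [m^(2d)]. Separating boxes by [m^q] gains an exponential of order
    [m^(qb)], which wins once [q b >= 2d + 1]. *)
Lemma exponential_mixing : (0 < d)%N -> exponentially_clustering P X ->
  exists2 q : nat, (0 < q)%N & mixing q.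
Proof.
move=> d0 [_ _ [C [c [phi [[Cc0 C_mono _] [[phi0 phi_mono _] clus] [c0 c0_gt0 c0c] [a /andP[a0 a1] CO] [b b0 hphi]]]]]].
have C0 k : 0 < C k := (Cc0 k).1.
have [delta delta0 [t0 hdelta]] := stretched_exponential_bound hphi.
have [K K0 [k0 _ hK]] : exists2 K, 0 < K & \forall k \near \oo, `|C k| <= K * `|k%:R `^ (a * k%:R) : R| by have /eqO_exP[K K0 hK] := CO; exists K.
pose q := (Num.truncn (((2 * d).+1)%:R / b)).+1.
have qb : (2 * d).+1%:R <= q%:R * b by rewrite -ler_pdivrMr//; apply: ltW; exact: truncnS_gt.
exists q => // k.
pose N m := (k * (2 * m).+1 ^ d)%N.
pose e m := 3 ^+ N m * (C (N m + N m)%N * phi (c0 * (m ^ q)%:R)).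
have phi_ge0 m : 0 <= phi (c0 * (m ^ q)%:R) by have /andP[] := phi0 _ (mulr_ge0 (ltW c0_gt0) (ler0n R (m ^ q))).
have e0 m : 0 <= e m by rewrite !mulr_ge0 ?exprn_ge0 ?(ltW (C0 _)).
exists e; split=> [|//|m A B f g M1 M2 m0 AB sep lf lg fM gM]; last first.
  have := local_mixing C0 C_mono phi0 phi_mono clus c0_gt0 c0c (_ : (0 < m ^ q)%N) AB sep lf lg fM gM.
  rewrite expn_gt0 m0 => /(_ isT) h; apply: le_trans h _.
  by rewrite /e -/(N m) le_eqVlt; apply/orP; left; apply/eqP; ring.
pose kap : nat := (2 * k.+1 * 3 ^ d)%N.
pose del := delta * c0 `^ b.
have del0 : 0 < del by rewrite mulr_gt0// powR_gt0.
pose m1 := (Num.truncn (((kap + kap ^ 2).+1)%:R / del)).+1.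
pose m2 := (Num.truncn (`|t0| / c0)).+1.
apply: (@fastdec_tail _ _ (fun m => K * expR (- (1 * m%:R))) (maxn k0 (maxn m1 m2)).+1).
  by apply: fastdec_expR.
move=> m; rewrite gtn_max gtn_max => /and3P[mk0 mm1 mm2].
have m0 : (0 < m)%N by apply: leq_ltn_trans mk0.
rewrite (ger0_norm (e0 m)) ger0_norm; last by rewrite mulr_ge0 ?expR_ge0// ltW.
pose M' := (kap * m ^ d)%N.
have NM : (N m + N m <= M')%N.
  rewrite addnn -mul2n /N /M' /kap -!mulnA leq_mul2l /= leq_mul//.
  by rewrite -expnMn leq_exp2r// (mulSn 2 m) -addn1 addnC leq_add2r.
have M'1 : (0 < M')%N by rewrite !muln_gt0 !expn_gt0 m0.
have M'k : (k0 <= M')%N.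
  apply: leq_trans (ltnW mk0) _; apply: (@leq_trans (m ^ d)).
    by rewrite -{1}[m]expn1 leq_pexp2l.
  by rewrite leq_pmull// !muln_gt0 expn_gt0.
have h3 : (3 : R) ^+ N m <= expR M'%:R.
  apply: (@le_trans _ _ (expR 2 ^+ N m)).
    by rewrite lerXn2r ?nnegrE ?expR_ge0//; apply: le_trans (expR_ge1Dx 2); rewrite -natr1; lra.
  by rewrite -expRM_natr ler_expR -natrM ler_nat mul2n -addnn.
(* The growth [k^(ak)] is bounded by [k^k], hence by [exp(k^2)], here with [k] equal to [M']. *)
have hC : C (N m + N m)%N <= K * expR (M' * M')%:R.
  apply: le_trans (C_mono _ _ NM) _.
  have := hK M' M'k; rewrite /= (ger0_norm (ltW (C0 _))) => /le_trans; apply.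
  rewrite ler_wpM2l ?(ltW K0)// ger0_norm ?powR_ge0//.
  have M1 : 1 <= M'%:R :> R by rewrite ler1n.
  apply: (@le_trans _ _ (M'%:R `^ M'%:R)).
    by apply: ler_powR => //; rewrite ler_piMl// ltW.
  rewrite powR_mulrn// natrM expRM_natr lerXn2r ?nnegrE ?expR_ge0//.
  by apply: le_trans (expR_ge1Dx _); rewrite lerDr.
have hm : 1 <= m%:R :> R by rewrite ler1n.
have hp : phi (c0 * (m ^ q)%:R) <= expR (- (del * m%:R ^+ (2 * d).+1)).
  have mq : m%:R <= (m ^ q)%:R :> R by rewrite ler_nat -{1}[m]expn1 leq_pexp2l.
  apply: le_trans (hdelta _ _) _.
    apply: le_trans (ler_norm _) _; rewrite mulrC -ler_pdivrMr//; apply: le_trans mq.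
    by apply: le_trans (ltW (truncnS_gt _)) _; rewrite ler_nat ltnW.
  rewrite ler_expR lerN2 /del -mulrA ler_wpM2l ?(ltW delta0)//.
  rewrite powRM ?(ltW c0_gt0)// ler_wpM2l ?powR_ge0// natrX -powR_mulrn//.
  by rewrite -[X in _ <= X `^ b]powR_mulrn// -powRrM; exact: ler_powR.
apply: (@le_trans _ _ (expR M'%:R * (K * expR (M' * M')%:R * expR (- (del * m%:R ^+ (2 * d).+1))))).
  apply: ler_pM => //; rewrite ?exprn_ge0 ?mulr_ge0 ?(ltW (C0 _))//.
  by apply: ler_pM => //; exact: ltW.
rewrite mulrA mulrCA -!mulrA ler_wpM2l ?(ltW K0)// -!expRD ler_expR mul1r.
have h1 : (kap + kap ^ 2).+1%:R <= del * m%:R.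
  rewrite mulrC -ler_pdivrMr//; apply: le_trans (ltW (truncnS_gt _)) _.
  by rewrite ler_nat ltnW.
have hmd : (M' + M' * M' + m <= (kap + kap ^ 2).+1 * m ^ (2 * d))%N.
  have md : (m ^ d <= m ^ (2 * d))%N by rewrite leq_pexp2l// leq_pmull.
  have m1d : (m <= m ^ (2 * d))%N by rewrite -{1}[m]expn1 leq_pexp2l// muln_gt0.
  have -> : (M' * M' = kap ^ 2 * m ^ (2 * d))%N by rewrite /M' mulnACA -expnD addnn -mul2n expnS expn1.
  rewrite -[(kap + _).+1]addn1 mulnDl [((kap + _) * _)%N]mulnDl mul1n; apply: leq_add => //.
  by rewrite leq_add2r /M' leq_mul2l md orbT.
have : (M' + M' * M' + m)%:R <= del * m%:R ^+ (2 * d).+1 :> R.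
  rewrite exprS mulrA; apply: (@le_trans _ _ ((kap + kap ^ 2).+1%:R * m%:R ^+ (2 * d))).
    by rewrite -natrX -natrM ler_nat.
  by rewrite ler_wpM2r ?exprn_ge0.
rewrite [delta * _]mulrA -/del !natrD; move: (del * _) (M'%:R) ((M' * M')%:R) => x y z; lra.
Qed.

End Mixing.

Lemma sum_const_seq (R : pzRingType) (I : Type) (s : seq I) (c : R) :
  \sum_(x <- s) c = (size s)%:R * c.
Proof. by rewrite big_const_seq count_predT iter_addr addr0 mulr_natl. Qed.

(** * Counting lattice points *)

Section LatticeCounting.
Variable d : nat.
Implicit Types (x y z : lattice d).

Lemma l1normD x y : (l1norm (x + y) <= l1norm x + l1norm y)%N.
Proof.
have absD (a b : int) : (`|(a + b)%R| <= `|a| + `|b|)%N by lia.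
by rewrite /l1norm -big_split /=; apply: leq_sum => i _; rewrite mxE absD.
Qed.

Lemma l1normN x : l1norm (- x) = l1norm x.
Proof. by apply: eq_bigr => i _; rewrite mxE abszN. Qed.

Lemma l1normB x y : l1norm (x - y) = l1norm (y - x).
Proof. by rewrite -l1normN opprB. Qed.

Lemma l1norm0 : l1norm (0 : lattice d) = 0%N.
Proof. by apply: big1 => i _; rewrite mxE. Qed.

Lemma l1norm_triangle x y z : (l1norm (x - z) <= l1norm (x - y) + l1norm (y - z))%N.
Proof. by apply: leq_trans (l1normD _ _); rewrite addrA subrK. Qed.

Lemma coord_le_l1norm x i : (`|x 0%R i| <= l1norm x)%N.
Proof. by rewrite /l1norm (bigD1 i) //= leq_addr. Qed.

Lemma l1norm_le_sup x m : (forall i, `|x 0%R i| <= m)%N -> (l1norm x <= d * m)%N.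
Proof.
move=> h; rewrite /l1norm -[X in (_ <= X * _)%N]card_ord -sum_nat_const.
by apply: leq_sum => i _.
Qed.

Definition supbox x m : seq (lattice d) :=
  [seq x + \row_i ((f i : nat)%:Z - m%:Z) | f : {ffun 'I_d -> 'I_(2 * m).+1}].

Lemma size_supbox x m : size (supbox x m) = ((2 * m).+1 ^ d)%N.
Proof. by rewrite size_image card_ffun !card_ord. Qed.

Lemma mem_supbox x m y : (y \in supbox x m) = [forall i, (`|y 0%R i - x 0%R i| <= m)%N].
Proof.
rewrite /supbox; apply/mapP/forallP => [[f _ -> i]|h].
  have aux (a : int) (k : nat) : (k < (2 * m).+1)%N -> (`|((a + (k%:Z - m%:Z)) - a)%R| <= m)%N by lia.
  by rewrite !mxE; apply: aux.
have hi i : (`|(y 0%R i - x 0%R i + m%:Z)%R| < (2 * m).+1)%N by rewrite ltnS; have := h i; lia.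
exists [ffun i => Ordinal (hi i)]; first by rewrite mem_enum.
apply/rowP => i; rewrite !mxE ffunE /=.
have := h i; lia.
Qed.

Lemma supboxP x m y : reflect (forall i, (`|y 0%R i - x 0%R i| <= m)%N) (y \in supbox x m).
Proof. by rewrite mem_supbox; exact: forallP. Qed.

Lemma uniq_supbox x m : uniq (supbox x m).
Proof.
rewrite map_inj_uniq ?enum_uniq// => f g /addrI/rowP fg.
apply/ffunP => i; apply/val_inj; have := fg i; rewrite !mxE => /addIr [].
by [].
Qed.

Lemma finite_window n : finite_set (window d n).
Proof.
apply: (@sub_finite_set _ _ [set` supbox 0 n]); last exact: finite_seq.
move=> y yn /=; apply/supboxP => i; rewrite mxE subr0.
exact: leq_trans (coord_le_l1norm y i) yn.
Qed.

Definition wfs n : {fset lattice d} := fset_set (window d n).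

Lemma in_wfs n x : (x \in wfs n) = (l1norm x <= n)%N.
Proof. by apply/idP/idP; rewrite in_fset_set ?inE//; exact: finite_window. Qed.

Lemma wfs_gt0 n : (0 < #|` wfs n|)%N.
Proof. by rewrite cardfs_gt0; apply/fset0Pn; exists 0; rewrite in_wfs l1norm0. Qed.

Lemma card_fset_sub_seq (A : {fset lattice d}) (s : seq (lattice d)) :
  {subset A <= s} -> (#|` A| <= size s)%N.
Proof. by move=> As; apply: uniq_leq_size => //; exact: fset_uniq. Qed.

Lemma wfs_card_le n : (#|` wfs n| <= (2 * n).+1 ^ d)%N.
Proof.
rewrite -(size_supbox 0); apply: card_fset_sub_seq => x; rewrite in_wfs => xn.
by apply/supboxP => i; rewrite mxE subr0 (leq_trans (coord_le_l1norm x i)).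
Qed.

Lemma wfs_card_leR (R : numDomainType) n : #|` wfs n|%:R <= 2 ^+ d * n.+1%:R ^+ d :> R.
Proof.
rewrite -exprMn -natrM -natrX ler_nat; apply: leq_trans (wfs_card_le n) _.
by case: (d) => // d'; rewrite leq_exp2r//; lia.
Qed.

Hypothesis d0 : (0 < d)%N.

Lemma wfs_card_ge n : ((n %/ d).+1 ^ d <= #|` wfs n|)%N.
Proof.
apply: (@leq_trans ((2 * (n %/ d)).+1 ^ d)%N); first by rewrite leq_exp2r// ltnS leq_pmull.
rewrite -(size_supbox 0); apply: uniq_leq_size => [|x /supboxP xb]; first exact: uniq_supbox.
rewrite in_wfs; apply: leq_trans (l1norm_le_sup (m := n %/ d) _) _.
  by move=> i; have := xb i; rewrite mxE subr0.
by rewrite mulnC leq_trunc_div.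
Qed.

Lemma wfs_card_gtn n : (n < #|` wfs n|)%N.
Proof.
pose i0 := Ordinal d0.
rewrite -(size_iota 0 n.+1) -(size_map (fun k : nat => k%:Z *: delta_mx 0 i0 : lattice d)).
apply: uniq_leq_size.
  rewrite map_inj_uniq ?iota_uniq// => a b /rowP/(_ i0).
  by rewrite !mxE !eqxx !mulr1 => -[].
move=> x /mapP[k]; rewrite mem_iota add0n ltnS => /andP[_ kn] ->.
rewrite in_wfs /l1norm (bigD1 i0) //= big1 ?addn0 => [|i ii0].
  by rewrite !mxE !eqxx mulr1.
by rewrite !mxE (negbTE ii0) andbF mulr0.
Qed.

(** A point of given norm is determined by all coordinates but one together with the sign of the
    missing one. *)
Lemma sphere_card j : (#|` [fset x in wfs j | l1norm x == j]%fset| <= 2 * (2 * j).+1 ^ d.-1)%N.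
Proof.
pose i0 := Ordinal d0.
pose code (x : lattice d) : bool * seq int := (0 <= x 0%R i0, [seq x 0%R i | i <- enum 'I_d & i != i0]).
pose idx := [seq i <- enum 'I_d | i != i0].
have szi : size idx = d.-1.
  have := count_predC (pred1 i0) (enum 'I_d); rewrite size_enum_ord count_uniq_mem ?enum_uniq//.
  rewrite mem_enum => /(congr1 predn) <-; rewrite /idx size_filter add1n /=.
  exact: eq_count.
pose dec (bf : bool * {ffun 'I_(d.-1) -> 'I_(2 * j).+1}) : bool * seq int :=
  (bf.1, [seq (bf.2 i : nat)%:Z - j%:Z | i <- enum 'I_(d.-1)]).
have inj : {in [fset x in wfs j | l1norm x == j]%fset &, injective code}.
  move=> x y; rewrite !inE /= => /andP[_ /eqP xj] /andP[_ /eqP yj] [sg /eq_in_map e].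
  have ei i : i != i0 -> x 0%R i = y 0%R i by move=> ii; apply: e; rewrite mem_filter ii mem_enum.
  apply/rowP => i; have [->|/ei//] := eqVneq i i0.
  have : (`|x 0%R i0| = `|y 0%R i0|)%N.
    apply/eqP; move: (xj); rewrite -yj /l1norm (bigD1 i0)//= [in RHS](bigD1 i0)//=.
    rewrite (eq_bigr (fun i => `|y 0%R i|%N)); first by move/addIn => ->.
    by move=> k /ei ->.
  by move: (x 0%R i0) (y 0%R i0) sg => a b; lia.
have -> : #|` [fset x in wfs j | l1norm x == j]%fset| = size [seq code x | x <- [fset x in wfs j | l1norm x == j]%fset] by rewrite size_map.
have -> : (2 * (2 * j).+1 ^ d.-1)%N = size [seq dec bf | bf : (bool * {ffun 'I_(d.-1) -> 'I_(2 * j).+1})] by rewrite size_image card_prod card_bool card_ffun !card_ord.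
apply: uniq_leq_size; first by rewrite map_inj_in_uniq ?fset_uniq.
move=> c /mapP[x]; rewrite !inE /= in_wfs => /andP[xj _] ->.
have hx (k : 'I_(d.-1)) : (`|(x 0%R (nth i0 idx k) + j%:Z)%R| < (2 * j).+1)%N by have := leq_trans (coord_le_l1norm x (nth i0 idx k)) xj; move: (x 0%R _) => v; lia.
apply/mapP; exists (0 <= x 0%R i0, [ffun k => Ordinal (hx k)]); first by rewrite mem_enum.
rewrite /code /dec; congr pair.
apply: (@eq_from_nth _ 0) => [|k]; first by rewrite size_map -/idx szi size_map size_enum_ord.
rewrite size_map szi => kd; rewrite (nth_map i0) ?szi// (nth_map (Ordinal kd)) ?size_enum_ord//.
rewrite ffunE /= nth_enum_ord//.
have := leq_trans (coord_le_l1norm x (nth i0 idx k)) xj.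
by rewrite -/idx; move: (x 0%R _) => v; lia.
Qed.

(** Bounds a boundary layer by its thickness times a quantity of order [n^(d-1)], so that boundary
    sites are negligible in volume averages. *)
Lemma wfs_shell n r : (#|` wfs n| <= #|` wfs (n - r)| + r * (2 * (2 * n).+1 ^ d.-1))%N.
Proof.
elim: r n => [|r IH] n; first by rewrite subn0 mul0n addn0.
case: n => [|n]; first by rewrite sub0n leq_addr.
rewrite subSS; have step : (#|` wfs n.+1| <= #|` wfs n| + 2 * (2 * n.+1).+1 ^ d.-1)%N.
  apply: leq_trans (leq_add (leqnn _) (sphere_card n.+1)).
  apply: leq_trans (_ : #|` (wfs n `|` [fset x in wfs n.+1 | l1norm x == n.+1])%fset| <= _)%N; last by rewrite cardfsU leq_subr.
  apply: fsubset_leq_card; apply/fsubsetP => x; rewrite !inE !in_wfs.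
  by move=> h; move: (h); rewrite {1}leq_eqVlt ltnS => /orP[/eqP e|->//]; rewrite h e eqxx orbT.
apply: leq_trans step _; have : (2 * (2 * n).+1 ^ d.-1 <= 2 * (2 * n.+1).+1 ^ d.-1)%N.
  by rewrite leq_mul2l /=; case: (d.-1) => // p; rewrite leq_exp2r// !ltnS leq_mul.
move: (2 * _)%N (2 * _)%N (IH n) => a b IHn ab.
rewrite mulSn addnA addnAC; apply: leq_trans (leq_add IHn (leqnn _)) _.
by rewrite leq_add2r leq_add2l leq_mul2l ab orbT.
Qed.

End LatticeCounting.
Arguments wfs : clear implicits.

(** * Lattice sums with polynomial decay *)

Section AbsoluteSums.
Variables (R : realType) (d : nat) (c : lattice d -> R) (C : R).
Hypothesis d0 : (0 < d)%N.
Hypothesis cC : forall z, `|c z| * (l1norm z).+1%:R ^+ d.+1 <= C.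

Let C' := C * 2 ^+ d.

Let C_ge0 : 0 <= C.
Proof. by apply: le_trans (cC 0); rewrite mulr_ge0// exprn_ge0. Qed.

(** The sphere has order [j^(d-1)] points and each term is of order [j^-(d+1)], leaving the summable
    [j^-2]. *)
Let shell j : \sum_(z <- [fset x in wfs d j | l1norm x == j]%fset) `|c z| <= C' / j.+1%:R ^+ 2.
Proof.
have j0 : 0 < j.+1%:R :> R by rewrite ltr0n.
apply: (@le_trans _ _ (\sum_(z <- [fset x in wfs d j | l1norm x == j]%fset) C / j.+1%:R ^+ d.+1)).
  rewrite big_seq [leRHS]big_seq; apply: ler_sum => z; rewrite !inE /= => /andP[_ /eqP zj].
  by rewrite ler_pdivlMr ?exprn_gt0// -zj.
rewrite sum_const_seq [leLHS]mulrC.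
have h : (#|` [fset x in wfs d j | l1norm x == j]%fset|%:R : R) <= 2 ^+ d * j.+1%:R ^+ d.-1.
  apply: (@le_trans _ _ ((2 * (2 * j.+1) ^ d.-1)%N%:R)).
    rewrite ler_nat; apply: leq_trans (sphere_card d0 j) _.
    by rewrite leq_mul2l /=; case: (d.-1) => // p; rewrite leq_exp2r//; lia.
  by rewrite natrM natrX natrM exprMn mulrA -exprS prednK.
apply: le_trans (ler_wpM2l _ h) _; first by rewrite divr_ge0// exprn_ge0.
have -> : d.+1 = (d.-1 + 2)%N by rewrite addn2 prednK.
have p0 : j.+1%:R ^+ d.-1 != 0 :> R by rewrite expf_neq0// lt0r_neq0.
have s0 : j.+1%:R ^+ 2 != 0 :> R by rewrite expf_neq0// lt0r_neq0.
rewrite exprD le_eqVlt; apply/orP; left; apply/eqP; move: p0 s0; rewrite /C'.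
move: (_ ^+ d.-1) (_ ^+ 2) (2 ^+ d) => p q t p0 q0.
by field; rewrite p0 q0.
Qed.

Let shells N (A : {fset lattice d}) : (forall z, z \in A -> (N < l1norm z)%N) ->
  \sum_(z <- A) `|c z| <= C' / N.+1%:R.
Proof.
move=> AN.
have [K hK] : exists K, forall z, z \in A -> (l1norm z <= K)%N.
  exists (\max_(z : A) l1norm (val z)) => z zA.
  exact: (@leq_bigmax _ (fun z : A => l1norm (val z)) [` zA]%fset).
have C'0 : 0 <= C' by rewrite mulr_ge0// exprn_ge0.
apply: (@le_trans _ _ (\sum_(N.+1 <= j < (maxn N K).+1) C' / j.+1%:R ^+ 2)).
  apply: (@le_trans _ _ (\sum_(N.+1 <= j < (maxn N K).+1)
     \sum_(z <- [fset x in wfs d j | l1norm x == j]%fset) `|c z|)); last first.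
    by apply: ler_sum => j _; exact: shell.
  have -> : \sum_(z <- A) `|c z| = \sum_(N.+1 <= j < (maxn N K).+1) \sum_(z <- A | l1norm z == j) `|c z|.
    under [RHS]eq_bigr do rewrite big_mkcond.
    rewrite exchange_big big_seq [RHS]big_seq; apply: eq_bigr => z zA.
    rewrite (bigD1_seq (l1norm z)) ?iota_uniq ?mem_index_iota ?AN ?ltnS ?leq_max ?hK ?orbT//= eqxx.
    by rewrite big1 ?addr0// => j /negbTE; rewrite eq_sym => ->.
  apply: ler_sum => j _.
  rewrite -big_filter; set s := [seq z <- _ | _].
  have us : uniq s by rewrite filter_uniq.
  rewrite [leRHS](bigID (fun z => z \in s) predT)/= -[leLHS]addr0; apply: lerD; last exact: sumr_ge0.
  rewrite le_eqVlt; apply/orP; left; apply/eqP; rewrite -[RHS]big_filter; apply: perm_big; apply: uniq_perm => //.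
    by apply: filter_uniq; exact: fset_uniq.
  move=> z; rewrite [RHS]mem_filter; case zs : (z \in s) => //.
  move: zs; rewrite mem_filter => /andP[/eqP zj _].
  by rewrite !inE /= in_wfs zj leqnn eqxx.
rewrite -mulr_sumr ler_wpM2l//.
elim: (maxn N K) (leq_maxl N K) => [|m IH] Nm.
  by rewrite big_geq.
move: Nm; rewrite leq_eqVlt => /orP[/eqP->|Nm]; first by rewrite big_geq.
rewrite ltnS in Nm.
have tele : \sum_(N.+1 <= j < m.+1) (j.+1%:R ^+ 2)^-1 <= N.+1%:R^-1 - m.+1%:R^-1 :> R.
  elim: m Nm {IH} => [|m IH]; first by rewrite leqn0 => /eqP ->; rewrite big_geq// subrr.
  rewrite leq_eqVlt => /orP[/eqP->|Nm]; first by rewrite big_geq// subrr.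
  rewrite big_nat_recr//=; apply: le_trans (lerD (IH Nm) (lexx _)) _.
  rewrite -addrA lerD2l -lerBrDl opprK addrC.
  have m1 : 0 < m.+1%:R :> R by rewrite ltr0n.
  have m2 : m.+2%:R = m.+1%:R + 1 :> R by rewrite natr1.
  rewrite m2; move: (m.+1%:R : R) m1 => x x0.
  have x1 : 0 < x + 1 by lra.
  rewrite -subr_ge0 (_ : _ - _ = (x * (x + 1) ^+ 2)^-1); last by field; rewrite !lt0r_neq0.
  by rewrite invr_ge0 mulr_ge0// ?exprn_ge0// ltW.
rewrite big_nat_recr//=; apply: le_trans (lerD tele (lexx _)) _.
have m1 : 0 < m.+1%:R :> R by rewrite ltr0n.
have m2 : m.+2%:R = m.+1%:R + 1 :> R by rewrite natr1.
rewrite m2; move: (m.+1%:R : R) (N.+1%:R^-1 : R) m1 => x y x0.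
have x1 : 0 < x + 1 by lra.
rewrite -subr_ge0 (_ : _ - _ = (x ^+ 2 + x + 1) / (x * (x + 1) ^+ 2)); last by field; rewrite !lt0r_neq0.
by rewrite divr_ge0 ?addr_ge0 ?mulr_ge0 ?exprn_ge0// ltW.
Qed.

Let tail N (B : {fset lattice d}) : (wfs d N `<=` B)%fset ->
  `|\sum_(z <- B) c z - \sum_(z <- wfs d N) c z| <= C' / N.+1%:R.
Proof.
move=> WB.
have -> : \sum_(z <- B) c z = \sum_(z <- wfs d N) c z + \sum_(z <- (B `\` wfs d N)%fset) c z.
  rewrite (bigID (fun z => z \in wfs d N)) /=; congr (_ + _).
    rewrite -big_filter; apply: perm_big; apply: uniq_perm; rewrite ?filter_uniq ?fset_uniq//.
    by move=> z; rewrite mem_filter; case zW : (z \in wfs d N) => //=; exact: (fsubsetP WB).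
  rewrite -big_filter; apply: perm_big; apply: uniq_perm; rewrite ?filter_uniq ?fset_uniq//.
  by move=> z; rewrite mem_filter !inE.
rewrite addrC addKr; apply: le_trans (ler_norm_sum _ _ _) _; apply: shells => z.
by rewrite !inE in_wfs -ltnNge => /andP[].
Qed.

(** Besides summability, the explicit rate is kept because the covariance limit cuts the series at a
    radius that grows with the window. *)
Lemma has_sum_polynomial_decay : exists2 s : R, has_sum c s &
  exists C'' : R, forall N, `|\sum_(z <- wfs d N) c z - s| <= C'' / N.+1%:R.
Proof.
pose u N := \sum_(z <- wfs d N) c z.
have uN N K : (N <= K)%N -> `|u K - u N| <= C' / N.+1%:R.
  move=> NK; apply: tail; apply/fsubsetP => z; rewrite !in_wfs => zN.
  exact: leq_trans zN NK.
have small (e : R) : 0 < e -> exists N0, C' / N0.+1%:R <= e.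
  move=> e0; exists (Num.truncn (C' / e)).
  by rewrite ler_pdivrMr ?ltr0n// mulrC -ler_pdivrMr//; apply: ltW; exact: truncnS_gt.
have cu : cvgn u.
  apply: cauchy_cvg; apply: cauchy_exP => e e0.
  have [|N0 hN0] := small (e / 2); first by rewrite divr_gt0.
  exists (u N0), N0 => // n /= nN; rewrite /ball /= distrC.
  by apply: le_lt_trans (le_trans (uN _ _ nN) hN0) _; rewrite ltr_pdivrMr// mulr2n mulrDr mulr1 ltrDl.
have lim_u N : `|u N - limn u| <= C' / N.+1%:R.
  rewrite distrC; have cuN : `|u K - u N| @[K --> \oo] --> `|limn u - u N|.
    by apply: cvg_norm; apply: cvgB => //; exact: cvg_cst.
  rewrite -(cvg_lim (@Rhausdorff R) cuN); apply: limr_le.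
    by apply/cvg_ex; exists `|limn u - u N|.
  by exists N => // K /= NK; exact: uN.
exists (limn u); last by exists C'.
have PF := @summability.totally_filter (lattice d).
apply/cvgrPdist_le => e e0.
have [|N0 hN0] := small (e / 2); first by rewrite divr_gt0.
exists (wfs d N0) => // B /= WB.
have h1 := le_trans (tail WB) hN0; have h2 := le_trans (lim_u N0) hN0.
have -> : summability.partial_sum c B = \sum_(z <- B) c z by rewrite /summability.partial_sum big_seq_fsetE.
rewrite distrC (_ : _ - _ = (\sum_(z <- B) c z - u N0) + (u N0 - limn u)); last by ring.
apply: le_trans (ler_normD _ _) _; rewrite [leRHS]splitr; exact: lerD.
Qed.

End AbsoluteSums.

Lemma leq_doubleS n : ((2 * n).+1 <= 2 * n.+1)%N.
Proof. lia. Qed.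

Lemma cvg0_near_le (R : realType) (f g : nat -> R) : g n @[n --> \oo] --> (0 : R) ->
  (\forall n \near \oo, `|f n| <= g n) -> f n @[n --> \oo] --> (0 : R).
Proof.
move=> g0 fg; apply/cvgr0Pnorm_le => e e0; near=> n.
apply: le_trans (_ : `|g n| <= e); last by near: n; move/cvgr0Pnorm_le: g0; exact.
by apply: le_trans (ler_norm _); near: n.
Unshelve. all: by end_near. Qed.

(** * Integer roots as truncation levels *)

Section IntegerRoots.
Variable L : nat.
Hypothesis L0 : (0 < L)%N.

(** The integer part of the [L]-th root. At truncation level [m = nroot n], powers of [m] stay below
    small powers of [n], while fast decay in [m] still beats every power of [n]. *)
Definition nroot n := \max_(m < n.+1 | (m ^ L <= n)%N) m.

Lemma nrootX_le n : (nroot n ^ L <= n)%N.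
Proof.
rewrite /nroot; elim/big_ind: _ => [|a b an bn|//].
  by rewrite exp0n.
by rewrite /maxn; case: ifP.
Qed.

Lemma nroot_ge n m : (m ^ L <= n)%N -> (m <= nroot n)%N.
Proof.
move=> mn; have mn1 : (m < n.+1)%N.
  rewrite ltnS; apply: leq_trans mn; case: m => // m.
  by rewrite -[X in (X <= _)%N]expn1 leq_pexp2l.
exact: (@leq_bigmax_cond _ _ (fun i : 'I_n.+1 => i : nat) (Ordinal mn1)).
Qed.

Lemma ltn_nrootS n : (n < (nroot n).+1 ^ L)%N.
Proof. by rewrite ltnNge; apply/negP => /nroot_ge; rewrite ltnn. Qed.

Lemma cvg_nroot : nroot n @[n --> \oo] --> \oo.
Proof.
move=> A [m0 _ hA]; exists (m0 ^ L)%N => // n /= mn; apply: hA => /=.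
exact: nroot_ge.
Qed.

Lemma near_nroot m : \forall n \near \oo, (m <= nroot n)%N.
Proof. by exists (m ^ L)%N => // n /=; exact: nroot_ge. Qed.

Lemma nroot_inv_cvg0 (R : realType) : (nroot n)%:R^-1 @[n --> \oo] --> (0 : R).
Proof.
have h := @cvg_harmonic R; have h2 : (fun m => (m%:R : R)^-1) m @[m --> \oo] --> (0 : R).
  by rewrite -(cvg_shiftS (fun m => (m%:R : R)^-1)).
exact: cvg_comp cvg_nroot h2.
Qed.

Lemma fastdec_nroot (R : realType) (e : nat -> R) j : fastdec e ->
  n.+1%:R ^+ j * e (nroot n) @[n --> \oo] --> (0 : R).
Proof.
move=> fe; have := fastdec_cvg0 (fastdec_poly 1 (L * j) fe).
move=> h; have {}h := cvg_comp _ _ cvg_nroot h.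
apply/cvgr0Pnorm_le => eps eps0; near=> n.
have : `|((fun m => 1 * m.+1%:R ^+ (L * j) * e m) \o nroot) n| <= eps.
  near: n; have /cvgr0Pnorm_le := h; exact.
apply: le_trans; rewrite /= mul1r !normrM ler_wpM2r// !normrX !normr_nat exprM.
rewrite lerXn2r ?nnegrE ?exprn_ge0// -natrX ler_nat; exact: ltn_nrootS.
Unshelve. all: by end_near. Qed.

End IntegerRoots.

Lemma cv_bound1 (R : realType) (dT : measure_display) (T : measurableType dT) (P : probability T R)
  (f g : T -> R) (N : R) : bmf f -> bmf g -> (forall w, `|g w| <= N) ->
  `|cv P f g| <= 2 * N * Ex P (fun w => `|f w|).
Proof.
move=> bf bg gN; rewrite /cv; apply: le_trans (ler_normB _ _) _.
have h1 : `|Ex P (fun w => f w * g w)| <= N * Ex P (fun w => `|f w|).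
  apply: le_trans (Ex_abs P (bmfM bf bg)) _; rewrite -ExZ; last exact: bmf_norm.
  apply: Ex_le; [exact: bmf_norm (bmfM bf bg)|exact: bmfZ (bmf_norm bf)|].
  by move=> w; rewrite normrM mulrC ler_wpM2r.
have h2 : `|Ex P f * Ex P g| <= N * Ex P (fun w => `|f w|) by rewrite normrM mulrC; apply: ler_pM => //; [exact: Ex_bound|exact: Ex_abs].
by apply: le_trans (lerD h1 h2) _; rewrite mulr2n mulrDl mulrDl !mul1r.
Qed.

(** Covariances ignore constants, so the approximation may hold only up to the shifts [al] and
    [al']. The duality constant of the window enters in this way. *)
Lemma cv_approx (R : realType) (dT : measure_display) (T : measurableType dT) (P : probability T R)
  (S S' A A' : T -> R) (al al' N N' : R) : bmf S -> bmf S' -> bmf A -> bmf A' ->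
  (forall w, `|S' w| <= N) -> (forall w, `|A w| <= N') ->
  `|cv P S S' - cv P A A'| <= 2 * N * Ex P (fun w => `|S w - al - A w|) +
     2 * N' * Ex P (fun w => `|S' w - al' - A' w|).
Proof.
move=> bS bS' bA bA' hN hN'.
have bD f g c : bmf f -> bmf g -> bmf (fun w : T => f w - c - g w) by move=> bf bg; apply: bmfB => //; apply: bmfB => //; exact: (bmf_cst _).
have sub f g h c : bmf f -> bmf g -> bmf h -> cv P (fun w => f w - c - g w) h = cv P f h - cv P g h.
  move=> bf bg bh; rewrite (_ : (fun w => _) = (fun w => f w + (- c + (-1) * g w))); last first.
    by apply/funext => w; ring.
  have b1 : bmf (fun w => (-1) * g w) by exact: bmfZ.
  have b2 : bmf (fun w => - c + (-1) * g w) by exact: bmfD (@bmf_cst _ _ T (- c)) b1.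
  by rewrite cvDl// cvDl// ?cv_cst// ?cvZl//; [ring|exact: (bmf_cst _)].
have -> : cv P S S' - cv P A A' = cv P (fun w => S w - al - A w) S' + cv P (fun w => S' w - al' - A' w) A by rewrite !sub// [cv P S' A]cvC [cv P A' A]cvC; ring.
by apply: le_trans (ler_normD _ _) _; apply: lerD; apply: cv_bound1 => //; exact: bD.
Qed.

Section Lipschitz.
Variable R : realType.

Lemma lipschitz_of_derivative (f g : R -> R) : (forall x : R, is_derive x (1 : R) f (g x)) ->
  (forall x, `|g x| <= 1) -> forall x y, `|f x - f y| <= `|x - y|.
Proof.
move=> df g1.
suff h a b : a <= b -> `|f b - f a| <= `|b - a|.
  move=> x y; have [xy|/ltW xy] := leP x y; last exact: h.
  by rewrite distrC [leRHS]distrC; exact: h.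
rewrite le_eqVlt => /predU1P[->|ab]; first by rewrite !subrr.
have cf : {within `[a, b], continuous f}.
  apply: continuous_subspaceT => x; apply: differentiable_continuous.
  exact/derivable1_diffP.
have [z _ ->] := MVT ab (fun x _ => df x) cf.
by rewrite normrM ler_piMl.
Qed.

Lemma cos_lipschitz (x y : R) : `|cos x - cos y| <= `|x - y|.
Proof.
apply: (@lipschitz_of_derivative cos (fun x => - sin x)) => z.
by rewrite normrN sin_max.
Qed.

Lemma sin_lipschitz (x y : R) : `|sin x - sin y| <= `|x - y|.
Proof. by apply: (@lipschitz_of_derivative sin cos) => z; exact: cos_max. Qed.

End Lipschitz.

(** * Central limit theorem for local fields *)

Section Field.
Import mathcomp.boot.fintype mathcomp.boot.finset.
Context (R : realType) (dT : measure_display) (T : measurableType dT).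
Context (P : probability T R) (d : nat) (X : {RV P >-> config d}).
Hypothesis d0 : (0 < d)%N.
Variable q : nat.
Hypothesis q0 : (0 < q)%N.
Hypothesis mix : mixing X q.
Implicit Types (u v : lattice d -> set (lattice d) -> R).

(** A distance between centres that keeps two boxes of radius [m+1] at distance at least [m^q]. *)
Definition range m := (m ^ q + 2 * d * m.+1)%N.

Lemma range_le m : (0 < m)%N -> (range m <= (4 * d).+1 * m ^ q)%N.
Proof.
move=> m0; rewrite /range mulSn leq_add2l.
apply: (@leq_trans (4 * d * m)%N); last by rewrite leq_mul2l -{1}[m]expn1 leq_pexp2l ?orbT.
have m2 : (m.+1 <= 2 * m)%N by lia.
by apply: leq_trans (leq_mul (leqnn (2 * d)%N) m2) _; rewrite mulnACA mulnA.
Qed.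

Lemma supbox_separated m (x y a b : lattice d) : (range m <= l1norm (x - y))%N ->
  a \in supbox x m.+1 -> b \in supbox y m.+1 -> (m ^ q <= l1norm (a - b))%N.
Proof.
move=> xy /supboxP ax /supboxP by_.
have h1 : (l1norm (a - x) <= d * m.+1)%N by apply: l1norm_le_sup => i; have := ax i; rewrite !mxE.
have h2 : (l1norm (b - y) <= d * m.+1)%N by apply: l1norm_le_sup => i; have := by_ i; rewrite !mxE.
have h3 := l1norm_triangle x a y; have h4 := l1norm_triangle a b y.
rewrite l1normB in h1; move: xy h1 h2 h3 h4; rewrite /range -mulnA.
move: (d * m.+1)%N (m ^ q)%N => p r; lia.
Qed.

(** [cum_bound] with sites declared near when within [range m]. A chain of [k] steps stays in a box
    of radius [k * range m], whose volume is of order [m^(qd)], and [mixing] supplies the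
    factorization error. *)
Lemma cum_field_bound (k : nat) (M : R) : 0 <= M -> exists (C : R) (e : nat -> R),
  [/\ 0 <= C, fastdec e, forall m, 0 <= e m &
  forall m (W : {fset lattice d}) u, (0 < m)%N -> (0 < #|` W|)%N ->
    (forall x, local (u x) (supbox x m.+1)) -> (forall x mu, `|u x mu| <= M) ->
    let S := fun w => \sum_(x <- W) u x (X w) in
    `|cum (moment P (fun w => S w - Ex P S)) k| <=
      C * #|` W|%:R * m%:R ^+ (q * d * k.+1) + C * #|` W|%:R ^+ k.+1 * e m].
Proof.
move=> M0.
pose Bd := 2 * M + 1.
have Bd1 : 1 <= Bd by rewrite lerDr mulr_ge0.
have [c c0 hc] := cum_bound P k Bd1.
(* Two groups of at most [k.+1] boxes each; the factor [2 ^ d] compares boxes of radius [m+1] with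
   boxes of radius [m]. *)
have [e [fe e0 he]] := mix (2 * k.+1 * 2 ^ d)%N.
pose D m := ((2 * (k * range m)).+1 ^ d)%N.
pose K := (((2 * (k * (4 * d).+1)).+1 ^ d) ^ k.+1)%N.
exists (c * (K%:R + 1)), (fun m => Bd ^+ k.+1 * Bd ^+ k.+1 * e m); split=> [|||m W u m0 W0 lu uM /=].
- by rewrite mulr_ge0// addr_ge0.
- exact: fastdecZ.
- by move=> m; rewrite !mulr_ge0 ?exprn_ge0// (le_trans ler01).
set S := fun w => \sum_(x <- W) u x (X w).
have bu x : bmf (fun w => u x (X w)) by exact: local_bmf (lu x).
pose z x mu := u x mu - Ex P (fun w => u x (X w)).
pose Z (x : W) w := z (val x) (X w).
have SZ : (fun w => S w - Ex P S) = (fun w => \sum_x Z x w).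
  apply/funext => w; rewrite /S Ex_sum// big_seq_fsetE [in X in _ - X]big_seq_fsetE -sumrB.
  by apply: eq_bigr.
have cardW : #|{: W}| = #|` W| by rewrite cardfE.
have zloc x : local (z x) (supbox x m.+1) by move=> mu nu h; rewrite /z (lu x _ _ h).
have zM x mu : `|z x mu| <= Bd.
  apply: le_trans (ler_normB _ _) _; rewrite /Bd [2 * M]mulr_natl mulr2n -addrA lerD//.
  by rewrite ler_wpDr// Ex_bound.
pose near (x y : W) := (l1norm (val x - val y) < range m)%N.
pose ball (x : W) := [set y : W | (l1norm (val x - val y) <= k * range m)%N]%SET.
have bD x : (#|ball x| <= D m)%N.
  rewrite /D -(size_supbox (val x)) cardE -(size_map val).
  apply: uniq_leq_size => [|y /mapP[y' + ->]]; first by rewrite map_inj_uniq ?enum_uniq//; exact: val_inj.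
  rewrite mem_enum inE => h; apply/supboxP => i.
  by apply: leq_trans h; rewrite l1normB; have := coord_le_l1norm (val y' - val x) i; rewrite !mxE.
rewrite SZ; apply: le_trans (hc _ Z near ball (D m) (Bd ^+ k.+1 * Bd ^+ k.+1 * e m) _ _ _ _ _ bD _) _.
- by rewrite cardW.
- by move=> x y; rewrite /near l1normB.
- by move=> x; apply: bmfB => //; exact: bmf_cst.
- by move=> x w; exact: zM.
- move=> x p; rewrite inE => px pk.
  apply: (@leq_trans (size p * range m)%N); last by rewrite leq_mul2r pk orbT.
  elim: p x px {pk} => [|y p IH] x /=; first by rewrite subrr l1norm0.
  move=> /andP[xy /IH h]; apply: leq_trans (l1norm_triangle _ (val y) _) _.
  by rewrite mulSn leq_add// ltnW.
- move=> f U hU A; rewrite /mixed_moment.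
  pose g (Q : {set 'I_k.+1}) mu := \prod_(i in Q) z (val (f i)) mu.
  pose sup (Q : {set 'I_k.+1}) := flatten [seq supbox (val (f i)) m.+1 | i in Q].
  have gl Q : local (g Q) (sup Q) by apply: local_prod => i; exact: zloc.
  have gB Q mu : `|g Q mu| <= Bd ^+ k.+1.
    rewrite normr_prod; apply: (@le_trans _ _ (\prod_(i in Q) Bd)).
      by apply: ler_prod => i _; rewrite normr_ge0 zM.
    rewrite prodr_const; apply: ler_weXn2l => //.
    by rewrite -[leqRHS]card_ord max_card.
  have sz Q : (size (sup Q) <= k.+1 * (2 ^ d * (2 * m).+1 ^ d))%N.
    have -> : size (sup Q) = (#|Q| * (2 * m.+1).+1 ^ d)%N.
      rewrite size_flatten /shape -map_comp (eq_map (g := fun=> ((2 * m.+1).+1 ^ d)%N)); last first.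
        by move=> i /=; rewrite size_supbox.
      by rewrite sumnE big_map big_const_seq count_predT iter_addn_0 -cardE mulnC.
    apply: leq_mul; first by rewrite -[leqRHS]card_ord max_card.
    by rewrite -expnMn leq_exp2r//; lia.
  have := he m (sup (A :&: U)) (sup (A :\: U)) (g (A :&: U)) (g (A :\: U)) (Bd ^+ k.+1) (Bd ^+ k.+1) m0.
  have -> : cv P (fun w => g (A :&: U) (X w)) (fun w => g (A :\: U) (X w)) =
      Ex P (fun w => \prod_(i in A) Z (f i) w) -
      Ex P (fun w => \prod_(i in A :&: U) Z (f i) w) * Ex P (fun w => \prod_(i in A :\: U) Z (f i) w).
    congr (_ - _); congr (Ex P _); apply/funext => w.
    by rewrite (big_setID U).
  apply=> //.
    apply: leq_trans (leq_add (sz _) (sz _)) _.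
    by rewrite addnn -mul2n !mulnA.
  move=> a b /flattenP[_ /mapP[i + ->] ai] /flattenP[_ /mapP[j + ->] bj].
  rewrite !mem_enum !inE => /andP[_ iU] /andP[jU _].
  by apply: supbox_separated ai bj; have := hU i j iU jU; rewrite /near -leqNgt.
rewrite cardW mulrDr; apply: lerD; last first.
  rewrite [leLHS]mulrA ler_wpM2r//.
    by rewrite !mulr_ge0 ?exprn_ge0// (le_trans ler01 Bd1).
  by rewrite ler_wpM2r ?exprn_ge0// mulrDr mulr1 lerDr mulr_ge0.
have DK : (D m ^ k.+1 <= K * m ^ (q * d * k.+1))%N.
  rewrite /D /K; apply: (@leq_trans ((((2 * (k * (4 * d).+1)).+1 * m ^ q) ^ d) ^ k.+1)%N).
    rewrite leq_exp2r// leq_exp2r//.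
    have h := range_le m0; have mq : (0 < m ^ q)%N by rewrite expn_gt0 m0.
    have {}h : (2 * (k * range m) <= 2 * (k * (4 * d).+1) * m ^ q)%N by rewrite -!mulnA !leq_mul2l h !orbT.
    move: (2 * _)%N (2 * _)%N (m ^ q)%N h mq => n1 n2 n3 n123 n30.
    by rewrite mulSn -addn1 addnC leq_add.
  by rewrite !(expnM m) -!expnMn.
have DK' : (D m)%:R ^+ k.+1 <= K%:R * m%:R ^+ (q * d * k.+1) :> R by rewrite -!natrX -natrM ler_nat.
rewrite mulrA; apply: le_trans (_ : c * #|` W|%:R * (K%:R * m%:R ^+ (q * d * k.+1)) <= _).
  by rewrite ler_wpM2l// mulr_ge0.
have := exprn_ge0 (q * d * k.+1) (ler0n R m); move: (_ ^+ (q * d * k.+1)) => y y0.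
have e1 : c * (K%:R + 1) * #|` W|%:R * y = c * #|` W|%:R * (K%:R * y) + c * #|` W|%:R * y by ring.
by rewrite e1 lerDl !mulr_ge0.
Qed.

(** The chained tuples number about [W m^(qd(k+1))] for the volume [W], and the normalization is at
    least of order [W^(nu(k+1)/2)]. As [m] is at most the [L]-th root of [W], the condition on [L]
    makes the ratio smaller than [1/m]. *)
Lemma cum_field_cvg0 (k L : nat) (M c nu : R) (a : nat -> R)
    (u : nat -> nat -> lattice d -> set (lattice d) -> R) :
  (0 < L)%N -> 0 < c -> 0 <= nu ->
  (forall m n x, local (u m n x) (supbox x m.+1)) -> (forall m n x mu, `|u m n x mu| <= M) ->
  (forall n, 0 < a n) -> (\forall n \near \oo, c * #|` wfs d n|%:R `^ nu <= a n ^+ 2) ->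
  2 * (q * d * k.+1 + 1)%:R <= L%:R * (nu * k.+1%:R - 2) ->
  let S n w := \sum_(x <- wfs d n) u (nroot L n) n x (X w) in
  cum (moment P (fun w => (a n)^-1 * (S n w - Ex P (S n)))) k @[n --> \oo] --> (0 : R).
Proof.
move=> L0 c0 nu0 lu uM a0 ac hL S.
have M0 : 0 <= M := le_trans (normr_ge0 _) (uM 0%N 0%N 0 classical_sets.set0).
have [C [e [C0 fe e0 hC]]] := cum_field_bound k M0.
pose A := (q * d * k.+1)%N; pose sc := Num.sqrt c ^+ k.+1.
have sc0 : 0 < sc by rewrite exprn_gt0// sqrtr_gt0.
pose b2 n := n.+1%:R ^+ (d * k.+1) * (C * (2 ^+ d) ^+ k.+1 / sc * e (nroot L n)).
have cb2 := fastdec_nroot L0 (d * k.+1) (fastdecZ (C * (2 ^+ d) ^+ k.+1 / sc) fe).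
pose b1 n := C / sc * (nroot L n)%:R^-1.
have cb1 : b1 n @[n --> \oo] --> (0 : R) by rewrite -(mulr0 (C / sc)); apply: cvgMl_tmp; exact: nroot_inv_cvg0.
have cb : b1 n + b2 n @[n --> \oo] --> (0 : R) by rewrite -(addr0 0); exact: cvgD.
apply: (cvg0_near_le cb); near=> n.
have m1 : (0 < nroot L n)%N by near: n; exact: (near_nroot L0 1).
have acn : c * #|` wfs d n|%:R `^ nu <= a n ^+ 2 by near: n.
set m := nroot L n in m1 *; set W := (#|` wfs d n|%:R : R) in acn *.
have mL : (m ^ L <= n)%N by exact: nrootX_le.
have W1 : 1 <= W by rewrite ler1n wfs_gt0.
have mW : m%:R ^+ L <= W by rewrite -natrX ler_nat (leq_trans mL)// ltnW// wfs_card_gtn.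
have m1R : 1 <= m%:R :> R by rewrite ler1n.
have c_sc : c = Num.sqrt c ^+ 2 by rewrite sqr_sqrtr// ltW.
have ak0 : 0 < a n ^+ k.+1 by rewrite exprn_gt0.
(* Proved after squaring, to avoid half-integral powers: the surplus [W^(nu(k+1)-2)] dominates the
   squared powers of [m] because [m^L <= W]. *)
have aW : sc * (W * m%:R ^+ A * m%:R) <= a n ^+ k.+1.
  have W0 : 0 <= W by rewrite (le_trans ler01).
  rewrite -(@ler_pXn2r _ 2)// ?nnegrE ?mulr_ge0 ?exprn_ge0 ?(ltW sc0) ?(ltW (a0 n))//.
  have Wn0 : W != 0 by rewrite lt0r_neq0// (lt_le_trans ltr01).
  have e1 : (sc * (W * m%:R ^+ A * m%:R)) ^+ 2 = c ^+ k.+1 * (W ^+ 2 * m%:R ^+ (2 * (A + 1))).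
    rewrite exprMn /sc exprAC -c_sc; congr (_ * _).
    by rewrite -mulrA -exprSr exprMn -exprM addn1 [(A.+1 * 2)%N]mulnC.
  have e2 : (c * W `^ nu) ^+ k.+1 = c ^+ k.+1 * (W ^+ 2 * W `^ (nu * k.+1%:R - 2)).
    rewrite exprMn; congr (_ * _); rewrite -[LHS]powR_mulrn ?powR_ge0// -powRrM.
    rewrite -[W ^+ 2]powR_mulrn// -powRD ?Wn0 ?implybT//.
    by rewrite addrC subrK.
  rewrite exprAC; apply: le_trans (_ : (c * W `^ nu) ^+ k.+1 <= _); last by rewrite lerXn2r ?nnegrE ?mulr_ge0 ?powR_ge0 ?exprn_ge0 ?(ltW c0) ?(ltW (a0 n)).
  rewrite e1 e2 ler_wpM2l ?exprn_ge0 ?(ltW c0)// ler_wpM2l ?exprn_ge0//.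
  apply: (@le_trans _ _ ((m%:R ^+ L) `^ (nu * k.+1%:R - 2))).
    rewrite -powR_mulrn// -[_ ^+ L]powR_mulrn// -powRrM; apply: ler_powR => //.
    by apply: le_trans hL; rewrite natrM.
  apply: ge0_ler_powR; rewrite ?nnegrE ?exprn_ge0//.
  have : 0 <= L%:R * (nu * k.+1%:R - 2) by apply: le_trans hL; rewrite mulr_ge0.
  by rewrite pmulr_rge0// ltr0n.
have asc : sc <= a n ^+ k.+1.
  apply: le_trans aW; rewrite ler_peMr ?(ltW sc0)// -mulrA.
  by rewrite mulr_ege1// mulr_ege1// exprn_ege1.
have scale : cum (moment P (fun w => (a n)^-1 * (S n w - Ex P (S n)))) k =
    (a n)^-1 ^+ k.+1 * cum (moment P (fun w => S n w - Ex P (S n))) k.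
  rewrite -cum_scale; apply: eq_cum => l _; rewrite /moment -ExZ.
    by congr (Ex P _); apply/funext => w; rewrite exprMn.
  apply: bmfX; apply: bmfB; last exact: bmf_cst.
  by apply: bmf_sum => x _; exact: local_bmf (lu m n x).
rewrite scale normrM ger0_norm ?exprn_ge0 ?invr_ge0 ?(ltW (a0 n))//.
have hCn := hC m (wfs d n) (u m n) m1 (wfs_gt0 d n) (lu m n) (uM m n).
rewrite exprVn; apply: le_trans (ler_wpM2l _ hCn) _; first by rewrite invr_ge0 (ltW ak0).
rewrite -/W mulrDr; apply: lerD.
  rewrite mulrC ler_pdivrMr// /b1 -/m; apply: le_trans (ler_wpM2l _ aW); last by rewrite !mulr_ge0 ?invr_ge0 ?(ltW sc0).
  rewrite le_eqVlt; apply/orP; left; apply/eqP; rewrite -/A; move: (m%:R ^+ A) => z.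
  have m0 : m%:R != 0 :> R by rewrite lt0r_neq0// (lt_le_trans ltr01).
  by field; rewrite m0 lt0r_neq0.
rewrite mulrC ler_pdivrMr// /b2 -/m; apply: le_trans (ler_wpM2l _ asc); last by rewrite !mulr_ge0 ?exprn_ge0 ?invr_ge0 ?(ltW sc0)//.
have W0 : 0 <= W by rewrite (le_trans ler01).
have hW : W <= 2 ^+ d * n.+1%:R ^+ d by exact: wfs_card_leR.
apply: (@le_trans _ _ (C * (2 ^+ d * n.+1%:R ^+ d) ^+ k.+1 * e m)).
  rewrite ler_wpM2r// ler_wpM2l// lerXn2r// nnegrE.
  exact: le_trans W0 hW.
rewrite le_eqVlt; apply/orP; left; apply/eqP; rewrite exprM exprMn.
move: (_ ^+ k.+1) (_ ^+ k.+1) (e m) => x y z; field; exact: lt0r_neq0.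
Unshelve. all: by end_near. Qed.

Lemma approx_error_cvg0 (S : nat -> T -> R) (al : nat -> R) (r c1 L : nat) (eta : nat -> R)
    (u : nat -> nat -> lattice d -> set (lattice d) -> R) (K : R) j : (2 <= L)%N -> fastdec eta ->
  (forall m n, (c1 * m.+1 <= n)%N ->
    Ex P (fun w => `|S n w - al n - \sum_(x <- wfs d n) u m n x (X w)|) <= n.+1%:R ^+ r * eta m) ->
  K * n.+1%:R ^+ j * Ex P (fun w => `|S n w - al n - \sum_(x <- wfs d n) u (nroot L n) n x (X w)|)
    @[n --> \oo] --> (0 : R).
Proof.
move=> L2 feta ap.
have L0 : (0 < L)%N by apply: leq_trans L2.
pose E1 n := Ex P (fun w => `|S n w - al n - \sum_(x <- wfs d n) u (nroot L n) n x (X w)|).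
have E1_ge0 n : 0 <= E1 n by apply: Ex_ge0.
have h := fastdec_nroot L0 (j + r) feta.
have {}h : `|K| * (n.+1%:R ^+ (j + r) * eta (nroot L n)) @[n --> \oo] --> (0 : R) by rewrite -(mulr0 `|K|); exact: cvgMl_tmp.
apply: (cvg0_near_le h); near=> n.
rewrite -/(E1 n) -mulrA normrM ler_wpM2l// ger0_norm; last by rewrite mulr_ge0 ?exprn_ge0.
rewrite exprD -mulrA ler_wpM2l ?exprn_ge0//.
apply: ap.
have m1 : (1 <= nroot L n)%N by near: n; exact: (near_nroot L0 1).
have m2 : (2 * c1 <= nroot L n)%N by near: n; exact: (near_nroot L0 (2 * c1)).
apply: leq_trans (nrootX_le L0 n); move: (nroot L n) m1 m2 => m m1 m2.
apply: (@leq_trans (m ^ 2)%N); last by rewrite leq_pexp2l.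
by rewrite -mulnn; nia.
Unshelve. all: by end_near. Qed.

Lemma field_sum_bound (M : R) n (v : lattice d -> R) : (forall x, `|v x| <= M) ->
  `|\sum_(x <- wfs d n) v x| <= 2 ^+ d * M * n.+1%:R ^+ d.
Proof.
move=> vM; have M0 : 0 <= M := le_trans (normr_ge0 _) (vM 0).
apply: le_trans (ler_norm_sum _ _ _) _.
apply: (@le_trans _ _ (\sum_(x <- wfs d n) M)); first by apply: ler_sum => x _.
by rewrite sum_const_seq mulrAC ler_wpM2r// wfs_card_leR.
Qed.

(* The field [u] replaces the functional [S] of the window up to the deterministic
   shift [al]; the truncation level is a small power of the window radius. *)
Lemma clt_of_local_approximation (S : nat -> T -> R) (al : nat -> R) (M c nu v : R)
    (a : nat -> R) (r c1 : nat) (eta : nat -> R)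
    (u : nat -> nat -> lattice d -> set (lattice d) -> R) :
  0 < c -> 0 < nu -> (v = 1 \/ nu = 1) -> fastdec eta ->
  (forall n, bmf (S n)) -> (forall n w, `|S n w| <= M * n.+1%:R ^+ r) ->
  (forall m n x, local (u m n x) (supbox x m.+1)) -> (forall m n x mu, `|u m n x mu| <= M) ->
  (forall m n, (c1 * m.+1 <= n)%N ->
    Ex P (fun w => `|S n w - al n - \sum_(x <- wfs d n) u m n x (X w)|) <= n.+1%:R ^+ r * eta m) ->
  (forall n, 0 < a n) -> (\forall n \near \oo, c * #|` wfs d n|%:R `^ nu <= a n ^+ 2) ->
  (a n)^-1 ^+ 2 * cv P (S n) (S n) @[n --> \oo] --> v ->
  forall t,
  Ex P (fun w => cos (t * ((a n)^-1 * (S n w - Ex P (S n))))) @[n --> \oo] --> expR (- (t ^+ 2 * v / 2)) /\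
  Ex P (fun w => sin (t * ((a n)^-1 * (S n w - Ex P (S n))))) @[n --> \oo] --> (0 : R).
Proof.
move=> c0 nu0 vnu feta bS SB lu uM ap a0 ac cvv t.
have M0 : 0 <= M := le_trans (normr_ge0 _) (uM 0%N 0%N 0 classical_sets.set0).
(* The first summands serve every order at least three when [nu = 1]. The last one gives
   [L nu >= 4(qd+1)], which serves orders with [nu (j+1) >= 4] for general [nu]. *)
pose L := (6 * (q * d) + 6 + (Num.truncn ((4 * (q * d + 1))%N%:R / nu)).+1)%N.
have L2 : (2 <= L)%N by rewrite /L; lia.
have L0 : (0 < L)%N by lia.
have L6 : (6 * (q * d) + 6 <= L)%N by rewrite leq_addr.
have Lnu : (4 * (q * d + 1))%N%:R <= L%:R * nu.
  rewrite -ler_pdivrMr//; apply: le_trans (ltW (truncnS_gt _)) _.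
  by rewrite ler_nat leq_addl.
pose S' n w := \sum_(x <- wfs d n) u (nroot L n) n x (X w).
have bS' n : bmf (S' n) by apply: bmf_sum => x _; exact: local_bmf (lu _ n x).
pose De n w := S n w - al n - S' n w.
have bDe n : bmf (De n) by apply: bmfB => //; apply: bmfB => //; exact: bmf_cst.
pose E1 n := Ex P (fun w => `|De n w|).
have E1_ge0 n : 0 <= E1 n by apply: Ex_ge0.
have E1small (K : R) j : K * n.+1%:R ^+ j * E1 n @[n --> \oo] --> (0 : R).
  exact: (approx_error_cvg0 K j L2 feta ap).
pose Y n w := (a n)^-1 * (S n w - Ex P (S n)).
pose Y' n w := (a n)^-1 * (S' n w - Ex P (S' n)).
have bY n : bmf (Y n) by apply: bmfZ; apply: bmfB => //; exact: bmf_cst.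
have bY' n : bmf (Y' n) by apply: bmfZ; apply: bmfB => //; exact: bmf_cst.
have sc0 : 0 < Num.sqrt c by rewrite sqrtr_gt0.
have ac' : \forall n \near \oo, c <= a n ^+ 2.
  near=> n; apply: (@le_trans _ _ (c * #|` wfs d n|%:R `^ nu)); last by near: n.
  rewrite ler_peMr ?(ltW c0)//; apply: le_trans (_ : 1 `^ nu <= _); first by rewrite powR1.
  by rewrite ge0_ler_powR ?nnegrE ?(ltW nu0)// ler1n wfs_gt0.
have ac1 : \forall n \near \oo, (a n)^-1 <= (Num.sqrt c)^-1.
  near=> n; rewrite lef_pV2 ?posrE// -(@ler_pXn2r _ 2)// ?nnegrE ?sqrtr_ge0 ?(ltW (a0 n))//.
  by rewrite sqr_sqrtr ?(ltW c0)//; near: n.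
have YY' : Ex P (fun w => `|Y n w - Y' n w|) @[n --> \oo] --> (0 : R).
  apply: (cvg0_near_le (E1small (2 * (Num.sqrt c)^-1) 0%N)); near=> n.
  rewrite ger0_norm ?Ex_ge0// expr0 mulr1.
  have h w : `|Y n w - Y' n w| <= (a n)^-1 * (`|De n w| + E1 n).
    have -> : Y n w - Y' n w = (a n)^-1 * (De n w - Ex P (De n)).
      rewrite /Y /Y' /De ExB// ?ExB// ?Ex_cst; first by ring.
        exact: bmf_cst.
      by apply: bmfB => //; exact: bmf_cst.
    rewrite normrM ger0_norm ?invr_ge0 ?(ltW (a0 n))// ler_wpM2l ?invr_ge0 ?(ltW (a0 n))//.
    by apply: le_trans (ler_normB _ _) _; rewrite lerD2l Ex_abs.
  have bn := bmf_norm (bDe n).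
  apply: (@le_trans _ _ (Ex P (fun w => (a n)^-1 * (`|De n w| + E1 n)))).
    apply: Ex_le => //; first exact: bmf_norm (bmfB (bY n) (bY' n)).
    exact: (bmfZ (a n)^-1 (bmfD bn (bmf_cst _ (E1 n)))).
  rewrite ExZ; last exact: (bmfD bn (bmf_cst _ (E1 n))).
  rewrite ExD//; last exact: bmf_cst.
  rewrite Ex_cst -/(E1 n) -mulr2n -[_ *+ 2]mulr_natl mulrCA mulrA ler_wpM2r// ler_wpM2l//.
  by near: n.
have var' : (a n)^-1 ^+ 2 * cv P (S' n) (S' n) @[n --> \oo] --> v.
  pose K n : R := (2 / c * M) * n.+1%:R ^+ r * E1 n + (2 / c * (2 ^+ d * M)) * n.+1%:R ^+ d * E1 n.
  have cK : K n @[n --> \oo] --> (0 : R) by rewrite -(addr0 0); apply: cvgD; exact: E1small.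
  rewrite -(subr0 v) -{1}(@add0r R 0); rewrite (_ : (fun n => _) = (fun n => (a n)^-1 ^+ 2 * cv P (S n) (S n) -
      (a n)^-1 ^+ 2 * (cv P (S n) (S n) - cv P (S' n) (S' n)))); last first.
    by apply/funext => n; ring.
  apply: cvgB => //; rewrite add0r.
  apply: (cvg0_near_le cK); near=> n.
  have S'B w : `|S' n w| <= 2 ^+ d * M * n.+1%:R ^+ d by apply: field_sum_bound.
  have an2 : (a n)^-1 ^+ 2 <= c^-1 by rewrite exprVn lef_pV2 ?posrE ?exprn_gt0//; near: n.
  rewrite normrM ger0_norm ?exprn_ge0 ?invr_ge0 ?(ltW (a0 n))//.
  apply: le_trans (ler_wpM2r (normr_ge0 _) an2) _.
  have h := cv_approx P (al n) (al n) (bS n) (bS n) (bS' n) (bS' n) (SB n) S'B.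
  apply: le_trans (ler_wpM2l _ h) _; first by rewrite invr_ge0 ltW.
  by rewrite -!/(E1 n) /K le_eqVlt; apply/orP; left; apply/eqP; ring.
have Y'1 n : Ex P (Y' n) = 0.
  rewrite /Y' ExZ; last by apply: bmfB => //; exact: bmf_cst.
  by rewrite ExB ?Ex_cst ?subrr ?mulr0//; exact: bmf_cst.
have mom1 n : moment P (Y' n) 1 = 0 by rewrite -[RHS](Y'1 n); congr (Ex P _); apply/funext => w; rewrite expr1.
have mom2 n : moment P (Y' n) 2 = (a n)^-1 ^+ 2 * cv P (S' n) (S' n).
  rewrite /moment (_ : (fun w => _) = (fun w => (a n)^-1 ^+ 2 * ((S' n w * S' n w) +
     ((- 2 * Ex P (S' n)) * S' n w + Ex P (S' n) ^+ 2)))); last by apply/funext => w; rewrite /Y'; ring.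
  have b1 := bmfM (bS' n) (bS' n); have b2 := bmfZ (- 2 * Ex P (S' n)) (bS' n).
  have b3 : bmf (fun _ : T => Ex P (S' n) ^+ 2) by exact: bmf_cst.
  rewrite ExZ; last exact: bmfD b1 (bmfD b2 b3).
  rewrite ExD//; last exact: bmfD b2 b3.
  rewrite ExD// ExZ// Ex_cst /cv; ring.
have cum0 n : cum (moment P (Y' n)) 0 = 0 by rewrite cum_rec big_ord0 subr0 mom1.
have cum1 n : cum (moment P (Y' n)) 1 = moment P (Y' n) 2 by rewrite cum_rec big_ord_recl big_ord0 cum0 mulr0 mul0r addr0 subr0.
have ccum1 : cum (moment P (Y' n)) 1 @[n --> \oo] --> v by under eq_fun do rewrite cum1 mom2.
have ccum (k : nat) : 2 * (q * d * k.+1 + 1)%:R <= L%:R * (nu * k.+1%:R - 2) ->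
    cum (moment P (Y' n)) k @[n --> \oo] --> (0 : R).
  by move=> hL; exact: (cum_field_cvg0 L0 c0 (ltW nu0) lu uM a0 ac hL).
(* With [v = 1] only large orders are controlled directly and [janson] recovers the others. With
   [nu = 1] every order from three on is controlled directly, so [v] may be zero. *)
have ccum2 k : (2 <= k)%N -> cum (moment P (Y' n)) k @[n --> \oo] --> (0 : R).
  move=> k2; case: vnu => [v1|nu1].
    apply: (@janson _ _ _ P Y' (Num.truncn (4 / nu)).+1) => //.
      by under eq_fun do rewrite -cum1; rewrite -v1.
    move=> j jK; apply: ccum.
    have j4 : 4 <= nu * j.+1%:R.
      rewrite mulrC -ler_pdivrMr//; apply: le_trans (ltW (truncnS_gt _)) _.
      by rewrite ler_nat (leq_trans jK).
    have jq : (q * d * j.+1 + 1 <= (q * d + 1) * j.+1)%N by rewrite mulnDl mul1n leq_add2l.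
    have jq' : (q * d * j.+1 + 1)%:R <= (q * d + 1)%N%:R * j.+1%:R :> R by rewrite -natrM ler_nat.
    apply: (@le_trans _ _ (L%:R * (nu * j.+1%:R / 2))); last first.
      by rewrite ler_wpM2l//; move: (nu * _) j4 => z; lra.
    apply: le_trans (ler_wpM2l _ jq') _ => //.
    rewrite natrM in Lnu; have j0 : 0 <= j.+1%:R :> R by [].
    have := ler_wpM2r j0 Lnu; move: ((q * d + 1)%N%:R : R) (j.+1%:R : R) (L%:R : R) => x y z.
    by rewrite !mulrA; lra.
  apply: ccum; rewrite nu1 mul1r.
  have : (2 * (q * d * k.+1 + 1) <= (6 * (q * d) + 6) * (k.+1 - 2))%N by move: (q * d)%N => y; nia.
  move=> /leq_trans/(_ (leq_mul L6 (leqnn (k.+1 - 2)%N))).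
  rewrite -(ler_nat R) natrM => /le_trans; apply.
  by rewrite natrM natrB//; lia.
have ccumne j : j != 1%N -> cum (moment P (Y' n)) j @[n --> \oo] --> (0 : R).
  case: j => [_|[//|j _]]; last exact: ccum2.
  by under eq_fun do rewrite cum0; exact: cvg_cst.
have close (h : R -> R) (l : R) : (forall n, bmf (fun w => h (t * Y n w))) -> (forall n, bmf (fun w => h (t * Y' n w))) ->
    (forall x y, `|h x - h y| <= `|x - y|) ->
    Ex P (fun w => h (t * Y' n w)) @[n --> \oo] --> l -> Ex P (fun w => h (t * Y n w)) @[n --> \oo] --> l.
  move=> b1 b2 hlip cl; rewrite -(addr0 l).
  rewrite (_ : (fun n => _) = (fun n => Ex P (fun w => h (t * Y' n w)) +
      (Ex P (fun w => h (t * Y n w)) - Ex P (fun w => h (t * Y' n w))))); last by apply/funext => n; rewrite addrC subrK.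
  apply: cvgD => //.
  have ct : `|t| * Ex P (fun w => `|Y n w - Y' n w|) @[n --> \oo] --> (0 : R) by rewrite -(mulr0 `|t|); exact: cvgMl_tmp.
  apply: (cvg0_near_le ct); near=> n.
  rewrite -ExB//; apply: le_trans (Ex_abs P (bmfB (b1 n) (b2 n))) _.
  have bn := bmf_norm (bmfB (bY n) (bY' n)).
  rewrite -ExZ//; apply: Ex_le; [exact: bmf_norm (bmfB (b1 n) (b2 n))|exact: bmfZ|].
  by move=> w; apply: le_trans (hlip _ _) _; rewrite -mulrBr normrM.
split.
  apply: close; [by move=> n; exact: bmf_cos|by move=> n; exact: bmf_cos| |].
    by move=> x y; exact: cos_lipschitz.
  exact: (@cvg_Ex_cos _ _ _ P Y' v bY' ccum1 ccumne).
apply: close; [by move=> n; exact: bmf_sin|by move=> n; exact: bmf_sin| |].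
  by move=> x y; exact: sin_lipschitz.
exact: (@cvg_Ex_sin _ _ _ P Y' v bY' ccum1 ccumne).
Unshelve. all: by end_near. Qed.

End Field.

(** * Stationarity and translations *)

Section Translation.
Context (R : realType) (dT : measure_display) (T : measurableType dT).
Context (P : probability T R) (d : nat) (X : {RV P >-> config d}).
Hypothesis stat : stationary P X.

Lemma translateE (mu : set (lattice d)) y x : translate mu y x <-> mu (x - y).
Proof.
split=> [[z mz <-]|h]; first by rewrite addrK.
by exists (x - y) => //; rewrite subrK.
Qed.

Lemma translateD (mu : set (lattice d)) x y : translate (translate mu x) y = translate mu (x + y).
Proof.
apply/seteqP; split=> z /translateE.
  by move=> /translateE h; apply/translateE; rewrite opprD addrA addrAC.
by move=> h; apply/translateE/translateE; rewrite -addrA -opprD [y + x]addrC.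
Qed.

Lemma translate0 (mu : set (lattice d)) : translate mu 0 = mu.
Proof. by apply/seteqP; split=> z; rewrite translateE subr0. Qed.

Lemma local_translate (f : set (lattice d) -> R) (A : seq (lattice d)) y : local f A ->
  local (fun mu => f (translate mu y)) [seq x - y | x <- A].
Proof.
move=> lf mu nu h; apply: lf => x xA; rewrite !translateE; apply: h.
exact: map_f.
Qed.

Lemma measurable_translate y : measurable_fun setT (fun w => translate (X w) y : config d).
Proof.
apply: (@measurability _ _ T (config d) setT _ (@coordinate_events d) erefl) => _ [_ [x _ <-] <-].
rewrite setTI (_ : _ @^-1` _ = [set w | X w (x - y)]); first exact: measurable_site.
by apply/seteqP; split=> w /translateE.
Qed.

Lemma Ex_translate (f : config d -> R) y : bmf f ->
  Ex P (fun w => f (translate (X w) y)) = Ex P (fun w => f (X w)).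
Proof.
move=> bf; have mX : measurable_fun setT (X : T -> config d) by exact: measurable_funP.
have [Q1 [h1 e1]] := pushforward_probability P (measurable_translate y).
have [Q2 [h2 e2]] := pushforward_probability P mX.
have [_ e1f] := e1 _ bf; have [_ e2f] := e2 _ bf.
have -> : (fun w => f (translate (X w) y)) = f \o (fun w => translate (X w) y : config d) by [].
rewrite -e1f -[RHS]e2f; rewrite /Ex /Rintegral; congr fine.
apply: eq_measure_integral => B mB _.
by apply: etrans (h1 B mB) _; apply: etrans (stat y mB) _; exact/esym/(h2 B mB).
Qed.

Lemma local_bmf_config (f : config d -> R) (A : seq (lattice d)) : local f A -> bmf f.
Proof.
elim: A f => [|x A IH] f lf.
  by rewrite (_ : f = fun=> f set0); [exact: bmf_cst|apply/funext => mu; apply: lf].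
rewrite (_ : f = (fun mu => f (mu `\ x) + contains [:: x] mu * (f (x |` mu) - f (mu `\ x)))); last first.
  by apply/funext => mu; exact: local_split.
have b0 := IH _ (local_remove lf); have b1 := IH _ (local_add lf).
have bx : bmf (fun mu : config d => contains [:: x] mu : R).
  rewrite (_ : (fun _ => _) = (fun mu => \1_[set mu : config d | mu x] mu)).
    by apply: bmf_indic; apply: sub_sigma_algebra; exists x.
  apply/funext => mu; rewrite indicE /contains; congr (nat_of_bool _)%:R.
  apply/asboolP/idP => [h|/set_mem h y]; first by rewrite inE; apply: h; rewrite inE.
  by rewrite inE => /eqP->.
exact: (bmfD b0 (bmfM bx (bmfB b1 b0))).
Qed.

Lemma bmf_translate (f : config d -> R) y : bmf f -> bmf (fun w => f (translate (X w) y)).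
Proof.
by move=> bf; have [Q [_ e1]] := pushforward_probability P (measurable_translate y); have [] := e1 _ bf.
Qed.

Lemma bmf_config (f : config d -> R) : bmf f -> bmf (fun w => f (X w)).
Proof.
move=> bf; have := bmf_translate 0 bf.
by under eq_fun do rewrite translate0.
Qed.

Lemma bmf_window (h : config d -> R) n : bmf (fun w => h (X w `&` window d n)).
Proof.
have l : local (fun mu => h (mu `&` window d n)) (wfs d n).
  move=> mu nu e; congr (h _); apply/seteqP; split=> x [mx xn]; split=> //; apply/(e x) => //;
    by rewrite in_wfs.
exact: bmf_config (local_bmf_config l).
Qed.

Lemma bmf_shift (f : config d -> R) y : bmf f -> bmf (fun mu : config d => f (translate mu y)).
Proof.
case=> mf [M fM]; split; last by exists M => mu; exact: fM.
apply: (measurableT_comp mf).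
apply: (@measurability _ _ (config d) (config d) setT _ (@coordinate_events d) erefl) => _ [_ [x _ <-] <-].
rewrite setTI (_ : _ @^-1` _ = [set mu | mu (x - y)]); last first.
  by apply/seteqP; split=> w /translateE.
by apply: sub_sigma_algebra; exists (x - y).
Qed.

Lemma cv_translate (f g : config d -> R) x y : bmf f -> bmf g ->
  cv P (fun w => f (translate (X w) (- x))) (fun w => g (translate (X w) (- y))) =
  cv P (fun w => f (X w)) (fun w => g (translate (X w) (- (y - x)))).
Proof.
move=> bf bg; rewrite /cv Ex_translate// Ex_translate// [in RHS]Ex_translate//; congr (_ - _).
have := @Ex_translate (fun mu => f mu * g (translate mu (- (y - x)))) (- x) (bmfM bf (bmf_shift _ bg)).
move=> <-; congr (Ex P _); apply/funext => w; congr (_ * g _).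
by rewrite translateD opprB addrA addNr add0r.
Qed.

End Translation.

(** * Convergence of normalized covariances *)

Section CovarianceLimit.
Context (R : realType) (dT : measure_display) (T : measurableType dT).
Context (P : probability T R) (d : nat) (X : {RV P >-> config d}).
Hypothesis d0 : (0 < d)%N.
Hypothesis stat : stationary P X.
Variable q : nat.
Hypothesis q0 : (0 < q)%N.
Hypothesis mix : mixing X q.

Variables (M : R) (eta : nat -> R).
Hypothesis feta : fastdec eta.
Variables (V W : nat -> set (lattice d) -> R) (Z Y : set (lattice d) -> R).
Hypotheses (lV : forall m, local (V m) (supbox 0 m.+1)) (lW : forall m, local (W m) (supbox 0 m.+1)).
Hypotheses (VM : forall m mu, `|V m mu| <= M) (WM : forall m mu, `|W m mu| <= M).
Hypotheses (bZ : bmf (Z : config d -> R)) (bY : bmf (Y : config d -> R)).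
Hypotheses (ZM : forall mu, `|Z mu| <= M) (YM : forall mu, `|Y mu| <= M).
Hypotheses (VZ : forall m, Ex P (fun w => `|V m (X w) - Z (X w)|) <= eta m)
  (WY : forall m, Ex P (fun w => `|W m (X w) - Y (X w)|) <= eta m).

Definition limit_cov (z : lattice d) : R :=
  cv P (fun w => Z (X w)) (fun w => Y (translate (X w) (- z))).
Let cm m (z : lattice d) : R := cv P (fun w => V m (X w)) (fun w => W m (translate (X w) (- z))).

Let M0 : 0 <= M. Proof. exact: le_trans (normr_ge0 _) (ZM set0). Qed.

Lemma cm_limit_cov m z : `|cm m z - limit_cov z| <= 4 * M * eta m.
Proof.
have bV := local_bmf_config (@lV m); have bW := local_bmf_config (@lW m).
have bVX := bmf_config X bV; have bZX := bmf_config X bZ.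
have bWX := bmf_translate X (- z) bW; have bYX := bmf_translate X (- z) bY.
have s0 (u v : T -> R) : (fun w => `|u w - 0 - v w|) = (fun w => `|u w - v w|).
  by apply/funext => w; rewrite subr0.
have := cv_approx P 0 0 bVX bWX bZX bYX (fun w => WM m _) (fun w => ZM _).
rewrite !s0 => /le_trans; apply.
have -> : Ex P (fun w => `|W m (translate (X w) (- z)) - Y (translate (X w) (- z))|) =
    Ex P (fun w => `|W m (X w) - Y (X w)|).
  exact: (Ex_translate stat (f := fun mu => `|W m mu - Y mu|) (- z) (bmf_norm (bmfB bW bY))).
have h3 := ler_wpM2l M0 (VZ m); have h4 := ler_wpM2l M0 (WY m).
move: (Ex P _) (Ex P _) h3 h4 => x y h3 h4; rewrite -!mulrA; move: (M * _) (M * _) (M * _) h3 h4 => p r s; lra.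
Qed.

Lemma supbox_sub (x : lattice d) m : [seq y - (- x) | y <- supbox 0 m] =i supbox x m.
Proof.
move=> y; apply/mapP/supboxP => [[z /supboxP zb ->] i|yb].
  by have := zb i; rewrite !mxE subr0 opprK addrK.
exists (y - x); last by rewrite opprK subrK.
by apply/supboxP => i; have := yb i; rewrite !mxE subr0.
Qed.

Lemma local_at (f : set (lattice d) -> R) x m : local f (supbox 0 m) ->
  local (fun mu => f (translate mu (- x))) (supbox x m).
Proof.
move=> lf; apply: (local_sub _ (@local_translate _ _ f _ (- x) lf)) => y; by rewrite supbox_sub.
Qed.

Lemma far_cov : exists e : nat -> R, [/\ fastdec e, forall m, 0 <= e m &
  forall m x y (f g : set (lattice d) -> R), (0 < m)%N -> (range d q m <= l1norm (x - y))%N ->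
    local f (supbox x m.+1) -> local g (supbox y m.+1) ->
    (forall mu, `|f mu| <= M) -> (forall mu, `|g mu| <= M) ->
    `|cv P (fun w => f (X w)) (fun w => g (X w))| <= e m].
Proof.
have [e [fe e0 he]] := mix (2 * 2 ^ d)%N.
exists (fun m => M * M * e m); split=> [|m|m x y f g m0 xy lf lg fM gM].
- exact: fastdecZ.
- by rewrite !mulr_ge0.
apply: he lf lg fM gM => //; last by move=> a b; exact: supbox_separated.
have h : ((2 * m.+1).+1 ^ d <= 2 ^ d * (2 * m).+1 ^ d)%N by rewrite -expnMn leq_exp2r//; lia.
by rewrite !size_supbox addnn -mul2n -mulnA leq_mul2l h.
Qed.

(** Both scores are truncated at a level [m] of order the [q]-th root of the distance. The truncated
    scores then live on separated boxes, and both errors decay fast in [m], hence in the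
    distance. *)
Lemma limit_cov_decay : exists C : R, forall z,
  `|limit_cov z| * (l1norm z).+1%:R ^+ d.+1 <= C.
Proof.
have [e [fe e0 he]] := far_cov.
pose kap := (4 * d).+1.
pose f m : R := kap%:R ^+ d.+1 * m.+1%:R ^+ (q * d.+1) * (4 * M * eta m + e m).
have ff : fastdec f.
  apply: fastdec_poly; apply: fastdecD => //; exact: fastdecZ.
have [B hB] := fastdec_bound ff.
exists (2 * M * M * kap%:R ^+ d.+1 + `|B|) => z.
have cz : `|limit_cov z| <= 2 * M * M.
  apply: cv_bound; [exact: bmf_config|exact: bmf_translate|by move=> w|by move=> w].
set m := nroot q (l1norm z %/ kap).
have zm : ((l1norm z).+1 <= kap * m.+1 ^ q)%N.
  have := ltn_nrootS q0 (l1norm z %/ kap); rewrite -/m => h.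
  have := divn_eq (l1norm z) kap; have := ltn_pmod (l1norm z) (ltn0Sn (4 * d)).
  rewrite -/kap; move: (_ %/ _)%N h (_ %% _)%N => u uh v vk ->.
  by apply: (@leq_trans (u.+1 * kap)%N); [rewrite mulSn -addnS addnC leq_add2r|rewrite mulnC leq_mul2l uh orbT].
have zmR : (l1norm z).+1%:R ^+ d.+1 <= kap%:R ^+ d.+1 * m.+1%:R ^+ (q * d.+1) :> R by rewrite exprM -exprMn lerXn2r ?nnegrE ?mulr_ge0 ?exprn_ge0// -natrX -natrM ler_nat.
have [m0|m0] := posnP m.
  apply: (@le_trans _ _ (2 * M * M * kap%:R ^+ d.+1)); last by rewrite lerDl.
  by apply: ler_pM => //; rewrite ?exprn_ge0//; apply: le_trans zmR _; rewrite m0 expr1n mulr1.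
apply: (@le_trans _ _ `|B|); last by rewrite lerDr !mulr_ge0 ?exprn_ge0.
apply: (@le_trans _ _ (f m)); last by apply: le_trans (ler_norm _) _; apply: le_trans (hB m) (ler_norm _).
rewrite mulrC; apply: ler_pM => //; rewrite ?exprn_ge0//.
have far : (range d q m <= l1norm (0 - z))%N.
  rewrite sub0r l1normN; apply: leq_trans; first exact: range_le.
  by rewrite mulnC -leq_divRL//; exact: nrootX_le.
have h1 := he m 0 z (V m) (fun mu => W m (translate mu (- z))) m0 far (@lV m) (local_at (x := z) (@lW m)) (VM m) (fun mu => WM m _).
have h2 := cm_limit_cov m z.
by rewrite -(subKr (cm m z) (limit_cov z)); apply: le_trans (ler_normB _ _) _; rewrite addrC lerD.
Qed.

Variables (U U' : nat -> nat -> lattice d -> set (lattice d) -> R) (L : nat).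
Hypothesis L1 : (q * d.+1 + 1 <= L)%N.
Hypotheses (lU : forall m n x, local (U m n x) (supbox x m.+1))
  (lU' : forall m n x, local (U' m n x) (supbox x m.+1)).
Hypotheses (UM : forall m n x mu, `|U m n x mu| <= M) (UM' : forall m n x mu, `|U' m n x mu| <= M).
Hypotheses
  (UV : forall m n x mu, (l1norm x + d * m.+2 <= n)%N -> U m n x mu = V m (translate mu (- x)))
  (UW : forall m n x mu, (l1norm x + d * m.+2 <= n)%N -> U' m n x mu = W m (translate mu (- x))).

Let cU m n x y := cv P (fun w => U m n x (X w)) (fun w => U' m n y (X w)).

(** Far sites contribute through mixing. Near sites of a bulk row are recentred by stationarity and
    compared with the limiting series, whose tail costs [C'' / m]. Rows close to the boundary
    receive only a crude bound, which is harmless because they are few. *)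
Lemma cov_row_bound : exists e : nat -> R, exists s C'' : R,
  [/\ has_sum limit_cov s, fastdec e, forall m, 0 <= e m, 0 <= C'' &
  forall m n x, (0 < m)%N -> (l1norm x <= n)%N ->
   `|\sum_(y <- wfs d n) cU m n x y - s| <=
     #|` wfs d n|%:R * e m + (4 * M * eta m) * (2 * range d q m).+1%:R ^+ d + C'' / m%:R +
     (if (n < l1norm x + (range d q m + d * m.+2))%N then
        `|s| + 2 * M * M * (2 * range d q m).+1%:R ^+ d else 0)].
Proof.
have [e [fe e0 he]] := far_cov.
have [C hC] := limit_cov_decay.
have [s hs [C'' hC'']] := has_sum_polynomial_decay d0 hC.
have C''0 : 0 <= C'' by have := le_trans (normr_ge0 _) (hC'' 0%N); rewrite divr1.
exists e, s, C''; split=> // m n x m0 xn.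
set rho := range d q m.
have rho_m : (m <= rho)%N by apply: (@leq_trans (m ^ q)%N); [rewrite -{1}[m]expn1 leq_pexp2l|exact: leq_addr].
have rho0 : (0 < rho)%N by apply: leq_trans rho_m.
have eta0 : 0 <= eta m by apply: le_trans (VZ m); exact: Ex_ge0.
rewrite (bigID (fun y => (l1norm (x - y) < rho)%N)) /=.
set N1 := \sum_(y <- _ | _) _; set F1 := \sum_(y <- _ | _) _.
have F1b : `|F1| <= #|` wfs d n|%:R * e m.
  apply: le_trans (ler_norm_sum _ _ _) _.
  apply: (@le_trans _ _ (\sum_(y <- wfs d n) e m)).
    rewrite [leRHS](bigID (fun y => ~~ (l1norm (x - y) < rho)%N)) /=.
    rewrite -[leLHS]addr0; apply: lerD; last by apply: sumr_ge0.
    apply: ler_sum => y; rewrite -leqNgt => xy.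
    exact: (he m x y (U m n x) (U' m n y) m0 xy (@lU m n x) (@lU' m n y) (UM m n x) (UM' m n y)).
  by rewrite sum_const_seq.
have cntb : (size [seq y <- wfs d n | (l1norm (x - y) < rho)%N] <= (2 * rho).+1 ^ d)%N.
  rewrite -(size_supbox x); apply: uniq_leq_size; first by rewrite filter_uniq ?fset_uniq.
  move=> y; rewrite mem_filter => /andP[xy _]; apply/supboxP => i.
  by have := coord_le_l1norm (y - x) i; rewrite !mxE l1normB => /leq_trans; apply; exact: ltnW.
have N1b : `|N1| <= 2 * M * M * (2 * rho).+1%:R ^+ d.
  rewrite /N1 -big_filter; apply: le_trans (ler_norm_sum _ _ _) _.
  apply: (@le_trans _ _ (\sum_(y <- [seq y <- wfs d n | (l1norm (x - y) < rho)%N]) 2 * M * M)).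
    apply: ler_sum => y _; apply: cv_bound; [exact: local_bmf (@lU m n x)|exact: local_bmf (@lU' m n y)|by move=> w|by move=> w].
  rewrite sum_const_seq [leLHS]mulrC ler_wpM2l ?mulr_ge0//.
  by rewrite -natrX ler_nat.
case: ifP => [_|/negbT].
  rewrite (_ : N1 + F1 - s = F1 + (N1 - s)); last by ring.
  apply: le_trans (ler_normD _ _) _; rewrite -!addrA; apply: lerD => //.
  apply: ler_wpDl; first by rewrite !mulr_ge0 ?exprn_ge0.
  apply: ler_wpDl; first by rewrite divr_ge0.
  by apply: le_trans (ler_normB _ _) _; rewrite addrC lerD2l.
rewrite -leqNgt => bulk.
(* The bulk condition leaves room for the near range and for the boxes of radius [m+1], so every
   field value in the sum is the translate of the stationary one. *)
have N1E : N1 = \sum_(z <- wfs d rho.-1) cm m z.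
  have bxm : (l1norm x + d * m.+2 <= n)%N by apply: leq_trans bulk; rewrite leq_add2l leq_addl.
  rewrite /N1 -big_filter.
  rewrite (perm_big [seq x + z | z <- wfs d rho.-1]) /=.
    rewrite big_map big_seq [RHS]big_seq; apply: eq_bigr => z; rewrite in_wfs => zr.
    have zb : (l1norm (x + z) + d * m.+2 <= n)%N.
      apply: leq_trans bulk; rewrite addnA leq_add2r; apply: leq_trans (l1normD _ _) _.
      by rewrite leq_add2l; apply: leq_trans zr _; exact: leq_pred.
    rewrite /cU /cm; under eq_fun do rewrite UV//.
    under [X in cv P _ X]eq_fun do rewrite UW//.
    rewrite (cv_translate stat x (x + z) (local_bmf_config (@lV m)) (local_bmf_config (@lW m))).
    by congr (cv P _ _); apply/funext => w; rewrite addrC addKr.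
  apply: uniq_perm; rewrite ?filter_uniq ?fset_uniq//.
    by rewrite map_inj_uniq ?fset_uniq//; exact: addrI.
  move=> y; rewrite mem_filter; apply/andP/mapP => [[xy yn]|[z]].
    exists (y - x); last by rewrite addrC subrK.
    by rewrite in_wfs l1normB -ltnS prednK.
  rewrite in_wfs => zr ->; rewrite opprD addrA subrr sub0r l1normN.
  split; first by rewrite -(prednK rho0) ltnS.
  rewrite in_wfs; apply: leq_trans bulk; apply: leq_trans (l1normD _ _) _.
  by rewrite leq_add2l; apply: leq_trans zr _; apply: leq_trans (leq_pred _) (leq_addr _ _).
rewrite addr0 (_ : N1 + F1 - s = F1 + ((\sum_(z <- wfs d rho.-1) (cm m z - limit_cov z)) +
   (\sum_(z <- wfs d rho.-1) limit_cov z - s))); last by rewrite sumrB -N1E; ring.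
apply: le_trans (ler_normD _ _) _; rewrite -addrA; apply: lerD => //.
apply: le_trans (ler_normD _ _) _; apply: lerD.
  apply: le_trans (ler_norm_sum _ _ _) _.
  apply: (@le_trans _ _ (\sum_(z <- wfs d rho.-1) 4 * M * eta m)).
    by apply: ler_sum => z _; exact: cm_limit_cov.
  rewrite sum_const_seq [leLHS]mulrC ler_wpM2l ?mulr_ge0//.
  rewrite -natrX ler_nat; apply: leq_trans (wfs_card_le d _) _.
  by rewrite leq_exp2r// ltnS leq_mul2l leq_pred.
apply: le_trans (hC'' _) _; rewrite prednK// ler_wpM2l// lef_pV2 ?posrE ?ltr0n//.
by rewrite ler_nat.
Qed.

(** Averaging the row bounds: bulk errors vanish with [m], and the boundary rows, of order
    [m^q n^(d-1)] with values of order [m^(qd)], are negligible against the volume. *)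
Lemma cov_sum_cvg : exists2 s : R, has_sum limit_cov s &
  (#|` wfs d n|%:R)^-1 * (\sum_(x <- wfs d n) \sum_(y <- wfs d n) cU (nroot L n) n x y)
    @[n --> \oo] --> s.
Proof.
have [e [s [C'' [hs fe e0 C''0 hrow]]]] := cov_row_bound.
exists s => //.
have L0 : (0 < L)%N by apply: leq_trans L1; rewrite addn1.
pose kap := (4 * d).+1.
pose K1 : R := (2 * kap).+1%:R ^+ d.
pose f1 n : R := n.+1%:R ^+ d * (2 ^+ d * e (nroot L n)).
pose f2 n : R := (4 * M * K1 * (nroot L n).+1%:R ^+ (q * d)) * eta (nroot L n).
pose f3 n : R := C'' * (nroot L n)%:R^-1.
pose K2 : R := (kap + 3 * d)%N%:R * 2 * (2 ^+ d.-1 * d%:R ^+ d) * (`|s| + 2 * M * M * K1).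
pose f4 n : R := K2 * (nroot L n)%:R^-1.
have c1 : f1 n @[n --> \oo] --> (0 : R).
  exact: (fastdec_nroot L0 d (fastdecZ (2 ^+ d) fe)).
have c2 : f2 n @[n --> \oo] --> (0 : R).
  exact: cvg_comp (cvg_nroot L0) (fastdec_cvg0 (fastdec_poly (4 * M * K1) (q * d) feta)).
have c3 : f3 n @[n --> \oo] --> (0 : R) by rewrite -(mulr0 C''); apply: cvgMl_tmp; exact: nroot_inv_cvg0.
have c4 : f4 n @[n --> \oo] --> (0 : R) by rewrite -(mulr0 K2); apply: cvgMl_tmp; exact: nroot_inv_cvg0.
have cf : f1 n + f2 n + f3 n + f4 n @[n --> \oo] --> (0 : R) by rewrite -(addr0 0) -[X in X + 0](addr0 0) -[X in X + 0 + 0](addr0 0); do 3 (apply: cvgD => //).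
apply/cvgrPdist_le => eps eps0; near=> n.
apply: (@le_trans _ _ `|f1 n + f2 n + f3 n + f4 n|); last by near: n; move/cvgr0Pnorm_le: cf; exact.
apply: le_trans (ler_norm _).
have m0 : (0 < nroot L n)%N by near: n; exact: (near_nroot L0 1).
have mk : (kap + 3 * d <= nroot L n)%N by near: n; exact: (near_nroot L0 (kap + 3 * d)).
have mL := nrootX_le L0 n.
rewrite /f1 /f2 /f3 /f4; move: (nroot L n) m0 mk mL => m m0 mk mL.
set w := (#|` wfs d n|%:R : R); have w0 : 0 < w by rewrite ltr0n wfs_gt0.
have eta0 : 0 <= eta m by apply: le_trans (VZ m); exact: Ex_ge0.
have m1R : 1 <= m%:R :> R by rewrite ler1n.
have rho_le := range_le d0 q0 m0; rewrite -/kap in rho_le.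
have rK : (2 * range d q m).+1%:R ^+ d <= K1 * m%:R ^+ (q * d) :> R.
  rewrite exprM -exprMn lerXn2r ?nnegrE ?mulr_ge0 ?exprn_ge0// -natrX -natrM ler_nat.
  have mq : (0 < m ^ q)%N by rewrite expn_gt0 m0.
  have h : (2 * range d q m <= 2 * kap * m ^ q)%N by rewrite -mulnA leq_mul2l rho_le.
  move: (2 * range d q m)%N (2 * kap)%N (m ^ q)%N h mq => n1 n2 n3 h2 n30.
  by rewrite mulSn -addn1 addnC leq_add.
have K10 : 0 <= K1 by rewrite exprn_ge0.
have mm1 : m%:R ^+ (q * d) <= m.+1%:R ^+ (q * d) :> R by rewrite lerXn2r ?nnegrE// ler_nat.
set r := (range d q m + d * m.+2)%N.
have r_le : (r <= (kap + 3 * d) * m ^ q)%N.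
  rewrite /r mulnDl; apply: leq_add => //.
  apply: (@leq_trans (3 * d * m)%N); last by rewrite leq_mul2l -{1}[m]expn1 leq_pexp2l ?orbT.
  by rewrite mulnAC mulnC leq_mul2r; apply/orP; right; lia.
have rn : (r <= n)%N.
  apply: leq_trans mL; apply: leq_trans r_le _; apply: (@leq_trans (m ^ q.+1)%N).
    by rewrite expnS leq_mul2r mk orbT.
  rewrite leq_pexp2l//; apply: leq_trans L1; rewrite addn1 ltnS mulnS.
  exact: leq_addr.
pose bd := [seq x <- wfs d n | (n < l1norm x + r)%N].
have bdc : (size bd <= r * (2 * (2 * n).+1 ^ d.-1))%N.
  rewrite -(leq_add2l #|` wfs d (n - r)|); apply: leq_trans (wfs_shell d0 n r).
  have -> : (#|` wfs d (n - r)| + size bd)%N = size (wfs d (n - r) ++ bd) by rewrite size_cat.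
  apply: uniq_leq_size => [|x].
    rewrite cat_uniq fset_uniq filter_uniq ?fset_uniq// andbT /=; apply/hasPn => x.
    rewrite mem_filter in_wfs => /andP[h _]; apply/negP; rewrite in_wfs leq_subRL// => h2.
    by move: h; rewrite ltnNge addnC h2.
  rewrite mem_cat mem_filter !in_wfs => /orP[h|/andP[_ //]].
  by apply: leq_trans h _; exact: leq_subr.
pose B1 := w * e m + 4 * M * eta m * (2 * range d q m).+1%:R ^+ d + C'' / m%:R.
pose B2 := `|s| + 2 * M * M * (2 * range d q m).+1%:R ^+ d.
have B20 : 0 <= B2 by rewrite addr_ge0// !mulr_ge0 ?exprn_ge0.
have total : `|\sum_(x <- wfs d n) (\sum_(y <- wfs d n) cU m n x y - s)| <= w * B1 + (size bd)%:R * B2.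
  apply: le_trans (ler_norm_sum _ _ _) _.
  apply: (@le_trans _ _ (\sum_(x <- wfs d n) (B1 + (if (n < l1norm x + r)%N then B2 else 0)))).
    rewrite big_seq [leRHS]big_seq; apply: ler_sum => x; rewrite in_wfs => xn; exact: hrow.
  rewrite big_split /= sum_const_seq lerD2l.
  by rewrite -big_mkcond /= -big_filter sum_const_seq.
have -> : s - w^-1 * (\sum_(x <- wfs d n) \sum_(y <- wfs d n) cU m n x y) =
    - (w^-1 * (\sum_(x <- wfs d n) (\sum_(y <- wfs d n) cU m n x y - s))).
  have sw : \sum_(x <- wfs d n) s = w * s by rewrite sum_const_seq.
  by rewrite sumrB sw mulrBr mulKf ?lt0r_neq0// opprB.
rewrite normrN normrM ger0_norm ?invr_ge0 ?(ltW w0)//.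
apply: le_trans (ler_wpM2l _ total) _; first by rewrite invr_ge0 ltW.
rewrite mulrDr mulKf ?lt0r_neq0//; apply: lerD; first apply: lerD; first apply: lerD.
- by rewrite mulrA ler_wpM2r// mulrC wfs_card_leR.
- rewrite [leRHS]mulrAC -!mulrA ler_wpM2l// [in leLHS]mulrC -!mulrA.
  rewrite [leLHS]mulrA [leLHS]mulrC.
  rewrite [leRHS](_ : _ = M * eta m * (K1 * m.+1%:R ^+ (q * d))); last by ring.
  rewrite [leLHS](_ : _ = M * eta m * (2 * range d q m).+1%:R ^+ d); last by ring.
  rewrite ler_wpM2l ?mulr_ge0//; apply: le_trans rK _; exact: ler_wpM2l.
- by [].
have wge : n.+1%:R ^+ d <= d%:R ^+ d * w.
  rewrite /w -!natrX -natrM ler_nat; apply: (@leq_trans (d ^ d * (n %/ d).+1 ^ d)%N); last by rewrite leq_mul2l wfs_card_ge ?orbT.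
  rewrite -expnMn leq_exp2r// mulnC; exact: ltn_ceil.
have sb : (size bd)%:R <= (kap + 3 * d)%N%:R * m%:R ^+ q * 2 * (2 ^+ d.-1 * n.+1%:R ^+ d.-1) :> R.
  rewrite -exprMn -natrM -!natrX -!natrM ler_nat; apply: leq_trans bdc _.
  rewrite -[X in (_ <= X)%N]mulnA; apply: leq_mul; first exact: r_le.
  by rewrite leq_mul2l /=; case: (d.-1) => // p; rewrite leq_exp2r// leq_doubleS.
have B2b : B2 <= (`|s| + 2 * M * M * K1) * m%:R ^+ (q * d).
  rewrite mulrDl lerD//; first by rewrite ler_peMr// exprn_ege1.
  by rewrite -!mulrA !ler_wpM2l.
have n1 : 0 < n.+1%:R :> R by rewrite ltr0n.
have wge2 : n.+1%:R ^+ d.-1 * w^-1 <= d%:R ^+ d / n.+1%:R :> R.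
  rewrite ler_pdivrMr// mulrAC ler_pdivlMr// -exprSr prednK//.
(* The requirement [q(d+1) + 1 <= L] leaves one spare power of [m], and this gives the rate [1/m] of
   the boundary term. *)
have mn : m%:R ^+ (q * d) * m%:R ^+ q * m%:R <= n.+1%:R :> R.
  rewrite -exprD -exprSr -natrX ler_nat; apply: leq_trans (leqW mL).
  by rewrite leq_pexp2l//; apply: leq_trans L1; rewrite addn1 ltnS mulnS addnC.
apply: (@le_trans _ _ (w^-1 * ((kap + 3 * d)%N%:R * m%:R ^+ q * 2 * (2 ^+ d.-1 * n.+1%:R ^+ d.-1) *
    ((`|s| + 2 * M * M * K1) * m%:R ^+ (q * d))))).
  by rewrite ler_wpM2l ?invr_ge0 ?(ltW w0)// ler_pM.
have s0 : 0 <= `|s| + 2 * M * M * K1 by rewrite addr_ge0// !mulr_ge0.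
rewrite /K2; move: (`|s| + _) s0 => S S0.
rewrite [leLHS](_ : _ = (kap + 3 * d)%N%:R * 2 * 2 ^+ d.-1 * S * (m%:R ^+ (q * d) * m%:R ^+ q) * (n.+1%:R ^+ d.-1 * w^-1)); last by ring.
have h0 : 0 <= (kap + 3 * d)%N%:R * 2 * 2 ^+ d.-1 * S :> R by rewrite !mulr_ge0 ?exprn_ge0.
apply: le_trans (ler_wpM2l _ wge2) _; first by rewrite mulr_ge0// mulr_ge0 ?exprn_ge0.
have mp : 0 < m%:R :> R by rewrite ltr0n.
rewrite [X in X <= _]mulrA ler_pdivrMr// [X in _ <= X]mulrAC ler_pdivlMr//.
rewrite [leLHS](_ : _ = (kap + 3 * d)%N%:R * 2 * 2 ^+ d.-1 * S * d%:R ^+ d * (m%:R ^+ (q * d) * m%:R ^+ q * m%:R)); last by ring.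
rewrite [leRHS](_ : _ = (kap + 3 * d)%N%:R * 2 * 2 ^+ d.-1 * S * d%:R ^+ d * n.+1%:R); last by ring.
by rewrite ler_wpM2l// mulr_ge0// exprn_ge0.
Unshelve. all: by end_near. Qed.

End CovarianceLimit.

(** * Tightness from second moments *)

Section SecondMoments.
Context (R : realType) (dT : measure_display) (T : measurableType dT).
Context (P : probability T R).

Lemma Ex_sqr_centered (f : T -> R) : bmf f -> Ex P (fun w => (f w - Ex P f) ^+ 2) = cv P f f.
Proof.
move=> bf; rewrite /cv.
rewrite (_ : (fun _ => _) = (fun w => f w * f w + (- (2 * Ex P f)) * f w + Ex P f ^+ 2)); last first.
  by apply/funext => w; ring.
have b2 := bmfM bf bf; have bZ := bmfZ (- (2 * Ex P f)) bf; have bc := @bmf_cst _ _ T (Ex P f ^+ 2).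
by rewrite (ExD _ (bmfD b2 bZ) bc) (ExD _ b2 bZ) ExZ// Ex_cst; ring.
Qed.

(** Markov's inequality: the squared norm divided by [A^2] dominates the indicator of leaving the
    box. *)
Lemma tight_of_second_moment p (Y : nat -> T -> 'rV[R]_p) (C : R) :
  (forall n i, bmf (fun w => Y n w 0 i)) ->
  (\forall n \near \oo, Ex P (fun w => \sum_i Y n w 0 i ^+ 2) <= C) ->
  forall e : R, 0 < e -> exists2 A : R, 0 < A &
  \forall n \near \oo, exists b : T -> R, [/\ bmf b, forall w, 0 <= b w,
    forall w, ~ (forall i, `|Y n w 0 i| <= A) -> 1 <= b w & Ex P b <= e].
Proof.
move=> bY YC e e0; pose A := Num.sqrt ((`|C| + 1) / e).
have Ap : 0 < (`|C| + 1) / e by rewrite divr_gt0// ltr_wpDl.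
have A0 : 0 < A by rewrite sqrtr_gt0.
have A2 : A ^+ 2 = (`|C| + 1) / e by rewrite sqr_sqrtr// ltW.
exists A => //; near=> n.
have bS : bmf (fun w => \sum_i Y n w 0 i ^+ 2) by apply: bmf_sum => i _; exact: bmfX.
exists (fun w => (A ^+ 2)^-1 * \sum_i Y n w 0 i ^+ 2); split.
- exact: bmfZ.
- by move=> w; rewrite mulr_ge0 ?invr_ge0 ?exprn_ge0 ?(ltW A0)// sumr_ge0// => i _; exact: sqr_ge0.
- move=> w /existsNP[i /negP]; rewrite -ltNge => Ai.
  rewrite mulrC ler_pdivlMr ?exprn_gt0// mul1r (bigD1 i)//=.
  apply: ler_wpDr; first by apply: sumr_ge0 => j _; exact: sqr_ge0.
  by rewrite -[leRHS]real_normK ?num_real// lerXn2r ?nnegrE ?(ltW A0)// ltW.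
rewrite ExZ// mulrC ler_pdivrMr ?exprn_gt0// A2 mulrC divfK ?lt0r_neq0//.
have : Ex P (fun w => \sum_i Y n w 0 i ^+ 2) <= C by near: n.
move=> /le_trans; apply; rewrite (le_trans (ler_norm _))// lerDl//.
Unshelve. all: by end_near. Qed.

Lemma integral_Ex (f : T -> R) : bmf f -> (\int[P]_w (f w)%:E = (Ex P f)%:E)%E.
Proof.
by move=> bf; rewrite /Ex /Rintegral fineK//; apply: integrable_fin_num => //; exact: bmf_integrable.
Qed.

Lemma bmf_continuous_rV p (Y : T -> 'rV[R]_p) (f : 'rV[R]_p -> R) :
  (forall i, bmf (fun w => Y w 0 i)) -> continuous f -> (exists M, forall x, `|f x| <= M) ->
  bmf (f \o Y).
Proof.
move=> bY cf [M fM]; split; last by exists M => w; exact: fM.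
have mY : measurable_fun setT (Y : T -> borel 'rV[R]_p) by apply: measurable_rV => i; exact: (bY i).1.
exact: measurableT_comp (borel_measurable_continuous cf) mY.
Qed.

End SecondMoments.

(** * Several functionals at once *)

Section LocalSystem.
Context (R : realType) (dT : measure_display) (T : measurableType dT).
Context (P : probability T R) (d : nat) (X : {RV P >-> config d}).
Hypothesis d0 : (0 < d)%N.
Hypothesis stat : stationary P X.
Variable q : nat.
Hypothesis q0 : (0 < q)%N.
Hypothesis mix : mixing X q.

Variables (p : nat) (M : R) (r c1 : nat) (eta : nat -> R).
Variables (S : 'I_p -> nat -> T -> R) (al : 'I_p -> nat -> R).
Variables (U : 'I_p -> nat -> nat -> lattice d -> set (lattice d) -> R).
Hypothesis feta : fastdec eta.
Hypothesis bS : forall i n, bmf (S i n).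
Hypothesis SM : forall i n w, `|S i n w| <= M * n.+1%:R ^+ r.
Hypothesis lU : forall i m n x, local (U i m n x) (supbox x m.+1).
Hypothesis UM : forall i m n x mu, `|U i m n x mu| <= M.
Hypothesis SU : forall i m n, (c1 * m.+1 <= n)%N ->
  Ex P (fun w => `|S i n w - al i n - \sum_(x <- wfs d n) U i m n x (X w)|) <= n.+1%:R ^+ r * eta m.

Let W n : R := #|` wfs d n|%:R.

Let W_gt0 n : 0 < W n. Proof. by rewrite ltr0n wfs_gt0. Qed.

Let bU i m n : bmf (fun w => \sum_(x <- wfs d n) U i m n x (X w)).
Proof. by apply: bmf_sum => x _; have h := @local_bmf _ _ _ P _ X _ _ (@lU i m n x). Qed.

Section Combination.
Variables (t : 'rV[R]_p) (tS : nat -> T -> R).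
Hypothesis tSE : forall n w, tS n w = \sum_i t 0 i * S i n w.
Let t1 := \sum_i `|t 0 i|.

Let btS n : bmf (tS n).
Proof.
rewrite (_ : tS n = fun w => \sum_i t 0 i * S i n w); last exact/funext.
by apply: bmf_sum => i _; exact: bmfZ.
Qed.

(** The Cramer-Wold reduction: a linear combination of locally approximable functionals is again
    locally approximable, with constants multiplied by the sum of the coefficients. *)
Lemma clt_combination (c nu v : R) (a : nat -> R) : 0 < c -> 0 < nu -> (v = 1 \/ nu = 1) ->
  (forall n, 0 < a n) -> (\forall n \near \oo, c * W n `^ nu <= a n ^+ 2) ->
  (a n)^-1 ^+ 2 * cv P (tS n) (tS n) @[n --> \oo] --> v ->
  forall s,
  Ex P (fun w => cos (s * ((a n)^-1 * (tS n w - Ex P (tS n))))) @[n --> \oo] --> expR (- (s ^+ 2 * v / 2)) /\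
  Ex P (fun w => sin (s * ((a n)^-1 * (tS n w - Ex P (tS n))))) @[n --> \oo] --> (0 : R).
Proof.
move=> c0 nu0 vnu a0 ac cvv s.
have t1_ge0 : 0 <= t1 by apply: sumr_ge0.
have M_ge0 i : 0 <= M := le_trans (normr_ge0 _) (UM i 0%N 0%N 0 classical_sets.set0).
pose u m n x mu := \sum_i t 0 i * U i m n x mu.
have := @clt_of_local_approximation _ _ _ _ _ _ d0 _ q0 mix tS (fun n => \sum_i t 0 i * al i n)
  (t1 * M) c nu v a r c1 (fun m => t1 * eta m) u c0 nu0 vnu.
move=> /(_ (fastdecZ t1 feta) btS); apply => //.
- move=> n w; rewrite tSE; apply: le_trans (ler_norm_sum _ _ _) _.
  by rewrite -mulrA /t1 mulr_suml; apply: ler_sum => i _; rewrite normrM ler_wpM2l.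
- by move=> m n x mu mu' h; apply: eq_bigr => i _; congr (_ * _); exact: lU h.
- move=> m n x mu; apply: le_trans (ler_norm_sum _ _ _) _.
  by rewrite /t1 mulr_suml; apply: ler_sum => i _; rewrite normrM ler_wpM2l.
- move=> m n mn; have bD i : bmf (fun w => `|S i n w - al i n - \sum_(x <- wfs d n) U i m n x (X w)|).
    apply: bmf_norm; apply: bmfB; last exact: bU.
    by apply: bmfB => //; exact: (bmf_cst _).
  apply: (@le_trans _ _ (Ex P (fun w => \sum_i `|t 0 i| * `|S i n w - al i n - \sum_(x <- wfs d n) U i m n x (X w)|))).
    apply: Ex_le.
    + apply: bmf_norm; apply: bmfB; first by apply: bmfB => //; exact: (bmf_cst _).
      apply: bmf_sum => x _; apply: bmf_sum => i _; apply: bmfZ.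
      have h := @local_bmf _ _ _ P _ X _ _ (@lU i m n x); exact: h.
    + by apply: bmf_sum => i _; exact: bmfZ.
    move=> w; rewrite tSE /u exchange_big/= -!sumrB.
    apply: le_trans (ler_norm_sum _ _ _) _; apply: ler_sum => i _.
    by rewrite -mulr_sumr -!mulrBr normrM.
  rewrite Ex_sum => [|i _]; last exact: bmfZ.
  rewrite mulrCA /t1 mulr_suml; apply: ler_sum => i _.
  by rewrite ExZ// ler_wpM2l// SU.
Qed.

End Combination.

(** The convergence theorem concerns row vectors, so the scalar variable is viewed as a row of
    length one and the limit is pushed forward to the line. *)
Lemma clt_single (i : 'I_p) (c nu : R) : 0 < c -> 0 < nu ->
  (\forall n \near \oo, c * W n `^ nu <= cv P (S i n) (S i n)) ->
  cvg_in_law P (fun n w => cv P (S i n) (S i n) `^ (- 2^-1) * (S i n w - Ex P (S i n)))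
    (fun f => \int[normal_prob 0 1]_x (f x)%:E)%E.
Proof.
move=> c0 nu0 hv; pose v n := cv P (S i n) (S i n).
(* The normalization must be positive for every [n], while the variance bound holds only eventually;
   the value 1 fills the finitely many exceptions. *)
pose a n := if 0 < v n then Num.sqrt (v n) else 1.
have a0 n : 0 < a n by rewrite /a; case: ifPn => // h; rewrite sqrtr_gt0.
have v0 : \forall n \near \oo, 0 < v n.
  near=> n; apply: (@lt_le_trans _ _ (c * W n `^ nu)); first by rewrite mulr_gt0// powR_gt0.
  by near: n.
have a2 : \forall n \near \oo, a n ^+ 2 = v n by near=> n; rewrite /a ifT ?sqr_sqrtr// ?ltW//; near: n.
pose y n w := (a n)^-1 * (S i n w - Ex P (S i n)).
pose Y n w : 'rV[R]_1 := const_mx (y n w).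
have by1 n : bmf (y n) by apply: bmfZ; apply: bmfB => //; exact: (bmf_cst _).
have [gamma [gG gchf]] : exists gamma : probability (borel 'rV[R]_1) R,
    is_gaussian gamma 1%:M /\ forall t,
    Ex gamma (fun x => cos (dot t x)) = expR (- (qform 1%:M t / 2)) /\
    Ex gamma (fun x => sin (dot t x)) = 0.
  apply: gaussian_exists; first exact: trmx1.
  by move=> t; rewrite /qform mulmx1 mxE big_ord1 mxE -expr2 sqr_ge0.
have dotY (t : 'rV[R]_1) n w : dot t (Y n w) = t 0 0 * y n w by rewrite /dot big_ord1 mxE.
have clt (s : R) : Ex P (fun w => cos (s * y n w)) @[n --> \oo] --> expR (- (s ^+ 2 / 2)) /\
    Ex P (fun w => sin (s * y n w)) @[n --> \oo] --> (0 : R).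
  have SE n w : S i n w = \sum_j (delta_mx 0 i : 'rV[R]_p) 0 j * S j n w.
    rewrite (bigD1 i)//= mxE !eqxx mul1r big1 ?addr0// => j ji.
    by rewrite mxE (negPf ji) andbF mul0r.
  have := clt_combination SE c0 nu0 (or_introl erefl) a0.
  move=> /(_ _ _ s); rewrite mulr1; apply.
    by near=> n; rewrite (near a2 n)//; near: n.
  apply: (@cvg_trans _ ((fun=> 1) n @[n --> \oo])); last exact: cvg_cst.
  apply: near_eq_cvg; near=> n; rewrite exprVn (near a2 n)// mulVf// lt0r_neq0//; near: n; exact: v0.
have lawY : cvg_in_law P Y (fun f => \int[gamma]_x (f x)%:E)%E.
  apply: cvg_in_law_chf => //.
  - by move=> n f cf bf; apply: bmf_continuous_rV => // j; rewrite (_ : (fun _ => _) = y n)//; apply/funext => w; rewrite mxE.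
  - apply: (@tight_of_second_moment _ _ _ _ _ _ 1); first by move=> n j; rewrite (_ : (fun _ => _) = y n)//; apply/funext => w; rewrite mxE.
    near=> n; rewrite (_ : (fun _ => _) = (fun w => (a n)^-1 ^+ 2 * (S i n w - Ex P (S i n)) ^+ 2)); last first.
      by apply/funext => w; rewrite big_ord1 mxE exprMn.
    rewrite ExZ ?Ex_sqr_centered//; last by apply: bmfX; apply: bmfB => //; exact: (bmf_cst _).
    rewrite exprVn (near a2 n)// mulVf// lt0r_neq0//; near: n; exact: v0.
  - move=> t; under eq_fun do under eq_fun do rewrite dotY.
    rewrite (gchf t).1 /qform mulmx1 mxE big_ord1 mxE -expr2 -[X in X / 2]mulr1.
    by have := (clt (t 0 0)).1; rewrite mulr1.
  - move=> t; under eq_fun do under eq_fun do rewrite dotY.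
    by rewrite (gchf t).2; exact: (clt (t 0 0)).2.
move=> f cf fM.
have cf1 : continuous (fun x : 'rV[R]_1 => f (x 0 0)) by move=> x; apply: continuous_comp; [exact: continuous_coord|exact: cf].
have bf1 : exists N, forall x : 'rV[R]_1, `|f (x 0 0)| <= N by have [N hN] := fM; exists N.
have bf : bmf (f : measurableTypeR R -> R) by split; [exact: continuous_measurable_fun|exact: fM].
have mc : measurable_fun setT (fun x : borel 'rV[R]_1 => x 0 0 : measurableTypeR R) by apply: borel_measurable_continuous; exact: continuous_coord.
have [Q [QE QI]] := pushforward_probability gamma mc.
have eqI : (\int[gamma]_x (f (x 0 0))%:E = \int[normal_prob 0 1]_x (f x)%:E)%E.
  have [bfc eE] := QI _ bf.
  rewrite -[LHS]/(\int[gamma]_x ((f \o (fun x : borel 'rV[R]_1 => x 0 0)) x)%:E)%E.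
  rewrite integral_Ex// -eE -integral_Ex//; apply: eq_measure_integral => B mB _.
  apply: etrans (QE B mB) _; have [_ /(_ (const_mx 1))[_ /(_ B mB)]] := gG.
  have -> : ((const_mx 1 : 'rV[R]_1) *m (1%:M : 'M[R]_1) *m (const_mx 1 : 'rV[R]_1)^T) 0 0 = 1 by rewrite mulmx1 mxE big_ord1 !mxE mulr1.
  rewrite /centered_normal oner_eq0 sqrtr1 => h; apply: etrans h.
  congr (gamma _); apply/seteqP; split=> x /=; rewrite mxE big_ord1 !mxE mulr1//.
rewrite -eqI; apply: cvg_trans (lawY _ cf1 bf1).
apply: near_eq_cvg; near=> n; congr expectation; apply/funext => w; rewrite mxE /y; congr (f (_ * _)).
rewrite powRN; congr (_^-1); rewrite powR12_sqrt; last by apply: ltW; near: n; exact: v0.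
by rewrite /a ifT//; near: n.
Unshelve. all: by end_near. Qed.


Variable V : 'I_p -> nat -> set (lattice d) -> R.
Variable Z : 'I_p -> set (lattice d) -> R.
Hypothesis lV : forall i m, local (V i m) (supbox 0 m.+1).
Hypothesis VM : forall i m mu, `|V i m mu| <= M.
Hypothesis bZ : forall i, bmf (Z i : config d -> R).
Hypothesis ZM : forall i mu, `|Z i mu| <= M.
Hypothesis VZ : forall i m, Ex P (fun w => `|V i m (X w) - Z i (X w)|) <= eta m.
Hypothesis UV : forall i m n x mu, (l1norm x + d * m.+2 <= n)%N ->
  U i m n x mu = V i m (translate mu (- x)).

Lemma cov_S_cvg (i j : 'I_p) : exists2 s : R, has_sum (limit_cov X (Z i) (Z j)) s &
  (W n)^-1 * cv P (S i n) (S j n) @[n --> \oo] --> s.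
Proof.
have M0 : 0 <= M := le_trans (normr_ge0 _) (UM i 0%N 0%N 0 classical_sets.set0).
pose L := (q * d.+1 + 1 + 1)%N; have L1 : (q * d.+1 + 1 <= L)%N by rewrite leq_addr.
have L2 : (2 <= L)%N by rewrite /L; nia.
have [s hs cs] := cov_sum_cvg d0 stat q0 mix feta (lV i) (lV j) (VM i) (VM j) (bZ i) (bZ j)
  (ZM i) (ZM j) (VZ i) (VZ j) L1 (lU i) (lU j) (UM i) (UM j) (UV i) (UV j).
exists s => //.
pose A k n w := \sum_(x <- wfs d n) U k (nroot L n) n x (X w).
have bA k n : bmf (A k n) := bU k (nroot L n) n.
pose E k n := Ex P (fun w => `|S k n w - al k n - A k n w|).
have E0 k n : 0 <= E k n by exact: Ex_ge0.
have dA n : cv P (A i n) (A j n) = \sum_(x <- wfs d n) \sum_(y <- wfs d n)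
    cv P (fun w => U i (nroot L n) n x (X w)) (fun w => U j (nroot L n) n y (X w)).
  have bu k x : bmf (fun w => U k (nroot L n) n x (X w)) by have h := @local_bmf _ _ _ P _ X _ _ (@lU k (nroot L n) n x).
  rewrite /A cv_suml//; apply: eq_bigr => x _; rewrite cv_sumr//.
have c1' := @approx_error_cvg0 _ _ _ P d X d0 q q0 (S i) (al i) r c1 L eta (U i) (2 * M) r L2 feta (SU i).
have c2' := @approx_error_cvg0 _ _ _ P d X d0 q q0 (S j) (al j) r c1 L eta (U j) (2 * (2 ^+ d * M)) d L2 feta (SU j).
have c12 : 2 * (M * n.+1%:R ^+ r) * E i n + 2 * (2 ^+ d * M * n.+1%:R ^+ d) * E j n @[n --> \oo] --> (0 : R) by rewrite -[0 : R]addr0; apply: cvgD; under eq_fun do rewrite (mulrA 2); [exact: c1'|exact: c2'].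
have c3 : (W n)^-1 * (cv P (S i n) (S j n) - cv P (A i n) (A j n)) @[n --> \oo] --> (0 : R).
  apply: (cvg0_near_le c12); near=> n.
  rewrite normrM ger0_norm ?invr_ge0 ?(ltW (W_gt0 n))//.
  have h := cv_approx P (al i n) (al j n) (bS i n) (bS j n) (bA i n) (bA j n) (SM j n)
    (fun w => field_sum_bound n (fun x => UM i (nroot L n) n x (X w))).
  by apply: le_trans h; rewrite ler_piMl// invf_le1// /W ler1n wfs_gt0.
have -> : (fun n => (W n)^-1 * cv P (S i n) (S j n)) = (fun n => (W n)^-1 * cv P (A i n) (A j n) +
    (W n)^-1 * (cv P (S i n) (S j n) - cv P (A i n) (A j n))).
  by apply/funext => n; ring.
rewrite -[s]addr0; apply: cvgD => //.
by under eq_fun do rewrite dA.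
Unshelve. all: by end_near. Qed.

(** [Sigma] is a limit of covariance matrices, hence symmetric and nonnegative, so a Gaussian law
    with this covariance exists even if degenerate. Each linear form is normalized by the square
    root of the volume, with [nu = 1] and [v] equal to its limiting variance. *)
Lemma clt_vector : exists (Sigma : 'M[R]_p) (gamma : probability (borel 'rV[R]_p) R),
  [/\ forall i j, has_sum (limit_cov X (Z i) (Z j)) (Sigma i j),
      forall i j, (W n)^-1 * cv P (S i n) (S j n) @[n --> \oo] --> Sigma i j,
      is_gaussian gamma Sigma &
      cvg_in_law P (fun n w => \row_(i < p) (W n `^ (- 2^-1) * (S i n w - Ex P (S i n))))
        (fun f => \int[gamma]_x (f x)%:E)%E].
Proof.
pose Sigma := \matrix_(i < p, j < p) projT1 (cid2 (cov_S_cvg i j)).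
have hS i j : has_sum (limit_cov X (Z i) (Z j)) (Sigma i j) by rewrite mxE; case: cid2.
have cS i j : (W n)^-1 * cv P (S i n) (S j n) @[n --> \oo] --> Sigma i j by rewrite mxE; case: cid2.
have sS : Sigma^T = Sigma.
  apply/matrixP => i j; rewrite mxE; have := cS j i; under eq_fun do rewrite cvC.
  by move=> /(cvg_lim (@Rhausdorff R)) <-; exact/(cvg_lim (@Rhausdorff R)).
pose tS (t : 'rV[R]_p) n w := \sum_i t 0 i * S i n w.
have btS t n : bmf (tS t n) by apply: bmf_sum => i _; exact: bmfZ.
have cT t : (W n)^-1 * cv P (tS t n) (tS t n) @[n --> \oo] --> qform Sigma t.
  have -> : (fun n => (W n)^-1 * cv P (tS t n) (tS t n)) =
      (fun n => \sum_i \sum_j t 0 i * t 0 j * ((W n)^-1 * cv P (S i n) (S j n))).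
    apply/funext => n; rewrite /tS cv_suml => [|i _|]; [|exact: bmfZ|exact: btS].
    rewrite mulr_sumr; apply: eq_bigr => i _; rewrite cv_sumr => [|j _|]; [|exact: bmfZ|exact: bmfZ].
    rewrite mulr_sumr; apply: eq_bigr => j _; rewrite cvZl ?cvZr//; last exact: bmfZ.
    ring.
  have -> : qform Sigma t = \sum_i \sum_j t 0 i * t 0 j * Sigma i j.
    rewrite /qform mxE exchange_big/=; apply: eq_bigr => j _; rewrite !mxE mulr_suml.
    by apply: eq_bigr => i _; ring.
  apply: cvg_ord_sum => i; apply: cvg_ord_sum => j; exact: cvgMl_tmp.
have qS t : 0 <= qform Sigma t.
  rewrite leNgt; apply/negP => q0'; have /cvgrPdist_lt/(_ (- qform Sigma t)) := cT t.
  rewrite oppr_gt0 => /(_ q0')[N _ /(_ N (leqnn N))].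
  rewrite distrC ltr_norml => /andP[_]; apply/negP; rewrite -leNgt lerBrDl subrr.
  by rewrite mulr_ge0 ?invr_ge0 ?(ltW (W_gt0 N))//; apply: cv_ge0; exact: btS.
have [gamma [gG gchf]] := gaussian_exists sS qS.
exists Sigma, gamma; split => //.
pose a n := Num.sqrt (W n).
have a0 n : 0 < a n by rewrite sqrtr_gt0.
have WE n : W n `^ (- 2^-1) = (a n)^-1 by rewrite powRN powR12_sqrt ?ltW.
have a2 n : (a n)^-1 ^+ 2 = (W n)^-1 by rewrite exprVn sqr_sqrtr ?ltW.
pose Y n w := \row_(i < p) (W n `^ (- 2^-1) * (S i n w - Ex P (S i n))).
have bY n i : bmf (fun w => Y n w 0 i).
  rewrite (_ : (fun _ => _) = (fun w => W n `^ (- 2^-1) * (S i n w - Ex P (S i n)))).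
    by apply: bmfZ; apply: bmfB => //; exact: (bmf_cst _).
  by apply/funext => w; rewrite mxE.
have dotY t n w : dot t (Y n w) = 1 * ((a n)^-1 * (tS t n w - Ex P (tS t n))).
  rewrite mul1r /dot /tS Ex_sum => [|i _]; last exact: bmfZ.
  rewrite -sumrB mulr_sumr; apply: eq_bigr => i _; rewrite mxE WE ExZ//; ring.
have clt t := @clt_combination t (tS t) (fun n w => erefl) 1 1 (qform Sigma t) a ltr01 ltr01 (or_intror erefl) a0.
have hac : \forall n \near \oo, 1 * W n `^ 1 <= a n ^+ 2 by near=> n; rewrite mul1r powRr1 ?(ltW (W_gt0 _))// sqr_sqrtr// (ltW (W_gt0 _)).
have hcv t : (a n)^-1 ^+ 2 * cv P (tS t n) (tS t n) @[n --> \oo] --> qform Sigma t by under eq_fun do rewrite a2; exact: cT.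
apply: cvg_in_law_chf.
- by move=> n f cf bf; apply: bmf_continuous_rV => // i; exact: (bY n i).
- apply: (@tight_of_second_moment _ _ _ _ _ _ (\sum_i Sigma i i + 1)); first exact: bY.
  have cD : \sum_i (W n)^-1 * cv P (S i n) (S i n) @[n --> \oo] --> \sum_i Sigma i i by apply: cvg_ord_sum => i.
  near=> n; apply: (@le_trans _ _ (\sum_i (W n)^-1 * cv P (S i n) (S i n))).
    rewrite Ex_sum => [|i _]; last by apply: bmfX; exact: (bY n i).
    apply: ler_sum => i _.
    rewrite (_ : (fun _ => _) = (fun w => (W n)^-1 * (S i n w - Ex P (S i n)) ^+ 2)); last first.
      by apply/funext => w; rewrite mxE exprMn WE a2.
    by rewrite ExZ ?Ex_sqr_centered//; apply: bmfX; apply: bmfB => //; exact: (bmf_cst _).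
  have : `|\sum_i Sigma i i - \sum_i (W n)^-1 * cv P (S i n) (S i n)| <= 1 by near: n; move/cvgrPdist_le: cD; exact.
  by rewrite ler_norml => /andP[h _]; rewrite -lerBlDl -opprB lerNl.
- move=> t; under eq_fun do under eq_fun do rewrite dotY.
  rewrite (gchf t).1; have := (clt t hac (hcv t) 1).1; by rewrite expr1n mul1r.
- move=> t; under eq_fun do under eq_fun do rewrite dotY.
  rewrite (gchf t).2; exact: (clt t hac (hcv t) 1).2.
Unshelve. all: by end_near. Qed.

End LocalSystem.

(** * Lattice clusters *)

Section Clusters.
Variable d : nat.
Implicit Types (x y z : lattice d) (A B : set (lattice d)).

(** Distance at most 1 in the supremum norm, that is, the closed unit cubes meet. This is coarser
    than the edges of the Cayley graph, and the relation is reflexive. *)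
Definition adj x y := [forall i, (`|x 0%R i - y 0%R i| <= 1)%N].

Lemma adjP x y : reflect (forall i, (`|x 0%R i - y 0%R i| <= 1)%N) (adj x y).
Proof. exact: forallP. Qed.

Lemma adj_refl x : adj x x.
Proof. by apply/adjP => i; rewrite subrr. Qed.

Lemma adj_sym x y : adj x y = adj y x.
Proof. by apply: eq_forallb => i; rewrite -abszN opprB. Qed.

Lemma adj_translate x y z : adj (x + z) (y + z) = adj x y.
Proof. by apply: eq_forallb => i; rewrite !mxE opprD addrACA subrr addr0. Qed.

Inductive cluster A x : lattice d -> Prop :=
| cluster_base of A x : cluster A x x
| cluster_step y z of cluster A x y & A z & adj y z : cluster A x z.

Lemma cluster_sub A x : cluster A x `<=` A.
Proof. by move=> y []. Qed.

Lemma cluster_self A x y : cluster A x y -> A x.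
Proof. by elim. Qed.

Lemma cluster_trans A x y z : cluster A x y -> cluster A y z -> cluster A x z.
Proof. by move=> xy; elim=> // u v _ xu Av uv; exact: cluster_step uv. Qed.

Lemma cluster_sym A x y : cluster A x y -> cluster A y x.
Proof.
elim=> [Ax|u v xu ux Av uv]; first exact: cluster_base.
apply: cluster_trans ux; apply: (@cluster_step _ _ v); first exact: cluster_base.
- exact: cluster_sub xu.
- by rewrite adj_sym.
Qed.

Lemma cluster_mono A B x : A `<=` B -> cluster A x `<=` cluster B x.
Proof.
move=> AB y; elim=> [/AB|u v _ xu /AB Bv uv]; first exact: cluster_base.
exact: cluster_step uv.
Qed.

Lemma cluster_eq A x y : cluster A x y -> cluster A y = cluster A x.
Proof.
move=> xy; apply/seteqP; split=> z h; first exact: cluster_trans h.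
exact: cluster_trans (cluster_sym xy) h.
Qed.

Lemma cluster_idem A x y : cluster A x y -> cluster (cluster A x) x y.
Proof.
move=> xy; elim: xy => [Ax|u v xu IH Av uv]; first by apply: cluster_base; exact: cluster_base.
by apply: (cluster_step IH _ uv); exact: cluster_step uv.
Qed.

Lemma cluster_within A B x : cluster A x `<=` B -> B `<=` A -> cluster B x = cluster A x.
Proof.
move=> AB BA; apply/seteqP; split; first exact: cluster_mono.
by move=> y /cluster_idem; exact: cluster_mono.
Qed.

(** Exploration of the cluster never looks beyond the neighbours of its points, so agreement on a
    box one unit larger suffices. This makes truncated scores local. *)
Lemma cluster_agree A B x m : (forall y, y \in supbox x m.+1 -> A y <-> B y) ->
  (forall y, cluster A x y -> y \in supbox x m) -> cluster A x = cluster B x.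
Proof.
move=> AB Am; have AmS y z : cluster A x y -> adj y z -> z \in supbox x m.+1.
  move=> /Am/supboxP h /adjP yz; apply/supboxP => i; have := h i; have := yz i; lia.
have x0 : x \in supbox x m.+1 by apply/supboxP => i; rewrite subrr.
have h1 y : cluster A x y -> cluster B x y.
  move=> xy; elim: xy => [Ax|u v xu IH Av uv]; first by apply: cluster_base; apply/AB.
  by apply: (cluster_step IH _ uv); apply/AB => //; exact: AmS uv.
apply/seteqP; split=> y; first exact: h1.
elim=> [Bx|u v xu IH Bv uv]; first by apply: cluster_base; apply/AB.
by apply: (cluster_step IH _ uv); apply/AB => //; exact: AmS uv.
Qed.

Lemma cluster_translate A x z : cluster (translate A z) (x + z) = translate (cluster A x) z.
Proof.
apply/seteqP; split=> y.
  elim=> [/translateE|u v _ IH Av uv].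
    by rewrite addrK => Ax; exists x => //; exact: cluster_base.
  move: IH Av => /translateE h1 /translateE h2; apply/translateE; apply: cluster_step h1 h2 _.
  by rewrite adj_translate.
move=> [u xu <-]; elim: xu => [Ax|v w _ IH Aw vw]; first by apply: cluster_base; exists x.
by apply: cluster_step IH _ _; [exists w|rewrite adj_translate].
Qed.

(** As adjacency is reflexive, separated sets are also disjoint. *)
Definition separated A B := forall a b, A a -> B b -> ~~ adj a b.

Lemma cluster_setD A x : separated (cluster A x) (A `\` cluster A x).
Proof. by move=> a b xa [Ab nb]; apply/negP => ab; apply: nb; exact: cluster_step ab. Qed.

Lemma cluster_notin A x y : A y -> ~ cluster A x y -> cluster (A `\` cluster A x) y = cluster A y.
Proof.
move=> Ay ny; apply: cluster_within => [z yz|z []//].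
split; first exact: cluster_sub yz.
by move=> xz; apply: ny; apply: cluster_trans xz _; exact: cluster_sym.
Qed.

(* First exit from a box of a cluster that is not contained in it. *)
Lemma cluster_exit A x m : A x -> ~ (forall y, cluster A x y -> y \in supbox x m) ->
  exists2 y, y \in supbox x m.+1 & (y \notin supbox x m) /\ cluster A x y.
Proof.
move=> Ax nA; apply: contrapT => h; apply: nA => y; elim=> [_|u v xu IH Av uv].
  by apply/supboxP => i; rewrite subrr.
apply/negPn/negP => vm; apply: h; exists v.
  move/supboxP: IH => IH; move/adjP: uv => uv.
  by apply/supboxP => i; have := IH i; have := uv i; lia.
by split=> //; exact: cluster_step uv.
Qed.

End Clusters.

(** * Score decomposition of additive functionals *)

Section ClusterSum.
Variables (R : realType) (d : nat) (h : set (lattice d) -> R).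
Hypothesis hU : forall A B, finite_set A -> finite_set B -> separated A B -> h (A `|` B) = h A + h B.

Lemma additive_set0 : h classical_sets.set0 = 0.
Proof.
have h0 := hU (@finite_set0 _) (@finite_set0 _) (fun a b (a0 : classical_sets.set0 a) _ => False_ind _ a0).
by move: h0; rewrite setUid => /eqP; rewrite -subr_eq subrr eq_sym => /eqP.
Qed.

(** Peel off one cluster at a time. Its contribution is spread evenly over its points, so the sum
    over those points returns it exactly. *)
Lemma cluster_sum (A : set (lattice d)) : finite_set A ->
  h A = \sum_(x <- fset_set A) h (cluster A x) / #|` fset_set (cluster A x)|%:R.
Proof.
move: {2}(#|` fset_set A|) (leqnn #|` fset_set A|) => n.
elim: n A => [|n IH] A An fA.
  have A0 : fset_set A = fset0 by apply/eqP; rewrite -cardfs_eq0 -leqn0.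
  by rewrite A0 big_seq_fset0 (fset_set_set0 fA A0) additive_set0.
have [->|/set0P[x Ax]] := eqVneq A classical_sets.set0.
  by rewrite fset_set0 big_seq_fset0 additive_set0.
have CA := @cluster_sub d A x; have fC := sub_finite_set CA fA.
have fD : finite_set (A `\` cluster A x) by apply: finite_setD.
have AE : A = cluster A x `|` (A `\` cluster A x) by rewrite setDUK.
have xC : x \in fset_set (cluster A x) by rewrite in_fset_set// inE; exact: cluster_base.
have C0 : (0 < #|` fset_set (cluster A x)|)%N by rewrite cardfs_gt0; apply/fset0Pn; exists x.
have pA : perm_eq (fset_set A) (fset_set (cluster A x) ++ fset_set (A `\` cluster A x)).
  apply: uniq_perm; first exact: fset_uniq.
    rewrite cat_uniq !fset_uniq andbT /=; apply/hasPn => y; rewrite !in_fset_set// !inE => -[_ ny].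
    by rewrite notin_setE.
  by move=> y; rewrite {1}AE fset_setU// inE mem_cat.
rewrite (perm_big _ pA) big_cat/= [in LHS]AE hU//; last exact: cluster_setD.
congr (_ + _).
  rewrite (eq_big_seq (fun=> h (cluster A x) / #|` fset_set (cluster A x)|%:R)) => [|y].
    rewrite sum_const_seq mulrCA divff ?mulr1//.
    by rewrite pnatr_eq0 -lt0n.
  by rewrite in_fset_set// inE => xy; rewrite (cluster_eq xy).
rewrite IH//; last first.
  move: An C0; rewrite (perm_size pA) size_cat; move: (size _) (size _) => a b; lia.
apply: eq_big_seq => y; rewrite in_fset_set// inE => -[Ay ny].
by rewrite cluster_notin.
Qed.

End ClusterSum.

(** * Topological components are lattice clusters *)

Section ClusterComponents.
Variables (R : realType) (d : nat).
Implicit Types (x y : lattice d) (A : set (lattice d)).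

Lemma cubes_mono A B : A `<=` B -> cubes R A `<=` cubes R B.
Proof. by move=> AB p [x Ax h]; exists x => //; exact: AB. Qed.

Lemma embed_cubes A x : cubes R A (embed R x) <-> A x.
Proof.
split=> [[y Ay h]|Ax]; last by exists x => // i; rewrite mxE subrr normr0 invr_ge0.
suff -> : x = y by [].
apply/rowP => i; have := h i; rewrite mxE -intrB -intr_norm.
have [->//|n] := eqVneq (x 0 i) (y 0 i).
have : (1 <= `|x 0 i - y 0 i|) by move/eqP: n; lia.
rewrite -(ler_int R) => h1 h2; have := le_trans h1 h2.
by rewrite leNgt invf_lt1// ltr1n.
Qed.

(** Cubes of points at integer distance at least 2 in some coordinate are at distance at least 1, so
    the strict inequality forces adjacency. *)
Lemma near_cubes_adj x y (p q : 'rV[R]_d) : (forall i, `|p 0 i - (x 0 i)%:~R| <= 2^-1) ->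
  (forall i, `|q 0 i - (y 0 i)%:~R| <= 2^-1) -> (forall i, `|p 0 i - q 0 i| < 1) -> adj x y.
Proof.
move=> hx hy pq; apply/adjP => i.
have : (`|(x 0 i - y 0 i)%:~R| < 2%:~R :> R).
  rewrite intrB; have := hx i; have := hy i; have := pq i.
  move: (p 0 i) (q 0 i) ((x 0 i)%:~R : R) ((y 0 i)%:~R : R) => a b u v.
  rewrite ltr_norml !ler_norml ltr_norml; lra.
by rewrite -intr_norm ltr_int; lia.
Qed.

Lemma connected_cube x (p q : 'rV[R]_d) : cubes R [set x] p -> cubes R [set x] q ->
  connected_component (cubes R [set x]) p q.
Proof.
move=> [_ -> hp] [_ -> hq].
pose g (t : R) : 'rV[R]_d := p + t *: (q - p).
have cg : continuous g by move=> t; apply: cvgD; [exact: cvg_cst|apply: cvgZr_tmp].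
exists (g @` `[0, 1]); last by exists 1; rewrite /= ?in_itv/= ?lexx ?ler01// /g scale1r addrC subrK.
split.
- by exists 0; rewrite /= ?in_itv/= ?lexx ?ler01// /g scale0r addr0.
- move=> _ [t /= t01 <-]; exists x => // i; rewrite /g !mxE.
  move: t01; rewrite in_itv/= => /andP[t0 t1].
  have := hp i; have := hq i; move: (p 0 i) (q 0 i) ((x 0 i)%:~R : R) => a b u.
  rewrite !ler_norml => /andP[b1 b2] /andP[a1 a2].
  have e : a + t * (b - a) - u = (1 - t) * (a - u) + t * (b - u) by ring.
  rewrite e; have t1' : 0 <= 1 - t by rewrite subr_ge0.
  apply/andP; split.
    have h1 := ler_wpM2l t1' a1; have h2 := ler_wpM2l t0 b1; move: (lerD h1 h2); lra.
  have h1 := ler_wpM2l t1' a2; have h2 := ler_wpM2l t0 b2; move: (lerD h1 h2); lra.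
- apply: connected_continuous_connected; first exact: segment_connected.
  exact: continuous_subspaceT.
Qed.

Lemma cluster_connected A x y : cluster A x y ->
  connected_component (cubes R A) (embed R x) (embed R y).
Proof.
elim=> [Ax|u v xu IH Av uv].
  by apply: connected_component_refl; apply/embed_cubes.
apply: connected_component_trans IH _.
pose r : 'rV[R]_d := \row_i (((u 0 i)%:~R + (v 0 i)%:~R) / 2).
have h (a b : int) : (`|a - b| <= 1)%N -> `|((a%:~R + b%:~R) / 2 - a%:~R : R)| <= 2^-1.
  move=> ab; rewrite (_ : _ - _ = (b - a)%:~R / 2); last by rewrite intrB; field.
  rewrite normrM (@ger0_norm _ (2^-1 : R)) ?invr_ge0// ler_piMl ?invr_ge0// -intr_norm (ler_int R _ 1%Z); lia.
have ru : cubes R [set u] r by exists u => // i; rewrite mxE; apply: h; exact: (adjP _ _ uv i).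
have rv : cubes R [set v] r.
  exists v => // i; rewrite mxE [X in X / 2]addrC; apply: h.
  by move: uv; rewrite adj_sym => /adjP; exact.
have sub z : A z -> cubes R [set z] `<=` cubes R A by move=> Az; apply: cubes_mono => _ ->.
have c1 := connected_cube (proj2 (embed_cubes [set u] u) erefl) ru.
have c2 := connected_cube rv (proj2 (embed_cubes [set v] v) erefl).
apply: (@connected_component_trans _ _ r).
  by case: c1 => B [Bu Bs Bc] Br; exists B => //; split=> //; apply: subset_trans Bs (sub _ (cluster_sub xu)).
by case: c2 => B [Bu Bs Bc] Br; exists B => //; split=> //; apply: subset_trans Bs (sub _ Av).
Qed.

(** Inside the union of cubes, the cubes of a cluster are both open and closed, because other cubes
    are at distance at least 1. Conversely, adjacent cubes share a point and each cube is
    connected. *)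
Lemma component_cluster A x : A x -> @component R d x A = cubes R (cluster A x).
Proof.
move=> Ax; apply/seteqP; split=> p.
  case=> B [Bx BA Bc] Bp.
  pose O := \bigcup_(q in cubes R (cluster A x)) ball q (1 : R).
  pose O' := \bigcup_(q in cubes R (A `\` cluster A x)) ball q (1 : R).
  have oO : open O by apply: bigcup_open => q _; exact: ball_open.
  have oO' : open O' by apply: bigcup_open => q _; exact: ball_open.
  have ballE (q1 q2 : 'rV[R]_d) : ball q1 (1 : R) q2 -> forall i, `|q1 0 i - q2 0 i| < 1 by move=> [_ h] i; exact: (h 0 i).
  have BO : B `&` cubes R (cluster A x) = B `&` O.
    apply/seteqP; split=> q [Bq].
      by move=> cq; split=> //; exists q => //; exact: ballxx.
    move=> [q' [y xy hy] /ballE q'q]; split=> //.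
    have [z Az hz] := BA _ Bq; exists z => //; apply: cluster_step xy Az _.
    exact: near_cubes_adj hy hz q'q.
  have BO' : B `&` cubes R (cluster A x) = B `&` ~` O'.
    apply/seteqP; split=> q [Bq].
      move=> [y xy hy]; split=> // -[q' [z [Az nz] hz] /ballE q'q]; apply: nz.
      apply: cluster_step xy Az _; rewrite adj_sym; exact: near_cubes_adj hz hy q'q.
    move=> nO'; split=> //; have [z Az hz] := BA _ Bq; exists z => //.
    apply: contrapT => nz; apply: nO'; exists q; last exact: ballxx.
    by exists z.
  have BE : B `&` cubes R (cluster A x) = B.
    apply: Bc.
    - exists (embed R x); split=> //; apply/embed_cubes; exact: cluster_base.
    - by exists O.
    - by exists (~` O') => //; exact: open_closedC.
  by move: Bp; rewrite -BE => -[].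
move=> [y xy hy].
apply: connected_component_trans (cluster_connected xy) _.
have : connected_component (cubes R [set y]) (embed R y) p by apply: connected_cube; [apply/embed_cubes|exists y].
case=> B [Bu Bs Bc] Bp; exists B => //; split=> //; apply: subset_trans Bs _.
by apply: cubes_mono => _ ->; exact: cluster_sub xy.
Qed.

Lemma component_out A x : ~ A x -> @component R d x A = classical_sets.set0.
Proof.
move=> nA; apply: connected_component_out => /embed_cubes; exact: nA.
Qed.

Lemma component_points_cluster A x : component_points R x A = cluster A x.
Proof.
apply/seteqP; split=> y; rewrite /component_points/=.
  have [Ax|nAx] := pselect (A x); last by rewrite component_out.
  by rewrite component_cluster// => /embed_cubes.
by move=> xy; rewrite component_cluster; [exact/embed_cubes|exact: cluster_self xy].
Qed.

End ClusterComponents.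

(** * Scores truncated at a box *)

Section TruncatedScores.
Variables (R : realType) (d : nat).
Implicit Types (A B : set (lattice d)) (x y : lattice d) (h : set (lattice d) -> R).

Definition small m x A := forall y, cluster A x y -> y \in supbox x m.

Definition cscore h x A : R := h (cluster A x) / #|` fset_set (cluster A x)|%:R.

Definition tscore h m x A : R := if `[< A x /\ small m x A >] then cscore h x A else 0.

(** The limit of the truncated scores. An infinite cluster gets the value 0, in agreement with the
    convention of [score]. *)
Definition fscore h x A : R := if `[< A x /\ finite_set (cluster A x) >] then cscore h x A else 0.

Definition large m x A : R := (`[< A x /\ ~ small m x A >])%:R.

Lemma small_agree A B x m : (forall y, y \in supbox x m.+1 -> A y <-> B y) ->
  small m x A -> small m x B.
Proof. by move=> AB sA y; rewrite -(cluster_agree AB sA); exact: sA. Qed.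

Lemma supbox_self x m : x \in supbox x m.
Proof. by apply/supboxP => i; rewrite subrr. Qed.

Lemma small_agreeE A B x m : (forall y, y \in supbox x m.+1 -> A y <-> B y) ->
  (A x /\ small m x A) <-> (B x /\ small m x B).
Proof.
move=> AB; have BA y : y \in supbox x m.+1 -> B y <-> A y by move=> /AB h; split=> /h.
by split=> -[hx hs]; (split; [exact/(AB _ (supbox_self _ _))|]); [exact: small_agree AB hs|exact: small_agree BA hs].
Qed.

Lemma tscore_local h m x : local (tscore h m x) (supbox x m.+1).
Proof.
move=> A B AB; rewrite /tscore (asbool_equiv_eq (small_agreeE AB)).
case: ifPn => // /asboolP [Bx sB]; rewrite /cscore.
suff -> : cluster A x = cluster B x by [].
by apply: cluster_agree (AB) _; have [_ ] := (small_agreeE AB).2 (conj Bx sB).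
Qed.

Lemma large_local m x : local (large m x) (supbox x m.+1).
Proof.
move=> A B AB; congr (nat_of_bool _)%:R; apply: asbool_equiv_eq.
have AxBx := AB _ (supbox_self x m.+1); have sAB := small_agreeE AB.
split=> -[hx ns]; (split; first exact/AxBx) => s; apply: ns.
  by have [] := sAB.2 (conj (AxBx.1 hx) s).
by have [] := sAB.1 (conj (AxBx.2 hx) s).
Qed.

Lemma small_finite m x A : small m x A -> finite_set (cluster A x).
Proof. by move=> s; apply: (@sub_finite_set _ _ [set` supbox x m]) => //; exact: finite_seq. Qed.

Lemma finite_small x A : finite_set (cluster A x) -> exists m, small m x A.
Proof.
move=> /finite_seqP[s sE]; exists (\max_(y <- s) l1norm (y - x)) => y xy.
have ys : y \in s by have : [set` s] y by rewrite -sE.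
apply/supboxP => i; have := coord_le_l1norm (y - x) i; rewrite !mxE => /leq_trans; apply.
by rewrite (big_rem y ys) /= leq_maxl.
Qed.

Lemma small_mono m m' x A : (m <= m')%N -> small m x A -> small m' x A.
Proof.
move=> mm s y /s /supboxP h; apply/supboxP => i; exact: leq_trans (h i) mm.
Qed.

Lemma fscore_cvg h x A : tscore h m x A @[m --> \oo] --> fscore h x A.
Proof.
rewrite /fscore; case: ifPn => [/asboolP[Ax fx]|/asboolP nf].
  have [m0 s0] := finite_small fx; apply: (@cvg_trans _ ((fun=> cscore h x A) @ \oo)); last exact: cvg_cst.
  apply: near_eq_cvg; near=> m; rewrite /tscore asboolT//; split=> //.
  by apply: small_mono s0; near: m; exact: nbhs_infty_ge.
rewrite (_ : (fun _ => _) = fun=> 0); first exact: cvg_cst.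
apply/funext => m; rewrite /tscore asboolF// => -[Ax /small_finite fx]; exact: nf.
Unshelve. all: by end_near. Qed.

Lemma cluster_card_gt0 x A : A x -> finite_set (cluster A x) -> (0 < #|` fset_set (cluster A x)|)%N.
Proof.
move=> Ax fx; rewrite cardfs_gt0; apply/fset0Pn; exists x; rewrite in_fset_set// inE.
exact: cluster_base.
Qed.

Variable K : R.
Hypothesis K0 : 0 <= K.

Lemma cscore_bound h x A : (forall B, finite_set B -> `|h B| <= K * #|` fset_set B|%:R) ->
  A x -> finite_set (cluster A x) -> `|cscore h x A| <= K.
Proof.
move=> hK Ax fx; have c0 := cluster_card_gt0 Ax fx.
by rewrite /cscore normrM normfV normr_nat ler_pdivrMr ?ltr0n// hK.
Qed.

Lemma tscore_bound h m x A : (forall B, finite_set B -> `|h B| <= K * #|` fset_set B|%:R) ->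
  `|tscore h m x A| <= K.
Proof.
move=> hK; rewrite /tscore; case: ifPn => [/asboolP[Ax /small_finite fx]|_]; last by rewrite normr0.
exact: cscore_bound.
Qed.

Lemma fscore_bound h x A : (forall B, finite_set B -> `|h B| <= K * #|` fset_set B|%:R) ->
  `|fscore h x A| <= K.
Proof.
move=> hK; rewrite /fscore; case: ifPn => [/asboolP[Ax fx]|_]; last by rewrite normr0.
exact: cscore_bound.
Qed.

Lemma tscore_fscore h m x A : (forall B, finite_set B -> `|h B| <= K * #|` fset_set B|%:R) ->
  `|tscore h m x A - fscore h x A| <= K * (`[< [/\ A x, finite_set (cluster A x) & ~ small m x A] >])%:R.
Proof.
move=> hK; rewrite /tscore /fscore; case: ifPn => [/asboolP[Ax s]|/asboolP ns].
  rewrite asboolT ?subrr ?normr0 ?mulr_ge0//; split=> //; exact: small_finite s.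
case: ifPn => [/asboolP[Ax fx]|_]; last by rewrite subrr normr0 mulr_ge0.
rewrite sub0r normrN asboolT ?mulr1; first exact: cscore_bound.
by split=> // s; apply: ns.
Qed.

Lemma card_translate A y : finite_set A -> #|` fset_set (translate A y)| = #|` fset_set A|.
Proof.
by move=> fA; rewrite /translate fset_set_image// card_imfset//; exact: addIr.
Qed.

Lemma tscore_translate h m x A y : (forall B z, finite_set B -> h (translate B z) = h B) ->
  tscore h m (x + y) (translate A y) = tscore h m x A.
Proof.
move=> hT; rewrite /tscore /small cluster_translate.
have -> : `[< translate A y (x + y) /\ forall u, translate (cluster A x) y u -> u \in supbox (x + y) m >] =
    `[< A x /\ forall u, cluster A x u -> u \in supbox x m >].
  apply: asbool_equiv_eq; split=> -[hx hs].
    split; first by move: hx => /translateE; rewrite addrK.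
    move=> u xu; have /hs/supboxP h' : translate (cluster A x) y (u + y) by exists u.
    by apply/supboxP => i; have := h' i; rewrite !mxE opprD addrACA subrr addr0.
  split; first by exists x.
  move=> _ [u /hs/supboxP h' <-]; apply/supboxP => i; have := h' i.
  by rewrite !mxE opprD addrACA subrr addr0.
case: ifPn => // /asboolP[Ax /small_finite fx]; rewrite /cscore cluster_translate hT//.
by rewrite card_translate.
Qed.

Lemma large_translate m x A y : large m (x + y) (translate A y) = large m x A.
Proof.
congr (nat_of_bool _)%:R; apply: asbool_equiv_eq; rewrite /small cluster_translate.
have e : translate A y (x + y) <-> A x by rewrite translateE addrK.
split=> -[hx hs]; (split; first exact/e) => s; apply: hs.
  move=> _ [u /s/supboxP h' <-]; apply/supboxP => i; have := h' i.
  by rewrite !mxE opprD addrACA subrr addr0.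
move=> u xu; have /s/supboxP h' : translate (cluster A x) y (u + y) by exists u.
by apply/supboxP => i; have := h' i; rewrite !mxE opprD addrACA subrr addr0.
Qed.

Definition flip b A := if b then ~` A else A.

Lemma flip_translate b A y : flip b (translate A y) = translate (flip b A) y.
Proof.
case: b => //=; apply/seteqP; split=> z; rewrite /= translateE.
  by move=> h; exact/translateE.
by move=> /translateE h; exact: h.
Qed.

Lemma flip_local b (f : set (lattice d) -> R) s : local f s -> local (fun A => f (flip b A)) s.
Proof.
move=> lf A B AB; apply: lf => x /AB h; case: b => //=.
by split=> h1 h2; apply: h1; exact/h.
Qed.

Lemma cluster_sum_window h A n :
  (forall B C, finite_set B -> finite_set C -> separated B C -> h (B `|` C) = h B + h C) ->
  let B := A `&` window d n in
  h B = \sum_(x <- wfs d n) (if `[< B x >] then cscore h x B else 0).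
Proof.
move=> hU B; have fB : finite_set B by apply: sub_finite_set (@finite_window d n) => x [].
rewrite (cluster_sum hU fB) -[RHS]big_mkcond -big_filter; apply: perm_big.
apply: uniq_perm; rewrite ?filter_uniq ?fset_uniq// => x.
rewrite mem_filter in_wfs in_fset_set//; apply/idP/andP => [/set_mem Bx|[/asboolP Bx _]].
  by split; [apply/asboolP|case: Bx].
by rewrite inE.
Qed.

(** A cluster of the windowed set that leaves the box lies in a cluster of the full set that leaves
    it, so the error is expressed by the [large] events of the unrestricted configuration, whose
    probability does not depend on the site. *)
Lemma cluster_error h (A : set (lattice d)) n m : (forall B, finite_set B -> `|h B| <= K * #|` fset_set B|%:R) ->
  (forall B C, finite_set B -> finite_set C -> separated B C -> h (B `|` C) = h B + h C) ->
  `|h (A `&` window d n) - \sum_(x <- wfs d n) tscore h m x (A `&` window d n)| <=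
    K * \sum_(x <- wfs d n) large m x A.
Proof.
move=> hK hU; pose B := A `&` window d n.
have fB : finite_set B by apply: sub_finite_set (@finite_window d n) => x [].
rewrite (cluster_sum_window A n hU) -/B.
rewrite -sumrB mulr_sumr; apply: le_trans (ler_norm_sum _ _ _) _; apply: ler_sum => x _.
rewrite /tscore /large; case: ifPn => [/asboolP Bx|/asboolP nB]; last by rewrite asboolF ?subrr ?normr0 ?mulr_ge0// => -[].
have [s|ns] := pselect (small m x B).
  by rewrite asboolT// subrr normr0 mulr_ge0.
rewrite ifF; last by apply: asboolF => -[].
rewrite subr0 asboolT ?mulr1.
  by apply: cscore_bound => //; apply: sub_finite_set fB; exact: cluster_sub.
split; first by case: Bx.
by move=> s; apply: ns => y xy; apply: s; apply: cluster_mono xy => z [].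
Qed.

End TruncatedScores.

(** * Central limit theorem for cluster functionals *)

Section ClusterSystem.
Context (R : realType) (dT : measure_display) (T : measurableType dT).
Context (P : probability T R) (d : nat) (X : {RV P >-> config d}).
Hypothesis d0 : (0 < d)%N.
Hypothesis stat : stationary P X.
Variable q : nat.
Hypothesis q0 : (0 < q)%N.
Hypothesis mix : mixing X q.

Variables (b : bool) (p : nat) (K : R).
Hypothesis K0 : 0 <= K.
Variables (h : 'I_p -> nat -> set (lattice d) -> R) (hinf : 'I_p -> set (lattice d) -> R).
Hypothesis hK : forall i n A, finite_set A -> `|h i n A| <= K * #|` fset_set A|%:R.
Hypothesis hinfK : forall i A, finite_set A -> `|hinf i A| <= K * #|` fset_set A|%:R.
Hypothesis hU : forall i n A B, finite_set A -> finite_set B -> separated A B ->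
  h i n (A `|` B) = h i n A + h i n B.
Hypothesis hT : forall i A z, finite_set A -> hinf i (translate A z) = hinf i A.
Hypothesis hbulk : forall i n A, finite_set A ->
  (forall x y, A x -> adj x y -> window d n y) -> h i n A = hinf i A.

Definition trunc i m n (x : lattice d) mu := tscore (h i n) m x (flip b mu `&` window d n).
Definition trunc0 i m mu := tscore (hinf i) m 0 (flip b mu).
Definition zscore i mu := fscore (hinf i) 0 (flip b mu).


Lemma trunc_local i m n x : local (trunc i m n x) (supbox x m.+1).
Proof.
have l1 := @flip_local R d b _ _ (@tscore_local R d (h i n) m x).
move=> mu nu e; rewrite /trunc; apply: tscore_local => y yb.
have h1 := e y yb; case: b => /=; split=> -[h2 h3]; split=> //; try exact/h1.
all: by move=> h4; apply: h2; exact/h1.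
Qed.

Lemma trunc0_local i m : local (trunc0 i m) (supbox 0 m.+1).
Proof. exact: flip_local (@tscore_local R d (hinf i) m 0). Qed.

(** A truncated cluster with its neighbours lies in the box of radius [m+2]. Once this box is inside
    the window, the boundary is invisible and the functional is the stationary one. *)
Lemma trunc_bulk i m n x mu : (l1norm x + d * m.+2 <= n)%N ->
  trunc i m n x mu = trunc0 i m (translate mu (- x)).
Proof.
move=> xn; have box y : y \in supbox x m.+2 -> window d n y.
  move=> /supboxP hy; rewrite /window/=; apply: leq_trans xn.
  rewrite -[y](subrK x) addrC; apply: leq_trans (l1normD _ _) _; rewrite leq_add2l.
  by apply: l1norm_le_sup => i'; rewrite !mxE.
have grow y z k : y \in supbox x k -> adj y z -> z \in supbox x k.+1 by move=> /supboxP hy /adjP yz; apply/supboxP => j; have := hy j; have := yz j; lia.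
rewrite /trunc /trunc0 flip_translate.
have -> : tscore (hinf i) m 0 (translate (flip b mu) (- x)) = tscore (hinf i) m x (flip b mu) by rewrite -[0](subrr x) tscore_translate// => B z; exact: hT.
have -> : tscore (h i n) m x (flip b mu `&` window d n) = tscore (h i n) m x (flip b mu).
  apply: tscore_local => y /supboxP hy; split=> [[]//|fy]; split=> //; apply: box.
  by apply/supboxP => j; apply: leq_trans (hy j) _.
rewrite /tscore; case: ifPn => // /asboolP[Bx s]; rewrite /cscore hbulk//.
  exact: small_finite s.
move=> a y /s ax ay; apply: box; have /supboxP hy := grow _ _ _ ax ay.
by apply/supboxP => j; apply: leq_trans (hy j) _.
Qed.

Lemma zscore_bmf i : bmf (zscore i : config d -> R).
Proof.
split.
  apply: (@measurable_fun_cvg _ _ _ _ (fun m => trunc0 i m : config d -> R)).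
    by move=> m; have [] := local_bmf_config (@trunc0_local i m).
  by move=> mu _; exact: fscore_cvg.
by exists K => mu; apply: fscore_bound => // B; exact: hinfK.
Qed.

Variables (S : 'I_p -> nat -> T -> R) (al : 'I_p -> nat -> R).
Hypothesis bS : forall i n, bmf (S i n).
Hypothesis SE : forall i n w, S i n w = al i n + h i n (flip b (X w) `&` window d n).

Lemma Ex_large m x : Ex P (fun w => large R m x (flip b (X w))) = Ex P (fun w => large R m 0 (flip b (X w))).
Proof.
have l0 : local (fun mu => large R m (0 : lattice d) (flip b mu) : R) (supbox 0 m.+1).
  exact: flip_local (@large_local R d m 0).
rewrite -(Ex_translate stat (- x) (local_bmf_config l0)); congr Ex; apply/funext => w.
by rewrite flip_translate -[0](subrr x) large_translate.
Qed.

Let bL m x : bmf (fun w => large R m x (flip b (X w)) : R).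
Proof.
have l0 : local (fun mu => large R m x (flip b mu) : R) (supbox x m.+1).
  exact: flip_local (@large_local R d m x).
by have hh := @local_bmf _ _ _ P _ X _ _ l0.
Qed.

Variable tl : nat -> R.
Hypothesis ftl : fastdec tl.
Hypothesis tlE : forall m, Ex P (fun w => large R m 0 (flip b (X w))) <= tl m.

Lemma trunc_error i m n :
  Ex P (fun w => `|S i n w - al i n - \sum_(x <- wfs d n) trunc i m n x (X w)|) <=
  n.+1%:R ^+ d * (2 ^+ d * K * tl m).
Proof.
apply: (@le_trans _ _ (Ex P (fun w => K * \sum_(x <- wfs d n) large R m x (flip b (X w))))).
  apply: Ex_le.
  - apply: bmf_norm; apply: bmfB; first by apply: bmfB => //; exact: (bmf_cst _).
    by apply: bmf_sum => x _; have hh := @local_bmf _ _ _ P _ X _ _ (@trunc_local i m n x).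
  - by apply: bmfZ; apply: bmf_sum => x _; exact: bL.
  move=> w; rewrite SE [al i n + _]addrC addrK; apply: cluster_error => // B; [exact: hK|exact: hU].
rewrite ExZ; last by apply: bmf_sum => x _; exact: bL.
rewrite Ex_sum => [|x _]; last exact: bL.
rewrite (eq_bigr (fun=> Ex P (fun w => large R m 0 (flip b (X w))))); last by move=> x _; exact: Ex_large.
rewrite sum_const_seq.
rewrite [leRHS](_ : _ = K * ((2 ^+ d * n.+1%:R ^+ d) * tl m)); last by ring.
by rewrite ler_wpM2l// ler_pM ?wfs_card_leR//; exact: Ex_ge0.
Qed.

Lemma zscore_error i m : Ex P (fun w => `|trunc0 i m (X w) - zscore i (X w)|) <= K * tl m.
Proof.
apply: le_trans (ler_wpM2l K0 (tlE m)); rewrite -ExZ; last exact: bL.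
apply: Ex_le.
- apply: bmf_norm; apply: bmfB; last exact: bmf_config (zscore_bmf i).
  by have hh := @local_bmf _ _ _ P _ X _ _ (@trunc0_local i m).
- by apply: bmfZ; exact: bL.
move=> w; apply: le_trans (tscore_fscore K0 _ _ _ (hinfK i)) _; rewrite ler_wpM2l// ler_nat /large.
by case: asboolP => // -[Ax fx ns]; rewrite asboolT.
Qed.

Variable M : R.
Hypothesis KM : K <= M.
Hypothesis SM : forall i n w, `|S i n w| <= M * n.+1%:R ^+ d.

Let eta m := (2 ^+ d * K + K) * `|tl m|.

Let feta : fastdec eta.
Proof.
have f1 := fastdecZ (2 ^+ d * K + K) ftl.
by apply: (@fastdec_tail _ _ _ 0 f1) => m _; rewrite !normrM normr_id.
Qed.

Let trunc_bound i m n x mu : `|trunc i m n x mu| <= M.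
Proof. by apply: le_trans KM; apply: tscore_bound => // B; exact: hK. Qed.

Let trunc0_bound i m mu : `|trunc0 i m mu| <= M.
Proof. by apply: le_trans KM; apply: tscore_bound => // B; exact: hinfK. Qed.

Let zscore_bound i mu : `|zscore i mu| <= M.
Proof. by apply: le_trans KM; apply: fscore_bound => // B; exact: hinfK. Qed.

Let SU i m n : (0 * m.+1 <= n)%N ->
  Ex P (fun w => `|S i n w - al i n - \sum_(x <- wfs d n) trunc i m n x (X w)|) <= n.+1%:R ^+ d * eta m.
Proof.
move=> _; apply: le_trans (trunc_error i m n) _; rewrite ler_wpM2l ?exprn_ge0// /eta mulrDl.
apply: (@le_trans _ _ (2 ^+ d * K * `|tl m|)); last by rewrite lerDl mulr_ge0.
by rewrite ler_wpM2l ?ler_norm// mulr_ge0 ?exprn_ge0.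
Qed.

Let VZ i m : Ex P (fun w => `|trunc0 i m (X w) - zscore i (X w)|) <= eta m.
Proof.
apply: le_trans (zscore_error i m) _; rewrite /eta mulrDl.
apply: (@le_trans _ _ (K * `|tl m|)); first by rewrite ler_wpM2l ?ler_norm.
by rewrite lerDr !mulr_ge0 ?exprn_ge0.
Qed.

Lemma cluster_clt_single (i : 'I_p) (c nu : R) : 0 < c -> 0 < nu ->
  (\forall n \near \oo, c * #|` wfs d n|%:R `^ nu <= cv P (S i n) (S i n)) ->
  cvg_in_law P (fun n w => cv P (S i n) (S i n) `^ (- 2^-1) * (S i n w - Ex P (S i n)))
    (fun f => \int[normal_prob 0 1]_x (f x)%:E)%E.
Proof.
exact: (@clt_single _ _ _ P d X d0 q q0 mix p M d 0 eta S al trunc feta bS SM trunc_local trunc_bound SU).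
Qed.

Lemma cluster_cov (i j : 'I_p) : exists2 s : R, has_sum (limit_cov X (zscore i) (zscore j)) s &
  (#|` wfs d n|%:R)^-1 * cv P (S i n) (S j n) @[n --> \oo] --> s.
Proof.
exact: (@cov_S_cvg _ _ _ P d X d0 stat q q0 mix p M d 0 eta S al trunc feta bS SM trunc_local
  trunc_bound SU trunc0 zscore trunc0_local trunc0_bound zscore_bmf zscore_bound VZ trunc_bulk).
Qed.

Lemma cluster_clt_vector : exists (Sigma : 'M[R]_p) (gamma : probability (borel 'rV[R]_p) R),
  [/\ forall i j, has_sum (limit_cov X (zscore i) (zscore j)) (Sigma i j),
      forall i j, (#|` wfs d n|%:R)^-1 * cv P (S i n) (S j n) @[n --> \oo] --> Sigma i j,
      is_gaussian gamma Sigma &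
      cvg_in_law P (fun n w => \row_(i < p) (#|` wfs d n|%:R `^ (- 2^-1) * (S i n w - Ex P (S i n))))
        (fun f => \int[gamma]_x (f x)%:E)%E].
Proof.
exact: (@clt_vector _ _ _ P d X d0 stat q q0 mix p M d 0 eta S al trunc feta bS SM trunc_local
  trunc_bound SU trunc0 zscore trunc0_local trunc0_bound zscore_bmf zscore_bound VZ trunc_bulk).
Qed.

End ClusterSystem.

(** * Cluster tails of subcritical models *)

Section Tails.
Context (R : realType) (dT : measure_display) (T : measurableType dT).
Context (P : probability T R) (d : nat) (X : {RV P >-> config d}).

Lemma measurable_local (Q : set (set (lattice d))) (s : seq (lattice d)) :
  (forall mu nu, (forall x, x \in s -> mu x <-> nu x) -> Q mu <-> Q nu) ->
  measurable [set w | Q (X w)].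
Proof.
move=> lQ; have lf : local (fun mu => (`[< Q mu >])%:R : R) s.
  by move=> mu nu e; congr (nat_of_bool _)%:R; apply: asbool_equiv_eq; exact: lQ.
have [mf _] := @local_bmf _ _ _ P _ X _ _ lf.
rewrite (_ : [set w | _] = (fun w => (`[< Q (X w) >])%:R : R) @^-1` [set 1]).
  by rewrite -[X in measurable X]setTI; apply: mf.
apply/seteqP; split=> w /=; first by move=> h; rewrite asboolT.
by case: asboolP => // _ /eqP; rewrite eq_sym oner_eq0.
Qed.

Lemma flip_agree b (mu nu : set (lattice d)) z : (mu z <-> nu z) -> (flip b mu z <-> flip b nu z).
Proof. by case: b => //= h; split=> h1 h2; apply: h1; exact/h. Qed.

(** The event involves infinitely many sites, but a connecting chain is finite, so the event is a
    countable union of events that depend on one box each. *)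
Lemma cluster_local_event b x y : measurable [set w | cluster (flip b (X w)) x y].
Proof.
rewrite (_ : [set w | _] = \bigcup_N [set w | cluster (flip b (X w) `&` [set` supbox (0 : lattice d) N]) x y]).
  apply: bigcup_measurable => N _.
  apply: (@measurable_local (fun mu => cluster (flip b mu `&` [set` supbox (0 : lattice d) N]) x y) (supbox 0 N)).
  move=> mu nu e; have -> // : flip b mu `&` [set` supbox 0 N] = flip b nu `&` [set` supbox 0 N].
  apply/seteqP; split=> z [h1 zN]; split=> //; move: h1; exact: (flip_agree b (e z zN)).1 || exact: (flip_agree b (e z zN)).2.
apply/seteqP; split=> [w xy|w [N _ /=]]; last by apply: cluster_mono => z [].
have [N hN] : exists N, cluster (flip b (X w) `&` [set` supbox (0 : lattice d) N]) x y.
  have box z : exists N, forall M, (N <= M)%N -> z \in supbox (0 : lattice d) M.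
    exists (l1norm z) => M zM; apply/supboxP => i; rewrite mxE subr0.
    exact: leq_trans (coord_le_l1norm z i) zM.
  elim: xy => [xX|u v xu [N IH] vX uv].
    by have [N h] := box x; exists N; apply: cluster_base; split=> //; exact: h.
  have [N' h] := box v; exists (maxn N N'); apply: (cluster_step (y := u)) => //.
    apply: cluster_mono IH => z [h1 /supboxP h2]; split=> //; apply/supboxP => i.
    by apply: leq_trans (h2 i) _; exact: leq_maxl.
  by split=> //; apply: h; exact: leq_maxr.
by exists N.
Qed.

Lemma large_exit m (A : set (lattice d)) :
  large R m 0 A <= \sum_(y <- supbox (0 : lattice d) m.+1 | y \notin supbox 0 m) (`[< cluster A 0 y >])%:R.
Proof.
rewrite /large; case: asboolP => [[A0 ns]|_]; last by apply: sumr_ge0.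
have [y y1 [y2 xy]] := cluster_exit A0 ns.
rewrite (big_rem y y1) /= y2 asboolT// lerDl; exact: sumr_ge0.
Qed.

Lemma outside_box_l1norm m (y : lattice d) : y \notin supbox 0 m -> (m < l1norm y)%N.
Proof.
rewrite ltnNge; apply: contra => h; apply/supboxP => i; rewrite mxE subr0.
exact: leq_trans (coord_le_l1norm y i) h.
Qed.

(** A cluster leaving the box of radius [m] contains a point of the next box with norm above [m]. A
    union bound over these points costs only a power of [m]. *)
Lemma subcritical_tail b : subcritical P (fun w => flip b (X w)) ->
  exists2 tl : nat -> R, fastdec tl & forall m, Ex P (fun w => large R m 0 (flip b (X w))) <= tl m.
Proof.
move=> [C [c [C0 c0 hC]]].
exists (fun m => 3 ^+ d * m.+1%:R ^+ d * (C * expR (- (c * m%:R)))).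
  exact: fastdec_poly (fastdec_expR C c0).
move=> m; have mc y := @cluster_local_event b 0 y.
have bI y : bmf (fun w => (`[< cluster (flip b (X w)) 0 y >])%:R : R).
  rewrite (_ : (fun _ => _) = (\1_[set w | cluster (flip b (X w)) 0 y] : T -> R)).
    exact: bmf_indic.
  by apply/funext => w; rewrite indicE /in_mem.
have hI y : y \notin supbox 0 m -> Ex P (fun w => (`[< cluster (flip b (X w)) 0 y >])%:R) <= C * expR (- (c * m%:R)).
  move=> ym; rewrite (_ : (fun _ => _) = (\1_[set w | cluster (flip b (X w)) 0 y] : T -> R)); last first.
    by apply/funext => w; rewrite indicE /in_mem.
  rewrite Ex_indic//; apply: (@le_trans _ _ (C * expR (- (c * (l1norm (0 - y))%:R)))).
    have := hC 0 y; rewrite (_ : [set w | _] = [set w | cluster (flip b (X w)) 0 y]).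
      by rewrite -[X in (X <= _)%E]fineK ?lee_fin//; exact: fin_num_measure.
    by apply/seteqP; split=> w /=; rewrite component_points_cluster.
  rewrite ler_wpM2l ?(ltW C0)// ler_expR lerN2 ler_wpM2l ?(ltW c0)// ler_nat sub0r l1normN.
  by apply: ltnW; exact: outside_box_l1norm.
apply: (@le_trans _ _ (Ex P (fun w => \sum_(y <- supbox (0 : lattice d) m.+1 | y \notin supbox 0 m) (`[< cluster (flip b (X w)) 0 y >])%:R))).
  apply: Ex_le; last by move=> w; exact: large_exit.
    have l0 := @flip_local R d b _ _ (@large_local R d m 0).
    by have hh := @local_bmf _ _ _ P _ X _ _ l0.
  by apply: bmf_sum => y _.
rewrite Ex_sum//; apply: (@le_trans _ _ (\sum_(y <- supbox (0 : lattice d) m.+1) C * expR (- (c * m%:R)))).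
  rewrite big_mkcond; apply: ler_sum => y _; case: ifP => [|_]; first exact: hI.
  by rewrite mulr_ge0 ?(ltW C0) ?expR_ge0.
rewrite sum_const_seq ler_wpM2r//.
  by rewrite mulr_ge0 ?(ltW C0) ?expR_ge0.
rewrite size_supbox -exprMn -natrM -natrX ler_nat; case: (d) => // d'; rewrite leq_exp2r//; lia.
Qed.

End Tails.

(** * Cluster tails in dimension one *)

Section TailsDim1.
Context (R : realType) (dT : measure_display) (T : measurableType dT).
Context (P : probability T R) (X : {RV P >-> config 1}).
Hypothesis stat : stationary P X.
Hypothesis nondeg : nondegenerate_spin P X.
Variable q : nat.
Hypothesis q0 : (0 < q)%N.
Hypothesis mix : mixing X q.

Let pt (z : int) : lattice 1 := const_mx z.

Lemma cluster_interval (A : set (lattice 1)) y : cluster A 0 y ->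
  forall z : int, (0 <= z <= y 0 0) || (y 0 0 <= z <= 0) -> A (pt z).
Proof.
have ext (u : lattice 1) : u = pt (u 0 0) by apply/rowP => i; rewrite mxE (ord1 i).
elim=> [A0 z|u v _ IH Av uv z].
  rewrite mxE => h; have -> : z = 0 by lia.
  by rewrite (_ : pt 0 = 0)//; apply/rowP => i; rewrite !mxE.
move=> h; have [->|zv] := eqVneq z (v 0 0); first by rewrite -ext.
by apply: IH; have := adjP _ _ uv 0; move: zv h; move/eqP; move: (u 0 0) (v 0 0) => a b; lia.
Qed.

Lemma contains_local A : local (contains A : set (lattice 1) -> R) A.
Proof.
move=> mu nu e; congr (nat_of_bool _)%:R; apply: asbool_equiv_eq.
by split=> h x xA; apply/(e x xA); exact: h.
Qed.

(** Sites spaced by [l^q] are almost independent, so the probability that [l] of them are occupied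
    is at most [p^l] plus [l] mixing errors, with [p < 1] by nondegeneracy. The sign [sg] covers
    both directions. *)
Lemma spaced_points_tail : exists2 e : nat -> R, fastdec e & forall (sg : bool) l, (0 < l)%N ->
  Ex P (fun w => contains [seq pt ((-1) ^+ sg * (j * l ^ q)%N%:Z) | j <- iota 0 l] (X w)) <= e l.
Proof.
have [e [fe e0 he]] := mix 1.
pose p : R := Ex P (fun w => contains [:: pt 0] (X w)).
have pt0 : pt 0 = 0 by apply/rowP => i; rewrite !mxE.
have p01 : 0 < p < 1.
  rewrite /p Ex_contains /prob_contains (_ : [set w | _] = [set w | X w 0]).
    have nd := nondeg; rewrite /nondegenerate_spin in nd.
    have hf := @fin_num_measure _ _ _ P _ (measurable_site X 0).
    by move: nd; rewrite -(fineK hf) !lte_fin.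
  apply/seteqP; split=> w /=; first by move=> h; apply: h; rewrite inE pt0.
  by move=> h x; rewrite inE pt0 => /eqP->.
have shift z : Ex P (fun w => contains [:: pt z] (X w)) = p.
  rewrite /p -(Ex_translate stat (- pt z) (local_bmf_config (contains_local (A := [:: pt 0])))).
  congr Ex; apply/funext => w; congr (nat_of_bool _)%:R; apply: asbool_equiv_eq.
  split=> h x; rewrite inE => /eqP->.
    by apply/translateE; rewrite opprK pt0 add0r; apply: h; rewrite inE.
  have /translateE := h (pt 0) (mem_head _ _); by rewrite opprK pt0 add0r.
have [p0 p1] := andP p01.
have lnp : 0 < - ln p by rewrite oppr_gt0 ln_lt0.
exists (fun l => expR (- (- ln p * l%:R)) + 1 * l.+1%:R ^+ 1 * e l).
  apply: fastdecD; last exact: fastdec_poly.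
  have := fastdec_expR 1 lnp; under eq_fun do rewrite mul1r; exact.
move=> sg l l0; pose Ak k := [seq pt ((-1) ^+ sg * (j * l ^ q)%N%:Z) | j <- iota 0 k].
pose pk k := Ex P (fun w => contains (Ak k) (X w)).
have rec k : (k <= l)%N -> pk k <= p ^+ k + k%:R * e l.
  elim: k => [|k IH] kl.
    rewrite expr0 mul0r addr0 /pk (_ : (fun _ => _) = fun=> 1) ?Ex_cst//.
    by apply/funext => w; rewrite contains_nil.
  have {}IH := IH (ltnW kl); pose B := [:: pt ((-1) ^+ sg * (k * l ^ q)%N%:Z)].
  have pE : pk k.+1 = Ex P (fun w => contains (Ak k) (X w) * contains B (X w)).
    congr Ex; apply/funext => w; rewrite /contains -natrM mulnb; congr (nat_of_bool _)%:R.
    have -> : Ak k.+1 = Ak k ++ B by rewrite /Ak -(addn1 k) (iotaD 0 k 1) map_cat.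
    apply/asboolP/andP => [h|[/asboolP h1 /asboolP h2] x].
      by split; apply/asboolP => x xA; apply: h; rewrite mem_cat xA ?orbT.
    by rewrite mem_cat => /orP[/h1|/h2].
  have := he l (Ak k) B (contains (Ak k)) (contains B) 1 1 l0.
  rewrite size_map size_iota /= mul1n expn1 => /(_ _ _ (@contains_local _) (@contains_local _) (contains_norm _ _) (contains_norm _ _)).
  have bl A : bmf (fun w => contains A (X w) : R) by have hh := @local_bmf _ _ _ P _ X _ _ (@contains_local A).
  have sz : (k + 1 <= (2 * l).+1)%N by move: kl; lia.
  have sep a c : a \in Ak k -> c \in B -> (l ^ q <= l1norm (a - c))%N.
    move=> /mapP[j]; rewrite mem_iota /= add0n => jk -> ; rewrite inE => /eqP->.
    apply: leq_trans (coord_le_l1norm _ 0); rewrite !mxE.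
    have : (j * l ^ q + l ^ q <= k * l ^ q)%N by rewrite -mulSnr leq_mul2r jk orbT.
    rewrite -mulrBr abszMsign.
    have aux (a1 a2 a3 : nat) : (a1 + a3 <= a2 -> a3 <= `|(a1%:Z - a2%:Z)%R|)%N by lia.
    exact: aux.
  move=> /(_ sz sep); rewrite !mul1r /cv -pE (shift ((-1) ^+ sg * (k * l ^ q)%N%:Z)) ler_norml => /andP[_ h].
  have pk0 : 0 <= pk k by apply: Ex_ge0 => w; rewrite /contains.
  have h2 : pk k * p <= p ^+ k.+1 + k%:R * e l.
    apply: (@le_trans _ _ ((p ^+ k + k%:R * e l) * p)); first by rewrite ler_wpM2r// ltW.
    by rewrite mulrDl -exprSr lerD2l ler_piMr ?mulr_ge0// ltW.
  move: h; rewrite -/(pk k) -[k.+1]addn1 natrD mulrDl mul1r addn1; move: h2.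
  move: (pk k.+1) (pk k * p) (p ^+ _) (k%:R * e l) (e l) => a1 a2 a3 a4 a5; lra.
apply: le_trans (rec l (leqnn l)) _; rewrite lerD//.
  by rewrite mulNr opprK expRM_natr lnK// posrE.
by rewrite mul1r expr1 ler_wpM2r// ler_nat.
Qed.

(** On the line, a cluster reaching distance [m] fills the whole interval. It contains [l] sites
    spaced by [l^q] on one side, with [l] the root of order [q+1] of [m]. *)
Lemma tail_dim1 : fastdec (fun m => Ex P (fun w => large R m 0 (X w))).
Proof.
have [e fe he] := spaced_points_tail; have L0 : (0 < q.+1)%N by [].
apply: fastdec_near => j; exists 2.
have /cvgr0Pnorm_le/(_ 1 ltr01) hn := fastdec_nroot L0 j fe.
have [N _ hN] : \forall n \near \oo, (1 <= nroot q.+1 n)%N /\ `|n.+1%:R ^+ j * e (nroot q.+1 n)| <= 1 by near=> n; split; near: n; [exact: near_nroot|exact: hn].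
exists N => m Nm; have [l1 hl] := hN m Nm; have lm := nrootX_le L0 m.
move: (nroot q.+1 m) l1 hl lm => l l1 hl lm.
rewrite ger0_norm; last by apply: Ex_ge0 => w; rewrite /large.
pose Asg (sg : bool) := [seq pt ((-1) ^+ sg * (i * l ^ q)%N%:Z) | i <- iota 0 l].
have bl A : bmf (fun w => contains A (X w) : R) by have hh := @local_bmf _ _ _ P _ X _ _ (@contains_local A).
have le1 : Ex P (fun w => large R m 0 (X w)) <= 2 * e l.
  apply: (@le_trans _ _ (Ex P (fun w => contains (Asg false) (X w) + contains (Asg true) (X w)))); last by rewrite ExD// mulr2n mulrDl mul1r lerD// he.
  apply: Ex_le; [by have hh := @local_bmf _ _ _ P _ X _ _ (@large_local R 1 m 0)|exact: bmfD|].
  move=> w; rewrite /large; case: asboolP => [[A0 ns]|_]; last by rewrite addr_ge0// /contains.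
  have [y _ [ym xy]] := cluster_exit A0 ns.
  have ml : (m < absz ((y 0 0)%R))%N.
    rewrite ltnNge; apply: contra ym => h; apply/supboxP => i; by rewrite (ord1 i) mxE subr0.
  have il i : (i < l)%N -> (i * l ^ q <= m)%N by move=> il; apply: leq_trans lm; rewrite expnS leq_mul2r ltnW ?orbT.
  have [y0|y0] := leP 0 (y 0 0).
    suff -> : contains (Asg false) (X w) = 1 :> R by rewrite lerDl /contains.
    rewrite /contains asboolT// => x /mapP[i]; rewrite mem_iota add0n /= => /il h ->.
    apply: (cluster_interval xy); rewrite expr0 mul1r; move: (i * _)%N (y 0 0) h ml y0 => a u; lia.
  suff -> : contains (Asg true) (X w) = 1 :> R by rewrite lerDr /contains.
  rewrite /contains asboolT// => x /mapP[i]; rewrite mem_iota add0n /= => /il h ->.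
  apply: (cluster_interval xy); rewrite expr1; move: (i * _)%N (y 0 0) h ml y0 => a u; lia.
apply: le_trans (ler_wpM2r _ le1) _; first exact: exprn_ge0.
rewrite -mulrA ler_piMr// mulrC; exact: le_trans (ler_norm _) hl.
Unshelve. all: by end_near. Qed.

End TailsDim1.

(** * Ranks of matrices labelled by sequences *)

Section KernelMatrices.
Variables (F : fieldType) (V : eqType) (v0 : V) (D : V -> V -> F).
Implicit Types s t : seq V.

Definition kmx s t : 'M[F]_(size s, size t) := \matrix_(i, j) D (nth v0 s i) (nth v0 t j).

Definition kmxn m n s t : 'M[F]_(m, n) := \matrix_(i, j) D (nth v0 s i) (nth v0 t j).

(** Selection matrices on both sides exhibit a submatrix. In consequence the rank depends only on
    the sets of row and column labels, whatever their order and repetitions. *)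
Lemma rank_kmx_sub s t s' t' : {subset s <= s'} -> {subset t <= t'} ->
  (\rank (kmx s t) <= \rank (kmx s' t'))%N.
Proof.
move=> ss tt.
pose A : 'M[F]_(size s, size s') := \matrix_(i, j) (j == index (nth v0 s i) s' :> nat)%:R.
pose B : 'M[F]_(size t', size t) := \matrix_(i, j) (i == index (nth v0 t j) t' :> nat)%:R.
have sI (i : 'I_(size s)) : (index (nth v0 s i) s' < size s')%N by rewrite index_mem ss ?mem_nth.
have tI (i : 'I_(size t)) : (index (nth v0 t i) t' < size t')%N by rewrite index_mem tt ?mem_nth.
have -> : kmx s t = A *m kmx s' t' *m B.
  apply/matrixP => i j; rewrite !mxE (bigD1 (Ordinal (tI j)))//= !mxE eqxx mulr1.
  rewrite [X in _ = _ + X]big1 => [|k]; last first.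
    by rewrite !mxE -val_eqE /= => /negPf ->; rewrite mulr0.
  rewrite addr0 (bigD1 (Ordinal (sI i)))//= !mxE eqxx mul1r big1 => [|k]; last first.
    by rewrite !mxE -val_eqE /= => /negPf ->; rewrite mul0r.
  by rewrite addr0 /= !nth_index ?ss ?tt ?mem_nth.
by apply: leq_trans (mxrankM_maxl _ _) _; exact: mxrankM_maxr.
Qed.

Lemma rank_kmx_eq s t s' t' : s =i s' -> t =i t' -> \rank (kmx s t) = \rank (kmx s' t').
Proof.
by move=> ss tt; apply/eqP; rewrite eqn_leq !rank_kmx_sub// => x; rewrite ?ss ?tt.
Qed.

Lemma rank_kmxn m n s t : size s = m -> size t = n -> \rank (kmx s t) = \rank (kmxn m n s t).
Proof. by move=> <- <-. Qed.

Lemma rank_kmx_cat s1 s2 t1 t2 :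
  (forall a b, a \in s1 -> b \in t2 -> D a b = 0) -> (forall a b, a \in s2 -> b \in t1 -> D a b = 0) ->
  \rank (kmx (s1 ++ s2) (t1 ++ t2)) = (\rank (kmx s1 t1) + \rank (kmx s2 t2))%N.
Proof.
move=> h12 h21; rewrite (rank_kmxn (size_cat _ _) (size_cat _ _)).
rewrite -rank_diag_block_mx; congr (\rank _).
apply/matrixP => i j; rewrite mxE.
have [i' ->|i' ->] := split_ordP i; have [j' ->|j' ->] := split_ordP j;
  rewrite ?(block_mxEul, block_mxEur, block_mxEdl, block_mxEdr) !mxE !nth_cat /=
    ?ltn_ord ?[(_ + _ < _)%N]ltnNge ?leq_addr //= ?addKn//.
- by apply: h12; rewrite mem_nth.
- by apply: h21; rewrite mem_nth.
Qed.

Lemma rank_kmx_nilr s : \rank (kmx s [::]) = 0%N.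
Proof. by apply/eqP; rewrite -leqn0; apply: leq_trans (rank_leq_col _) _. Qed.

Lemma rank_kmx_nill t : \rank (kmx [::] t) = 0%N.
Proof. by apply/eqP; rewrite -leqn0; apply: leq_trans (rank_leq_row _) _. Qed.

Lemma rank_kmx_rows s' s t : (forall a b, a \in s -> a \notin s' -> b \in t -> D a b = 0) ->
  {subset s' <= s} -> \rank (kmx s t) = \rank (kmx s' t).
Proof.
move=> h ss; pose r := [seq a <- s | a \notin s'].
have -> : \rank (kmx s t) = \rank (kmx (s' ++ r) (t ++ [::])).
  apply: rank_kmx_eq => x; last by rewrite cats0.
  by rewrite mem_cat mem_filter; case: (boolP (x \in s')) => // /ss ->.
rewrite rank_kmx_cat ?rank_kmx_nilr ?addn0//= => a b.
by rewrite mem_filter => /andP[as' ra] bt; apply: h.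
Qed.

Lemma rank_kmx_cols t' s t : (forall a b, a \in s -> b \in t -> b \notin t' -> D a b = 0) ->
  {subset t' <= t} -> \rank (kmx s t) = \rank (kmx s t').
Proof.
move=> h ss; pose r := [seq a <- t | a \notin t'].
have -> : \rank (kmx s t) = \rank (kmx (s ++ [::]) (t' ++ r)).
  apply: rank_kmx_eq => x; first by rewrite cats0.
  by rewrite mem_cat mem_filter; case: (boolP (x \in t')) => // /ss ->.
rewrite rank_kmx_cat ?rank_kmx_nill ?addn0//= => a b sa.
by rewrite mem_filter => /andP[as' ra]; apply: h.
Qed.

Lemma kmx_mul s t u : kmx s t *m kmx t u = \matrix_(i, j)
  \sum_(b <- t) D (nth v0 s i) b * D b (nth v0 u j).
Proof.
apply/matrixP => i j; rewrite !mxE (big_nth v0) big_mkord; apply: eq_bigr => k _.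
by rewrite !mxE.
Qed.

Lemma kmx_map (T : V -> V) s t : (forall a b, D (T a) (T b) = D a b) ->
  \rank (kmx (map T s) (map T t)) = \rank (kmx s t).
Proof.
move=> h; rewrite (rank_kmxn (size_map _ _) (size_map _ _)); congr (\rank _).
by apply/matrixP => i j; rewrite !mxE !(nth_map v0).
Qed.

(* Triangular with respect to phi, with nonzero diagonal. *)
Lemma rank_kmx_matching (phi : V -> nat) (mu : V -> V) s : uniq s ->
  (forall c, c \in s -> D c (mu c) != 0) ->
  (forall c c', c \in s -> c' \in s -> c != c' -> (phi c <= phi c')%N -> D c (mu c') = 0) ->
  \rank (kmx s (map mu s)) = size s.
Proof.
move=> us h1 h2; apply/eqP; rewrite -/(row_free _); apply: inj_row_free => v vM.
apply/rowP => i; rewrite mxE; apply/eqP/negPn/negP => vi.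
pose P := [pred j | v 0 j != 0].
have [j] := @arg_maxnP _ i P (fun j : 'I_(size s) => phi (nth v0 s j)) vi.
rewrite inE => vj jmax.
have js : (j < size (map mu s))%N by rewrite size_map.
have := congr1 (fun w : 'rV_(size (map mu s)) => w 0 (Ordinal js)) vM; rewrite !mxE (bigD1 j)//= big1 => [|k kj].
  rewrite addr0 mxE /= (nth_map v0)// => /eqP; rewrite mulf_eq0 (negPf vj) /=.
  by rewrite (negPf (h1 _ _))// mem_nth.
rewrite mxE /= (nth_map v0)//; have [->|vk] := eqVneq (v 0 k) 0; first by rewrite mul0r.
rewrite h2 ?mulr0 ?mem_nth//; last exact: jmax.
by rewrite nth_uniq.
Qed.

End KernelMatrices.

(** Linear algebra of duality. Exactness says that the row space of [A] is the kernel of [B].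
    Projecting it to the last [q] coordinates loses the vectors supported on the first [p], which
    form the kernel of the upper rows of [B]. *)
Lemma rank_acyclic_split (F : fieldType) m p q n (A : 'M[F]_(m, p + q)) (B : 'M[F]_(p + q, n)) :
  A *m B = 0 -> (\rank A + \rank B = p + q)%N ->
  \rank A = (\rank (rsubmx A) + (p - \rank (usubmx B)))%N.
Proof.
move=> AB rAB; pose Pv : 'M[F]_(p + q, q) := col_mx 0 1%:M.
have APv : A *m Pv = rsubmx A by rewrite -{1}[A]hsubmxK mul_row_col mulmx0 add0r mulmx1.
have AK : (A <= kermx B)%MS by rewrite sub_kermx AB.
have kA : (kermx B <= A)%MS by have [_ <-] := mxrank_leqif_sup AK; rewrite mxrank_ker; apply/eqP; move: rAB; lia.
pose Pe : 'M[F]_(p, p + q) := row_mx 1%:M 0.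
have PeK : (Pe <= kermx Pv)%MS by rewrite sub_kermx /Pe /Pv mul_row_col mulmx0 mul0mx addr0.
have rPe : \rank Pe = p by rewrite rank_row_mx0 mxrank1.
have rPv : \rank Pv = q by rewrite -mxrank_tr tr_col_mx trmx0 trmx1 rank_row_0mx mxrank1.
have KPe : (kermx Pv <= Pe)%MS by have [_ <-] := mxrank_leqif_sup PeK; rewrite mxrank_ker rPv rPe addnK.
have rcap : \rank (A :&: kermx Pv)%MS = (p - \rank (usubmx B))%N.
  have -> : \rank (A :&: kermx Pv)%MS = \rank (Pe :&: kermx B)%MS.
    apply/eqP; rewrite eqn_leq; apply/andP; split; apply: mxrankS; rewrite sub_capmx; apply/andP; split.
    - exact: submx_trans (capmxSr _ _) KPe.
    - exact: submx_trans (capmxSl _ _) AK.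
    - exact: submx_trans (capmxSr _ _) kA.
    - exact: submx_trans (capmxSl _ _) PeK.
  have := mxrank_mul_ker Pe B.
  have -> : Pe *m B = usubmx B by rewrite -{1}[B]vsubmxK mul_row_col mul1mx mul0mx addr0.
  by rewrite rPe; move: (\rank _) (\rank _) => a b; lia.
by rewrite -(mxrank_mul_ker A Pv) APv rcap.
Qed.

Lemma dvdz2 (z : int) : (2 %| z)%Z = ~~ odd `|z|.
Proof. by rewrite dvdzE dvdn2. Qed.

Lemma dvdz2D1 (z : int) : (2 %| z + 1)%Z = ~~ (2 %| z)%Z.
Proof. rewrite !dvdz2; lia. Qed.

Lemma dvdz2B1 (z : int) : (2 %| z - 1)%Z = ~~ (2 %| z)%Z.
Proof. rewrite !dvdz2; lia. Qed.

Lemma dvdz2DM2 (z y : int) : (2 %| z + y *+ 2)%Z = (2 %| z)%Z.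
Proof. rewrite !dvdz2 mulr2n; lia. Qed.

(** * The cubical chain complex *)

Section CubicalComplex.
Variables (F : fieldType) (d : nat).
Implicit Types (c b e x y : lattice d) (A B : set (lattice d)).

Definition evenc c (i : 'I_d) := (2 %| c ord0 i)%Z.

Definition csign c (j : 'I_d) : F := (-1) ^+ #|[pred l : 'I_d | (l < j)%N && evenc c l]|.

Notation dl := (delta_mx 0 : 'I_d -> lattice d).

Lemma incidenceE c b : incidence F c b =
  \sum_(i < d | evenc c i) csign c i * ((b == c + dl i)%:R - (b == c - dl i)%:R).
Proof. by []. Qed.

Lemma delta_coord i j : dl i 0 j = (i == j)%:R.
Proof. by rewrite mxE eqxx eq_sym. Qed.

(* [g] is a face of [c] in direction [i] *)
Definition flipped c g i := [&& evenc c i, ~~ evenc g i & [forall l, (l != i) ==> (g 0 l == c 0 l)]].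

Lemma flippedD c i : evenc c i -> flipped c (c + dl i) i /\ flipped c (c - dl i) i.
Proof.
move=> ci; rewrite /flipped ci /=; split; apply/andP; split.
- by rewrite /evenc mxE delta_coord eqxx dvdz2D1 negbK.
- by apply/forallP => l; apply/implyP => li; rewrite mxE delta_coord eq_sym; rewrite eq_sym in li; rewrite (negPf li) addr0.
- by rewrite /evenc !mxE !eqxx dvdz2B1 negbK.
- by apply/forallP => l; apply/implyP => li; rewrite !mxE eqxx (negPf li) subr0.
Qed.

Lemma flipped_even c g i j : flipped c g i -> evenc g j = evenc c j && (j != i).
Proof.
case/and3P => ci gi /forallP h; have [->|ji] := eqVneq j i; first by rewrite andbF (negPf gi).
by have := h j; rewrite ji /= /evenc andbT => /eqP->.
Qed.

Lemma flipped_sign c g i j : flipped c g i -> j != i -> csign g j = (-1) ^+ (i < j)%N * csign c j.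
Proof.
move=> cg ji; have [ci _ _] := and3P cg; rewrite /csign.
have E l : evenc g l = evenc c l && (l != i) := flipped_even l cg.
have [ij|ij] := boolP (i < j)%N; last first.
  rewrite mul1r; congr (_ ^+ _); apply: eq_card => l; rewrite !inE E.
  case: (eqVneq l i) => [->|_]; last by rewrite andbT.
  by rewrite (negPf ij).
rewrite (cardD1 i [pred l : 'I_d | (l < j)%N && evenc c l]) inE ij ci /= expr1 add1n exprS.
rewrite mulrA mulrNN mulr1 mul1r; congr (_ ^+ _); apply: eq_card => l; rewrite !inE E.
by case: (l < j)%N; case: evenc; case: (l != i).
Qed.

Lemma sum_incidence c s (f : lattice d -> F) : uniq s ->
  (forall i, evenc c i -> c + dl i \in s /\ c - dl i \in s) ->
  \sum_(b <- s) incidence F c b * f b = \sum_(i < d | evenc c i) csign c i * (f (c + dl i) - f (c - dl i)).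
Proof.
move=> us hs.
have pick y : y \in s -> \sum_(b <- s) (b == y)%:R * f b = f y.
  move=> ys; rewrite (bigD1_seq y)//= eqxx mul1r big1 ?addr0// => b /negPf->.
  by rewrite mul0r.
under eq_bigr do rewrite incidenceE mulr_suml.
rewrite exchange_big /=; apply: eq_bigr => i ci.
have [h1 h2] := hs i ci; rewrite -(pick _ h1) -(pick _ h2) -sumrB mulr_sumr.
by apply: eq_bigr => b _; ring.
Qed.

(** Removing directions [i] and [j] in the two orders reaches the same faces with opposite signs, as
    removing one direction shifts the parity count of the later one only. *)
Lemma boundary_boundary c e s : uniq s ->
  (forall i, evenc c i -> c + dl i \in s /\ c - dl i \in s) ->
  \sum_(b <- s) incidence F c b * incidence F b e = 0.
Proof.
move=> us hs; rewrite sum_incidence//.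
pose E i j : F := csign c i * csign c j * ((e == c + dl i + dl j)%:R - (e == c + dl i - dl j)%:R
   - (e == c - dl i + dl j)%:R + (e == c - dl i - dl j)%:R).
have Esym i j : E i j = E j i.
  rewrite /E [csign c i * _]mulrC; congr (_ * _).
  by rewrite [c + dl i + dl j]addrAC [c + dl i - dl j]addrAC [c - dl i + dl j]addrAC [c - dl i - dl j]addrAC; ring.
transitivity (\sum_(i < d | evenc c i) \sum_(j < d | evenc c j && (j != i)) (-1) ^+ (i < j)%N * E i j).
  apply: eq_bigr => i ci; have [f1 f2] := flippedD ci.
  rewrite !incidenceE (eq_bigl _ _ (fun j => flipped_even j f1)) [X in _ - X](eq_bigl _ _ (fun j => flipped_even j f2)).
  rewrite -sumrB mulr_sumr; apply: eq_bigr => j /andP[cj ji].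
  by rewrite (flipped_sign f1 ji) (flipped_sign f2 ji) /E; ring.
rewrite pair_big_dep /=.
rewrite (bigID (fun p : 'I_d * 'I_d => (p.1 < p.2)%N)) /=.
have -> : \sum_(p : 'I_d * 'I_d | [&& evenc c p.1, evenc c p.2 & p.2 != p.1] && (p.1 < p.2)%N)
    (-1) ^+ (p.1 < p.2)%N * E p.1 p.2 =
  - \sum_(p : 'I_d * 'I_d | [&& evenc c p.1, evenc c p.2 & p.2 != p.1] && (p.1 < p.2)%N) E p.1 p.2.
  by rewrite -sumrN; apply: eq_bigr => p /andP[_ ->]; rewrite mulN1r.
have swapK : cancel (fun p : 'I_d * 'I_d => (p.2, p.1)) (fun p : 'I_d * 'I_d => (p.2, p.1)) by case.
rewrite [X in _ + X](reindex (fun p : 'I_d * 'I_d => (p.2, p.1)))/=; last by exists (fun p : 'I_d * 'I_d => (p.2, p.1)) => p _; exact: swapK.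
apply/eqP; rewrite addrC subr_eq0; apply/eqP; apply: eq_big => [[i j]|[i j]] /=.
  rewrite andbCA eq_sym; have [//|ji] := eqVneq j i; first by rewrite !andbF.
  by congr (_ && _); move: ji; rewrite -val_eqE /= -leqNgt ltn_neqAle eq_sym => ->.
by move=> /andP[_ /negPf ->]; rewrite mul1r Esym.
Qed.

Lemma incidence_translate c b y : incidence F (c + y *+ 2) (b + y *+ 2) = incidence F c b.
Proof.
have ev z i : evenc (z + y *+ 2) i = evenc z i by rewrite /evenc mxE mulr2n mxE -mulr2n dvdz2DM2.
rewrite !incidenceE (eq_bigl _ _ (ev c)); apply: eq_bigr => i _; congr (_ * _).
  by rewrite /csign; congr (_ ^+ _); apply: eq_card => l; rewrite !inE ev.
by rewrite addrAC [c + _ - _]addrAC !(inj_eq (addIr _)).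
Qed.

Lemma cube_dim_translate c y : cube_dim (c + y *+ 2) = cube_dim c.
Proof. by apply: eq_card => i; rewrite !inE mxE mulr2n mxE -mulr2n dvdz2DM2. Qed.

Lemma incidence_neq0 c b : incidence F c b != 0 ->
  exists2 i, evenc c i & b = c + dl i \/ b = c - dl i.
Proof.
move=> h; apply: contrapT => nh; move/eqP: h; apply; rewrite incidenceE big1// => i ci.
have [h1|h1] := eqVneq b (c + dl i); first by exfalso; apply: nh; exists i => //; left.
have [h2|h2] := eqVneq b (c - dl i); first by exfalso; apply: nh; exists i => //; right.
by rewrite subrr mulr0.
Qed.

Lemma flipped_dim c g i : flipped c g i -> cube_dim c = (cube_dim g).+1.
Proof.
move=> cg; have [ci _ _] := and3P cg.
rewrite /cube_dim (cardD1 i) inE; rewrite -/(evenc c i) ci /=; congr _.+1.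
by apply: eq_card => j; rewrite !inE -/(evenc c j) -/(evenc g j) (flipped_even j cg) andbC.
Qed.

(* [x] is one of the lattice points whose unit cube contains the cube coded by [c] *)
Definition touch c x := [forall i, (`|c 0%R i - x 0%R i *+ 2| <= 1)%N].

Lemma touchP c x : reflect (forall i, (`|c 0%R i - x 0%R i *+ 2| <= 1)%N) (touch c x).
Proof. exact: forallP. Qed.

Lemma touch_adj c x y : touch c x -> touch c y -> adj x y.
Proof.
move=> /touchP hx /touchP hy; apply/adjP => i; have := hx i; have := hy i.
by rewrite !mulr2n; lia.
Qed.

Lemma touch_translate c x y : touch (c + y *+ 2) (x + y) = touch c x.
Proof. by apply: eq_forallb => i; rewrite !mxE !mulr2n; congr (`|_| <= _)%N; ring. Qed.

Lemma touch_face c g i x : flipped c g i -> (g = c + dl i \/ g = c - dl i) -> touch c x -> touch g x.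
Proof.
move=> /and3P[ci _ _] hg /touchP h; apply/touchP => j; have := h j.
have {hg} : g 0 j = c 0 j + (i == j)%:R \/ g 0 j = c 0 j - (i == j)%:R by case: hg => ->; [left|right]; rewrite !mxE eqxx eq_sym.
have [<-|ij] := eqVneq i j; last by case=> ->; rewrite ?addr0 ?subr0.
move: ci; rewrite /evenc dvdz2 !mulr2n => ci.
by case=> ->; rewrite ?mulr1n; move: ci; move: (c 0 i) (x 0 i) => a b; lia.
Qed.

Lemma incidence_touch c b x : incidence F c b != 0 -> touch c x -> touch b x.
Proof.
move=> /incidence_neq0[i ci hb]; have [f1 f2] := flippedD ci.
by case: (hb) => hb'; apply: (@touch_face _ _ i) => //; rewrite hb'.
Qed.

Lemma incidence_dim c b : incidence F c b != 0 -> cube_dim c = (cube_dim b).+1.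
Proof.
by move=> /incidence_neq0[i ci hb]; have [f1 f2] := flippedD ci; case: hb => ->; [exact: flipped_dim f1|exact: flipped_dim f2].
Qed.

Lemma touch_supbox c x : touch c x = (c \in supbox (x *+ 2) 1).
Proof. by rewrite mem_supbox; apply: eq_forallb => i; rewrite !mxE. Qed.

End CubicalComplex.

(** * Cell counts and boundary ranks as additive functionals *)

Section CellFunctionals.
Variables (R : realType) (F : fieldType) (d : nat).
Implicit Types (c b x y : lattice d) (A B : set (lattice d)).

Definition cells k A : set (lattice d) := [set c | cube_dim c = k /\ exists2 x, A x & touch c x].

Lemma elementary_cubeP A c : @elementary_cube R d c `<=` cubes R A <-> exists2 x, A x & touch c x.
Proof.
split=> [h|[x Ax /touchP cx] p hp].
  have [i|x Ax hx] := h (\row_i ((c 0 i)%:~R / 2)).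
    rewrite mxE mulrC divfK//; case: ifP => // _; by rewrite subrr normr0.
  exists x => //; apply/touchP => i; have := hx i; rewrite mxE.
  rewrite (_ : _ - _ = (c 0 i - x 0 i *+ 2)%:~R / 2); last by rewrite intrB mulr2n intrD; field.
  rewrite normrM (@ger0_norm _ (2^-1 : R)) ?invr_ge0// ler_pdivrMr// mulVf// -intr_norm (ler_int R _ 1%Z); lia.
have e2 (u : R) : (`|u| <= 2^-1) = (`|2 * u| <= 1) by rewrite normrM (@ger0_norm _ (2 : R))// -ler_pdivlMl// mulr1.
exists x => // i; have := hp i; have := cx i.
rewrite e2 mulrBr => h.
case: ifP => ev.
  have -> : (c 0 i)%:~R = 2 * (x 0 i)%:~R :> R.
    rewrite -(intrM R 2%Z); congr (_%:~R).
    by move: ev h; rewrite dvdz2 mulr2n; move: (c 0 i) (x 0 i) => a e; lia.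
  by [].
move=> ->; have -> : 2 * (x 0 i)%:~R = (x 0 i *+ 2)%:~R :> R by rewrite mulr2n intrD; ring.
by rewrite -intrB -intr_norm (ler_int R _ 1%Z); lia.
Qed.

Lemma elementary_cubesE k A : elementary_cubes k (cubes R A) = fset_set (cells k A).
Proof.
rewrite /elementary_cubes; congr (enum_fset (fset_set _)); apply/seteqP.
by split=> c [ck] /elementary_cubeP.
Qed.

Lemma finite_cells k A : finite_set A -> finite_set (cells k A).
Proof.
move=> fA; apply: (@sub_finite_set _ _ (\bigcup_(x in A) [set` supbox (x *+ 2) 1])).
  by move=> c [_ [x Ax cx]]; exists x => //=; rewrite -touch_supbox.
by apply: bigcup_finite => // x _; exact: finite_seq.
Qed.

Lemma cells_card k A : finite_set A -> (#|` fset_set (cells k A)| <= 3 ^ d * #|` fset_set A|)%N.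
Proof.
move=> fA.
have -> : (3 ^ d * #|` fset_set A|)%N = size (flatten [seq supbox (x *+ 2) 1 | x <- fset_set A]).
  rewrite size_flatten /shape -map_comp (eq_map (fun x => size_supbox (x *+ 2) 1)).
  by elim: (enum_fset _) => [|x s IH] /=; rewrite ?muln0// mulnS IH.
apply: uniq_leq_size; first exact: fset_uniq.
move=> c; rewrite in_fset_set ?inE; last exact: finite_cells.
move=> [_ [x Ax cx]]; apply/flatten_mapP; exists x; last by rewrite -touch_supbox.
by rewrite in_fset_set ?inE.
Qed.

Section Family.
(** An abstract family of cells, used for the cells of a set and for the cells relative to the rest
    of the window. Both split over separated sets with no incidence between the parts. *)
Variable G : nat -> set (lattice d) -> set (lattice d).
Hypothesis Gcells : forall p A, G p A `<=` cells p A.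
Hypothesis GU : forall p A B, separated A B -> G p (A `|` B) = G p A `|` G p B.
Hypothesis G0 : forall p q A B a b, separated A B -> G p A a -> G q B b -> a <> b /\ incidence F a b = 0.

Definition cnt p A : R := (#|` fset_set (G p A)|)%:R.

Definition rkf p A : R :=
  (\rank (kmx 0 (@incidence d F) (fset_set (G p A)) (fset_set (G p.-1 A))))%:R.

Let fG p A : finite_set A -> finite_set (G p A).
Proof. by move=> fA; apply: sub_finite_set (@Gcells p A) _; exact: finite_cells. Qed.

Lemma separatedC A B : separated A B -> separated B A.
Proof. by move=> h a b Ba Ab; rewrite adj_sym; exact: h. Qed.

Let GUs p A B : finite_set A -> finite_set B -> separated A B ->
  perm_eq (fset_set (G p (A `|` B))) (fset_set (G p A) ++ fset_set (G p B)).
Proof.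
move=> fA fB sAB; apply: uniq_perm; first exact: fset_uniq.
  rewrite cat_uniq !fset_uniq andbT /=; apply/hasPn => y.
  rewrite !in_fset_set ?inE; [|exact: fG..] => By; apply/negP => /set_mem Ay.
  by have [] := G0 sAB Ay By.
move=> y; rewrite mem_cat GU// fset_setU ?inE//; exact: fG.
Qed.

Lemma cnt_additive p A B : finite_set A -> finite_set B -> separated A B ->
  cnt p (A `|` B) = cnt p A + cnt p B.
Proof. by move=> fA fB sAB; rewrite /cnt (perm_size (GUs p fA fB sAB)) size_cat natrD. Qed.

Lemma rkf_additive p A B : finite_set A -> finite_set B -> separated A B ->
  rkf p (A `|` B) = rkf p A + rkf p B.
Proof.
move=> fA fB sAB; rewrite /rkf -natrD -rank_kmx_cat => [||a b].
- by congr (_%:R); apply: rank_kmx_eq; apply: perm_mem; exact: GUs.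
- move=> a b; rewrite !in_fset_set ?inE; [|exact: fG..] => h1 h2.
  by have [] := G0 sAB h1 h2.
- rewrite !in_fset_set ?inE; [|exact: fG..] => h1 h2.
  by have [] := G0 (separatedC sAB) h1 h2.
Qed.

Lemma cnt_bound p A : finite_set A -> `|cnt p A| <= 3 ^+ d * (#|` fset_set A|)%:R.
Proof.
move=> fA; rewrite /cnt normr_nat -natrX -natrM ler_nat; apply: leq_trans (cells_card p fA).
apply: uniq_leq_size; first exact: fset_uniq.
move=> c; rewrite !in_fset_set ?inE; [exact: Gcells|exact: finite_cells|exact: fG].
Qed.

Lemma rkf_bound p A : finite_set A -> `|rkf p A| <= 3 ^+ d * (#|` fset_set A|)%:R.
Proof.
move=> fA; apply: le_trans (cnt_bound p fA); rewrite /cnt /rkf !normr_nat ler_nat.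
exact: rank_leq_row.
Qed.

Hypothesis GT : forall p A y c, G p (translate A y) c <-> G p A (c - y *+ 2).

Let GTs p A y : finite_set A ->
  fset_set (G p (translate A y)) =i map (fun c => c + y *+ 2) (fset_set (G p A)).
Proof.
move=> fA c; rewrite in_fset_set; last by apply: fG; exact: finite_image.
apply/idP/mapP => [/set_mem/GT h|[c' + ->]].
  by exists (c - y *+ 2); rewrite ?subrK// in_fset_set ?inE//; exact: fG.
by rewrite in_fset_set ?inE; [move=> h; apply/GT; rewrite addrK|exact: fG].
Qed.

Lemma cnt_translate p A y : finite_set A -> cnt p (translate A y) = cnt p A.
Proof.
move=> fA; rewrite /cnt -[X in _ = X%:R](size_map (fun c => c + y *+ 2)); congr (_%:R); apply: perm_size.
apply: uniq_perm; [exact: fset_uniq| |exact: GTs].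
by rewrite map_inj_uniq ?fset_uniq//; exact: addIr.
Qed.

Lemma rkf_translate p A y : finite_set A -> rkf p (translate A y) = rkf p A.
Proof.
move=> fA; rewrite /rkf; congr (_%:R).
rewrite -[RHS](@kmx_map _ _ _ _ (fun c => c + y *+ 2)) => [|a b]; last exact: incidence_translate.
by apply: rank_kmx_eq; exact: GTs.
Qed.

End Family.

Lemma cellsU p A B : cells p (A `|` B) = cells p A `|` cells p B.
Proof.
apply/seteqP; split=> c.
  by move=> [cp [x [Ax|Bx] cx]]; [left|right]; split=> //; exists x.
by move=> [[cp [x Ax cx]]|[cp [x Bx cx]]]; split=> //; exists x => //; [left|right].
Qed.

Lemma cells_separated p q A B a b : separated A B -> cells p A a -> cells q B b ->
  a <> b /\ incidence F a b = 0.
Proof.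
move=> sAB [_ [x Ax ax]] [_ [y By yb]].
have sep z : touch b z -> ~ A z by move=> zb Az; move/negP: (sAB _ _ Az By); apply; exact: touch_adj zb yb.
split=> [ab|]; first by apply: (sep x); rewrite -?ab.
by apply/eqP/negPn/negP => h; apply: (sep x) => //; exact: incidence_touch h ax.
Qed.

Lemma cells_translate p A y c : cells p (translate A y) c <-> cells p A (c - y *+ 2).
Proof.
split=> -[cp [x Ax cx]].
  split; first by rewrite -(cube_dim_translate _ y) subrK.
  exists (x - y); first exact/translateE.
  by rewrite -(touch_translate _ _ y) !subrK.
split; first by rewrite -(cube_dim_translate _ y) subrK in cp.
exists (x + y); first by exists x.
by rewrite -(touch_translate _ _ y) !subrK in cx.
Qed.

(* The cells of the window [W] all of whose lattice points in [W] lie in [A]: the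
   complement in the cells of [W] of the cells of [W \ A]. *)
Definition cocells W p A : set (lattice d) :=
  [set c | cells p W c /\ forall x, W x -> touch c x -> A x].

Lemma cocells_cells W p A : cocells W p A `<=` cells p A.
Proof. by move=> c [[cp [x Wx cx]] h]; split=> //; exists x => //; exact: h. Qed.

Lemma cocellsU W p A B : separated A B -> cocells W p (A `|` B) = cocells W p A `|` cocells W p B.
Proof.
move=> sAB; apply/seteqP; split=> c.
  move=> [[cp [x Wx cx]] h]; have [Ax|Bx] := h x Wx cx.
    left; split; first by split=> //; exists x.
    move=> y Wy cy; have [//|By] := h y Wy cy.
    by have := sAB _ _ Ax By; rewrite (touch_adj cx cy).
  right; split; first by split=> //; exists x.
  move=> y Wy cy; have [Ay|//] := h y Wy cy.
  by have := sAB _ _ Ay Bx; rewrite (touch_adj cy cx).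
by move=> [[cW h]|[cW h]]; split=> // x Wx cx; [left|right]; exact: h.
Qed.

Lemma cocells_separated W p q A B a b : separated A B -> cocells W p A a -> cocells W q B b ->
  a <> b /\ incidence F a b = 0.
Proof. by move=> sAB /cocells_cells h1 /cocells_cells; exact: cells_separated h1. Qed.

Lemma cocells_bulk W p A : (forall x y, A x -> adj x y -> W y) -> cocells W p A = cocells setT p A.
Proof.
move=> h; apply/seteqP; split=> c [[cp [x Wx cx]] hc].
  have Ax := hc _ Wx cx; split; first by split=> //; exists x.
  by move=> y _ cy; apply: hc => //; apply: h Ax _; exact: touch_adj cx cy.
have Ax := hc _ Wx cx; split; first by split=> //; exists x => //; apply: h Ax _; exact: adj_refl.
by move=> y _; exact: hc.
Qed.

Lemma cocells_translate p A y c : cocells setT p (translate A y) c <-> cocells setT p A (c - y *+ 2).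
Proof.
have aux B z : translate setT z = setT :> set (lattice d) by apply/seteqP; split=> // u _; apply/translateE.
split=> -[cT h].
  split; first by apply/cells_translate; rewrite aux.
  move=> x _ cx; have := h (x + y) I.
  rewrite -{1}[c](subrK (y *+ 2)) touch_translate => /(_ cx) /translateE.
  by rewrite addrK.
split; first by move: cT => /cells_translate; rewrite aux.
move=> x _ cx; apply/translateE; apply: h => //.
by rewrite -(touch_translate _ _ y) !subrK.
Qed.

End CellFunctionals.

(** * Betti numbers, duality and acyclicity of the window *)

Section BettiFunctionals.
Variables (R : realType) (F : fieldType) (d : nat).
Implicit Types (c b x y : lattice d) (A B : set (lattice d)).

Notation dl := (delta_mx 0 : 'I_d -> lattice d).
Notation inc := (@incidence d F).

Lemma cell_faces k A c i : cells k.+1 A c -> evenc c i -> cells k A (c + dl i) /\ cells k A (c - dl i).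
Proof.
move=> [ck [x Ax cx]] ci; have [f1 f2] := flippedD ci.
split; (split; [apply: succn_inj; rewrite -ck|exists x => //]).
- exact/esym/(flipped_dim f1).
- by apply: (touch_face f1) => //; left.
- exact/esym/(flipped_dim f2).
- by apply: (touch_face f2) => //; right.
Qed.

Lemma cells_boundary k A c e : finite_set A -> cells k.+1 A c ->
  \sum_(b <- fset_set (cells k A)) inc c b * inc b e = 0.
Proof.
move=> fA ck; apply: boundary_boundary; first exact: fset_uniq.
by move=> i ci; rewrite !in_fset_set; [|exact: finite_cells..]; have [h1 h2] := cell_faces ck ci; rewrite !inE.
Qed.

Lemma complex_rank_le k A (t : seq (lattice d)) : finite_set A ->
  (\rank (kmx (0%R : lattice d) inc (fset_set (cells k.+1 A)) (fset_set (cells k A))) +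
   \rank (kmx (0%R : lattice d) inc (fset_set (cells k A)) t) <= #|` fset_set (cells k A)|)%N.
Proof.
move=> fA; apply: mulmx0_rank_max; apply/matrixP => i j; rewrite kmx_mul !mxE.
apply: cells_boundary => //; have := mem_nth 0 (ltn_ord i).
by rewrite in_fset_set ?inE//; exact: finite_cells.
Qed.

Definition primal k A : R := (betti F k (cubes R A))%:R.

(** Rank-nullity. The truncated subtraction in [betti] is harmless because boundaries are cycles. *)
Lemma primalE k A : finite_set A ->
  primal k A = cnt R (@cells d) k A - rkf R F (@cells d) k A - rkf R F (@cells d) k.+1 A.
Proof.
move=> fA; rewrite /primal /betti mxrank_ker.
have er j : \rank (boundary_mx F j (cubes R A)) =
    \rank (kmx (0%R : lattice d) inc (fset_set (cells j A)) (fset_set (cells j.-1 A))).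
  by rewrite -!(elementary_cubesE R).
have es : size (elementary_cubes k (cubes R A)) = #|` fset_set (cells k A)| by rewrite elementary_cubesE.
rewrite !er es /cnt /rkf /=.
have := complex_rank_le k (fset_set (cells k.-1 A)) fA.
set r1 := \rank _; set r2 := \rank _ => h.
rewrite natrB; last by rewrite leq_subRL; [rewrite addnC|exact: rank_leq_row].
by rewrite natrB//; exact: rank_leq_row.
Qed.

Lemma primal_additive k A B : finite_set A -> finite_set B -> separated A B ->
  primal k (A `|` B) = primal k A + primal k B.
Proof.
move=> fA fB sAB; rewrite !primalE ?finite_setU//.
have sub p C : cells p C `<=` @cells d p C by [].
have U p C D (_ : separated C D) : cells p (C `|` D) = cells p C `|` @cells d p D := cellsU p C D.
have S := @cells_separated F d.
rewrite (cnt_additive R sub U S)// !(rkf_additive R sub U S)//; ring.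
Qed.

Lemma primal_bound k A : finite_set A -> `|primal k A| <= 3 ^+ d.+1 * (#|` fset_set A|)%:R.
Proof.
move=> fA; rewrite primalE//; have sub p C : cells p C `<=` @cells d p C by [].
have h1 := cnt_bound R sub k fA; have h2 := rkf_bound R F sub k fA; have h3 := rkf_bound R F sub k.+1 fA.
apply: le_trans (ler_normB _ _) _; apply: le_trans (lerD (ler_normB _ _) (lexx _)) _.
apply: le_trans (lerD (lerD h1 h2) h3) _; rewrite exprS -mulrA; set z := _ * _; lra.
Qed.

Lemma primal_translate k A y : finite_set A -> primal k (translate A y) = primal k A.
Proof.
move=> fA; have fT : finite_set (translate A y) by exact: finite_image.
rewrite !primalE//; have sub p C : cells p C `<=` @cells d p C by [].
have T p C z c : cells p (translate C z) c <-> @cells d p C (c - z *+ 2) := cells_translate p C z c.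
by rewrite (cnt_translate R sub T)// !(rkf_translate R F sub T).
Qed.

(** For [k > 0], the dimension of the homology of degree [k+1] of [W] relative to the cubes of [W]
    without [A]. For [k = 0], the relative dimension in degree 1 minus the one in degree 0; the
    common rank cancels, which leaves this formula. *)
Definition dual W k A : R := cnt R (cocells W) k.+1 A - rkf R F (cocells W) k.+2 A -
  (if k == 0%N then cnt R (cocells W) 0 A else rkf R F (cocells W) k.+1 A).

Lemma dual_additive W k A B : finite_set A -> finite_set B -> separated A B ->
  dual W k (A `|` B) = dual W k A + dual W k B.
Proof.
move=> fA fB sAB; rewrite /dual; have sub := @cocells_cells d W.
have U := @cocellsU d W; have S := @cocells_separated F d W.
rewrite !(cnt_additive R sub U S)// !(rkf_additive R sub U S)//; case: ifP => _; ring.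
Qed.

Lemma dual_bound W k A : finite_set A -> `|dual W k A| <= 3 ^+ d.+1 * (#|` fset_set A|)%:R.
Proof.
move=> fA; rewrite /dual; have sub := @cocells_cells d W.
have h1 := cnt_bound R sub k.+1 fA; have h2 := rkf_bound R F sub k.+2 fA.
apply: le_trans (ler_normB _ _) _; apply: le_trans (lerD (ler_normB _ _) (lexx _)) _.
rewrite exprS -mulrA; case: ifP => _.
  have h3 := cnt_bound R sub 0%N fA.
  apply: le_trans (lerD (lerD h1 h2) h3) _; set z := _ * _; lra.
have h3 := rkf_bound R F sub k.+1 fA.
apply: le_trans (lerD (lerD h1 h2) h3) _; set z := _ * _; lra.
Qed.

Lemma dual_translate k A y : finite_set A -> dual setT k (translate A y) = dual setT k A.
Proof.
move=> fA; rewrite /dual; have sub := @cocells_cells d setT.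
have T := @cocells_translate d.
by rewrite !(cnt_translate R sub T)// !(rkf_translate R F sub T).
Qed.

Lemma dual_bulk W k A : (forall x y, A x -> adj x y -> W y) -> dual W k A = dual setT k A.
Proof. by move=> h; rewrite /dual /cnt /rkf !(cocells_bulk _ h). Qed.

(* Retraction of the window onto the vertex (1, ..., 1): the first coordinate of [c]
   different from 1 is moved away from 1. *)
Definition firstneq c : option 'I_d := [pick i | (c 0 i != 1) && [forall j : 'I_d, (j < i)%N ==> (c 0 j == 1)]].

Lemma firstneqP c : (c = const_mx 1 /\ firstneq c = None) \/
  (exists2 i, firstneq c = Some i & c 0 i != 1 /\ forall j : 'I_d, (j < i)%N -> c 0 j = 1).
Proof.
rewrite /firstneq; case: pickP => [i /andP[ci /forallP h]|h].
  right; exists i => //; split=> // j ji; apply/eqP; have := h j; rewrite ji; exact.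
left; split=> //; apply/rowP => i; rewrite mxE; move: {2}(val i) (leqnn (val i)) => n.
elim: n i => [|n IH] i hi.
  have := h i; have [->//|ci] := eqVneq (c 0 i) 1; rewrite /=; move=> /forallP[j].
  by apply/implyP; move: hi; rewrite leqn0 => /eqP /= ->.
have := h i; have [->//|ci] := eqVneq (c 0 i) 1; rewrite /=; move=> /forallP[j].
apply/implyP => ji; rewrite IH// -ltnS; exact: leq_trans ji hi.
Qed.

Lemma firstneq_uniq c i : c 0 i != 1 -> (forall j : 'I_d, (j < i)%N -> c 0 j = 1) -> firstneq c = Some i.
Proof.
move=> ci h; have [[ce _]|[k -> [ck hk]]] := firstneqP c.
  by move: ci; rewrite ce mxE eqxx.
congr Some; apply/val_inj; have [ik|ki|//] := ltngtP i k.
  by move: ci; rewrite hk ?eqxx.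
by move: ck; rewrite h ?eqxx.
Qed.

(** An acyclic matching in the sense of discrete Morse theory. [up] moves coordinate [i] one step
    away from the value 1; a cell is upper when its first coordinate different from 1 is
    nondegenerate, and it is then matched with the face [up] produces. *)
Definition up c (i : 'I_d) : lattice d := if 2 <= c 0 i then c + dl i else c - dl i.

Definition upper c := if firstneq c is Some i then evenc c i else false.

Definition partner c := if firstneq c is Some i then up c i else c.

(** The distance of the code to the critical vertex [(1, ..., 1)]; it orders the matching and makes
    its matrix triangular. *)
Definition height c : nat := (\sum_(i < d) `|c 0%R i - 1|)%N.



Lemma up_coord c i : up c i 0 i = if 2 <= c 0 i then c 0 i + 1 else c 0 i - 1.
Proof. by rewrite /up; case: ifP; rewrite !mxE !eqxx. Qed.

Lemma up_other c i j : j != i -> up c i 0 j = c 0 j.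
Proof. by move=> ji; rewrite /up; case: ifP; rewrite !mxE !eqxx (negPf ji) ?addr0 ?subr0. Qed.

Lemma height_split c i : height c = (`|c 0%R i - 1| + \sum_(j < d | j != i) `|c 0%R j - 1|)%N.
Proof. by rewrite /height (bigD1 i). Qed.

Lemma height_up c i : evenc c i -> height (up c i) = (height c).+1.
Proof.
move=> ci; rewrite !(height_split _ i) up_coord -addSn; congr (_ + _)%N.
  by move: ci; rewrite /evenc dvdz2; case: ifP; move: (c 0 i) => a; lia.
by apply: eq_bigr => j ji; rewrite up_other.
Qed.

Lemma firstneq_up c i : firstneq c = Some i -> evenc c i -> firstneq (up c i) = Some i.
Proof.
move=> ci ev; apply: firstneq_uniq.
  by rewrite up_coord; move: ev; rewrite /evenc dvdz2; case: ifP; move: (c 0 i) => a; lia.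
have [[_ h]|[k h [_ hk]]] := firstneqP c; first by rewrite h in ci.
have ki : k = i by move: h; rewrite ci => -[].
move=> j ji; rewrite up_other; first by apply: hk; rewrite ki.
by apply/eqP => e; rewrite e ltnn in ji.
Qed.

(* A face of [c] that is the partner of another cell of at least the same height would
   be obtained from [c] by moving a coordinate after the first one different from 1,
   and would then be an upper cell. *)
Lemma partner_triangular c c' : upper c -> upper c' -> c != c' -> (height c <= height c')%N ->
  inc c (partner c') = 0.
Proof.
rewrite /upper /partner; case ec: (firstneq c) => [i|]//; case ec': (firstneq c') => [i'|]// ci ci' cc' hh.
apply/eqP/negPn/negP => /incidence_neq0[j cj hb].
have fb := firstneq_up ec' ci'; have nev : ~~ evenc (up c' i') i'.
  by rewrite /evenc up_coord; case: ifP; rewrite ?dvdz2D1 ?dvdz2B1 negbK.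
have hb' : height (up c' i') = (height c').+1 := height_up ci'.
move Eb: (up c' i') hb fb nev hb' => b hb fb nev hb'.
have [[_ h]|[k h [ck hk]]] := firstneqP c; first by rewrite h in ec.
have ki : k = i by move: h; rewrite ec => -[].
move: ck hk; rewrite {k h}ki => ck hk.
have bc l : l != j -> b 0 l = c 0 l by move=> lj; case: hb => ->; rewrite !mxE !eqxx (negPf lj) ?addr0 ?subr0.
have ij : (i <= j)%N.
  rewrite leqNgt; apply/negP => ji; move: cj; by rewrite /evenc hk.
have [ji|ji] := eqVneq j i; last first.
  have fbi : firstneq b = Some i.
    apply: firstneq_uniq; first by rewrite bc// eq_sym.
    move=> l li; rewrite bc ?hk//; apply/eqP => e; move: ij; rewrite -e leqNgt li //.
  move: nev; have -> : i' = i by move: fb; rewrite fbi => -[].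
  by rewrite /evenc bc 1?eq_sym// -/(evenc c i) ci.
rewrite ji in hb bc.
have bi : b 0 i = if 2 <= c 0 i then c 0 i + 1 else c 0 i - 1.
  have hs : \sum_(l < d | l != i) `|b 0%R l - 1|%N = \sum_(l < d | l != i) `|c 0%R l - 1|%N by apply: eq_bigr => l li; rewrite bc.
  move: hh; rewrite -ltnS -hb' !(height_split _ i) hs ltn_add2r.
  have : b 0 i = c 0 i + 1 \/ b 0 i = c 0 i - 1 by case: hb => ->; [left|right]; rewrite !mxE !eqxx.
  move: ci; rewrite /evenc dvdz2; move: (b 0 i) (c 0 i) => u v; case: ifP; lia.
have fbi : firstneq b = Some i.
  apply: firstneq_uniq.
    by rewrite bi; move: ci; rewrite /evenc dvdz2; move: (c 0 i) => v; case: ifP; lia.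
  by move=> l li; rewrite bc ?hk//; apply/eqP => e; move: li; rewrite e ltnn.
have ii : i' = i by move: fb; rewrite fbi => -[].
rewrite ii in Eb ci'; move/eqP: cc'; apply; apply/rowP => l.
have [->|li] := eqVneq l i; last by rewrite -bc// -Eb up_other.
have := bi; rewrite -Eb up_coord; move: ci ci'; rewrite /evenc !dvdz2.
move: (c 0 i) (c' 0 i) => u v; case: ifP; case: ifP; lia.
Qed.

Lemma partner_incidence c : upper c -> inc c (partner c) != 0.
Proof.
rewrite /upper /partner; case: (firstneq c) => [i|]// ci; rewrite incidenceE.
have dne (j : 'I_d) : dl j != - dl j by apply/eqP => /(congr1 (fun z : lattice d => z 0 j)); rewrite !mxE !eqxx.
have dinj (j k : 'I_d) : dl j = dl k -> j = k by move=> /(congr1 (fun z : lattice d => z 0 j)); rewrite !mxE !eqxx; case: eqVneq.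
have dN (j k : 'I_d) : dl j != - dl k.
  apply/eqP => /(congr1 (fun z : lattice d => z 0 j)); rewrite !mxE !eqxx.
  by case: eqVneq.
have sg : csign F c i != 0 by rewrite /csign expf_neq0// oppr_eq0 oner_eq0.
rewrite (bigD1 i)//= big1 => [|j /andP[cj ji]].
  rewrite addr0 mulf_neq0// /up; case: ifP => _.
    by rewrite eqxx (inj_eq (addrI c)) (negPf (dN i i)) subr0 oner_neq0.
  by rewrite eqxx (inj_eq (addrI c)) [- _ == _]eq_sym (negPf (dN i i)) sub0r oppr_eq0 oner_neq0.
have ij : (dl i == dl j) = false by apply/eqP => /dinj e; rewrite e eqxx in ji.
rewrite /up; case: ifP => _; rewrite !(inj_eq (addrI c)).
  by rewrite ij (negPf (dN i j)) subr0 mulr0.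
by rewrite eqr_opp ij [- _ == _]eq_sym (negPf (dN j i)) subr0 mulr0.
Qed.

Definition shrinking (W : set (lattice d)) :=
  forall x y, W x -> (forall i, (`|y 0%R i| <= `|x 0%R i|)%N) -> W y.

Notation KM := (kmx (0%R : lattice d) inc).
Notation cs k A := (fset_set (cells k A)).

Lemma in_fset_cells k A c : finite_set A -> (c \in cs k A) = `[< cells k A c >].
Proof. by move=> fA; rewrite in_fset_set; [rewrite /in_mem /= /in_set|exact: finite_cells]. Qed.

Lemma rkf0 A : finite_set A -> rkf R F (@cells d) 0 A = 0.
Proof.
move=> fA; rewrite /rkf /= (_ : KM _ _ = 0) ?mxrank0//; apply/matrixP => i j; rewrite !mxE.
apply/eqP/negPn/negP => /incidence_dim.
have := mem_nth 0 (ltn_ord i); have := mem_nth 0 (ltn_ord j).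
by rewrite !in_fset_cells// => /asboolP[-> _] /asboolP[-> _].
Qed.

Section Acyclic.
Variable W : set (lattice d).
Hypothesis fW : finite_set W.
Hypothesis sW : shrinking W.

Let in_cells k c : (c \in cs k W) = `[< cells k W c >].
Proof. exact: in_fset_cells. Qed.

Lemma partner_cell k c : cells k.+1 W c -> upper c -> cells k W (partner c).
Proof.
rewrite /upper /partner => Wc; case: (firstneq c) => [i|]// ci.
by rewrite /up; have [h1 h2] := cell_faces Wc ci; case: ifP.
Qed.

(** The inverse of the matching: the first coordinate different from 1 is moved one step towards 1.
    The set [W] is stable under shrinking coordinates, so the new cell still touches a point of
    [W]. *)
Lemma lower_partner k b i : cells k W b -> firstneq b = Some i -> ~~ evenc b i ->
  exists2 c, cells k.+1 W c & upper c /\ b = partner c.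
Proof.
move=> [bk [x Wx bx]] fb ev.
have [[_ h]|[j h [bj hb]]] := firstneqP b; first by rewrite h in fb.
have {h} ji : j = i by move: h; rewrite fb => -[].
rewrite ji in bj hb.
pose v : int := if 3 <= b 0 i then b 0 i - 1 else b 0 i + 1.
pose c : lattice d := \row_l (if l == i then v else b 0 l).
have ci : c 0 i = v by rewrite mxE eqxx.
have cl l : l != i -> c 0 l = b 0 l by move=> li; rewrite mxE (negPf li).
have evc : evenc c i by move: ev; rewrite /evenc ci /v; case: ifP => _ ev; rewrite ?dvdz2B1 ?dvdz2D1.
have fc : firstneq c = Some i.
  apply: firstneq_uniq.
    by rewrite ci /v; move: ev bj; rewrite /evenc dvdz2; move: (b 0 i) => u; case: ifP; lia.
  by move=> l li; rewrite cl ?hb//; apply/eqP => e; move: li; rewrite e ltnn.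
have flip : flipped c b i by apply/and3P; split=> //; apply/forallP => l; apply/implyP => li; rewrite cl.
have pc : b = up c i.
  apply/rowP => l; have [->|li] := eqVneq l i; last by rewrite up_other// cl.
  rewrite up_coord ci /v; move: ev bj; rewrite /evenc dvdz2; move: (b 0 i) => u.
  by case: ifP; case: ifP; lia.
exists c; last by rewrite /upper /partner fc.
split; first by rewrite (flipped_dim flip) bk.
exists (\row_l (if l == i then (v %/ 2)%Z else x 0 l)).
  apply: (sW Wx) => l; rewrite mxE; case: ifP => [/eqP->|//].
  move/touchP: bx => /(_ i); rewrite /v mulr2n; move: ev bj; rewrite /evenc dvdz2.
  by move: (b 0 i) (x 0 i) => u z; case: ifP; lia.
apply/touchP => l; rewrite !mxE; have [_|li] := eqVneq l i; last exact: (touchP _ _ bx).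
by move: evc; rewrite /evenc ci dvdz2 mulr2n; move: (v) => u; lia.
Qed.

(** Exactness in every positive degree. Each cell is upper or the partner of an upper cell one
    dimension higher, and the triangular matchings bound the two boundary ranks from below by the
    sizes of these classes. The reverse inequality holds for any complex. *)
Lemma acyclic_window k : (\rank (KM (cs k.+1 W) (cs k W)) + \rank (KM (cs k.+2 W) (cs k.+1 W)))%N = #|` cs k.+1 W|.
Proof.
apply/eqP; rewrite eqn_leq; apply/andP; split.
  by rewrite addnC; exact: complex_rank_le.
have rk j : (size [seq c <- cs j.+1 W | upper c] <= \rank (KM (cs j.+1 W) (cs j W)))%N.
  set s := [seq c <- _ | _]; have us : uniq s by rewrite filter_uniq// fset_uniq.
  have sP c : c \in s -> upper c /\ cells j.+1 W c by rewrite mem_filter in_cells => /andP[? /asboolP].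
  rewrite -(@rank_kmx_matching _ _ (0 : lattice d) inc height partner s us).
  - apply: rank_kmx_sub => c; first by rewrite mem_filter => /andP[].
    by move=> /mapP[c' /sP[uc' Wc'] ->]; rewrite in_cells; apply/asboolP; exact: partner_cell.
  - by move=> c /sP[uc _]; exact: partner_incidence.
  - by move=> c c' /sP[uc _] /sP[uc' _]; exact: partner_triangular.
apply: leq_trans (leq_add (rk k) (rk k.+1)).
rewrite -(size_map partner [seq c <- cs k.+2 W | upper c]) -size_cat.
apply: uniq_leq_size; first exact: fset_uniq.
move=> c; rewrite in_cells => /asboolP Wc; rewrite mem_cat mem_filter in_cells.
have [[ce _]|[i fc _]] := firstneqP c.
  case: Wc => ck _; exfalso; move: ck; rewrite /cube_dim eq_card0 => [//|i].
  by rewrite !inE ce mxE.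
have [ev|ev] := boolP (evenc c i).
  by apply/orP; left; rewrite /upper fc ev; apply/asboolP.
apply/orP; right; have [c' Wc' [uc' ->]] := lower_partner Wc fc ev.
by apply: map_f; rewrite mem_filter uc' in_cells; apply/asboolP.
Qed.

Variable mu : set (lattice d).
Hypothesis muW : mu `<=` W.

Let fmu : finite_set mu := sub_finite_set muW fW.
Notation V := (W `\` mu).
Notation vs k := (fset_set (cocells W k V)).

Let fV k : finite_set (cocells W k V).
Proof. by apply: sub_finite_set (@cocells_cells d W k V) _; apply: finite_cells; exact: finite_setD. Qed.

Let in_mu k c : (c \in cs k mu) = `[< cells k mu c >].
Proof. exact: in_fset_cells. Qed.

Let in_co k c : (c \in vs k) = `[< cocells W k V c >].
Proof. by rewrite in_fset_set; [rewrite /in_mem /= /in_set|exact: fV]. Qed.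

Let cells_split k c : (c \in cs k W) = (c \in cs k mu) || (c \in vs k).
Proof.
rewrite in_cells in_mu in_co; apply/asboolP/orP => [[ck [x Wx cx]]|[/asboolP[ck [x mx cx]]|/asboolP[]//]].
  have [h|h] := pselect (exists2 y, mu y & touch c y); first by left; apply/asboolP.
  right; apply/asboolP; split; first by split=> //; exists x.
  by move=> y Wy cy; split=> // my; apply: h; exists y.
by split=> //; exists x => //; exact: muW.
Qed.

Let mu_not_co k c : c \in cs k mu -> c \notin vs k.
Proof.
rewrite in_mu in_co => /asboolP[_ [x mx cx]]; apply/asboolP => -[_ h].
by have [] := h _ (muW mx) cx.
Qed.

Lemma window_perm k : perm_eq (cs k W) (cs k mu ++ vs k).
Proof.
apply: uniq_perm; first exact: fset_uniq.
  rewrite cat_uniq !fset_uniq andbT /=; apply/hasPn => y yv; apply/negP => /mu_not_co.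
  by rewrite yv.
by move=> c; rewrite mem_cat cells_split.
Qed.

(** The columns of the boundary of the window are split into cells of [mu] and relative cells. By
    exactness, [rank_acyclic_split] expresses the rank as a relative rank plus the number of cycles
    of [mu]. *)
Lemma relative_rank k : \rank (KM (cs k.+2 W) (cs k.+1 W)) =
  (\rank (KM (vs k.+2) (vs k.+1)) + (#|` cs k.+1 mu| - \rank (KM (cs k.+1 mu) (cs k mu))))%N.
Proof.
have := acyclic_window k; have /perm_mem pm := window_perm k.+1.
have ps := perm_size (window_perm k.+1); rewrite size_cat in ps.
have idW j : cs j W =i cs j W by [].
rewrite (rank_kmx_eq (0%R : lattice d) inc pm (idW k)).
rewrite (rank_kmx_eq (0%R : lattice d) inc (idW k.+2) pm) ps.
rewrite (@rank_kmxn _ _ (0%R : lattice d) inc _ (size (cs k W)) (cs k.+1 mu ++ vs k.+1) _ (size_cat _ _) erefl).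
rewrite (@rank_kmxn _ _ (0%R : lattice d) inc (size (cs k.+2 W)) _ _ (cs k.+1 mu ++ vs k.+1) erefl (size_cat _ _)).
rewrite addnC; set A := kmxn _ _ _ _ _ _; set B := kmxn _ _ _ _ _ _ => rAB.
have AB : A *m B = 0.
  apply/matrixP => i j; rewrite !mxE.
  have h : \sum_(b <- cs k.+1 mu ++ vs k.+1) inc (nth 0 (cs k.+2 W) i) b * inc b (nth 0 (cs k W) j) = 0.
    rewrite -(perm_big _ (window_perm k.+1)); apply: cells_boundary => //.
    have := mem_nth 0 (ltn_ord i); by rewrite in_cells => /asboolP.
  rewrite -[RHS]h (big_nth 0) big_mkord size_cat; apply: eq_bigr => l _.
  by rewrite !mxE.
rewrite (rank_acyclic_split AB rAB); congr (_ + (_ - _))%N.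
- have -> : rsubmx A = KM (cs k.+2 W) (vs k.+1) by apply/matrixP => i j; rewrite !mxE nth_cat /= ltnNge leq_addr /= addKn.
  apply: rank_kmx_rows => [a b|a]; last by rewrite cells_split => ->; rewrite orbT.
  rewrite cells_split => /orP[|->//]; rewrite in_mu => /asboolP[_ [x mx ax]] _.
  rewrite in_co => /asboolP[_ hb]; apply/eqP/negPn/negP => h.
  by have [] := hb _ (muW mx) (incidence_touch h ax).
- have -> : usubmx B = KM (cs k.+1 mu) (cs k W) by apply/matrixP => i j; rewrite !mxE nth_cat /= ltn_ord.
  apply: rank_kmx_cols => [a b|b]; last by rewrite cells_split => ->.
  rewrite in_mu in_cells in_mu => /asboolP[_ [x mx ax]] /asboolP[bk _] nb.
  apply/eqP/negPn/negP => h; move/asboolP: nb; apply; split=> //; exists x => //.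
  exact: incidence_touch h ax.
Qed.

Lemma primal_cocells k : primal k mu =
  (if k == 0%N then cnt R (@cells d) 0 W - rkf R F (@cells d) 1 W else 0) + dual W k V.
Proof.
rewrite primalE// /dual.
have cW j : cnt R (@cells d) j W = cnt R (@cells d) j mu + cnt R (cocells W) j V by rewrite /cnt -natrD -size_cat (perm_size (window_perm j)).
have rr j : rkf R F (@cells d) j.+2 W = rkf R F (cocells W) j.+2 V + (cnt R (@cells d) j.+1 mu - rkf R F (@cells d) j.+1 mu).
  rewrite /rkf /cnt -natrB; last exact: rank_leq_row.
  by rewrite -natrD -relative_rank.
have aW j : rkf R F (@cells d) j.+1 W + rkf R F (@cells d) j.+2 W = cnt R (@cells d) j.+1 W by rewrite /rkf /cnt -natrD addnC /= addnC acyclic_window.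
case: k => [|k] /=.
  rewrite rkf0//; have := rr 0%N; have := aW 0%N; have := cW 0%N; have := cW 1%N; lra.
have := rr k; have := rr k.+1; have := aW k.+1; have := cW k.+2; lra.
Qed.

End Acyclic.

(** Alexander duality in numerical form: the Betti number of [mu] becomes an additive functional of
    the removed points, up to a constant of the window. *)
Lemma primal_dual W mu k : finite_set W -> shrinking W -> mu `<=` W ->
  primal k mu = primal k W + dual W k (W `\` mu).
Proof.
move=> fW sW muW; rewrite (primal_cocells fW sW muW) (primal_cocells fW sW (@subset_refl _ W)).
rewrite setDv (additive_set0 (h := dual W k)) ?addr0//.
by move=> A B; exact: dual_additive.
Qed.

Definition corner (x : lattice d) : lattice d := x *+ 2 + const_mx 1.

Lemma cornerP x : cube_dim (corner x) = 0%N /\ touch (corner x) x.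
Proof.
split; last by apply/touchP => i; rewrite !mxE ?mulr2n; move: (x 0 i) => u; lia.
by apply: eq_card0 => i; rewrite !inE !mxE; apply/negbTE; rewrite dvdz2 ?mulr2n; move: (x 0 i) => u; lia.
Qed.

Lemma nth_interpolation (s : seq (lattice d)) (u : 'I_(size s) -> F) : uniq s ->
  exists phi : lattice d -> F, forall j : 'I_(size s), phi (nth 0 s j) = u j.
Proof.
move=> us; exists (fun b => \sum_(j < size s) u j * (b == nth 0 s j)%:R) => j.
rewrite (bigD1 j)//= eqxx mulr1 big1 ?addr0// => l lj.
by rewrite nth_uniq// eq_sym (negPf (lj : val l != val j)) mulr0.
Qed.

Section Connected.
Variables (A : set (lattice d)) (x0 : lattice d).
Hypothesis fA : finite_set A.
Hypothesis cA : forall y, A y -> cluster A x0 y.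
Hypothesis Ax0 : A x0.

Let in_A k c : (c \in cs k A) = `[< cells k A c >].
Proof. exact: in_fset_cells. Qed.

Lemma cocycle_edge (phi : lattice d -> F) :
  (forall e, cells 1 A e -> \sum_(b <- cs 0 A) inc e b * phi b = 0) ->
  forall e i, cells 1 A e -> evenc e i -> phi (e + dl i) = phi (e - dl i).
Proof.
move=> h e i he ei; have := h e he; rewrite sum_incidence ?fset_uniq// => [|j ej]; last first.
  by have [h1 h2] := cell_faces he ej; rewrite !in_A; split; apply/asboolP.
rewrite (bigD1 i)//= big1 ?addr0 => [|j /andP[ej ji]].
  move/eqP; rewrite mulf_eq0 expf_eq0 oppr_eq0 oner_eq0 andbF /= subr_eq0 => /eqP //.
case: he => /eqP; rewrite /cube_dim (cardD1 i) (cardD1 j) !inE ji -/(evenc e i) -/(evenc e j) ei ej //.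
Qed.

(** Two vertices of one unit cube are joined by changing one coordinate at a time along edges of
    that cube. *)
Lemma cocycle_cube (phi : lattice d -> F) x b b' : A x ->
  (forall e i, cells 1 A e -> evenc e i -> phi (e + dl i) = phi (e - dl i)) ->
  cube_dim b = 0%N -> cube_dim b' = 0%N -> touch b x -> touch b' x -> phi b = phi b'.
Proof.
move=> Ax hphi; move: {2}(#|[pred i | b 0 i != b' 0 i]|) (leqnn #|[pred i | b 0 i != b' 0 i]|) => n.
elim: n b => [|n IH] b hn b0 b'0 bx b'x.
  suff -> : b = b' by [].
  apply/rowP => i; apply/eqP/negPn/negP => bi; move: hn; rewrite leqn0 => /eqP/card0_eq/(_ i).
  by rewrite !inE bi.
have [i bi|bb] := pickP [pred i | b 0 i != b' 0 i]; last first.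
  suff -> : b = b' by [].
  by apply/rowP => i; have /negbT := bb i; rewrite !inE negbK => /eqP.
rewrite inE in bi.
have ob c l : cube_dim c = 0%N -> ~~ evenc c l by move=> /card0_eq /(_ l); rewrite inE /evenc => ->.
pose e : lattice d := \row_l (if l == i then x 0 i *+ 2 else b 0 l).
pose b2 : lattice d := \row_l (if l == i then b' 0 i else b 0 l).
have hb := ob b i b0; have hb' := ob b' i b'0.
have tb := touchP _ _ bx i; have tb' := touchP _ _ b'x i.
have ei : evenc e i by rewrite /evenc mxE eqxx mulr2n dvdz2; move: (x 0 i) => u; lia.
have flip c : ~~ evenc c i -> (forall l, l != i -> c 0 l = b 0 l) -> flipped e c i.
  move=> ci hc; apply/and3P; split=> //; apply/forallP => l; apply/implyP => li.
  by rewrite mxE (negPf li) hc.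
have e1 : cells 1 A e.
  split; first by rewrite (flipped_dim (flip b hb (fun l _ => erefl))) b0.
  exists x => //; apply/touchP => l; rewrite mxE; case: ifP => [/eqP->|_]; first by rewrite subrr.
  exact: (touchP _ _ bx).
have b2o : ~~ evenc b2 i by move: hb'; rewrite /evenc mxE eqxx.
have b20 : cube_dim b2 = 0%N.
  apply: succn_inj; rewrite -(flipped_dim (flip b2 b2o _)); first by case: e1.
  by move=> l li; rewrite mxE (negPf li).
have b2x : touch b2 x by apply/touchP => l; rewrite mxE; case: ifP => [/eqP->//|_]; exact: (touchP _ _ bx).
have st : phi b = phi b2.
  have h := hphi e i e1 ei.
  have bE : b = e + dl i \/ b = e - dl i.
    have : b 0 i = x 0 i *+ 2 + 1 \/ b 0 i = x 0 i *+ 2 - 1 by move: hb tb; rewrite /evenc dvdz2 mulr2n; move: (b 0 i) (x 0 i) => u v; lia.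
    by case=> E; [left|right]; apply/rowP => l; rewrite !mxE eqxx; case: eqVneq => [->|_] //=; rewrite ?addr0 ?subr0.
  have b2E : b2 = e + dl i \/ b2 = e - dl i.
    have : b' 0 i = x 0 i *+ 2 + 1 \/ b' 0 i = x 0 i *+ 2 - 1 by move: hb' tb'; rewrite /evenc dvdz2 mulr2n; move: (b' 0 i) (x 0 i) => u v; lia.
    by case=> E; [left|right]; apply/rowP => l; rewrite !mxE eqxx; case: eqVneq => [_|_] /=; rewrite ?E ?addr0 ?subr0.
  by case: bE => ->; case: b2E => ->.
rewrite st; apply: IH => //; rewrite -ltnS; apply: leq_trans hn.
rewrite [X in (_ < X)%N](cardD1 i) inE bi add1n ltnS; apply: subset_leq_card.
apply/fintype.subsetP => l; rewrite !inE mxE; have [->|li] := eqVneq l i; first by rewrite eqxx.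
by [].
Qed.

Lemma cocycle_const (phi : lattice d -> F) :
  (forall e, cells 1 A e -> \sum_(b <- cs 0 A) inc e b * phi b = 0) ->
  forall b, cells 0 A b -> phi b = phi (corner x0).
Proof.
move=> /cocycle_edge hphi b [b0 [y Ay bty]].
have dim1 (c : lattice d) : (forall i, ~~ evenc c i) -> cube_dim c = 0%N by move=> h; apply: eq_card0 => i; rewrite !inE; exact/negbTE/h.
elim: (cA Ay) b b0 bty => [_|u v xu IH Av uv] b b0 bt.
  by apply: (cocycle_cube Ax0 hphi) => //; [exact: (cornerP x0).1|exact: (cornerP x0).2].
(* A vertex shared by the cubes of the adjacent points [u] and [v]; where their coordinates agree
   the choice of side is arbitrary. *)
pose s : lattice d := \row_i (if u 0 i == v 0 i then u 0 i *+ 2 + 1 else u 0 i + v 0 i).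
have s0 : cube_dim s = 0%N.
  apply: dim1 => i; rewrite /evenc !mxE dvdz2; have := adjP _ _ uv i; case: eqVneq.
    by rewrite mulr2n; move: (u 0 i) => p; lia.
  by move=> /eqP; move: (u 0 i) (v 0 i) => p q; lia.
have su : touch s u.
  apply/touchP => i; rewrite !mxE; have := adjP _ _ uv i; rewrite !mulr2n; case: eqVneq => [_|/eqP];
    by move: (u 0 i) (v 0 i) => p q; lia.
have sv : touch s v.
  apply/touchP => i; rewrite !mxE; have := adjP _ _ uv i; rewrite !mulr2n; case: eqVneq => [->|/eqP];
    by move: (u 0 i) (v 0 i) => p q; lia.
by rewrite (cocycle_cube Av hphi b0 s0 bt sv); exact: IH.
Qed.

(** Functions on vertices with zero coboundary are constant by [cocycle_const], so the coboundary
    has a one-dimensional kernel and its rank is one less than the number of vertices. *)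
Lemma primal0_connected : primal 0 A = 1.
Proof.
rewrite primalE//; pose s := cs 0 A; pose M : 'M[F]_(size (cs 1 A), size s) := KM (cs 1 A) s.
have us : uniq s := fset_uniq _.
have v0s : corner x0 \in s.
  by rewrite in_A; apply/asboolP; have [h1 h2] := cornerP x0; split=> //; exists x0.
have s0 : (0 < size s)%N by rewrite -has_predT; apply/hasP; exists (corner x0).
pose one : 'rV[F]_(size s) := const_mx 1.
have edge (i : 'I_(size (cs 1 A))) : cells 1 A (nth 0 (cs 1 A) i) by have := mem_nth 0 (ltn_ord i); rewrite in_A => /asboolP.
have oneK : (one <= kermx M^T)%MS.
  rewrite sub_kermx; apply/eqP/rowP => i; rewrite !mxE.
  rewrite (eq_bigr (fun j : 'I_(size s) => inc (nth 0 (cs 1 A) i) (nth 0 s j) * 1)); last first.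
    by move=> j _; rewrite !mxE mulrC.
  rewrite -(big_mkord predT (fun j => inc (nth 0 (cs 1 A) i) (nth 0 s j) * 1)) -(big_nth 0 predT (fun b => inc _ b * 1)).
  rewrite (@sum_incidence F d _ s (fun=> 1)) ?big1// => [j _|j ej]; first by rewrite subrr mulr0.
  by have [h1 h2] := cell_faces (edge i) ej; rewrite !in_A; split; apply/asboolP.
have Kone : (kermx M^T <= one)%MS.
  apply/row_subP => k; set u := row k _.
  have uM : u *m M^T = 0 by apply/eqP; rewrite -sub_kermx row_sub.
  have [phi phiE] := nth_interpolation (fun j => u 0 j) us.
  have hphi e : cells 1 A e -> \sum_(b <- s) inc e b * phi b = 0.
    move=> e1; have es : e \in cs 1 A by rewrite in_A; apply/asboolP.
    have ei : (index e (cs 1 A) < size (cs 1 A))%N by rewrite index_mem.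
    have := congr1 (fun w : 'rV_(size (cs 1 A)) => w 0 (Ordinal ei)) uM; rewrite !mxE => h; apply: etrans _ h.
    rewrite (big_nth 0) big_mkord; apply: eq_bigr => j _.
    have ME : M^T j (Ordinal ei) = inc e (nth 0 s j) by rewrite mxE mxE /= nth_index.
    by rewrite phiE ME mulrC.
  have -> : u = phi (corner x0) *: one.
    apply/rowP => j; rewrite -phiE [RHS]mxE [one _ _]mxE mulr1; apply: (cocycle_const hphi).
    by have := mem_nth 0 (ltn_ord j); rewrite in_A => /asboolP.
  exact: scalemx_sub.
have rK : \rank (kermx M^T) = 1%N.
  have -> : \rank (kermx M^T) = \rank one by apply/eqP; rewrite eqn_leq !mxrankS.
  rewrite rank_rV; case: eqP => // /rowP/(_ (Ordinal s0)); rewrite !mxE => /eqP.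
  by rewrite oner_eq0.
rewrite rkf0// subr0 /cnt /rkf /=; rewrite mxrank_ker mxrank_tr in rK.
rewrite -/s -/M; move: rK; move: (\rank M) => r rK.
have -> : size s = (r + 1)%N by lia.
by rewrite natrD addrAC subrr add0r.
Qed.

End Connected.
End BettiFunctionals.

(** * Separation in the window *)

Section Janiszewski.
Variables (R : realType) (F : fieldType) (d : nat).
Implicit Types (c b e x y z o : lattice d) (A B C : set (lattice d)).
Notation inc := (@incidence d F).
Notation KM := (kmx (0%R : lattice d) inc).
Notation cs k A := (fset_set (cells k A)).
Notation dl := (delta_mx 0 : 'I_d -> lattice d).

Variable W : set (lattice d).
Hypothesis fW : finite_set W.
Hypothesis sW : shrinking W.

Let in_W k c : (c \in cs k W) = `[< cells k W c >].
Proof. exact: in_fset_cells. Qed.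

Let D1 := KM (cs 1 W) (cs 0 W).
Let D2 := KM (cs 2 W) (cs 1 W).
Let cell1 (i : 'I_(size (cs 1 W))) := nth 0 (cs 1 W) i.

Let cell1P i : cells 1 W (cell1 i).
Proof. by have := mem_nth 0 (ltn_ord i); rewrite in_W => /asboolP. Qed.

Let dirac x : 'rV[F]_(size (cs 0 W)) := \row_j (nth 0 (cs 0 W) j == corner x)%:R.

Lemma dirac_pairing x (phi : lattice d -> F) : W x ->
  \sum_j dirac x 0 j * phi (nth 0 (cs 0 W) j) = phi (corner x).
Proof.
move=> Wx; have xs : corner x \in cs 0 W.
  by rewrite in_W; apply/asboolP; have [h1 h2] := cornerP x; split=> //; exists x.
have hi : (index (corner x) (cs 0 W) < size (cs 0 W))%N by rewrite index_mem.
rewrite (bigD1 (Ordinal hi))//= mxE nth_index// eqxx mul1r big1 ?addr0// => j ji.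
rewrite mxE; case: eqVneq => [e|_]; last by rewrite mul0r.
by move: ji; rewrite -val_eqE /= -e index_uniq ?fset_uniq// eqxx.
Qed.

Lemma dirac_difference x o (phi : lattice d -> F) : W x -> W o ->
  \sum_j (dirac x - dirac o) 0 j * phi (nth 0 (cs 0 W) j) = phi (corner x) - phi (corner o).
Proof.
move=> Wx Wo; rewrite -(dirac_pairing phi Wx) -(dirac_pairing phi Wo) -sumrB.
by apply: eq_bigr => j _; rewrite -mulrBl; congr (_ * _); rewrite !mxE.
Qed.

Lemma coboundary_pairing (phi : lattice d -> F) i :
  \sum_j D1 i j * phi (nth 0 (cs 0 W) j) =
  \sum_(l < d | evenc (cell1 i) l) csign F (cell1 i) l * (phi (cell1 i + dl l) - phi (cell1 i - dl l)).
Proof.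
rewrite -(@sum_incidence F d _ (cs 0 W) phi) ?fset_uniq//.
  by rewrite (big_nth 0) big_mkord; apply: eq_bigr => j _; rewrite mxE.
by move=> l el; have [h1 h2] := cell_faces (cell1P i) el; rewrite !in_W; split; apply/asboolP.
Qed.

(** By duality of linear systems, the difference of two vertices is a boundary of edges in [B] as
    soon as every function killed by those edges takes equal values at both. Constancy on the
    cluster gives this. *)
Lemma path_chain B o x : B `<=` W -> cluster B o x ->
  exists p : 'rV[F]_(size (cs 1 W)), (forall i, ~ cells 1 B (cell1 i) -> p 0 i = 0) /\
    p *m D1 = dirac x - dirac o.
Proof.
move=> BW ox; pose G := cluster B o; have GB : G `<=` B := @cluster_sub d B o.
have fG : finite_set G by apply: sub_finite_set fW; exact: subset_trans GB BW.
have Bo := cluster_self ox.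
pose M : 'M[F]_(size (cs 1 W), size (cs 0 W)) := \matrix_(i, j) (if `[< cells 1 B (cell1 i) >] then D1 i j else 0).
have : (dirac x - dirac o <= M)%MS.
  rewrite submxE; apply/eqP/rowP => k; rewrite [LHS]mxE [RHS]mxE.
  have [phi phiE] := nth_interpolation (fun j => cokermx M j k) (fset_uniq (cs 0 W)).
  under eq_bigr do rewrite -phiE.
  rewrite dirac_difference; [|exact/BW/(cluster_sub ox)|exact: BW].
  suff -> : phi (corner x) = phi (corner o) by rewrite subrr.
  have hphi e : cells 1 G e -> \sum_(b <- cs 0 G) inc e b * phi b = 0.
    move=> Ge; have Be : cells 1 B e by case: Ge => e1 [y Gy ye]; split=> //; exists y => //; exact: GB.
    have We : cells 1 W e by case: Be => e1 [y By ye]; split=> //; exists y => //; exact: BW.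
    have es : e \in cs 1 W by rewrite in_W; apply/asboolP.
    have ei : (index e (cs 1 W) < size (cs 1 W))%N by rewrite index_mem.
    have ee : cell1 (Ordinal ei) = e by rewrite /cell1 /= nth_index.
    rewrite sum_incidence ?fset_uniq// => [|l el]; last first.
      by have [h1 h2] := cell_faces Ge el; rewrite !in_fset_set ?inE//; exact: finite_cells.
    have := coboundary_pairing phi (Ordinal ei); rewrite ee => <-.
    have /matrixP/(_ (Ordinal ei) k) := mulmx_coker M; rewrite [LHS]mxE [RHS]mxE => h.
    apply: etrans _ h; apply: eq_bigr => j _.
    by rewrite phiE [M _ _]mxE ee asboolT.
  have cG y : G y -> cluster G o y by exact: cluster_idem.
  have Go : G o by exact: cluster_base.
  apply: (cocycle_const fG cG Go hphi); have [h1 h2] := cornerP x.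
  by split=> //; exists x.
move=> /submxP[D DE]; exists (\row_i (if `[< cells 1 B (cell1 i) >] then D 0 i else 0)); split.
  by move=> i nB; rewrite mxE asboolF.
rewrite DE; apply/rowP => j; rewrite !mxE; apply: eq_bigr => i _; rewrite !mxE.
by case: ifP; rewrite ?mulr0 ?mul0r.
Qed.

(** The indicator of the cells touching the cluster of [o] has zero coboundary on [B]. Paired with
    the chain, it would give two different values if [x] were outside the cluster. *)
Lemma chain_path B o x (p : 'rV[F]_(size (cs 1 W))) : B `<=` W -> B o -> B x ->
  (forall i, ~ cells 1 B (cell1 i) -> p 0 i = 0) -> p *m D1 = dirac x - dirac o -> cluster B o x.
Proof.
move=> BW Bo Bx pB pD; apply: contrapT => nx.
pose phi b : F := (`[< exists2 y, cluster B o y & touch b y >])%:R.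
have phio : phi (corner o) = 1 by rewrite /phi asboolT//; exists o; [exact: cluster_base|exact: (cornerP o).2].
have phix : phi (corner x) = 0.
  rewrite /phi asboolF// => -[y oy yx]; apply: nx; apply: cluster_step oy Bx _.
  exact: touch_adj yx (cornerP x).2.
have cob i : cells 1 B (cell1 i) -> \sum_j D1 i j * phi (nth 0 (cs 0 W) j) = 0.
  move=> [_ [y By ye]]; rewrite coboundary_pairing; apply: big1 => l el.
  suff -> : phi (cell1 i + dl l) = phi (cell1 i - dl l) by rewrite subrr mulr0.
  have [f1 f2] := flippedD el.
  have t1 : touch (cell1 i + dl l) y by apply: (touch_face f1) => //; left.
  have t2 : touch (cell1 i - dl l) y by apply: (touch_face f2) => //; right.
  congr (nat_of_bool _)%:R; apply: asbool_equiv_eq; split=> -[z oz tz]; exists y => //.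
    by apply: cluster_step oz By _; exact: touch_adj tz t1.
  by apply: cluster_step oz By _; exact: touch_adj tz t2.
have h1 : \sum_j (p *m D1) 0 j * phi (nth 0 (cs 0 W) j) = 0.
  under eq_bigr do rewrite mxE mulr_suml.
  rewrite exchange_big /=; apply: big1 => i _.
  under eq_bigr do rewrite -mulrA.
  rewrite -mulr_sumr; have [Bi|nBi] := pselect (cells 1 B (cell1 i)).
    by rewrite cob// mulr0.
  by rewrite pB// mul0r.
move: h1; rewrite pD dirac_difference; [|exact: BW|exact: BW].
by rewrite phio phix sub0r => /eqP; rewrite oppr_eq0 oner_eq0.
Qed.

(** Janiszewski's theorem. Two chains joining the points, one in the cubes outside [A] and one in
    the cubes outside [C], differ by a cycle, which bounds because the window is acyclic. Correcting
    the first chain by part of the bounding surface makes it avoid both sets. *)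
Lemma janiszewski A C o x : separated A C ->
  cluster (W `\` A) o x -> cluster (W `\` C) o x -> cluster (W `\` (A `|` C)) o x.
Proof.
move=> sAC ox1 ox2.
have [p [pA pD]] := path_chain (@subDsetl _ W A) ox1.
have [r [rC rD]] := path_chain (@subDsetl _ W C) ox2.
have D21 : D2 *m D1 = 0.
  apply/matrixP => i j; rewrite kmx_mul !mxE; apply: cells_boundary => //.
  by have := mem_nth 0 (ltn_ord i); rewrite in_W => /asboolP.
have kD : (kermx D1 <= D2)%MS.
  have le : (D2 <= kermx D1)%MS by rewrite sub_kermx D21.
  have [_ <-] := mxrank_leqif_sup le; rewrite mxrank_ker; apply/eqP.
  have h : (\rank D1 + \rank D2)%N = #|` cs 1 W| := acyclic_window F fW sW 0.
  by have := congr1 (fun z : nat => z - \rank D1)%N h; rewrite addKn => ->.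
have : (p - r <= D2)%MS by apply: submx_trans kD; rewrite sub_kermx mulmxBl pD rD subrr.
move=> /submxP[s sE].
pose cell2 (i : 'I_(size (cs 2 W))) := nth 0 (cs 2 W) i.
have cell2P i : cells 2 W (cell2 i) by have := mem_nth 0 (ltn_ord i); rewrite in_W => /asboolP.
(* The part of the surface made of faces that touch a point outside [A]. A remaining face touches
   only points of [A], hence none of [C], so the corrected chain can be read from either side. *)
pose sA := \row_i (if `[< cells 2 (W `\` A) (cell2 i) >] then s 0 i else 0).
pose p' := p - sA *m D2.
have p'E : p' = r + (s - sA) *m D2 by rewrite /p' mulmxBl -sE; apply/rowP => j; rewrite !mxE; ring.
have faces B i k : cells 2 B (cell2 i) -> D2 i k != 0 -> cells 1 B (cell1 k).
  move=> [_ [y By ye]]; rewrite mxE => h; split; first by case: (cell1P k).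
  by exists y => //; exact: incidence_touch h ye.
have supA k : ~ cells 1 (W `\` A) (cell1 k) -> p' 0 k = 0.
  move=> nk; rewrite !mxE pA// sub0r; apply/eqP; rewrite oppr_eq0; apply/eqP; apply: big1 => i _.
  rewrite mxE; case: ifP => [/asboolP hi|_]; last by rewrite mul0r.
  have [->|h] := eqVneq (D2 i k) 0; first by rewrite mulr0.
  by case: nk; exact: faces h.
have supC k : ~ cells 1 (W `\` C) (cell1 k) -> p' 0 k = 0.
  move=> nk; rewrite p'E !mxE rC// add0r; apply: big1 => i _.
  rewrite !mxE; case: ifP => [_|/asboolP hi]; first by rewrite subrr mul0r.
  have [e|h] := eqVneq (D2 i k) 0; first by move: e; rewrite mxE => ->; rewrite mulr0.
  case: nk; apply: (faces _ i k _ h); have [e2 [y Wy ye]] := cell2P i; split=> //; exists y => //.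
  split=> // Cy; apply: hi; split=> //; exists y => //; split=> // Ay.
  by have := sAC _ _ Ay Cy; rewrite adj_refl.
have I1 : W `\` (A `|` C) `<=` W by move=> z [].
have nB z : cluster (W `\` A) o z -> cluster (W `\` C) o z -> (W `\` (A `|` C)) z by move=> /cluster_sub[Wz nA] /cluster_sub[_ nC]; split=> // -[].
have o1 := cluster_self ox1; have o2 := cluster_self ox2.
apply: (chain_path I1 (p := p')).
- by case: o1 => Wo nA; case: o2 => _ nC; split=> // -[].
- exact: nB.
- move=> k nk; have [h1|h1] := pselect (cells 1 (W `\` A) (cell1 k)); last exact: supA.
  have [h2|h2] := pselect (cells 1 (W `\` C) (cell1 k)); last exact: supC.
  exfalso; apply: nk; case: h1 => e1 [y [Wy nAy] ye]; case: h2 => _ [z [Wz nCz] ze].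
  split=> //; have [Cy|nCy] := pselect (C y); last by exists y => //; split=> // -[].
  exists z => //; split=> // -[Az|//].
  by have := sAC _ _ Az Cy; rewrite (touch_adj ze ye).
- by rewrite /p' mulmxBl pD -mulmxA D21 mulmx0 subr0.
Qed.

(** Clusters of [B] are pairwise separated, so [janiszewski] removes them one at a time: a set
    separates two points only if one of its clusters does. *)
Lemma cluster_separation B o x : (forall y, W y -> cluster W o y) -> W x ->
  (forall b, B b -> cluster (W `\` cluster B b) o x) -> B `<=` W -> cluster (W `\` B) o x.
Proof.
move=> cW Wx; move: {2}(#|` fset_set B|) (leqnn #|` fset_set B|) => n.
elim: n B => [|n IH] B Bn hB BW; have fB := sub_finite_set BW fW.
  have B0 : fset_set B = fset0 by apply/eqP; rewrite -cardfs_eq0 -leqn0.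
  by rewrite (fset_set_set0 fB B0) setD0; exact: cW.
have [->|/set0P[b Bb]] := eqVneq B classical_sets.set0; first by rewrite setD0; exact: cW.
have -> : B = cluster B b `|` (B `\` cluster B b) by rewrite setDUK//; exact: cluster_sub.
apply: janiszewski; [exact: cluster_setD|exact: hB|].
have sub : B `\` cluster B b `<=` B by move=> z [].
apply: IH.
- rewrite -ltnS; apply: leq_trans Bn; rewrite fset_setD//; last exact: sub_finite_set (@cluster_sub d B b) fB.
  apply: fproper_ltn_card; rewrite fproperEneq fsubsetDl andbT; apply/eqP => /fsetP/(_ b).
  have bB : b \in fset_set B by rewrite in_fset_set// inE.
  have bC : b \in fset_set (cluster B b) by rewrite in_fset_set ?inE; [exact: cluster_base|exact: sub_finite_set (@cluster_sub d B b) fB].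
  by rewrite inE bB bC.
- by move=> b' [Bb' nb']; rewrite cluster_notin//; exact: hB.
- exact: subset_trans sub BW.
Qed.

End Janiszewski.

(** * Connectedness of the window outside a box *)

Section OutsideBox.
Variables (d n r : nat) (c : lattice d).
Implicit Types (x y z p q : lattice d) (A : set (lattice d)) (i j l : 'I_d).

Definition between (a b t : int) := (a <= t <= b) || (b <= t <= a).

Lemma cluster_rectangle A p q : (forall z, (forall i, between (p 0 i) (q 0 i) (z 0 i)) -> A z) -> cluster A p q.
Proof.
move: {2}(l1norm (p - q)) (leqnn (l1norm (p - q))) => N.
elim: N p => [|N IH] p pq hA.
all: have Ap : A p by apply: hA => i; rewrite /between lexx /=; case: leP => //= /ltW ->.
  have -> : q = p.
    apply/rowP => i; have := coord_le_l1norm (p - q) i; rewrite !mxE => /leq_trans/(_ pq); move: (p 0 i) (q 0 i) => a b; lia.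
  exact: cluster_base.
have [->|npq] := eqVneq q p; first exact: cluster_base.
pose p' : lattice d := \row_i (if p 0 i < q 0 i then p 0 i + 1 else if q 0 i < p 0 i then p 0 i - 1 else p 0 i).
have p'i i : between (p 0 i) (q 0 i) (p' 0 i) /\ (`|p' 0%R i - q 0%R i| <= `|p 0%R i - q 0%R i|)%N /\
    (p 0 i != q 0 i -> (`|p' 0%R i - q 0%R i| < `|p 0%R i - q 0%R i|)%N).
  rewrite mxE /between; move: (p 0 i) (q 0 i) => a b.
  case: ifP => h1; [|case: ifP => h2]; lia.
have step : cluster A p p'.
  apply: (@cluster_step _ _ _ p); first exact: cluster_base.
    by apply: hA => i; have [] := p'i i.
  apply/adjP => i; rewrite mxE; move: (p 0 i) (q 0 i) => a b; case: ifP => _; [|case: ifP => _]; lia.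
apply: cluster_trans step _; apply: IH.
  rewrite -ltnS; apply: leq_trans pq.
  have [i pi] : exists i, p 0 i != q 0 i.
    apply: contrapT => h; move/eqP: npq; apply; apply/rowP => i; apply/eqP; rewrite eq_sym; apply/negPn/negP => pi.
    by apply: h; exists i.
  rewrite /l1norm (bigD1 i)//= [X in (_ < X)%N](bigD1 i)//= -addSn; apply: leq_add.
    by rewrite mxE [(- q) _ _]mxE [(p - q) _ _]mxE [(- q) _ _]mxE; have [_ [_ /(_ pi)]] := p'i i.
  apply: leq_sum => l _; rewrite mxE [(- q) _ _]mxE [(p - q) _ _]mxE [(- q) _ _]mxE.
  by have [_ []] := p'i l.
move=> z hz; apply: hA => i; have := hz i; have [h1 _] := p'i i; move: h1; rewrite /between.
by move: (p' 0 i) (z 0 i) (p 0 i) (q 0 i) => a b e f; lia.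
Qed.

Definition axis2 i (t : int) j (s : int) : lattice d :=
  \row_l (if l == i then t else if l == j then s else 0).

Lemma l1norm_axis2 i t j s : i != j -> l1norm (axis2 i t j s) = (`|t| + `|s|)%N.
Proof.
move=> ij; rewrite /l1norm (bigD1 i)//= (bigD1 j) 1?eq_sym//= !mxE eqxx eq_sym (negPf ij) eqxx.
rewrite big1 ?addn0// => l /andP[li lj]; by rewrite mxE (negPf li) (negPf lj).
Qed.

Lemma l1norm_mono x y : (forall i, (`|x 0%R i| <= `|y 0%R i|)%N) -> (l1norm x <= l1norm y)%N.
Proof. by move=> h; apply: leq_sum => i _. Qed.

Variable S : set (lattice d).
Hypothesis SB : forall x, S x -> x \in supbox c r.
Hypothesis n4 : (4 * r + 2 <= n)%N.

Let A := window d n `\` S.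

Let freeA i z : (l1norm z <= n)%N -> (r < `|z 0%R i - c 0%R i|)%N -> A z.
Proof. by move=> zn zi; split=> // /SB/supboxP/(_ i); rewrite leqNgt zi. Qed.

(* Moves inside the coordinate plane (i, j). *)
Let move2 i j t s t' s' l : i != j -> l \in [:: i; j] \/ (r < `|c 0%R l|)%N /\ l != i /\ l != j ->
  (maxn `|t| `|t'| + maxn `|s| `|s'| <= n)%N ->
  (l = i -> forall u, between t t' u -> (r < `|u - c 0%R i|)%N) ->
  (l = j -> forall u, between s s' u -> (r < `|u - c 0%R j|)%N) ->
  cluster A (axis2 i t j s) (axis2 i t' j s').
Proof.
move=> ij hl hn hi hj; apply: cluster_rectangle => z hz.
have zi : between t t' (z 0 i) by have := hz i; rewrite !mxE eqxx.
have zj : between s s' (z 0 j) by have := hz j; rewrite !mxE eqxx eq_sym (negPf ij).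
have zl k : k != i -> k != j -> z 0 k = 0 by move=> ki kj; have := hz k; rewrite !mxE (negPf ki) (negPf kj) /between; lia.
have zE : z = axis2 i (z 0 i) j (z 0 j).
  apply/rowP => k; rewrite mxE; have [->//|ki] := eqVneq k i; have [->//|kj] := eqVneq k j.
  exact: zl.
apply: (freeA (i := l)).
  rewrite zE l1norm_axis2//; apply: leq_trans hn; apply: leq_add.
    by move: zi; rewrite /between; lia.
  by move: zj; rewrite /between; lia.
case: hl => [|[cl [li lj]]]; last by rewrite zl// sub0r abszN.
rewrite !inE => /orP[/eqP e|/eqP e]; rewrite e; [exact: hi|exact: hj].
Qed.

(** A point far from the box is brought to a coordinate axis and then to a common hub inside a
    coordinate plane. If some coordinate of the centre exceeds [r], the origin avoids the box and is
    the hub; otherwise the hub is the point [s] on an axis, just outside the box. *)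
Lemma outside_box_connected : (1 < d)%N -> exists h, forall p, (l1norm p <= n)%N ->
  p \notin supbox c (3 * r + 2) -> cluster A p h.
Proof.
move=> d1; pose s : int := (2 * r + 1)%N.
have toaxis p : (l1norm p <= n)%N -> p \notin supbox c (3 * r + 2) ->
    exists i, (3 * r + 2 < `|p 0%R i - c 0%R i|)%N /\
      (`|p 0%R i| <= n)%N /\ forall j, j != i -> cluster A p (axis2 i (p 0 i) j 0).
  move=> pn pb; have [i hi] : exists i, (3 * r + 2 < `|p 0%R i - c 0%R i|)%N.
    apply: contrapT => h; move/negP: pb; apply; apply/supboxP => i; rewrite leqNgt.
    by apply/negP => hi; apply: h; exists i.
  exists i; split=> //; split; first exact: leq_trans (coord_le_l1norm p i) pn.
  move=> j ji; apply: cluster_rectangle => z hz; apply: (freeA (i := i)).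
    apply: leq_trans pn; apply: l1norm_mono => l; have := hz l; rewrite mxE /between.
    by case: ifP => [/eqP->|_]; [lia|case: ifP => _; lia].
  have := hz i; rewrite mxE eqxx /between; lia.
have other i : exists j, j != i.
  have d0 : (0 < d)%N by apply: leq_trans d1.
  by have [e|ne] := eqVneq (Ordinal d1) i; [exists (Ordinal d0); rewrite -e|exists (Ordinal d1)].
(* When the axis is blocked by the box, the path stops just before it, turns to height [s] in a
   second direction, and passes beside it. *)
have detour i t j : j != i -> (3 * r + 2 < `|t - c 0%R i|)%N -> (`|t| <= n)%N -> (`|c 0%R j| <= r)%N ->
    ~ (forall u, between t 0 u -> (r < `|u - c 0%R i|)%N) -> cluster A (axis2 i t j 0) (axis2 i 0 j s).
  move=> ji ht tn cj nb; have ij : i != j by rewrite eq_sym.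
  have [u0 [bu0 hu0]] : exists u, between t 0 u /\ (`|u - c 0%R i| <= r)%N.
    apply: contrapT => h; apply: nb => u bu; rewrite ltnNge; apply/negP => hu; apply: h; by exists u.
  pose t' : int := if 0 <= t then c 0 i + r%:Z + 1 else c 0 i - r%:Z - 1.
  have ht' : (`|t'| + (2 * r + 1) <= `|t|)%N /\ (forall u, between t t' u -> (r < `|u - c 0%R i|)%N).
    rewrite /t'; move: bu0 hu0 ht; rewrite /between; move: (c 0 i) => k bu0 hu0 ht.
    by case: ifP => h0; split; [lia|move=> u; lia|lia|move=> u; lia].
  have [h1 h2] := ht'.
  apply: (@cluster_trans _ _ _ (axis2 i t' j 0)).
    apply: (@move2 i j _ _ _ _ i) => //; first by left; rewrite mem_head.
    - by rewrite /s; move: h1; lia.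
    - by move=> e; rewrite e eqxx in ij.
  apply: (@cluster_trans _ _ _ (axis2 i t' j s)).
    apply: (@move2 i j _ _ _ _ i) => //; first by left; rewrite mem_head.
    - by rewrite /s; move: h1 tn; lia.
    - move=> _ u hu; apply: h2; move: hu; rewrite /between; lia.
    - by move=> e; rewrite e eqxx in ij.
  apply: (@move2 i j _ _ _ _ j) => //; first by left; rewrite !inE eqxx orbT.
  - by rewrite /s; move: h1 tn; lia.
  - by move=> e; rewrite e eqxx in ij.
  - by move=> _ u; rewrite /between /s; lia.
have [[k ck]|no] := pselect (exists k, (r < `|c 0%R k|)%N).
  exists 0 => p pn pb; have [i [hi [pin hp]]] := toaxis p pn pb.
  have zero j : j != i -> axis2 i 0 j 0 = 0 by move=> ji; apply/rowP => l; rewrite !mxE; case: ifP => // _; case: ifP.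
  have [free|blocked] := pselect (forall u, between (p 0 i) 0 u -> (r < `|u - c 0%R i|)%N).
    have [j ji] := other i; apply: cluster_trans (hp j ji) _; rewrite -(zero j ji).
    apply: (@move2 i j _ _ _ _ i) => //; rewrite 1?eq_sym//; first by left; rewrite mem_head.
      by move: pin; lia.
    by move=> e; rewrite e eqxx in ji.
  have [ki|ki] := eqVneq k i; last first.
    apply: cluster_trans (hp k ki) _; rewrite -(zero k ki).
    apply: (@move2 i k _ _ _ _ k) => //; rewrite 1?eq_sym//; first by left; rewrite !inE eqxx orbT.
    - by move: pin; lia.
    - by move=> e; rewrite e eqxx in ki.
    - by move=> _ u; rewrite /between; move: ck; lia.
  have [j ji] := other i; have ij : i != j by rewrite eq_sym.
  have [cj|cj] := leqP `|c 0%R j| r.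
    apply: cluster_trans (hp j ji) _; apply: cluster_trans (detour i _ j ji hi pin cj blocked) _.
    rewrite -(zero j ji); apply: (@move2 i j _ _ _ _ i) => //; first by left; rewrite mem_head.
    - by rewrite /s; move: n4; lia.
    - by move=> _ u; rewrite /between -ki; move: ck; lia.
    - by move=> e; rewrite e eqxx in ij.
  apply: cluster_trans (hp j ji) _; rewrite -(zero j ji).
  apply: (@move2 i j _ _ _ _ j) => //; first by left; rewrite !inE eqxx orbT.
  - by move: pin; lia.
  - by move=> e; rewrite e eqxx in ij.
  - by move=> _ u; rewrite /between; move: cj; lia.
have cr k : (`|c 0%R k| <= r)%N by rewrite leqNgt; apply/negP => h; apply: no; exists k.
have d0 : (0 < d)%N by apply: leq_trans d1.
pose j0 := Ordinal d0; pose j1 := Ordinal d1.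
have j01 : j0 != j1 by [].
have blocked i (t : int) : ~ (forall u, between t 0 u -> (r < `|u - c 0%R i|)%N) by move=> /(_ 0); rewrite /between lexx /= sub0r abszN => h; have := cr i; rewrite leqNgt h//; lia.
have axisE i j : j != i -> axis2 i 0 j s = \row_l (if l == j then s else 0).
  move=> ji; apply/rowP => l; rewrite !mxE; case: eqVneq => [->|_] //.
  by rewrite eq_sym (negPf ji).
have hub : cluster A (axis2 j0 s j1 0) (axis2 j0 0 j1 s).
  apply: (@cluster_trans _ _ _ (axis2 j0 s j1 s)).
    apply: (@move2 j0 j1 _ _ _ _ j0) => //; first by left; rewrite mem_head.
    - by rewrite /s; move: n4; lia.
    - by move=> _ u; rewrite /between /s; have := cr j0; lia.
  apply: (@move2 j0 j1 _ _ _ _ j1) => //; first by left; rewrite !inE eqxx orbT.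
  - by rewrite /s; move: n4; lia.
  - by move=> _ u; rewrite /between /s; have := cr j1; lia.
exists (axis2 j0 0 j1 s) => p pn pb; have [i [hi [pin hp]]] := toaxis p pn pb.
have [i1|i1] := eqVneq i j1; last first.
  rewrite (axisE j0 j1)// -(axisE i j1) 1?eq_sym//; apply: cluster_trans (hp j1 _) _; rewrite 1?eq_sym//.
  by apply: detour => //; rewrite 1?eq_sym.
have ji : j0 != i by rewrite i1.
apply: cluster_trans (hp j0 ji) _; apply: cluster_trans (detour i _ j0 ji hi pin (cr j0) (@blocked i _)) _.
rewrite (axisE i j0)//; apply: (cluster_trans _ hub).
rewrite -(_ : axis2 j0 s j1 0 = \row_l (if l == j0 then s else 0)); last first.
  by apply/rowP => l; rewrite !mxE; case: ifP => // _; case: ifP.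
apply: cluster_base; exact: cluster_self hub.
Qed.

End OutsideBox.

(** * Large clusters in the window *)

Section WindowGeometry.
Variables (F : fieldType) (d n : nat).
Implicit Types (x y z o b : lattice d) (A B : set (lattice d)).

Lemma shrinking_window : shrinking (window d n).
Proof. by move=> x y xn h; apply: leq_trans xn; exact: l1norm_mono. Qed.

Lemma window_connected x y : window d n x -> window d n y -> cluster (window d n) x y.
Proof.
have to0 z : window d n z -> cluster (window d n) z 0.
  move=> zn; apply: cluster_rectangle => u hu; apply: leq_trans zn; apply: l1norm_mono => i.
  have := hu i; rewrite mxE /between; move: (z 0 i) (u 0 i) => a e; lia.
by move=> /to0 x0 /to0 y0; apply: cluster_trans x0 _; exact: cluster_sym.
Qed.

Lemma escape_box A x b k : A x -> ~ small (2 * k) x A -> exists2 y, cluster A x y & y \notin supbox b k.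
Proof.
move=> Ax ns; apply: contrapT => h; apply: ns => y xy.
have inb z : cluster A x z -> z \in supbox b k by move=> xz; apply/negPn/negP => zb; apply: h; exists z.
have /supboxP hy := inb y xy; have /supboxP hx := inb x (cluster_base Ax).
by apply/supboxP => i; have := hx i; have := hy i; move: (x 0 i) (y 0 i) (b 0 i) => u v w; lia.
Qed.

Variable r : nat.
Hypothesis d1 : (1 < d)%N.
Hypothesis n4 : (4 * r + 2 <= n)%N.
Notation W := (window d n).

(** By [cluster_separation] it suffices to avoid one cluster of [B] at a time. That cluster fits in
    a box of radius [r]. Both points escape the larger box around it, since a cluster not contained
    in the box of radius [2k] about its point leaves every box of radius [k], and outside they meet
    at the hub. *)
Lemma separated_small A B x y : B `<=` W -> A `<=` W `\` B -> A x -> A y ->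
  (forall b, B b -> small r b B) -> ~ small (2 * (3 * r + 2)) x A -> 
  (exists2 y', cluster (W `\` B) y y' & forall b, B b -> y' \notin supbox b (3 * r + 2)) \/
  ~ small (2 * (3 * r + 2)) y A ->
  cluster (W `\` B) x y.
Proof.
move=> BW AW Ax Ay sB nx hy; have fW := @finite_window d n.
have Wx : W x by case: (AW _ Ax).
have Wy : W y by case: (AW _ Ay).
apply: (cluster_separation F fW shrinking_window) => //; first by move=> z; exact: window_connected.
move=> b Bb; pose S := cluster B b.
have SB z : S z -> z \in supbox b r by exact: sB.
have SsubB : S `<=` B := @cluster_sub d B b.
have sub : W `\` B `<=` W `\` S by move=> z [Wz nz]; split=> // /SsubB.
have [h hub] := outside_box_connected SB n4 d1.
have reach z z' : cluster (W `\` B) z z' -> z' \notin supbox b (3 * r + 2) -> cluster (W `\` S) z h.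
  move=> zz' z'b; apply: cluster_trans (cluster_mono sub zz') _; apply: hub => //.
  by case: (cluster_sub zz').
have reachA z : A z -> ~ small (2 * (3 * r + 2)) z A -> cluster (W `\` S) z h.
  move=> Az ns; have [z' zz' z'b] := escape_box b Az ns.
  by apply: reach z'b; exact: cluster_mono AW _ zz'.
apply: cluster_trans (reachA x Ax nx) (cluster_sym _).
by case: hy => [[y' yy' hb]|ny]; [exact: reach yy' (hb b Bb)|exact: reachA].
Qed.

(* All but one of the components of a subset of the window are small if the
   components of its complement are. *)
Lemma large_cluster_unique A x y : (forall b, (W `\` A) b -> small r b (W `\` A)) ->
  (A `&` W) x -> (A `&` W) y ->
  ~ small (2 * (3 * r + 2)) x (A `&` W) -> ~ small (2 * (3 * r + 2)) y (A `&` W) ->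
  cluster (A `&` W) x y.
Proof.
move=> sB Ax Ay nx ny; have e : W `\` (W `\` A) = A `&` W by rewrite setDD setIC.
have h : cluster (W `\` (W `\` A)) x y; last by rewrite -e.
apply: (@separated_small (A `&` W) (W `\` A) x y) => //; last by right.
by rewrite e.
Qed.

End WindowGeometry.

(** * Boundaries of large finite clusters *)

Section FiniteCluster.
Variables (F : fieldType) (d r M : nat).
Implicit Types (x y z o b : lattice d) (A B : set (lattice d)).
Hypothesis d1 : (1 < d)%N.

(** If all complementary clusters near the cluster were small, its outer boundary would consist of
    small clusters and could not separate the origin from a far point. But any path from the cluster
    to that point must cross the boundary. *)
Lemma finite_cluster_boundary A : A 0 -> small M 0 A -> ~ small (2 * (3 * r + 2)) 0 A ->
  exists2 b, b \in supbox 0 M.+1 & ~ A b /\ ~ small r b (~` A).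
Proof.
move=> A0 sM ns; apply: contrapT => hn.
have sm b : b \in supbox 0 M.+1 -> ~ A b -> small r b (~` A) by move=> bM nb; apply: contrapT => h; apply: hn; exists b.
pose C := cluster A 0; have C0 : C 0 by exact: cluster_base.
pose B := [set b | ~ C b /\ exists2 c, C c & adj c b].
have BM b : B b -> b \in supbox 0 M.+1.
  move=> [_ [c /sM/supboxP hc /adjP cb]]; apply/supboxP => i; have := hc i; have := cb i.
  by rewrite mxE; move: (c 0 i) (b 0 i) => u v; lia.
have BnA b : B b -> ~ A b by move=> [nb [c cC cb]] Ab; apply: nb; exact: cluster_step cC Ab cb.
pose n := (d * (M + 3 * r + 4) + 4 * r + 2)%N.
have n4 : (4 * r + 2 <= n)%N by rewrite /n; lia.
have inW z : z \in supbox 0 (M + 3 * r + 4) -> window d n z.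
  move=> /supboxP h; rewrite /window/=; apply: leq_trans (leq_addr _ _); apply: leq_trans (leq_addr _ _).
  by apply: l1norm_le_sup => i; have := h i; rewrite mxE subr0.
have inW' z k : z \in supbox 0 k -> (k <= M + 3 * r + 4)%N -> window d n z by move=> /supboxP h hk; apply: inW; apply/supboxP => i; exact: leq_trans (h i) hk.
have BW : B `<=` window d n by move=> b /BM /inW'; apply; lia.
have CW : C `<=` window d n `\` B by move=> c Cc; split; [have := inW' c M (sM c Cc); apply; lia|case].
pose o : lattice d := const_mx (M + 3 * r + 4)%N%:Z.
have oC : ~ C o.
  move=> /sM/supboxP/(_ (Ordinal d1)); rewrite !mxE; lia.
have oB : ~ B o.
  move=> /BM/supboxP/(_ (Ordinal d1)); rewrite !mxE; lia.
have oW : window d n o by apply: inW; apply/supboxP => i; rewrite !mxE; lia.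
have h : cluster (window d n `\` B) 0 o.
  apply: (@separated_small F d n r d1 n4 (C `|` [set o])) => //.
  - by move=> z [/CW//|->].
  - by left.
  - by right.
  - move=> b Bb y; have h1 : cluster B b `<=` cluster (~` A) b.
      by apply: cluster_mono => z /BnA.
    by move=> /h1; apply: sm; [exact: BM|exact: BnA].
  - move=> s; apply: ns => y Cy; apply: s; apply: cluster_mono (cluster_idem Cy) => z; by left.
  left; exists o; first by apply: cluster_base.
  move=> b /BM/supboxP/(_ (Ordinal d1)) hb; apply/negP => /supboxP/(_ (Ordinal d1)).
  by move: hb; rewrite !mxE; move: (b 0 (Ordinal d1)) => u; lia.
apply: oC; elim: h => [_|u v _ Cu [Wv nv] uv]; first exact: C0.
by apply: contrapT => nC; apply: nv; split=> //; exists u.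
Qed.

End FiniteCluster.

(** * Tails of fast decaying sums *)

Section FastSums.
Variable R : realType.

Lemma sum_inv_squares (m N : nat) : \sum_(m <= M < N) (M.+1%:R ^- 2 : R) <= 2 - N%:R^-1.
Proof.
elim: N => [|N IH]; first by rewrite big_geq// invr0 subr0.
have [mN|Nm] := leqP m N; last first.
  have h : N.+1%:R^-1 <= 1 :> R by rewrite invf_le1 ?ltr0n// ler1n.
  by rewrite big_geq// subr_ge0; apply: le_trans h _; rewrite ler1n.
have [N0|N0] := eqVneq N 0%N.
  by move: mN; rewrite N0 leqn0 => /eqP->; rewrite big_nat1 expr1n invr1; lra.
rewrite big_nat_recr//=; apply: le_trans (lerD IH (lexx _)) _.
have n0 : 0 < N%:R :> R by rewrite ltr0n lt0n.
have n1 : N.+1%:R = N%:R + 1 :> R by rewrite -natr1.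
rewrite n1; have -> : 2 - N%:R^-1 + (N%:R + 1) ^- 2 = 2 - (N%:R + 1)^-1 - (N%:R * (N%:R + 1) ^+ 2)^-1 :> R.
  by field; rewrite !lt0r_neq0// addr_gt0.
by rewrite gerBl invr_ge0 mulr_ge0 ?exprn_ge0 ?addr_ge0 ?(ltW n0).
Qed.

Lemma fastdec_sum (e : nat -> R) : fastdec e -> exists2 t : nat -> R, fastdec t &
  forall m N, \sum_(m <= M < N) `|e M| <= t m.
Proof.
move=> fe; have bd j : exists C : R, forall m N, (\sum_(m <= M < N) `|e M|) * m.+1%:R ^+ j <= C.
  have [C hC] := fe (j + 2)%N; exists (C * 2) => m N; have C0 : 0 <= C.
    by apply: le_trans (hC 0%N); rewrite mulr_ge0.
  rewrite mulr_suml; apply: (@le_trans _ _ (\sum_(m <= M < N) C * M.+1%:R ^- 2)).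
    apply: ler_sum_nat => M /andP[mM _].
    have M0 : 0 < M.+1%:R :> R by rewrite ltr0n.
    rewrite ler_pdivlMr ?exprn_gt0//; apply: le_trans (hC M); rewrite exprD mulrA ler_wpM2r ?exprn_ge0//.
    by rewrite ler_wpM2l// lerXn2r ?nnegrE// ler_nat.
  rewrite -mulr_sumr ler_wpM2l//; apply: le_trans (sum_inv_squares m N) _.
  by rewrite gerBl invr_ge0.
pose E m := [set s | exists N, s = \sum_(m <= M < N) `|e M|].
have E0 m : E m !=set0 by exists (\sum_(m <= M < 0) `|e M|), 0%N.
have ub m j C : (forall m N, (\sum_(m <= M < N) `|e M|) * m.+1%:R ^+ j <= C) -> ubound (E m) (C / m.+1%:R ^+ j) by move=> h _ [N ->]; rewrite ler_pdivlMr ?exprn_gt0.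
have sE m : has_sup (E m) by split=> //; have [C hC] := bd 0%N; exists (C / m.+1%:R ^+ 0); exact: ub.
exists (fun m => sup (E m)) => [j|m N]; last first.
  by apply: ub_le_sup; [case: (sE m)|exists N].
have [C hC] := bd j; exists C => m.
have h0 : 0 <= sup (E m) by apply: (ub_le_sup (sE m).2); exists 0%N; rewrite big_geq.
rewrite ger0_norm// -ler_pdivlMr ?exprn_gt0//; apply: ge_sup => //; exact: ub.
Qed.

Lemma fastdec_rescale (e : nat -> R) (a c : nat) (l : nat -> nat) : fastdec e ->
  (forall m, (a <= m)%N -> (m.+1 <= c * (l m).+1)%N) -> fastdec (fun m => e (l m)).
Proof.
move=> fe hl; apply: fastdec_near => j; have [C hC] := fe j; exists (C * c%:R ^+ j), a => m am.
apply: (@le_trans _ _ (`|e (l m)| * (l m).+1%:R ^+ j * c%:R ^+ j)); last by rewrite ler_wpM2r ?exprn_ge0.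
rewrite -mulrA ler_wpM2l// -exprMn lerXn2r ?nnegrE// -natrM ler_nat mulnC; exact: hl.
Qed.

End FastSums.

(** * Tails of finite clusters when the complement is subcritical *)

Section FiniteClusterTail.
Context (R : realType) (dT : measure_display) (T : measurableType dT) (F : fieldType).
Context (P : probability T R) (d : nat) (X : {RV P >-> config d}).
Hypothesis d1 : (1 < d)%N.
Hypothesis stat : stationary P X.
Variable tl : nat -> R.
Hypothesis ftl : fastdec tl.
Hypothesis tlE : forall m, Ex P (fun w => large R m 0 (flip true (X w))) <= tl m.

(** Finite clusters are caught at a finite stage [N], so that the event depends on finitely many
    sites; [N] goes to infinity afterwards. *)
Definition stage m N (A : set (lattice d)) : R := (`[< [/\ A 0, small N 0 A & ~ small m 0 A] >])%:R.

Lemma stage_local m N : local (stage m N) (supbox (0 : lattice d) (maxn m N).+1).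
Proof.
move=> A B AB; congr (nat_of_bool _)%:R; apply: asbool_equiv_eq.
have sub k : (k <= maxn m N)%N -> forall y, y \in supbox (0 : lattice d) k.+1 -> A y <-> B y.
  move=> kN y /supboxP h; apply: AB; apply/supboxP => i; apply: leq_trans (h i) _.
  by rewrite ltnS.
have h1 := small_agreeE (sub m (leq_maxl _ _)); have h2 := small_agreeE (sub N (leq_maxr _ _)).
split=> -[h3 h4 h5].
  have [B0 sB] := h2.1 (conj h3 h4); split=> // s; apply: h5.
  by have [] := h1.2 (conj B0 s).
have [A0 sA] := h2.2 (conj h3 h4); split=> // s; apply: h5.
by have [] := h1.1 (conj A0 s).
Qed.

(** Take the least box containing the cluster. It forces a complementary cluster of about one sixth
    of its radius, as [r = (M - 5) / 6] satisfies [2(3r + 2) <= M - 1]. *)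
Lemma stage_bound m N A : (4 <= m)%N -> stage m N A <=
  \sum_(m <= M < N.+1) \sum_(b <- supbox (0 : lattice d) M.+1) large R ((M - 5) %/ 6) b (~` A).
Proof.
move=> m4; rewrite /stage; case: asboolP => [[A0 sN ns]|_]; last first.
  by apply: sumr_ge0 => M _; apply: sumr_ge0 => b _; rewrite /large.
have ex : exists M, `[< small M 0 A >] by exists N; apply/asboolP.
case: (ex_minnP ex) => -[|M] /asboolP sM Mmin.
  by exfalso; apply: ns; exact: small_mono sM.
have MN : (M.+1 <= N)%N by apply: Mmin; apply/asboolP.
have mM : (m < M.+1)%N by rewrite ltnNge; apply/negP => Mm; apply: ns; exact: small_mono sM.
have nM : ~ small M 0 A by move=> s; have := Mmin M (asboolT s); rewrite ltnn.
pose r := ((M.+1 - 5) %/ 6)%N.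
have rM : (2 * (3 * r + 2) <= M)%N.
  have := leq_divM (M.+1 - 5) 6; rewrite -/r; move: m4 mM; lia.
have nr : ~ small (2 * (3 * r + 2)) 0 A by move=> s; apply: nM; exact: small_mono s.
have [b bM [nb nsb]] := finite_cluster_boundary F d1 A0 sM nr.
rewrite (bigD1_seq M.+1) ?iota_uniq ?mem_index_iota ?(ltnW mM)//=.
rewrite (big_rem b bM)/= -/r /large asboolT// -addrA lerDl addr_ge0//; apply: sumr_ge0 => // M' _.
by apply: sumr_ge0.
Qed.

Lemma stage_tail : exists2 ft : nat -> R, fastdec ft & forall m N, Ex P (fun w => stage m N (X w)) <= ft m.
Proof.
pose e M := 5 ^+ d * M.+1%:R ^+ d * tl ((M - 5) %/ 6).
have fe : fastdec e.
  apply: fastdec_poly; apply: (@fastdec_rescale _ _ 0 12 _ ftl) => m _.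
  have := ltn_ceil (m - 5) (isT : 0 < 6)%N; lia.
have [t ft tE] := fastdec_sum fe.
exists (fun m => t m + (m < 4)%:R) => [|m N].
  apply: fastdecD => //; apply: fastdec_near => j; exists 0, 4%N => m m4.
  by rewrite ltnNge m4 normr0 mul0r.
have bs : bmf (fun w => stage m N (X w)) by have hh := @local_bmf _ _ _ P _ X _ _ (@stage_local m N).
have s1 w : stage m N (X w) <= 1 by rewrite /stage; case: asbool.
have [m4|m4] := ltnP m 4.
  have t0 : 0 <= t m by apply: le_trans (tE m 0%N); rewrite big_geq.
  apply: (@le_trans _ _ (0 + 1)); last by rewrite lerD2r.
  by rewrite add0r -(Ex_cst P 1); apply: Ex_le => //; exact: (bmf_cst _).
have bL M b : bmf (fun w => large R M b (flip true (X w)) : R).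
  have l0 := @flip_local R d true _ _ (@large_local R d M b).
  by have hh := @local_bmf _ _ _ P _ X _ _ l0.
rewrite addr0; apply: le_trans (tE m N.+1).
apply: (@le_trans _ _ (Ex P (fun w => \sum_(m <= M < N.+1) \sum_(b <- supbox (0 : lattice d) M.+1) large R ((M - 5) %/ 6) b (flip true (X w))))).
  apply: Ex_le => //; last by move=> w; exact: stage_bound.
  by apply: bmf_sum => M _; apply: bmf_sum.
rewrite Ex_sum => [|M _]; last exact: bmf_sum.
apply: ler_sum => M _; rewrite Ex_sum//.
rewrite (eq_bigr (fun=> Ex P (fun w => large R ((M - 5) %/ 6) 0 (flip true (X w))))); last by move=> b _; exact: Ex_large.
rewrite sum_const_seq /e normrM ger0_norm; last by rewrite mulr_ge0 ?exprn_ge0.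
apply: ler_pM => //; first exact: Ex_ge0.
  rewrite size_supbox -exprMn -natrM -natrX ler_nat leq_exp2r; last exact: ltnW.
  lia.
exact: le_trans (tlE _) (ler_norm _).
Qed.

Lemma tscore_stage h K m N A : 0 <= K -> (forall B, finite_set B -> `|h B| <= K * #|` fset_set B|%:R) ->
  (m <= N)%N -> `|tscore h m 0 A - tscore h N 0 A| <= K * stage m N A :> R.
Proof.
move=> K0 hK mN; rewrite /tscore /stage.
case: asboolP => [[A0 sm]|nm].
  rewrite asboolT ?subrr ?normr0 ?mulr_ge0//; split=> //; exact: small_mono sm.
case: ifPn => [/asboolP[A0 sN]|_]; last by rewrite subrr normr0 mulr_ge0.
rewrite asboolT; last by split=> // s; apply: nm.
by rewrite sub0r normrN mulr1; apply: cscore_bound => //; exact: small_finite sN.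
Qed.

(** The bound at each stage [N] is uniform in [N] and passes to the limit by bounded convergence. *)
Lemma fscore_tail h K (ft : nat -> R) m : 0 <= K -> (forall B, finite_set B -> `|h B| <= K * #|` fset_set B|%:R) ->
  (forall m N, Ex P (fun w => stage m N (X w)) <= ft m) ->
  Ex P (fun w => `|tscore h m 0 (X w) - fscore h 0 (X w)|) <= K * ft m.
Proof.
move=> K0 hK hft; have bt N : bmf (fun w => tscore h N 0 (X w)).
  by have hh := @local_bmf _ _ _ P _ X _ _ (@tscore_local R d h N 0).
have cv1 : Ex P (fun w => `|tscore h m 0 (X w) - tscore h N 0 (X w)|) @[N --> \oo] -->
    Ex P (fun w => `|tscore h m 0 (X w) - fscore h 0 (X w)|).
  apply: (@Ex_cvg_bounded R _ T P (fun N w => `|tscore h m 0 (X w) - tscore h N 0 (X w)|) _ (K + K)).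
  - by move=> N; apply: bmf_norm; exact: bmfB.
  - move=> N w; rewrite normr_id; apply: le_trans (ler_normB _ _) _.
    by apply: lerD; exact: tscore_bound.
  - by move=> w; apply: cvg_norm; apply: cvgB; [exact: cvg_cst|exact: fscore_cvg].
rewrite leNgt; apply/negP => hlt; move/cvgrPdist_lt: cv1.
move=> /(_ (Ex P (fun w => `|tscore h m 0 (X w) - fscore h 0 (X w)|) - K * ft m)); rewrite subr_gt0 => /(_ hlt)[N _ hN].
have := hN (maxn m N) (leq_maxr _ _); apply/negP; rewrite -leNgt; apply: le_trans (ler_norm _); rewrite lerD2l lerN2.
apply: le_trans (ler_wpM2l K0 (hft m (maxn m N))).
have bs : bmf (fun w => stage m (maxn m N) (X w)) by have hh := @local_bmf _ _ _ P _ X _ _ (@stage_local m (maxn m N)).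
rewrite -ExZ//; apply: Ex_le; [by apply: bmf_norm; exact: bmfB|exact: bmfZ|].
by move=> w; apply: tscore_stage => //; exact: leq_maxl.
Qed.

Lemma finite_component_tail : {ae P, forall w, finite_set (cluster (X w) 0)} ->
  exists2 ft : nat -> R, fastdec ft & forall m, Ex P (fun w => large R m 0 (X w)) <= ft m.
Proof.
move=> ae; have [ft fft hft] := stage_tail; exists ft => // m.
have card1 (B : set (lattice d)) : finite_set B -> `|(#|` fset_set B|)%:R : R| <= 1 * #|` fset_set B|%:R by move=> _; rewrite mul1r normr_nat.
(* The cardinality gives every finite cluster score 1. For almost surely finite clusters the
   truncation error is then exactly the [large] event. *)
pose h (B : set (lattice d)) : R := #|` fset_set B|%:R.
have := @fscore_tail h 1 ft m ler01 card1 hft; rewrite mul1r; apply: le_trans.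
have bt : bmf (fun w => tscore h m 0 (X w)) by have hh := @local_bmf _ _ _ P _ X _ _ (@tscore_local R d h m 0).
have bf : bmf (fun w => fscore h 0 (X w)).
  split; last by exists 1 => w; apply: fscore_bound.
  apply: (@measurable_fun_cvg _ _ _ _ (fun N w => tscore h N 0 (X w))).
    by move=> N; have [] := @local_bmf _ _ _ P _ X _ _ (@tscore_local R d h N 0).
  by move=> w _; exact: fscore_cvg.
have bL : bmf (fun w => large R m 0 (X w)) by have hh := @local_bmf _ _ _ P _ X _ _ (@large_local R d m 0).
rewrite /Ex /Rintegral le_eqVlt; apply/orP; left; apply/eqP; congr fine.
apply: ae_eq_integral => //.
- by apply/measurable_EFinP; case: bL.
- by apply/measurable_EFinP; apply: (bmf_norm (bmfB bt bf)).1.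
apply: filterS ae => w fw _; congr EFin; rewrite /large /tscore /fscore.
have [X0|nX0] := pselect (X w 0); last by rewrite !asboolF ?subrr ?normr0// => -[].
have c1 : cscore h 0 (X w) = 1 by rewrite /cscore /h divff// pnatr_eq0 -lt0n; exact: cluster_card_gt0.
rewrite [X in _ - (if X then _ else _)]asboolT// c1.
have [s|s] := pselect (small m 0 (X w)).
  by rewrite asboolF ?asboolT ?subrr ?normr0//; case.
by rewrite asboolT// asboolF ?sub0r ?normrN ?normr1//; case.
Qed.

End FiniteClusterTail.

(** * Bounded perturbations of the covariance limit *)

Section Perturbation.
Context (R : realType) (dT : measure_display) (T : measurableType dT) (P : probability T R).

Lemma cv_young (f g : T -> R) (e : R) : bmf f -> bmf g -> 0 < e ->
  `|2 * cv P f g| <= e * cv P f f + e^-1 * cv P g g.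
Proof.
move=> bf bg e0.
have h (sg : R) : sg ^+ 2 = 1 -> 0 <= e ^+ 2 * cv P f f + sg * (2 * e * cv P f g) + cv P g g.
  move=> s2; have bsum := bmfD (bmfZ e bf) (bmfZ sg bg).
  have := cv_ge0 P bsum.
  rewrite (cvDl P (bmfZ e bf) (bmfZ sg bg) bsum) (cvDr P (bmfZ e bf) (bmfZ sg bg) (bmfZ e bf)).
  rewrite (cvDr P (bmfZ e bf) (bmfZ sg bg) (bmfZ sg bg)).
  rewrite (cvZl P e bf (bmfZ e bf)) (cvZl P e bf (bmfZ sg bg)) (cvZl P sg bg (bmfZ e bf)) (cvZl P sg bg (bmfZ sg bg)).
  rewrite !(cvZr P _ bf) // !(cvZr P _ bg)// [cv P g f]cvC => hh; apply: le_trans hh _.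
  rewrite le_eqVlt; apply/orP; left; apply/eqP.
  rewrite [sg * (sg * cv P g g)]mulrA -expr2 s2; ring.
have h1 := h 1 (expr1n _ _); have h2 : (-1) ^+ 2 = 1 :> R by rewrite sqrrN expr1n.
have {}h2 := h (-1) h2.
have ei : e * e^-1 = 1 by rewrite divff// lt0r_neq0.
have E1 (a c : R) : e * (e * a + e^-1 * c) = e ^+ 2 * a + c by rewrite mulrDr !mulrA ei mul1r expr2.
have E2 (x : R) : e * `|x| = `|e * x| by rewrite normrM (gtr0_norm e0).
rewrite -(ler_pM2l e0) E1 E2 ler_norml; move: h1 h2.
move: (cv P f f) (cv P f g) (cv P g g) => a c g2 h1 h2; apply/andP; split; lra.
Qed.

(** The cross term is split by [cv_young] with a small weight on the variance of [A]; the remaining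
    terms are bounded and vanish after division by [W]. *)
Lemma cvg_cov_perturbation (A D : nat -> T -> R) (W : nat -> R) (s : R) :
  (forall n, bmf (A n)) -> (forall n, bmf (D n)) -> (forall n, n%:R < W n) ->
  (W n)^-1 * cv P (A n) (A n) @[n --> \oo] --> s ->
  (\forall n \near \oo, Ex P (fun w => D n w ^+ 2) <= 2) ->
  (W n)^-1 * cv P (fun w => A n w + D n w) (fun w => A n w + D n w) @[n --> \oo] --> s.
Proof.
move=> bA bD nW cA hD; apply/cvgrPdist_le => eta eta0.
pose e := eta / (4 * (`|s| + 1)); have s1 : 0 < `|s| + 1 by rewrite ltr_wpDl.
have e0 : 0 < e by rewrite divr_gt0// mulr_gt0.
have W0 n : 0 < W n by apply: le_lt_trans (nW n).
near=> n.
have hA : `|s - (W n)^-1 * cv P (A n) (A n)| <= eta / 4 by near: n; move/cvgrPdist_le: cA; apply; rewrite divr_gt0.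
have hA1 : `|s - (W n)^-1 * cv P (A n) (A n)| <= 1 by near: n; move/cvgrPdist_le: cA; apply.
have hn : (e^-1 + 1) * 2 * 4 / eta <= n%:R by near: n; exact: nbhs_infty_ger.
have Dn : cv P (D n) (D n) <= 2.
  apply: le_trans (_ : Ex P (fun w => D n w ^+ 2) <= 2); last by near: n.
  by rewrite /cv (_ : (fun w => D n w * D n w) = (fun w => D n w ^+ 2))// gerBl -expr2 sqr_ge0.
have exp : cv P (fun w => A n w + D n w) (fun w => A n w + D n w) =
    cv P (A n) (A n) + (2 * cv P (A n) (D n) + cv P (D n) (D n)).
  rewrite cvDl//; last exact: bmfD.
  rewrite !cvDr// [cv P (D n) (A n)]cvC; ring.
have y := cv_young (bA n) (bD n) e0.
have D0 := cv_ge0 P (bD n).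
rewrite exp mulrDr opprD addrA; apply: le_trans (ler_normB _ _) _.
have hw : (W n)^-1 * (e^-1 + 1) * 2 <= eta / 4.
  rewrite -mulrA mulrC ler_pdivrMr//; apply: (@le_trans _ _ (eta / 4 * n%:R)); last by rewrite ler_wpM2l ?(ltW (nW n))// divr_ge0// ltW.
  by move: hn; rewrite ler_pdivrMr//; lra.
have h3 : `|(W n)^-1 * (2 * cv P (A n) (D n) + cv P (D n) (D n))| <= eta / 4 + eta / 4.
  rewrite normrM ger0_norm ?invr_ge0 ?(ltW (W0 n))//.
  have h4 : `|2 * cv P (A n) (D n) + cv P (D n) (D n)| <= e * cv P (A n) (A n) + (e^-1 + 1) * 2.
    apply: le_trans (ler_normD _ _) _; rewrite (ger0_norm D0).
    apply: le_trans (lerD y (lexx _)) _; rewrite -addrA lerD2l.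
    rewrite [leRHS]mulrDl mul1r lerD// ler_wpM2l// invr_ge0 ltW//.
  apply: le_trans (ler_wpM2l _ h4) _; first by rewrite invr_ge0 ltW.
  rewrite mulrDr [X in _ + X]mulrA; apply: lerD => //.
  rewrite mulrCA; apply: (@le_trans _ _ (e * (`|s| + 1))).
    rewrite ler_wpM2l ?(ltW e0)//; move: hA1; rewrite distrC ler_norml => /andP[_ h5].
    by have := ler_norm s; lra.
  by rewrite /e le_eqVlt; apply/orP; left; apply/eqP; field; rewrite lt0r_neq0.
have e2 : eta / 4 + (eta / 4 + eta / 4) <= eta by lra.
by apply: le_trans e2; exact: lerD.
Unshelve. all: by end_near. Qed.

End Perturbation.

(** * Covariance of the number of components *)

Section ZeroCovariance.
Context (R : realType) (dT : measure_display) (T : measurableType dT) (F : fieldType).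
Context (P : probability T R) (d : nat) (X : {RV P >-> config d}).
Hypothesis d1 : (1 < d)%N.
Hypothesis stat : stationary P X.
Variable q : nat.
Hypothesis q0 : (0 < q)%N.
Hypothesis mix : mixing X q.
Variable tl : nat -> R.
Hypothesis ftl : fastdec tl.
Hypothesis tlE : forall m, Ex P (fun w => large R m 0 (flip true (X w))) <= tl m.

Notation b0 := (@primal R F d 0).
Let K : R := 3 ^+ d.+1.
Let K0 : 0 <= K. Proof. exact: exprn_ge0. Qed.
Let bK (B : set (lattice d)) : finite_set B -> `|b0 B| <= K * #|` fset_set B|%:R.
Proof. exact: primal_bound. Qed.
Let d0 : (0 < d)%N := ltnW d1.

Let U m n x (mu : set (lattice d)) := tscore b0 m x (mu `&` window d n).

(** The omitted scores belong to clusters of the window that are not small. When complementary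
    clusters are small these form a single cluster, whose scores sum to its number of components,
    that is 1. *)
Lemma window_defect (mu : set (lattice d)) m n r : (2 * (3 * r + 2) <= m)%N -> (4 * r + 2 <= n)%N ->
  (forall b, (window d n `\` mu) b -> small r b (~` mu)) ->
  `|b0 (mu `&` window d n) - \sum_(x <- wfs d n) U m n x mu| <= 1.
Proof.
move=> rm n4 good; pose B := mu `&` window d n.
have fB : finite_set B by apply: sub_finite_set (@finite_window d n) => x [].
have good' b : (window d n `\` mu) b -> small r b (window d n `\` mu) by move=> hb y hy; apply: (good b hb); apply: cluster_mono hy => z [].
rewrite (cluster_sum_window mu n (@primal_additive R F d 0)) -/B.
rewrite -sumrB.
have -> : \sum_(x <- wfs d n) ((if `[< B x >] then cscore b0 x B else 0) - U m n x mu) =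
    \sum_(x <- wfs d n) (if `[< B x /\ ~ small m x B >] then cscore b0 x B else 0).
  apply: eq_bigr => x _; rewrite /U /tscore -/B.
  have [Bx|nB] := pselect (B x); last by rewrite !asboolF ?subrr// => -[].
  have [s|s] := pselect (small m x B).
    by rewrite asboolT// asboolT// asboolF ?subrr//; case.
  by rewrite asboolT// asboolF ?asboolT ?subr0//; case.
have [[x0 [Bx0 nx0]]|none] := pselect (exists x, B x /\ ~ small m x B); last first.
  rewrite big1 ?normr0// => x _; rewrite asboolF// => h; apply: none; by exists x.
pose C := cluster B x0; have fC : finite_set C by apply: sub_finite_set fB; exact: cluster_sub.
have C0 : (0 < #|` fset_set C|)%N by exact: cluster_card_gt0.
have one : b0 C = 1 by apply: (primal0_connected R F fC (x0 := x0)); [exact: cluster_idem|exact: cluster_base].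
apply: le_trans (ler_norm_sum _ _ _) _.
apply: (@le_trans _ _ (\sum_(x <- wfs d n) (if x \in fset_set C then (#|` fset_set C|)%:R^-1 else 0))).
  apply: ler_sum => x _; case: ifPn => [/asboolP[Bx nx]|_]; last by rewrite normr0; case: ifP.
  have ns y : ~ small m y B -> ~ small (2 * (3 * r + 2)) y B by move=> h s; apply: h; exact: small_mono s.
  have xC : C x by apply: (large_cluster_unique F d1 n4 good') => //; exact: ns.
  rewrite in_fset_set// mem_set// /cscore (cluster_eq xC) -/C one mul1r.
  by rewrite ger0_norm ?invr_ge0.
rewrite -big_mkcond -big_filter sum_const_seq.
rewrite ler_pdivrMr ?ltr0n// mul1r ler_nat; apply: uniq_leq_size; first by rewrite filter_uniq// fset_uniq.
by move=> x; rewrite mem_filter => /andP[].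
Qed.

(** An infinite cluster has score 0 but counts for one component. The sum of truncated scores thus
    differs from the count by at most 1 outside a rare event on which the volume bounds the
    difference. This defect has bounded second moment and does not affect the limit. *)
Lemma zero_cov : exists2 s : R,
  has_sum (limit_cov X (fscore b0 0) (fscore b0 0)) s &
  (#|` wfs d n|%:R)^-1 * cv P (fun w => b0 (X w `&` window d n)) (fun w => b0 (X w `&` window d n))
    @[n --> \oo] --> s.
Proof.
have [ft fft hft] := stage_tail F d1 stat ftl tlE.
pose L := (q * d.+1 + 1 + 1)%N; have L1 : (q * d.+1 + 1 <= L)%N by rewrite leq_addr.
have L0 : (0 < L)%N by rewrite /L; lia.
pose V m mu := tscore b0 m 0 mu.
pose h (i : 'I_1) (n : nat) := b0; pose hinf (i : 'I_1) := b0.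
have hT (i : 'I_1) A z : finite_set A -> hinf i (translate A z) = hinf i A by exact: primal_translate.
have hb (i : 'I_1) n A : finite_set A -> (forall x y, A x -> adj x y -> window d n y) -> h i n A = hinf i A by [].
have UV m n x mu : (l1norm x + d * m.+2 <= n)%N -> U m n x mu = V m (translate mu (- x)) by move=> xn; have hh := @trunc_bulk R d d0 q q0 false 1 K K0 h hinf hT hb ord0 m n x mu xn; exact: hh.
have lU m n x : local (U m n x) (supbox x m.+1) by exact: (@trunc_local R d false 1 h ord0 m n x).
have lV m : local (V m) (supbox 0 m.+1) by exact: tscore_local.
have UM m n x mu : `|U m n x mu| <= K by exact: tscore_bound.
have VM m mu : `|V m mu| <= K by exact: tscore_bound.
have ZM mu : `|fscore b0 0 mu| <= K by exact: fscore_bound.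
have bZ : bmf (fscore b0 0 : config d -> R).
  exact: (@zscore_bmf R d false 1 K K0 hinf (fun i => @primal_bound R F d 0) ord0).
pose eta m := K * 1 * m.+1%:R ^+ 0 * ft m.
have feta : fastdec eta by rewrite /eta; exact: fastdec_poly.
have VZ m : Ex P (fun w => `|V m (X w) - fscore b0 0 (X w)|) <= eta m by rewrite /eta expr0 !mulr1; exact: fscore_tail.
have [s hs cs] := cov_sum_cvg d0 stat q0 mix feta lV lV VM VM bZ bZ ZM ZM VZ VZ L1 lU lU UM UM UV UV.
exists s => //.
have bu m n x : bmf (fun w => U m n x (X w)) by have hh := @local_bmf _ _ _ P _ X _ _ (@lU m n x).
pose A n w := \sum_(x <- wfs d n) U (nroot L n) n x (X w).
have bA n : bmf (A n) by apply: bmf_sum => x _; exact: bu.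
have bS n := bmf_window X b0 n.
pose D n w := b0 (X w `&` window d n) - A n w.
have bD n : bmf (D n) by exact: bmfB.
rewrite (_ : (fun n => _) = (fun n => (#|` wfs d n|%:R)^-1 * cv P (fun w => A n w + D n w) (fun w => A n w + D n w))); last first.
  by apply/funext => n; congr (_ * cv P _ _); apply/funext => w; rewrite /D addrC subrK.
apply: cvg_cov_perturbation => //.
- by move=> n; rewrite ltr_nat; exact: wfs_card_gtn.
- rewrite (_ : (fun n => _) = (fun n => (#|` wfs d n|%:R)^-1 *
    (\sum_(x <- wfs d n) \sum_(y <- wfs d n) cv P (fun w => U (nroot L n) n x (X w)) (fun w => U (nroot L n) n y (X w)))))//.
  apply/funext => n; congr (_ * _).
  rewrite {1}/A cv_suml => [|x _|]; [|exact: bu|exact: bA].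
  apply: eq_bigr => x _; rewrite /A cv_sumr => [//|y _|]; exact: bu.
pose tr m := tl ((m - 4) %/ 6).
have ftr : fastdec tr by apply: (@fastdec_rescale _ _ 0 12 _ ftl) => m _; have := ltn_ceil (m - 4) (isT : 0 < 6)%N; lia.
pose Q := K ^+ 2 * (2 ^+ d) ^+ 3.
have cQ : Q * (n.+1%:R ^+ (d * 3) * tr (nroot L n)) @[n --> \oo] --> (0 : R) by rewrite -(mulr0 Q); apply: cvgMl_tmp; exact: fastdec_nroot.
near=> n.
have m4 : (4 <= nroot L n)%N by near: n; exact: (near_nroot L0 4).
have qs : `|Q * (n.+1%:R ^+ (d * 3) * tr (nroot L n))| <= 1 by near: n; move/cvgr0Pnorm_le: cQ; apply.
have n2 : (2 <= n)%N by near: n; exact: nbhs_infty_ge.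
have mn : (nroot L n <= n)%N by apply: leq_trans (nrootX_le L0 n); rewrite -{1}[nroot L n]expn1 leq_pexp2l// (leq_trans _ m4).
rewrite /D /A; move: (nroot L n) m4 mn qs => m m4 mn qs; pose r := ((m - 4) %/ 6)%N.
have r1 : (6 * r <= m - 4)%N by rewrite mulnC; exact: leq_divM.
have rm : (2 * (3 * r + 2) <= m)%N by lia.
have n4 : (4 * r + 2 <= n)%N by lia.
pose w := #|` wfs d n|%:R : R.
have bL b : bmf (fun v => large R r b (flip true (X v)) : R).
  have l0 := @flip_local R d true _ _ (@large_local R d r b).
  by have hh := @local_bmf _ _ _ P _ X _ _ l0.
have pw v : (b0 (X v `&` window d n) - \sum_(x <- wfs d n) U m n x (X v)) ^+ 2 <=
    1 + (K * w) ^+ 2 * \sum_(b <- wfs d n) large R r b (flip true (X v)).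
  have s0 : 0 <= \sum_(b <- wfs d n) large R r b (flip true (X v)) by apply: sumr_ge0 => b _; rewrite /large.
  rewrite -[leLHS]real_normK ?num_real//.
  have [good|bad] := pselect (forall b, (window d n `\` X v) b -> small r b (~` X v)).
    apply: (@le_trans _ _ 1); last by rewrite lerDl mulr_ge0 ?sqr_ge0.
    by rewrite expr_le1//; exact: window_defect rm n4 good.
  have [b [[bn nXb] nsb]] : exists b, (window d n `\` X v) b /\ ~ small r b (~` X v).
    apply: contrapT => h'; apply: bad => b hb'; apply: contrapT => ns; apply: h'; by exists b.
  have bw : b \in wfs d n by rewrite in_wfs.
  have l1 : 1 <= \sum_(b <- wfs d n) large R r b (flip true (X v)).
    rewrite (big_rem b bw) /= {1}/large asboolT// lerDl; apply: sumr_ge0 => b' _; by rewrite /large.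
  apply: (@le_trans _ _ ((K * w) ^+ 2)); last first.
    by apply: ler_wpDl => //; rewrite ler_peMr// sqr_ge0.
  rewrite lerXn2r ?nnegrE ?mulr_ge0//.
  have ce := @cluster_error R d K K0 b0 (X v) n m bK (@primal_additive R F d 0).
  apply: le_trans ce _.
  rewrite ler_wpM2l//; apply: (@le_trans _ _ (\sum_(x <- wfs d n) 1)).
    by apply: ler_sum => x _; rewrite /large; case: asbool.
  by rewrite sum_const_seq mulr1.
apply: (@le_trans _ _ (Ex P (fun v => 1 + (K * w) ^+ 2 * \sum_(b <- wfs d n) large R r b (flip true (X v))))).
  apply: Ex_le => //; first by apply: bmfX; apply: bmfB => //; apply: bmf_sum.
  by apply: bmfD; [exact: (bmf_cst _)|apply: bmfZ; apply: bmf_sum].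
have bs : bmf (fun v => \sum_(b <- wfs d n) large R r b (flip true (X v)) : R) by apply: bmf_sum.
rewrite (ExD P (@bmf_cst _ _ T 1) (bmfZ _ bs)) Ex_cst ExZ// Ex_sum//.
rewrite (eq_bigr (fun=> Ex P (fun v => large R r 0 (flip true (X v))))); last by move=> b _; exact: Ex_large.
rewrite sum_const_seq -/w lerD2l.
apply: le_trans (_ : Q * (n.+1%:R ^+ (d * 3) * tr m) <= 1); last by apply: le_trans (ler_norm _) _.
have w0 : 0 <= w by rewrite /w.
have wn : w <= 2 ^+ d * n.+1%:R ^+ d by exact: wfs_card_leR.
rewrite [leLHS](_ : _ = K ^+ 2 * w ^+ 3 * Ex P (fun v => large R r 0 (flip true (X v)))); last by ring.
rewrite [leRHS](_ : _ = K ^+ 2 * (2 ^+ d * n.+1%:R ^+ d) ^+ 3 * tr m); last by rewrite /Q exprM; ring.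
apply: ler_pM => //; first by rewrite mulr_ge0 ?exprn_ge0.
  exact: Ex_ge0.
by rewrite ler_wpM2l ?exprn_ge0// lerXn2r ?nnegrE// (le_trans w0).
Unshelve. all: by end_near. Qed.

End ZeroCovariance.

(** * Application to Betti numbers *)

Section Betti.
Context (F : fieldType) (R : realType) (dT : measure_display) (T : measurableType dT).
Context (P : probability T R) (d : nat) (X : {RV P >-> config d}).
Notation prim := (@primal R F d).

(** For an infinite component the cardinal read by [score] is 0, so the quotient is 0, as in
    [fscore]. *)
Lemma scoreE k x (mu : set (lattice d)) : score F k x mu = fscore (prim k) x mu.
Proof.
rewrite /score /fscore component_points_cluster; case: asboolP => [mx|nmx]; last by rewrite asboolF// => -[].
rewrite component_cluster//; case: asboolP => [//|nf].
rewrite /fset_set; case: pselect => [fx|_]; last by rewrite cardfs0 invr0 mulr0.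
by exfalso; apply: nf.
Qed.

Lemma fscore_translate (h : set (lattice d) -> R) x (A : set (lattice d)) y :
  (forall B z, finite_set B -> h (translate B z) = h B) ->
  fscore h (x + y) (translate A y) = fscore h x A.
Proof.
move=> hT; rewrite /fscore cluster_translate.
have e1 : translate A y (x + y) <-> A x by rewrite translateE addrK.
have e2 : finite_set (translate (cluster A x) y) <-> finite_set (cluster A x).
  split=> [f|]; last exact: finite_image.
  have -> : cluster A x = translate (translate (cluster A x) y) (- y) by rewrite translateD subrr translate0.
  exact: finite_image.
rewrite (_ : `[< _ /\ _ >] = `[< A x /\ finite_set (cluster A x) >]); last first.
  by apply: asbool_equiv_eq; rewrite e1 e2.
by case: ifPn => // /asboolP[Ax fx]; rewrite /cscore cluster_translate hT// card_translate.
Qed.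

Lemma score_translate k z (mu : set (lattice d)) :
  score F k z mu = fscore (prim k) 0 (translate mu (- z)).
Proof.
rewrite scoreE -(subrr z) fscore_translate// => B y; exact: primal_translate.
Qed.

Lemma bmf_primal_score k : bmf (fscore (prim k) 0 : config d -> R).
Proof.
exact: (@zscore_bmf R d false 1 _ (exprn_ge0 _ (ler0n R 3)) (fun=> prim k) (fun=> @primal_bound R F d k) ord0).
Qed.

Hypothesis stat : stationary P X.

Lemma score_cov_limit i j :
  score_cov F P X i j = limit_cov X (fscore (prim i) 0) (fscore (prim j) 0).
Proof.
apply/funext => z; rewrite /score_cov /limit_cov.
have -> : (fun w => score F i 0 (X w)) = (fun w => fscore (prim i) 0 (X w)) by apply/funext => w; rewrite scoreE.
have -> : (fun w => score F j z (X w)) = (fun w => fscore (prim j) 0 (translate (X w) (- z))) by apply/funext => w; rewrite score_translate.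
by rewrite covariance_cv//; [exact: bmf_config (bmf_primal_score i)|exact: bmf_translate (bmf_primal_score j)].
Qed.

Lemma bmf_betti k n : bmf (betti_window F R X k n : T -> R).
Proof. exact: bmf_window X (prim k) n. Qed.

Lemma betti_meanE k n : betti_mean F P X k n = Ex P (betti_window F R X k n).
Proof. by rewrite /betti_mean expectation_Ex//; exact: bmf_betti. Qed.

Lemma betti_varE k n : betti_var F P X k n = cv P (betti_window F R X k n) (betti_window F R X k n).
Proof. by rewrite /betti_var variance_cv//; exact: bmf_betti. Qed.

Let K : R := 3 ^+ d.+1.
Let M : R := 3 ^+ d.+1 * 2 ^+ d.

Let K0 : 0 <= K. Proof. exact: exprn_ge0. Qed.

Let KM : K <= M. Proof. by rewrite /M ler_peMr// exprn_ege1// ler1n. Qed.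

Lemma betti_bound k n w : `|betti_window F R X k n w| <= M * n.+1%:R ^+ d.
Proof.
have fB : finite_set (X w `&` window d n) by apply: sub_finite_set (@finite_window d n) => x [].
apply: le_trans (@primal_bound R F d k _ fB) _; rewrite /M -mulrA ler_wpM2l//.
apply: le_trans (wfs_card_leR d R n); rewrite ler_nat; apply: uniq_leq_size; first exact: fset_uniq.
by move=> x; rewrite in_fset_set// inE in_wfs => -[].
Qed.

Hypothesis d0 : (0 < d)%N.
Variable q : nat.
Hypothesis q0 : (0 < q)%N.
Hypothesis mix : mixing X q.

Let S (i : 'I_d) n w : R := betti_window F R X i n w.

(* [b = true] when the complement of X has exponentially decaying clusters *)
Let h (b : bool) (i : 'I_d) n : set (lattice d) -> R := if b then dual R F (window d n) i else prim i.
Let hinf (b : bool) (i : 'I_d) : set (lattice d) -> R := if b then dual R F setT i else prim i.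
Let al (b : bool) (i : 'I_d) n : R := if b then prim i (window d n) else 0.

Let hK b (i : 'I_d) n A : finite_set A -> `|h b i n A| <= K * #|` fset_set A|%:R.
Proof. by case: b => fA; [exact: dual_bound|exact: primal_bound]. Qed.

Let hinfK b (i : 'I_d) A : finite_set A -> `|hinf b i A| <= K * #|` fset_set A|%:R.
Proof. by case: b => fA; [exact: dual_bound|exact: primal_bound]. Qed.

Let hU b (i : 'I_d) n A B : finite_set A -> finite_set B -> separated A B ->
  h b i n (A `|` B) = h b i n A + h b i n B.
Proof. by case: b => fA fB sAB; [exact: dual_additive|exact: primal_additive]. Qed.

Let hT b (i : 'I_d) A z : finite_set A -> hinf b i (translate A z) = hinf b i A.
Proof. by case: b => fA; [exact: dual_translate|exact: primal_translate]. Qed.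

Let hbulk b (i : 'I_d) n A : finite_set A ->
  (forall x y, A x -> adj x y -> window d n y) -> h b i n A = hinf b i A.
Proof. by case: b => fA // hA; exact: dual_bulk. Qed.

(** With [b] true this is [primal_dual]: the Betti number of the window becomes the deterministic
    shift [al], invisible to centered quantities. *)
Let SE b (i : 'I_d) n w : S i n w = al b i n + h b i n (flip b (X w) `&` window d n).
Proof.
case: b; rewrite /S /al /h /=; last by rewrite add0r.
have sub : X w `&` window d n `<=` window d n by move=> x [].
rewrite -[LHS]/(prim i (X w `&` window d n)).
rewrite (primal_dual R F i (@finite_window d n) (@shrinking_window d n) sub).
congr (_ + dual R F _ _ _); apply/seteqP; split=> x.
  by move=> [xn nx]; split=> // Xx; apply: nx.
by move=> [nX xn]; split=> // -[].
Qed.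

Section Tail.
Variables (b : bool) (tl : nat -> R).
Hypothesis ftl : fastdec tl.
Hypothesis tlE : forall m, Ex P (fun w => large R m 0 (flip b (X w))) <= tl m.

Lemma betti_clt (k : 'I_d) :
  (exists2 nu : R, 0 < nu & exists2 c : R, 0 < c &
     \forall n \near \oo, c * (window_card d n)%:R `^ nu <= betti_var F P X k n) ->
  cvg_in_law P (betti_normalized F P X k) (fun f => \int[normal_prob 0 1]_x (f x)%:E)%E.
Proof.
move=> [nu nu0 [c c0 hv]].
have -> : betti_normalized F P X k =
    (fun n w => cv P (S k n) (S k n) `^ (- 2^-1) * (S k n w - Ex P (S k n))).
  by apply/funext => n; apply/funext => w; rewrite /betti_normalized betti_varE betti_meanE.
apply: (cluster_clt_single d0 stat q0 mix K0 (@hK b) (@hU b) (fun i n => bmf_betti i n) (@SE b) ftl tlE KM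
  (fun i n w => betti_bound i n w) c0 nu0).
by apply: filterS hv => n; rewrite betti_varE.
Qed.

Lemma betti_vector_clt : exists (Sigma : 'M[R]_d) (gamma : probability (borel 'rV[R]_d) R),
  [/\ forall i j, has_sum (limit_cov X (zscore b (hinf b) i) (zscore b (hinf b) j)) (Sigma i j),
      forall i j, (#|` wfs d n|%:R)^-1 * cv P (S i n) (S j n) @[n --> \oo] --> Sigma i j,
      is_gaussian gamma Sigma &
      cvg_in_law P (betti_vector F P X) (fun f => \int[gamma]_x (f x)%:E)%E].
Proof.
have [Sigma [gamma [h1 h2 h3 h4]]] := cluster_clt_vector d0 stat q0 mix K0 (@hK b) (@hinfK b) (@hU b)
  (@hT b) (@hbulk b) (fun i n => bmf_betti i n) (@SE b) ftl tlE KM (fun i n w => betti_bound i n w).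
exists Sigma, gamma; split=> //; move: h4; congr (cvg_in_law P _ _).
apply/funext => n; apply/funext => w; apply/rowP => i; rewrite !mxE betti_meanE //.
Qed.

Lemma betti_cov i j : exists2 s : R, has_sum (limit_cov X (zscore b (hinf b) i) (zscore b (hinf b) j)) s &
  (#|` wfs d n|%:R)^-1 * cv P (S i n) (S j n) @[n --> \oo] --> s.
Proof.
exact: (cluster_cov d0 stat q0 mix K0 (@hK b) (@hinfK b) (@hU b)
  (@hT b) (@hbulk b) (fun i n => bmf_betti i n) (@SE b) ftl tlE KM (fun i n w => betti_bound i n w)).
Qed.

End Tail.

Lemma score_cov_primal (tl : nat -> R) (i j : 'I_d) : fastdec tl ->
  (forall m, Ex P (fun w => large R m 0 (X w)) <= tl m) ->
  exists2 s : R, has_sum (score_cov F P X i j) s &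
  (#|` wfs d n|%:R)^-1 * cv P (S i n) (S j n) @[n --> \oo] --> s.
Proof.
move=> ftl tlE; rewrite score_cov_limit; exact: (@betti_cov false tl ftl tlE i j).
Qed.

(** Either the clusters of [X] have fast tails themselves, because the dimension is one or because a
    positive index makes them almost surely finite, or both indices are 0 and the single large
    cluster is absorbed by [zero_cov]. *)
Lemma score_cov_dual (tl : nat -> R) (i j : 'I_d) : fastdec tl ->
  (forall m, Ex P (fun w => large R m 0 (flip true (X w))) <= tl m) ->
  (d = 1%N -> exists2 t : nat -> R, fastdec t & forall m, Ex P (fun w => large R m 0 (X w)) <= t m) ->
  score_meaningful P i X -> score_meaningful P j X ->
  exists2 s : R, has_sum (score_cov F P X i j) s &
  (#|` wfs d n|%:R)^-1 * cv P (S i n) (S j n) @[n --> \oo] --> s.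
Proof.
move=> ftl tlE dim1 hi hj.
have [/dim1[t ft tE]|dn1] := eqVneq d 1%N; first exact: score_cov_primal ft tE.
have d1 : (1 < d)%N by rewrite ltn_neqAle eq_sym dn1.
have fin k : score_meaningful P k X -> k <> 0%N ->
    exists2 t : nat -> R, fastdec t & forall m, Ex P (fun w => large R m 0 (X w)) <= t m.
  move=> [->//|ae] _; apply: (finite_component_tail F d1 stat ftl tlE).
  by apply: filterS ae => w; rewrite component_points_cluster.
have [i0|ni0] := eqVneq (i : nat) 0%N; last first.
  by have [t ft tE] := fin _ hi (elimN eqP ni0); exact: score_cov_primal ft tE.
have [j0|nj0] := eqVneq (j : nat) 0%N; last first.
  by have [t ft tE] := fin _ hj (elimN eqP nj0); exact: score_cov_primal ft tE.
rewrite score_cov_limit /S i0 j0; exact: (zero_cov F d1 stat q0 mix ftl tlE).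
Qed.

End Betti.

Lemma tail_of_dim1 (R : realType) (dT : measure_display) (T : measurableType dT)
    (P : probability T R) (d : nat) (X : {RV P >-> config d}) :
  (0 < d)%N -> exponentially_clustering P X -> d = 1%N ->
  exists2 t : nat -> R, fastdec t & forall m, Ex P (fun w => large R m 0 (X w)) <= t m.
Proof.
move=> d0 hX d1; case: _ / (esym d1) X d0 hX => X d0 hX.
have [q q0 mix] := exponential_mixing d0 hX; have [stat nd _] := hX.
by exists (fun m => Ex P (fun w => large R m 0 (X w))) => //; exact: (tail_dim1 stat nd q0 mix).
Qed.

Theorem theorem2p9 (F : fieldType) (R : realType)
    (dT : measure_display) (T : measurableType dT) (P : probability T R)
    (d : nat) (hd : (0 < d)%N) (X : {RV P >-> config d})
    (hX : exponentially_clustering P X)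
    (hsub : subcritical P X \/ subcritical P (fun w => ~` X w)) :
  (forall k : 'I_d,
     (exists2 nu : R, 0 < nu & exists2 c : R, 0 < c &
        \forall n \near \oo,
          c * (window_card d n)%:R `^ nu <= betti_var F P X k n) ->
     cvg_in_law P (betti_normalized F P X k)
       (fun f => \int[normal_prob 0 1]_x (f x)%:E)%E)
  /\
  (exists (Sigma : 'M[R]_d) (gamma : probability (borel 'rV[R]_d) R),
     [/\ forall i j : 'I_d, score_meaningful P i X -> score_meaningful P j X ->
           has_sum (score_cov F P X i j) (Sigma i j),
         is_gaussian gamma Sigma
       & cvg_in_law P (betti_vector F P X)
           (fun f => \int[gamma]_x (f x)%:E)%E]).
Proof.
have [q q0 mix] := exponential_mixing hd hX; have [stat _ _] := hX.
have dim1 := tail_of_dim1 hd hX.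
case: hsub => hsub.
  have [tl ftl tlE] := subcritical_tail (b := false) hsub.
  split; first exact: (betti_clt stat hd q0 mix (b := false) ftl tlE).
  have [Sigma [gamma [h1 h2 h3 h4]]] := betti_vector_clt F stat hd q0 mix (b := false) ftl tlE.
  exists Sigma, gamma; split=> // i j _ _.
  by rewrite score_cov_limit//; exact: h1.
have [tl ftl tlE] := subcritical_tail (b := true) hsub.
split; first exact: (betti_clt stat hd q0 mix (b := true) ftl tlE).
have [Sigma [gamma [h1 h2 h3 h4]]] := betti_vector_clt F stat hd q0 mix (b := true) ftl tlE.
exists Sigma, gamma; split=> // i j hi hj.
have [s hs s_lim] := score_cov_dual F stat hd q0 mix ftl tlE dim1 hi hj.
(* The dual series and the series of the original scores are both the limit of the same normalized
   covariances. *)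
by rewrite -(cvg_unique _ s_lim (h2 i j)).
Qed.
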